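(* Let $T>0$ and $m>0$. Assume: (Regularity) $(y^0,y^1)\in H^2(0,1)\times H^1(0,1)$, $g\in W^{1,1}(0,T;L^2(0,1))$, $(g^0,g^1)\in (H^2(0,T))^2$, with $g^0(0)=y^0(0)$, $g^1(0)=y^0(1)$, $\partial_t g^0(0)=y^1(0)$, $\partial_t g^1(0)=y^1(1)$. (Convergence of the data) For each $h=1/(N+1)$, $N\in\mathbb N$, discrete data $(y_h^0,y_h^1)$, $g_h$, $(g_h^0,g_h^1)$ are given such that, as $h\to0$, $$(\mathrm e_h^0(\Delta_h y_h^0),\mathrm e_h^0(\Delta_h y_h^1))\to(\partial_{xx}y^0,\partial_{xx}y^1)\ \text{ in } L^2(0,1)\times H^{-1}(0,1),$$ $$\mathrm e_h^0(g_h)\to g\ \text{ in } W^{1,1}(0,T;L^2(0,1)),\qquad (g_h^0,g_h^1)\to(g^0,g^1)\ \text{ in }(H^2(0,T))^2.$$ (Positivity) There is $r>0$ such that $\inf_{x\in(0,1)}|y^0(x)|\ge r$ and, for all $h$, $\inf_{1\le j\le N}|y^0_{j,h}|\ge r$. Then for every $p\in L^\infty(0,1)$ with $\|p\|_{L^\infty(0,1)}\le m$ there exist discrete potentials $p_h\in L^\infty_{h,\le m}(0,1)$ such that, as $h\to0$, $$\mathrm e_h^0(p_h)\to p\ \text{ in } L^2(0,1)\quad\text{and}\quad \Theta_h(p_h)\to\Theta_0(p)\ \text{ in } L^2(0,T)\times L^2((0,T)\times(0,1)).$$ Moreover $$\sup_{h\in(0,1)}\|y_h[p_h]\|_{H^1(0,T;L^\infty_h(0,1))}<\infty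 .$$
   Context: Grid: for $N\in\mathbb N$, $h=1/(N+1)$, $x_j=jh$ ($h$ only takes these values). $(\Delta_h v)_j=(v_{j+1}-2v_j+v_{j-1})/h^2$ and $(\partial_h^- v)_{N+1}=(v_{N+1}-v_N)/h$. $\|f_h\|_{L^\infty_h(0,1)}=\sup_{1\le j\le N}|f_{j,h}|$ and $L^\infty_{h,\le m}(0,1)=\{q_h=(q_{j,h})_{1\le j\le N}:\ \|q_h\|_{L^\infty_h(0,1)}\le m\}$. Continuous equation: $y[p]$ denotes the solution of $\partial_{tt}y-\partial_{xx}y+py=g$ in $(0,T)\times(0,1)$, $y(t,0)=g^0(t)$, $y(t,1)=g^1(t)$, $y(0,\cdot)=y^0$, $\partial_ty(0,\cdot)=y^1$. (Under the regularity assumption, $y[p]\in C^2([0,T];L^2(0,1))\cap C^1([0,T];H^1(0,1))\cap C^0([0,T];H^2(0,1))$ and $\partial_{tx}y[p](\cdot,1)\in L^2(0,T)$.) Semi-discrete equation: $y_h[p_h]=(y_{j,h}(t))_{0\le j\le N+1}$ denotes the solution of $\partial_{tt}y_{j,h}-(\Delta_hy_h)_j+p_{j,h}y_{j,h}=g_{j,h}$ for $t\in(0,T)$, $1\le j\le N$, with $y_{0,h}(t)=g_h^0(t)$, $y_{N+1,h}(t)=g_h^1(t)$, $y_{j,h}(0)=y^0_{j,h}$, $\partial_ty_{j,h}(0)=y^1_{j,h}$ for $1\le j\le N$. In $\Delta_hy_h^0$ and $\Delta_hy_h^1$ the boundary values are $y^0_{0,h}=g_h^0(0)$, $y^0_{N+1,h}=g_h^1(0)$,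 $y^1_{0,h}=\partial_tg_h^0(0)$, $y^1_{N+1,h}=\partial_tg_h^1(0)$. Extensions: for $(f_{j,h})_{0\le j\le N+1}$, $\mathrm e_h(f_h)$ is the continuous function on $[0,1]$, affine on each $[jh,(j+1)h]$, with value $f_{j,h}$ at $jh$. For $(f_{j,h})_{1\le j\le N}$, $\mathrm e_h^0(f_h)$ equals $f_{j,h}$ on $[(j-1/2)h,(j+1/2)h)$ for $1\le j\le N$ and $0$ on $[0,h/2)\cup[(N+1/2)h,1]$. Observation operators, with values in $L^2(0,T)\times L^2((0,T)\times(0,1))$: $\Theta_h(p_h)=\big(\partial_t(\partial_h^-y_h[p_h])_{N+1},\ h\,\partial_x\mathrm e_h(\partial_{tt}y_h[p_h])\big)$, and $\Theta_0(p)=\big(\partial_t\partial_xy[p](\cdot,1),\,0\big)$. *)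

(* Defs.v *)
From HB Require Import structures.
From mathcomp Require Import all_boot all_order all_algebra.
From mathcomp Require Import all_classical all_reals all_analysis.

Set Implicit Arguments.
Unset Strict Implicit.
Unset Printing Implicit Defensive.

Import Order.TTheory GRing.Theory Num.Theory.
Import numFieldNormedType.Exports.

Local Open Scope classical_set_scope.
Local Open Scope ring_scope.

Section LebesgueSpaces.
Context {d : measure_display} {X : measurableType d} {R : realType}.
Variables (mu : {measure set X -> \bar R}) (p : \bar R) (D : set X).

Definition in_Lp (f : X -> R) : Prop := (f \_ D) \in Lfun mu p.

Definition Lp_norm (f : X -> R) : \bar R := Lnorm mu p (EFin \o (f \_ D)).

End LebesgueSpaces.

Section SobolevSpaces.
Context {R : realType}.
Local Notation mu := (@lebesgue_measure R).

Definition test_function (a b : R) (phi : R -> R) : Prop :=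
  (forall n x, derivable (derive1n n phi) x 1) /\
  (exists c e, [/\ a < c, e < b & forall x : R, x \notin `[c, e] -> phi x = 0]).

(* [f'] is the derivative of [f] in the sense of distributions on ]a, b[;
   meaningful when both are locally integrable there. *)
Definition weak_derivative (a b : R) (f f' : R -> R) : Prop :=
  forall phi, test_function a b phi ->
    \int[mu]_(x in `]a, b[) (f x * derive1 phi x) =
    - \int[mu]_(x in `]a, b[) (f' x * phi x).

Definition L2_norm (a b : R) (f : R -> R) : \bar R := Lp_norm mu 2%:E `]a, b[ f.

Definition in_Linf (a b : R) (f : R -> R) : Prop := in_Lp mu +oo%E `]a, b[ f.

Definition Linf_norm (a b : R) (f : R -> R) : \bar R :=
  Lp_norm mu +oo%E `]a, b[ f.

(* An element of W^{k,p}(a,b) is given by its successive weak derivatives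
   [u 0], ..., [u k]; for orders < k we take the representative that is
   continuous on [a, b], so that boundary and initial values are pointwise
   values.  The functions [u i] with i > k play no role. *)
Definition Sobolev (k : nat) (p : \bar R) (a b : R) (u : nat -> R -> R) : Prop :=
  (forall i, (i <= k)%N -> in_Lp mu p `]a, b[ (u i)) /\
  (forall i, (i < k)%N ->
     {within `[a, b], continuous (u i)} /\ weak_derivative a b (u i) (u i.+1)).

Definition Hnorm (k : nat) (a b : R) (u : nat -> R -> R) : \bar R :=
  ((\sum_(i < k.+1) (L2_norm a b (u i)) ^+ 2) `^ 2^-1)%E.

Definition H10 (phi : nat -> R -> R) : Prop :=
  [/\ Sobolev 1 2%:E 0 1 phi, phi 0%N 0 = 0 & phi 0%N 1 = 0].

(* Dual norm of a linear form on H^1_0(0,1). *)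
Definition Hm1_norm (L : (nat -> R -> R) -> R) : \bar R :=
  ereal_sup [set (`|L phi|)%:E | phi in
    [set phi | H10 phi /\ (Hnorm 1 0 1 phi <= 1)%E]].

Definition fun_Hm1 (f : R -> R) (phi : nat -> R -> R) : R :=
  \int[mu]_(x in `]0, 1[) (f x * phi 0%N x).

(* The second derivative of [u] in H^1(0,1), as an element of H^{-1}(0,1). *)
Definition dxx_Hm1 (u : nat -> R -> R) (phi : nat -> R -> R) : R :=
  - \int[mu]_(x in `]0, 1[) (u 1%N x * phi 1%N x).

Definition L1L2_norm (T : R) (f : R -> R -> R) : \bar R :=
  (\int[mu]_(t in `]0%R, T[) L2_norm 0 1 (f t))%E.

Definition cylinder (T : R) : set (measurableTypeR R * measurableTypeR R) :=
  `]0, T[ `*` `]0, 1[.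

Definition L2L2_norm (T : R) (f : R * R -> R) : \bar R :=
  Lp_norm (mu \x mu)%E 2%:E (cylinder T) f.

(* W^{1,1}(0,T; L^2(0,1)): [g 0] and its time derivative [g 1], as functions
   of (t, x).  The L^2(0,1)-valued integrals in the definition of the weak
   derivative are evaluated at almost every x. *)
Definition W11L2 (T : R) (g : nat -> R -> R -> R) : Prop :=
  (forall i, (i <= 1)%N ->
     measurable_fun (cylinder T) (fun tx => g i tx.1 tx.2) /\
     (L1L2_norm T (g i) < +oo)%E) /\
  (forall phi, test_function 0 T phi ->
     {ae mu, forall x : R, x \in `]0, 1[ ->
       \int[mu]_(t in `]0, T[) (g 0%N t x * derive1 phi t) =
       - \int[mu]_(t in `]0, T[) (g 1%N t x * phi t)}).

End SobolevSpaces.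

(* Grid functions are maps [nat -> R] of which only the values at
   0, ..., N+1 (or 1, ..., N) matter. *)
Section Grid.
Context {R : realType}.
Variable N : nat.

Definition mesh : R := N.+1%:R^-1.

Definition laplacian_h (v : nat -> R) (j : nat) : R :=
  (v j.+1 - 2 * v j + v j.-1) / mesh ^+ 2.

Definition dminus_h (v : nat -> R) (j : nat) : R := (v j - v j.-1) / mesh.

Definition with_boundary (a : R) (v : nat -> R) (b : R) (j : nat) : R :=
  if j == 0%N then a else if j == N.+1 then b else v j.

Definition Linf_h (f : nat -> R) : R :=
  \big[Num.max/0]_(1 <= j < N.+1) `|f j|.

(* Each summand is a hat function centred at the node j h. *)
Definition ext_affine (f : nat -> R) (x : R) : R :=
  \sum_(0 <= j < N.+2) f j * Num.max 0 (1 - `|x / mesh - j%:R|).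

Definition ext_const (f : nat -> R) (x : R) : R :=
  \sum_(1 <= j < N.+1)
    f j * \1_(`[(j%:R - 2^-1) * mesh, (j%:R + 2^-1) * mesh[%classic) x.

End Grid.

Section WaveEquation.
Context {R : realType}.
Local Notation mu := (@lebesgue_measure R).

(* [y i k] stands for d_t^i d_x^k y, i + k <= 2, as a function of (t, x).
   The first three clauses say that y belongs to
   C^2([0,T];L^2) /\ C^1([0,T];H^1) /\ C^0([0,T];H^2). *)
Definition wave_solution (T : R) (p y0 y1 : R -> R) (g : R -> R -> R)
    (g0 g1 : R -> R) (y : nat -> nat -> R -> R -> R) : Prop :=
  [/\ forall i (t : R), (i <= 2)%N -> t \in `[0, T] ->
        Sobolev (2 - i) 2%:E 0 1 (fun k => y i k t),
      forall i (t : R), (i <= 2)%N -> t \in `[0, T] ->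
        Hnorm (2 - i) 0 1 (fun k x => y i k s x - y i k t x)
          @[s --> within `[0, T] (nbhs t)] --> 0%E,
      forall i (t : R), (i < 2)%N -> t \in `[0, T] ->
        Hnorm (2 - i.+1) 0 1
            (fun k x => (y i k s x - y i k t x) / (s - t) - y i.+1 k t x)
          @[s --> within `[0, T] t^'] --> 0%E,
      {ae mu, forall t : R, t \in `]0, T[ -> {ae mu, forall x : R, x \in `]0, 1[ ->
        y 2%N 0%N t x - y 0%N 2%N t x + p x * y 0%N 0%N t x = g t x}} &
      [/\ forall t : R, t \in `[0, T] -> y 0%N 0%N t 0 = g0 t,
          forall t : R, t \in `[0, T] -> y 0%N 0%N t 1 = g1 t,
          forall x : R, x \in `]0, 1[ -> y 0%N 0%N 0 x = y0 x &
          forall x : R, x \in `]0, 1[ -> y 1%N 0%N 0 x = y1 x]].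

(* [y j i] stands for d_t^i y_{j,h}, 0 <= j <= N+1, i <= 2. *)
Definition semidiscrete_solution (T : R) (N : nat) (p y0 y1 : nat -> R)
    (g : nat -> R -> R) (g0 g1 : R -> R) (y : nat -> nat -> R -> R) : Prop :=
  [/\ forall j, (j <= N.+1)%N -> Sobolev 2 2%:E 0 T (y j),
      {ae mu, forall t : R, t \in `]0, T[ -> forall j, (1 <= j <= N)%N ->
        y j 2%N t - laplacian_h N (fun l => y l 0%N t) j + p j * y j 0%N t
          = g j t},
      forall t : R, t \in `[0, T] -> y 0%N 0%N t = g0 t,
      forall t : R, t \in `[0, T] -> y N.+1 0%N t = g1 t &
      forall j, (1 <= j <= N)%N -> y j 0%N 0 = y0 j /\ y j 1%N 0 = y1 j].

Definition Theta_h_boundary (N : nat) (y : nat -> nat -> R -> R) (t : R) : R :=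
  dminus_h N (fun j => y j 1%N t) N.+1.

Definition Theta_h_interior (N : nat) (y : nat -> nat -> R -> R)
    (tx : R * R) : R :=
  mesh N * derive1 (ext_affine N (fun j => y j 2%N tx.1)) tx.2.

(* [theta] is d_t d_x y(., 1) in L^2(0,T). *)
Definition Theta_0_boundary (T : R) (y : nat -> nat -> R -> R -> R)
    (theta : R -> R) : Prop :=
  in_Lp mu 2%:E `]0, T[ theta /\
  weak_derivative 0 T (fun t => y 0%N 1%N t 1) theta.

Definition H1Linf_norm (T : R) (N : nat) (y : nat -> nat -> R -> R) : \bar R :=
  Hnorm 1 0 T (fun i t => Linf_h N (fun j => y j i t)).

End WaveEquation.

(* Main.v *)
(* Take for p_h the averages of p against the hat functions of the grid, and let
   z_h = d_t y_h.  Then z_h solves a semi-discrete wave equation with data in the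
   energy space, the first component of Theta_h is its last slope, and the second
   one consists of the increments of d_t z_h between neighbouring nodes.

   The key estimate bounds, uniformly in h and without any filtering of high
   frequencies, the L^2(0,T) norm of the last slope of a semi-discrete solution
   by the energy of its data.  Velocities and slopes, interleaved, form a chain
   h r_n' = r_(n+1) - r_(n-1) + h F_n; summing the derivatives of the correlations
   r_n r_(n+d) shows that the L^2 norms x_k of r_k satisfy
   x_k^2 <= k P + x_0 x_(2k), and descending from k ~ N, where the energy controls
   x_k, yields x_k <= k y and in particular a bound on x_1.

   This estimate is applied to the difference between z_h and the time averages,
   over windows of length e T, of the nodal values of d_t y.  Its data are small
   when first e and then h is small, because in time-averaged form the nodal
   values and the hat averages of y differ by O(sqrt h) for fixed e.  The last
   slope of the averaged nodal values converges as h -> 0, so the boundary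
   observations are Cauchy in L^2(0,T), and the primitive of their limit is
   d_x y(., 1) up to a constant.  The interior observations vanish because the
   energy of the difference is small and the averaged nodal values have
   increments O(sqrt h). *)

Require Import Defs.
From HB Require Import structures.
From mathcomp Require Import all_boot all_order all_algebra.
From mathcomp Require Import all_classical all_reals all_analysis.
From mathcomp Require Import measurable_realfun ess_sup_inf.
From mathcomp Require Import ring lra zify.

Set Implicit Arguments.
Unset Strict Implicit.
Unset Printing Implicit Defensive.

Import Order.TTheory GRing.Theory Num.Theory.
Import numFieldNormedType.Exports.

Local Open Scope classical_set_scope.
Local Open Scope ring_scope.

(** * Integrals and absolutely continuous functions *)

(** The obstacle is regularity. [y] has two derivatives in all, so the nodal values of [d_t y] are
    only continuous in time and cannot be inserted into a scheme of second order in time. Hat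
    averages of [d_t y] do have one more time derivative, and they turn [d_xx] into an exact second
    difference, but that second difference acts on nodal values, not on hat averages. Averaging
    twice in time supplies the two missing derivatives of the nodal values at the price [(e T)^-2],
    affordable only because [e] is fixed before [h] tends to 0; hence the nested limits of
    [vanish2]. The averaging windows slide inside [[0, T]], so no data are extended beyond the time
    interval, and each differentiation costs a factor [1 - e]. In the chain the two ends are the
    boundary velocities, which are data, and their neighbours are the first and the last slope; one
    estimate at the left end serves both, the other end being reached by reversing the chain. Weak
    derivatives are converted once into primitives ([AC]), and all calculus is done with these
    rather than with differentiability almost everywhere. *)

Section Elementary.
Context {F : realFieldType}.
Implicit Types x y A B C : F.

Lemma mul_le_sqrD x y : x * y <= x ^+ 2 + y ^+ 2.
Proof.
rewrite -subr_ge0.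
have -> : x ^+ 2 + y ^+ 2 - x * y = ((x - y) ^+ 2 + x ^+ 2 + y ^+ 2) / 2 by field.
by rewrite divr_ge0// !addr_ge0 ?sqr_ge0.
Qed.

(** Discriminant argument behind the Cauchy-Schwarz inequalities below, for integrals and for finite
    sums: the squared norms and the inner product are the coefficients of a nonnegative quadratic
    form. *)
Lemma sqr_le_of_form_ge0 A B C :
  (forall s t, 0 <= s ^+ 2 * A + 2 * (s * t) * C + t ^+ 2 * B) ->
  C ^+ 2 <= A * B.
Proof.
move=> H.
have A0 : 0 <= A by have := H 1 0; rewrite expr1n expr0n/= !(mulr0, mul0r, mul1r, addr0).
have B0 : 0 <= B by have := H 0 1; rewrite expr1n expr0n/= !(mulr0, mul0r, mul1r, add0r).
move: A0; rewrite le_eqVlt => /predU1P[A0|Ap].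
  (* With [A = 0] the form takes the value [-(B + 2) C^2] at this point, which forces [C = 0]. *)
  have := H (- B - 1) C; rewrite -A0.
  have -> : (- B - 1) ^+ 2 * 0 + 2 * ((- B - 1) * C) * C + C ^+ 2 * B = - ((B + 2) * C ^+ 2) by ring.
  by rewrite mul0r oppr_ge0 pmulr_rle0// ltr_wpDl.
have := H C (- A).
have -> : C ^+ 2 * A + 2 * (C * - A) * C + (- A) ^+ 2 * B = A * (A * B - C ^+ 2) by ring.
by rewrite pmulr_rge0// subr_ge0.
Qed.

End Elementary.

Section IntervalIntegral.
Context {R : realType}.
Local Notation mu := (@lebesgue_measure R).
Implicit Types (a b c k : R) (f g : R -> R).

Definition L1 a b f : Prop := mu.-integrable `]a, b[ (EFin \o f).

(** The interval is not oriented: for [b <= a] it is empty and the integral is 0, not the opposite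
    of the reversed one. Splittings and increments therefore always carry order hypotheses. *)
Definition itg a b f : R := \int[mu]_(x in `]a, b[) f x.

Definition L2 a b f : Prop :=
  measurable_fun `]a, b[ f /\ L1 a b (fun x => f x ^+ 2).

Lemma L1_meas a b f : L1 a b f -> measurable_fun `]a, b[ f.
Proof. by move=> /measurable_int/measurable_EFinP. Qed.

Lemma mu_oo_fin a b : (mu `]a, b[ < +oo)%E.
Proof. by rewrite lebesgue_measure_itv/=; case: ifP => // _; rewrite -EFinD ltry. Qed.

Lemma L1_eq a b f g : (forall x, a < x < b -> f x = g x) -> L1 a b f -> L1 a b g.
Proof.
move=> fg; apply: eq_integrable => // x; rewrite inE/= in_itv/= => xab.
by rewrite /= fg.
Qed.

Lemma L1_le a b f g : measurable_fun `]a, b[ f ->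
  (forall x, a < x < b -> `|f x| <= g x) -> L1 a b g -> L1 a b f.
Proof.
move=> mf fg; apply: le_integrable => //; first exact/measurable_EFinP.
move=> x /=; rewrite in_itv/= => xab; rewrite lee_fin (le_trans (fg _ xab))//.
exact: ler_norm.
Qed.

Lemma L1_cst a b k : L1 a b (fun=> k).
Proof.
apply: measurable_bounded_integrable => //; first exact: mu_oo_fin.
by exists `|k|; split; rewrite ?num_real// => x kx y _ /=; exact: ltW.
Qed.

Lemma L1_bounded a b f k : measurable_fun `]a, b[ f ->
  (forall x, a < x < b -> `|f x| <= k) -> L1 a b f.
Proof. by move=> mf fk; apply: L1_le mf fk _; exact: L1_cst. Qed.

Lemma L1D a b f g : L1 a b f -> L1 a b g -> L1 a b (fun x => f x + g x).
Proof. by move=> Hf Hg; apply: (integrableD _ Hf Hg). Qed.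

Lemma L1B a b f g : L1 a b f -> L1 a b g -> L1 a b (fun x => f x - g x).
Proof. by move=> Hf Hg; apply: (integrableB _ Hf Hg). Qed.

Lemma L1Z a b k f : L1 a b f -> L1 a b (fun x => k * f x).
Proof. by move=> Hf; apply: (integrableZl _ k Hf). Qed.

Lemma L1N a b f : L1 a b f -> L1 a b (fun x => - f x).
Proof. by move=> Hf; apply: (integrableN Hf). Qed.

Lemma L1_abs a b f : L1 a b f -> L1 a b (fun x => `|f x|).
Proof. by move=> Hf; apply: (integrable_norm Hf). Qed.

Lemma L1_sum a b (I : eqType) (s : seq I) (P : pred I) (F : I -> R -> R) :
  (forall i, i \in s -> P i -> L1 a b (F i)) ->
  L1 a b (fun x => \sum_(i <- s | P i) F i x).
Proof.
elim: s => [|i s IH] HF.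
  by apply: (@L1_eq _ _ (fun=> 0)) => [x _|]; [rewrite big_nil|exact: L1_cst].
have H1 : L1 a b (fun x => \sum_(j <- s | P j) F j x).
  by apply: IH => j js; apply: HF; rewrite inE js orbT.
case Pi : (P i); last by apply: L1_eq H1 => x _; rewrite big_cons Pi.
have Hi : L1 a b (F i) by apply: HF => //; rewrite inE eqxx.
by apply: L1_eq (L1D Hi H1) => x _; rewrite big_cons Pi.
Qed.

Lemma L1_sub a b c d f : a <= c -> d <= b -> L1 a b f -> L1 c d f.
Proof.
by move=> ac db; apply: integrableS => //; apply: subset_itv; rewrite bnd_simp.
Qed.

Lemma itg_eq a b f g : (forall x, a < x < b -> f x = g x) -> itg a b f = itg a b g.
Proof.
by move=> fg; apply: eq_Rintegral => x; rewrite inE/= in_itv/= => /fg.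
Qed.

Lemma itgD a b f g : L1 a b f -> L1 a b g ->
  itg a b (fun x => f x + g x) = itg a b f + itg a b g.
Proof. by move=> Hf Hg; apply: RintegralD. Qed.

Lemma itgB a b f g : L1 a b f -> L1 a b g ->
  itg a b (fun x => f x - g x) = itg a b f - itg a b g.
Proof. by move=> Hf Hg; apply: RintegralB. Qed.

Lemma itgZ a b k f : L1 a b f -> itg a b (fun x => k * f x) = k * itg a b f.
Proof. by move=> Hf; apply: RintegralZl. Qed.

Lemma itgN a b f : L1 a b f -> itg a b (fun x => - f x) = - itg a b f.
Proof.
move=> Hf; rewrite -mulN1r -itgZ//; apply: itg_eq => x _; by rewrite mulN1r.
Qed.

Lemma itg_nil a b f : b <= a -> itg a b f = 0.
Proof. by move=> ba; rewrite /itg set_itv_ge ?Rintegral_set0// bnd_simp -leNgt. Qed.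

Lemma itg_cst a b k : a <= b -> itg a b (fun=> k) = k * (b - a).
Proof.
rewrite le_eqVlt => /predU1P[->|ab]; first by rewrite itg_nil// subrr mulr0.
by rewrite /itg Rintegral_cst//= lebesgue_measure_itv/= lte_fin ab.
Qed.

Lemma itg0 a b : itg a b (fun=> 0) = 0.
Proof.
case: (leP a b) => [ab|/ltW ba]; first by rewrite itg_cst// mul0r.
by rewrite itg_nil.
Qed.

Lemma itg_sum a b (I : eqType) (s : seq I) (P : pred I) (F : I -> R -> R) :
  (forall i, i \in s -> P i -> L1 a b (F i)) ->
  itg a b (fun x => \sum_(i <- s | P i) F i x) = \sum_(i <- s | P i) itg a b (F i).
Proof.
elim: s => [|i s IH] HF.
  by rewrite big_nil -[RHS](itg0 a b); apply: itg_eq => x _; rewrite big_nil.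
have HF' j : j \in s -> P j -> L1 a b (F j).
  by move=> js; apply: HF; rewrite inE js orbT.
rewrite big_cons; case Pi : (P i); last first.
  by rewrite -IH//; apply: itg_eq => x _; rewrite big_cons Pi.
have Hi : L1 a b (F i) by apply: HF => //; rewrite inE eqxx.
rewrite -IH// -itgD//; last exact: L1_sum.
by apply: itg_eq => x _; rewrite big_cons Pi.
Qed.

Lemma itg_le a b f g : L1 a b f -> L1 a b g ->
  (forall x, a < x < b -> f x <= g x) -> itg a b f <= itg a b g.
Proof.
by move=> Hf Hg fg; apply: le_Rintegral => // x /=; rewrite in_itv/= => /fg.
Qed.

Lemma itg_ge0 a b f : (forall x, a < x < b -> 0 <= f x) -> 0 <= itg a b f.
Proof. by move=> f0; apply: Rintegral_ge0 => x /=; rewrite in_itv/= => /f0. Qed.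

Lemma itg_abs a b f : L1 a b f -> `|itg a b f| <= itg a b (fun x => `|f x|).
Proof. by move=> Hf; apply: le_normr_Rintegral. Qed.

Lemma itg_split a b c f : a <= c -> c <= b -> L1 a b f ->
  itg a b f = itg a c f + itg c b f.
Proof.
move=> ac cb Hf.
have [->|nca] := eqVneq a c; first by rewrite [itg c c _]itg_nil// add0r.
have [->|ncb] := eqVneq c b; first by rewrite [itg b b _]itg_nil// addr0.
have := @Rintegral_itvB _ f (BRight a) (BLeft b) c Hf.
rewrite !bnd_simp => /(_ ac); rewrite lt_neqAle ncb cb => /(_ isT) E.
have E2 := @Rintegral_itv_bndo_bndc _ (BRight a) c f (L1_sub (lexx a) cb Hf).
by rewrite /itg -E E2 addrC subrK.
Qed.

Lemma itg_le_sub a b c d f : a <= c -> c <= d -> d <= b -> L1 a b f ->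
  (forall x, a < x < b -> 0 <= f x) -> itg c d f <= itg a b f.
Proof.
move=> ac cd db Hf f0.
have cb := le_trans cd db.
rewrite (@itg_split a b c)// (@itg_split c b d)//; last exact: L1_sub Hf.
rewrite -[leLHS]add0r lerD// ?lerDl ?itg_ge0// => x /andP[x1 x2]; apply: f0.
  by rewrite x1 (lt_le_trans x2).
by rewrite x2 (le_lt_trans _ x1) ?(le_trans ac).
Qed.

Lemma itg_abs_le a b f k : a <= b -> L1 a b f ->
  (forall x, a < x < b -> `|f x| <= k) -> `|itg a b f| <= k * (b - a).
Proof.
move=> ab Hf fk; rewrite (le_trans (itg_abs Hf))// -itg_cst//.
by apply: itg_le => //; [exact: L1_abs|exact: L1_cst].
Qed.

Lemma L2_meas a b f : L2 a b f -> measurable_fun `]a, b[ f. Proof. by case. Qed.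

Lemma L2M a b f g : L2 a b f -> L2 a b g -> L1 a b (fun x => f x * g x).
Proof.
move=> [mf Hf] [mg Hg]; apply: (L1_le _ _ (L1D Hf Hg)).
  exact: measurable_funM.
move=> x _; rewrite normrM -[f x ^+ 2]real_normK ?num_real// -[g x ^+ 2]real_normK ?num_real//.
exact: mul_le_sqrD.
Qed.

Lemma L2_bounded a b f k : measurable_fun `]a, b[ f ->
  (forall x, a < x < b -> `|f x| <= k) -> L2 a b f.
Proof.
move=> mf fk; split => //; apply: (@L1_bounded _ _ _ (k ^+ 2)) => [|x xab].
  exact: measurable_funX.
by rewrite normrX lerXn2r ?nnegrE ?fk// (le_trans _ (fk _ xab)).
Qed.

Lemma L2_cst a b k : L2 a b (fun=> k).
Proof. by split; [exact: measurable_cst|exact: L1_cst]. Qed.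

Lemma L2_L1 a b f : L2 a b f -> L1 a b f.
Proof.
by move=> Hf; apply: L1_eq (L2M Hf (L2_cst a b 1)) => x _; rewrite mulr1.
Qed.

Lemma L2_eq a b f g : (forall x, a < x < b -> f x = g x) -> L2 a b f -> L2 a b g.
Proof.
move=> fg [mf Hf]; split.
  by apply: eq_measurable_fun mf => x; rewrite inE/= in_itv/= => /fg.
by apply: L1_eq Hf => x /fg ->.
Qed.

Lemma L2Z a b k f : L2 a b f -> L2 a b (fun x => k * f x).
Proof.
move=> [mf Hf]; split; first exact: measurable_funM.
by apply: L1_eq (L1Z (k ^+ 2) Hf) => x _; rewrite exprMn.
Qed.

Lemma L2D a b f g : L2 a b f -> L2 a b g -> L2 a b (fun x => f x + g x).
Proof.
move=> Hf Hg; split.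
  by apply: measurable_funD; [case: Hf|case: Hg].
have := L1D (L1D (proj2 Hf) (proj2 Hg)) (L1Z 2 (L2M Hf Hg)).
by apply: L1_eq => x _; ring.
Qed.

Lemma L2B a b f g : L2 a b f -> L2 a b g -> L2 a b (fun x => f x - g x).
Proof.
move=> Hf Hg; apply: L2_eq (L2D Hf (L2Z (-1) Hg)) => x _; by rewrite mulN1r.
Qed.

Lemma L2_sub a b c d f : a <= c -> d <= b -> L2 a b f -> L2 c d f.
Proof.
move=> ac db [mf Hf]; split; last exact: L1_sub Hf.
by apply: measurable_funS mf => //; apply: subset_itv; rewrite bnd_simp.
Qed.

Lemma itg_CS a b f g : L2 a b f -> L2 a b g ->
  itg a b (fun x => f x * g x) ^+ 2 <=
  itg a b (fun x => f x ^+ 2) * itg a b (fun x => g x ^+ 2).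
Proof.
move=> Hf Hg.
set A := itg a b (fun x => f x ^+ 2); set B := itg a b (fun x => g x ^+ 2).
set C := itg a b (fun x => f x * g x).
apply: sqr_le_of_form_ge0 => s t.
have Lf := Hf.2; have Lg := Hg.2; have Lfg := L2M Hf Hg.
rewrite /A /B /C -(itgZ _ Lf) -(itgZ _ Lg) -(itgZ _ Lfg).
rewrite -(itgD (L1Z _ Lf) (L1Z _ Lfg)) -itgD; last 2 first.
- by apply: L1D; exact: L1Z.
- exact: L1Z.
apply: itg_ge0 => x _.
have -> : s ^+ 2 * f x ^+ 2 + 2 * (s * t) * (f x * g x) + t ^+ 2 * g x ^+ 2 =
  (s * f x + t * g x) ^+ 2 by ring.
exact: sqr_ge0.
Qed.

Lemma itg_CS_sqrt a b f g : L2 a b f -> L2 a b g ->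
  `|itg a b (fun x => f x * g x)| <=
  Num.sqrt (itg a b (fun x => f x ^+ 2)) * Num.sqrt (itg a b (fun x => g x ^+ 2)).
Proof.
move=> Hf Hg; rewrite -sqrtrM ?itg_ge0// => [|x _]; last exact: sqr_ge0.
rewrite -sqrtr_sqr ler_sqrt ?sqr_ge0//; first exact: itg_CS.
by rewrite mulr_ge0// itg_ge0// => x _; rewrite sqr_ge0.
Qed.

Lemma itg_sqr_le a b f : a <= b -> L2 a b f ->
  itg a b f ^+ 2 <= (b - a) * itg a b (fun x => f x ^+ 2).
Proof.
move=> ab Hf; have := itg_CS Hf (L2_cst a b 1).
rewrite expr1n itg_cst// mul1r mulrC; apply: le_trans.
by rewrite (@itg_eq a b _ f)// => x _; rewrite mulr1.
Qed.

End IntervalIntegral.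

(** * Uniform continuity and primitives of integrable functions *)

Section AbsoluteContinuity.
Context {R : realType}.
Local Notation mu := (@lebesgue_measure R).
Implicit Types (a b c k : R) (f g : R -> R).

(* [d] plays the role of a pseudo-distance, e.g. the norm of a difference of
   two values of a vector-valued function. *)
Lemma segment_unif_cont a b (d : R -> R -> R) :
  (forall s t u, a <= s <= b -> a <= t <= b -> a <= u <= b ->
     d s t <= d s u + d t u) ->
  (forall t, a <= t <= b -> forall e : R, 0 < e -> exists2 del : R, 0 < del &
     forall s, a <= s <= b -> `|s - t| < del -> d s t < e) ->
  forall e : R, 0 < e -> exists2 del : R, 0 < del &
     forall s t, a <= s <= b -> a <= t <= b -> `|s - t| < del -> d s t < e.
Proof.
move=> tri loc e e0.
pose P (del : R) (t : R) :=
  forall s, a <= s <= b -> `|s - t| < del -> d s t < e.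
(* Compactness, in the form of near coverings, makes one radius serve all points; the local radius
   is halved so that the triangle inequality can pass through a neighbouring centre. *)
have /near_covering_withinP cov : near_covering `[a, b].
  exact/compact_near_coveringP/segment_compact.
have := cov _ (at_right (0:R)) P _.
have H : forall x, `[a, b]%classic x ->
    \forall x' \near x & i \near (0:R)^'+, `[a, b]%classic x' -> P i x'.
  move=> x /=; rewrite in_itv/= => xab.
  have e20 : 0 < e / 2 by rewrite divr_gt0.
  have [del del0 Hd] := loc x xab (e / 2) e20.
  exists (ball x (del / 2), [set i | 0 < i < del / 2]).
    split => /=; first by apply: nbhsx_ballx; rewrite divr_gt0.
    near=> i; apply/andP; split; first by near: i; exact: nbhs_right_gt.
    by near: i; apply: nbhs_right_lt; rewrite divr_gt0.
  - move=> [y i] [/= By /andP[i0 id]]; rewrite in_itv/= => yab s sab syi.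
    rewrite (le_lt_trans (tri s y x _ _ _))// (splitr e) ltrD//; apply: Hd => //.
      rewrite -(subrK y s) -addrA (le_lt_trans (ler_normD _ _))// (splitr del) ltrD//.
        exact: lt_trans id.
      by move: By; rewrite /ball/= distrC.
    by move: By; rewrite /ball/= distrC => /lt_le_trans; apply; rewrite ler_pdivrMr// ler_pMr// ler1n.
move=> /(_ _ H) [del /= del0 Hdel].
exists (del / 2); first by rewrite divr_gt0.
move=> s t sab tab st; apply: (Hdel (del / 2)) => //=.
- by rewrite sub0r normrN gtr0_norm ?divr_gt0// ltr_pdivrMr// ltr_pMr// ltr1n.
- by rewrite divr_gt0.
Unshelve. all: by end_near. Qed.

(** Same as continuity within the closed interval, by [within_ucont] and [ucont_within]; the
    explicit modulus is what the mollification and averaging arguments consume. *)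
Definition ucont a b f := forall e : R, 0 < e -> exists2 d : R, 0 < d &
  forall x y, a <= x <= b -> a <= y <= b -> `|x - y| < d -> `|f x - f y| < e.

Lemma within_ucont a b f : {within `[a, b], continuous f} -> ucont a b f.
Proof.
move=> cf; apply: (segment_unif_cont (d := fun s t => `|f s - f t|)).
  move=> s t u _ _ _; rewrite -(subrKA (f u)).
  by rewrite (le_trans (ler_normD _ _))// lerD2l distrC.
move=> t tab e e0; move/subspace_continuousP : cf => /(_ t).
rewrite /= in_itv/= => /(_ tab) /cvgrPdist_lt/(_ _ e0)[del /= del0 Hd].
exists del => // s sab st; rewrite distrC; apply: Hd => //=.
by rewrite distrC.
Qed.

Lemma ucont_within a b f : ucont a b f -> {within `[a, b], continuous f}.
Proof.
move=> cf; apply/subspace_continuousP => t; rewrite /= in_itv/= => tab.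
apply/cvgrPdist_lt => e e0; have [del del0 Hd] := cf e e0.
exists del => //= s st; rewrite in_itv/= => sab; exact: Hd.
Qed.

Lemma ucont_bounded a b f : ucont a b f ->
  exists2 M : R, 0 < M & forall x, a <= x <= b -> `|f x| <= M.
Proof.
move=> /ucont_within cf.
have /compact_bounded[M [_ mrt]] := continuous_compact cf (@segment_compact _ a b).
exists (`|M| + 1); first by rewrite ltr_wpDl.
move=> x xab; apply: (mrt (`|M| + 1)); first by rewrite (le_lt_trans (ler_norm _))// ltrDl.
by exists x => //=; rewrite in_itv.
Qed.

Lemma ucont_meas a b f : ucont a b f -> measurable_fun `]a, b[ f.
Proof.
move=> /ucont_within cf; apply: (@measurable_funS _ _ _ _ `[a, b]%classic) => //.
  exact: subset_itv_oo_cc.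
exact: subspace_continuous_measurable_fun.
Qed.

Lemma ucont_L2 a b f : ucont a b f -> L2 a b f.
Proof.
move=> cf; have [M M0 fM] := ucont_bounded cf.
apply: (@L2_bounded _ _ _ _ M); first exact: ucont_meas.
by move=> x /andP[x1 x2]; apply: fM; rewrite !ltW.
Qed.

Lemma ucont_L1 a b f : ucont a b f -> L1 a b f.
Proof. by move=> /ucont_L2/L2_L1. Qed.

Lemma ucont_sub a b c d f : a <= c -> d <= b -> ucont a b f -> ucont c d f.
Proof.
move=> ac db cf e /cf[del d0 H]; exists del => // x y /andP[x1 x2] /andP[y1 y2].
by apply: H; rewrite ?(le_trans ac)// (le_trans _ db).
Qed.

Lemma ucont_eq a b f g : (forall x, a <= x <= b -> f x = g x) ->
  ucont a b f -> ucont a b g.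
Proof.
move=> fg cf e /cf[del d0 H]; exists del => // x y xab yab; rewrite -!fg//.
exact: H.
Qed.

Lemma ucont_cst a b k : ucont a b (fun=> k).
Proof. by move=> e e0; exists 1 => // x y _ _ _; rewrite subrr normr0. Qed.

Lemma ucontD a b f g : ucont a b f -> ucont a b g -> ucont a b (fun x => f x + g x).
Proof.
move=> cf cg e e0; have e20 : 0 < e / 2 by rewrite divr_gt0.
have [d1 d10 H1] := cf _ e20; have [d2 d20 H2] := cg _ e20.
exists (Num.min d1 d2); first by rewrite lt_min d10.
move=> x y xab yab; rewrite lt_min => /andP[xy1 xy2].
rewrite opprD addrACA (le_lt_trans (ler_normD _ _))// (splitr e) ltrD//.
  exact: H1.
exact: H2.
Qed.

Lemma ucontZ a b k f : ucont a b f -> ucont a b (fun x => k * f x).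
Proof.
move=> cf e e0; have k0 : 0 < `|k| + 1 by rewrite ltr_wpDl.
have [d d0 H] := cf (e / (`|k| + 1)) (divr_gt0 e0 k0).
exists d => // x y xab yab xy; rewrite -mulrBr normrM.
have := H x y xab yab xy; rewrite ltr_pdivlMr// mulrC; apply: le_lt_trans.
by rewrite ler_wpM2r// lerDl.
Qed.

Lemma ucontN a b f : ucont a b f -> ucont a b (fun x => - f x).
Proof.
by move=> cf; apply: ucont_eq (ucontZ (-1) cf) => x _; rewrite mulN1r.
Qed.

Lemma ucontB a b f g : ucont a b f -> ucont a b g -> ucont a b (fun x => f x - g x).
Proof. by move=> cf cg; apply: ucontD => //; exact: ucontN. Qed.

Lemma ucontM a b f g : ucont a b f -> ucont a b g -> ucont a b (fun x => f x * g x).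
Proof.
move=> cf cg; have [M M0 fM] := ucont_bounded cf; have [N N0 gN] := ucont_bounded cg.
move=> e e0; have MN : 0 < M + N by rewrite addr_gt0.
have e1 : 0 < e / (M + N) by rewrite divr_gt0.
have [d1 d10 H1] := cf _ e1; have [d2 d20 H2] := cg _ e1.
exists (Num.min d1 d2); first by rewrite lt_min d10.
move=> x y xab yab; rewrite lt_min => /andP[xy1 xy2].
have -> : f x * g x - f y * g y = f x * (g x - g y) + (f x - f y) * g y by ring.
rewrite (le_lt_trans (ler_normD _ _))// !normrM.
have -> : e = M * (e / (M + N)) + (e / (M + N)) * N.
  by rewrite [in X in X + _]mulrC -mulrDr divfK// gt_eqF.
apply: ltr_leD.
  by rewrite (le_lt_trans (ler_wpM2r _ (fM _ xab)))// ltr_pM2l// H2.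
by rewrite ler_pM// ?gN// ltW// H1.
Qed.

Lemma ucont_affine a b c d k l f : ucont a b f ->
  (forall x, c <= x <= d -> a <= k * x + l <= b) ->
  ucont c d (fun x => f (k * x + l)).
Proof.
move=> cf kl e e0; have [del d0 H] := cf _ e0; have k0 : 0 < `|k| + 1 by rewrite ltr_wpDl.
exists (del / (`|k| + 1)); first by rewrite divr_gt0.
move=> x y xcd ycd xy; apply: H; [exact: kl|exact: kl|].
rewrite opprD addrACA subrr addr0 -mulrBr normrM.
move: xy; rewrite ltr_pdivlMr// mulrC; apply: le_lt_trans.
by rewrite ler_wpM2r// lerDl.
Qed.

Lemma L1M_ucont a b f g : ucont a b f -> L1 a b g -> L1 a b (fun x => f x * g x).
Proof.
move=> cf Hg; have [M M0 fM] := ucont_bounded cf.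
apply: (L1_le _ _ (L1Z M (L1_abs Hg))).
  by apply: measurable_funM; [exact: ucont_meas|exact: L1_meas].
move=> x /andP[x1 x2]; rewrite normrM ler_wpM2r// fM// !ltW//.
Qed.

(** Absolute continuity as being a primitive. It is a relation and not an operator because [f'] is
    determined only almost everywhere, whereas [f] is pinned down at every point of the closed
    interval. *)
Definition AC a b f f' := L1 a b f' /\
  forall x, a <= x <= b -> f x = f a + itg a x f'.

Lemma AC_sub a b c d f f' : a <= c -> d <= b -> AC a b f f' -> AC c d f f'.
Proof.
move=> ac db [If Hf]; split; first exact: L1_sub If.
move=> x /andP[cx xd]; have xb := le_trans xd db.
rewrite Hf ?(le_trans ac cx)// (@itg_split _ a x c)//; last exact: L1_sub If.
by rewrite addrA -Hf// ac (le_trans cx).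
Qed.

Lemma AC_diff a b f f' s t : AC a b f f' -> a <= s -> s <= t -> t <= b ->
  f t - f s = itg s t f'.
Proof.
move=> Hf as_ st tb; have [_ ->] := AC_sub as_ tb Hf; first by rewrite addrC addKr.
by rewrite st lexx.
Qed.

Lemma AC_primitive a b k f' : L1 a b f' -> AC a b (fun x => k + itg a x f') f'.
Proof. by move=> If; split => // x _; rewrite [itg a a _]itg_nil// addr0. Qed.

Lemma AC_eq a b f g f' : (forall x, a <= x <= b -> f x = g x) ->
  AC a b f f' -> AC a b g f'.
Proof.
move=> fg [If Hf]; split => // x /andP[ax xb].
by rewrite -!fg ?lexx ?ax ?(le_trans ax)// Hf// ax.
Qed.

Lemma AC_eqd a b f f' g' : (forall x, a < x < b -> f' x = g' x) ->
  AC a b f f' -> AC a b f g'.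
Proof.
move=> fg [If Hf]; split; first exact: L1_eq If.
move=> x /andP[ax xb]; rewrite Hf ?ax//; congr (_ + _); apply: itg_eq => y /andP[ay yx].
by rewrite fg// ay (lt_le_trans yx).
Qed.

Lemma ACD a b f f' g g' : AC a b f f' -> AC a b g g' ->
  AC a b (fun x => f x + g x) (fun x => f' x + g' x).
Proof.
move=> [If Hf] [Ig Hg]; split; first exact: L1D.
move=> x xab; have [/andP[ax xb]] := (xab).
rewrite (Hf x xab) (Hg x xab) itgD; [ring|exact: L1_sub If|exact: L1_sub Ig].
Qed.

Lemma ACZ a b k f f' : AC a b f f' -> AC a b (fun x => k * f x) (fun x => k * f' x).
Proof.
move=> [If Hf]; split; first exact: L1Z.
move=> x xab; have [/andP[ax xb]] := (xab).
rewrite (Hf x xab) itgZ; [ring|exact: L1_sub If].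
Qed.

Lemma ACN a b f f' : AC a b f f' -> AC a b (fun x => - f x) (fun x => - f' x).
Proof.
move=> Hf; apply: AC_eq (AC_eqd _ (ACZ (-1) Hf)) => x _; by rewrite mulN1r.
Qed.

Lemma ACB a b f f' g g' : AC a b f f' -> AC a b g g' ->
  AC a b (fun x => f x - g x) (fun x => f' x - g' x).
Proof. by move=> Hf Hg; apply: ACD => //; exact: ACN. Qed.

Lemma AC_cst a b k : AC a b (fun=> k) (fun=> 0).
Proof. by split; [exact: L1_cst|move=> x _; rewrite itg0 addr0]. Qed.

Lemma AC_id a b : AC a b id (fun=> 1).
Proof.
split; first exact: L1_cst.
by move=> x /andP[ax _]; rewrite itg_cst// mul1r addrC subrK.
Qed.

Lemma AC_sum a b (I : Type) (s : seq I) (P : pred I) (F F' : I -> R -> R) :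
  (forall i, P i -> AC a b (F i) (F' i)) ->
  AC a b (fun x => \sum_(i <- s | P i) F i x) (fun x => \sum_(i <- s | P i) F' i x).
Proof.
move=> HF; elim: s => [|i s IH].
  by apply: AC_eq (AC_eqd _ (AC_cst a b 0)) => x _; rewrite big_nil.
case Pi : (P i); last by apply: AC_eq (AC_eqd _ IH) => x _; rewrite big_cons Pi.
by apply: AC_eq (AC_eqd _ (ACD (HF i Pi) IH)) => x _; rewrite big_cons Pi.
Qed.

Lemma AC_ucont a b f f' : AC a b f f' -> ucont a b f.
Proof.
move=> Hf; case: (ltP a b) => [ab|ba]; last first.
  move=> e e0; exists 1 => // x y /andP[x1 x2] /andP[y1 y2] _.
  have -> : x = y by apply/le_anti/andP; split; rewrite ?(le_trans x2) ?(le_trans y2)// (le_trans ba).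
  by rewrite subrr normr0.
have [If Hf'] := Hf.
(* Extended by zero, [f'] is integrable on the closed interval, where continuity of the indefinite
   integral can be quoted. *)
pose F := f' \_ `]a, b[.
have If2 : mu.-integrable `[a, b] (EFin \o F).
  rewrite -restrict_EFin; apply/integrable_restrict => //.
  by rewrite setIidr//; exact: subset_itv_oo_cc.
apply: (@ucont_eq _ _ (fun x => f a + \int[mu]_(t in `[a, x]) F t)).
  move=> x /andP[ax xb]; rewrite (Hf' x) ?ax//; congr (_ + _).
  have FE y : a < y < x -> f' y = F y.
    move=> /andP[ay yx].
    by rewrite /F patchE mem_set//= in_itv/= ay (lt_le_trans yx).
  rewrite (itg_eq FE) /itg /Rintegral (@integral_itv_bndoo _ a x _ true false)//.
  apply: measurableT_comp => //.
  exact: L1_meas (L1_eq FE (L1_sub (lexx a) xb If)).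
apply: ucontD; first exact: ucont_cst.
exact/within_ucont/(parameterized_integral_continuous (ltW ab) If2).
Qed.

(** Cut [[a, b]] into equal pieces shorter than [d] and telescope: the total increment of [Phi] is
    at most [e] times that of [psi]. This replaces differentiation almost everywhere in the product
    rule and in the change of variables. *)
Lemma eq_of_small_increments a b (Phi psi : R -> R) : a <= b ->
  (forall e : R, 0 < e -> exists2 d : R, 0 < d & forall s t, a <= s -> s <= t -> t <= b ->
     t - s < d -> `|Phi t - Phi s| <= e * (psi t - psi s)) ->
  Phi b = Phi a.
Proof.
move=> ab H; apply/eqP; rewrite -subr_eq0 -normr_le0; apply/ler_addgt0Pl => e e0.
pose P0 := `|psi b - psi a| + 1.
have P0p : 0 < P0 by rewrite ltr_wpDl.
have [d d0 Hd] := H (e / P0) (divr_gt0 e0 P0p).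
pose n : nat := (Num.truncn ((b - a) / d)).+1.
have n0 : (0 : R) < n%:R by rewrite ltr0n.
pose st (k : nat) : R := a + (b - a) / n%:R * k%:R.
have stn : st n = b by rewrite /st divfK ?gt_eqF// addrC subrK.
have st0 : st 0%N = a by rewrite /st mulr0 addr0.
have c0 : 0 <= (b - a) / n%:R by rewrite divr_ge0 ?subr_ge0// ltW.
have stS (k : nat) : st k.+1 - st k = (b - a) / n%:R.
  by rewrite /st opprD addrACA subrr add0r -mulrBr -natrB// subSnn mulr1.
have mon (k l : nat) : (k <= l)%N -> st k <= st l.
  by move=> kl; rewrite /st lerD2l ler_wpM2l// ler_nat.
have small : (b - a) / n%:R < d.
  rewrite ltr_pdivrMr// mulrC -ltr_pdivrMr//.
  have q0 : 0 <= (b - a) / d by rewrite divr_ge0 ?subr_ge0// ltW.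
  by have /andP[_] := truncn_itv q0.
have K (k : nat) : (k <= n)%N -> `|Phi (st k) - Phi a| <= e / P0 * (psi (st k) - psi a).
  elim: k => [_|k IH kn]; first by rewrite st0 !subrr normr0 mulr0.
  rewrite -(subrKA (Phi (st k))) -[psi _ - psi a](subrKA (psi (st k))).
  rewrite (le_trans (ler_normD _ _))// mulrDr lerD ?IH ?(ltnW kn)//.
  apply: Hd; rewrite ?stS//; [|exact: mon|by rewrite -stn mon].
  by rewrite -st0 mon.
have := K n (leqnn n); rewrite stn addr0 => /le_trans; apply.
rewrite -mulrA ler_piMr ?(ltW e0)// mulrC ler_pdivrMr// mul1r.
by rewrite (le_trans (ler_norm _))// lerDl.
Qed.

(** Over a short interval [[s, t]] the defect in the product rule is the integral of
    [f' (g t - g) + (f s - f) g'], hence at most the oscillation of [f] and [g] times the increment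
    of a primitive of [|f'| + |g'|]; [eq_of_small_increments] concludes. *)
Lemma ACM a b f f' g g' : AC a b f f' -> AC a b g g' ->
  AC a b (fun x => f x * g x) (fun x => f' x * g x + f x * g' x).
Proof.
move=> Hf Hg; have cf := AC_ucont Hf; have cg := AC_ucont Hg.
have [If _] := Hf; have [Ig _] := Hg.
have I1 : L1 a b (fun x => f' x * g x).
  by apply: L1_eq (L1M_ucont cg If) => x _; rewrite mulrC.
have I2 : L1 a b (fun x => f x * g' x) by exact: L1M_ucont.
have I12 := L1D I1 I2.
split => // x /andP[ax xb].
pose Phi t := f t * g t - itg a t (fun x => f' x * g x + f x * g' x).
pose psi t := itg a t (fun x => `|f' x| + `|g' x|).
have Ipsi := L1D (L1_abs If) (L1_abs Ig).
suff : Phi x = Phi a.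
  by rewrite /Phi [itg a a _]itg_nil// subr0 => <-; rewrite subrK.
apply: (@eq_of_small_increments a x Phi psi) => // e e0.
have [d1 d10 H1] := cf _ e0; have [d2 d20 H2] := cg _ e0.
exists (Num.min d1 d2); first by rewrite lt_min d10.
move=> s t as_ st tx; rewrite lt_min => /andP[st1 st2].
have tb := le_trans tx xb; have sb := le_trans st tb; have at_ := le_trans as_ st.
have sub h : L1 a b h -> L1 s t h by exact: L1_sub.
have subat h : L1 a b h -> L1 a t h by exact: L1_sub.
have psiE : psi t - psi s = itg s t (fun x => `|f' x| + `|g' x|).
  by rewrite /psi (itg_split as_ st (subat _ Ipsi)) addrC addKr.
have -> : Phi t - Phi s =
    itg s t (fun r => f' r * (g t - g r) + (f s - f r) * g' r).
  transitivity ((f t - f s) * g t + f s * (g t - g s) -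
      itg s t (fun x => f' x * g x + f x * g' x)).
    by rewrite /Phi (itg_split as_ st (subat _ I12)); ring.
  rewrite (AC_diff Hf as_ st tb) (AC_diff Hg as_ st tb) mulrC.
  rewrite -(itgZ _ (sub _ If)) -(itgZ _ (sub _ Ig)).
  rewrite -itgD; [|exact/L1Z/sub|exact/L1Z/sub].
  rewrite -itgB; [|by apply: L1D; apply: L1Z; exact: sub|exact: sub].
  by apply: itg_eq => r _; ring.
have If1 : L1 s t (fun r => f' r * (g t - g r)).
  by apply: L1_eq (L1B (L1Z (g t) (sub _ If)) (sub _ I1)) => r _; ring.
have If2 : L1 s t (fun r => (f s - f r) * g' r).
  by apply: L1_eq (L1B (L1Z (f s) (sub _ Ig)) (sub _ I2)) => r _; ring.
rewrite psiE -(itgZ _ (sub _ Ipsi)).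
apply: (le_trans (itg_abs _)); first exact: L1D.
apply: itg_le; [exact/L1_abs/L1D|exact/L1Z/sub|].
move=> r /andP[sr rt].
have rab : a <= r <= b by rewrite (le_trans as_ (ltW sr)) (le_trans (ltW rt)).
rewrite (le_trans (ler_normD _ _))// !normrM mulrDr lerD//.
  rewrite mulrC ler_wpM2r// ltW// H2 ?at_ ?tb//.
  by rewrite gtr0_norm ?subr_gt0// (lt_trans _ st2)// ltrD2l ltrN2.
rewrite ler_wpM2r// ltW// H1 ?as_ ?sb//.
by rewrite distrC gtr0_norm ?subr_gt0// (lt_trans _ st1)// ltrD2r.
Qed.

Lemma itg_by_parts a b f f' g g' : a <= b -> AC a b f f' -> AC a b g g' ->
  itg a b (fun x => f' x * g x) = f b * g b - f a * g a - itg a b (fun x => f x * g' x).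
Proof.
move=> ab Hf Hg; have [_ H] := ACM Hf Hg.
have := H b; rewrite ab lexx => /(_ isT) ->.
rewrite itgD; first by ring.
  apply: L1_eq (L1M_ucont (AC_ucont Hg) (proj1 Hf)) => x _; by rewrite mulrC.
exact: (L1M_ucont (AC_ucont Hf) (proj1 Hg)).
Qed.

Lemma AC_of_derive a b f f' : ucont a b f -> ucont a b f' ->
  (forall x, a < x < b -> is_derive x 1 f (f' x)) -> AC a b f f'.
Proof.
move=> cf cf' Hd; split; first exact: ucont_L1.
move=> x /andP[ax xb]; move: ax; rewrite le_eqVlt => /predU1P[<-|ax].
  by rewrite itg_nil// addr0.
have := @continuous_FTC2 R f' f a x ax.
move=> /(_ (ucont_within (ucont_sub (lexx a) xb cf'))).
have D : derivable_oo_LRcontinuous f a x.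
  split.
  - move=> y; rewrite in_itv/= => /andP[ay yx].
    have := Hd y; rewrite ay (lt_le_trans yx xb) => /(_ isT) h; exact: ex_derive.
  - apply/cvgrPdist_lt => e e0; have [d d0 H] := cf e e0.
    near=> y; apply: H.
    + by rewrite lexx ltW// (lt_le_trans ax).
    + apply/andP; split; first by near: y; exact: nbhs_right_ge.
      by rewrite (le_trans _ xb)//; near: y; exact: nbhs_right_le.
    + have ay : a < y by near: y; exact: nbhs_right_gt.
      rewrite ltr0_norm ?subr_lt0// opprB ltrBlDl; near: y; apply: nbhs_right_lt.
      by rewrite ltrDl.
  - apply/cvgrPdist_lt => e e0; have [d d0 H] := cf e e0.
    near=> y; apply: H.
    + by rewrite xb ltW.
    + apply/andP; split; first by near: y; exact: nbhs_left_ge.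
      by rewrite (le_trans _ xb)//; near: y; exact: nbhs_left_le.
    + have ay : y < x by near: y; exact: nbhs_left_lt.
      rewrite gtr0_norm ?subr_gt0// ltrBlDl -ltrBlDr; near: y; apply: nbhs_left_gt.
      by rewrite ltrBlDr ltrDl.
move=> /(_ D); have E : {in `]a, x[, derive1 f =1 f'}.
  move=> y; rewrite in_itv/= => /andP[ay yx]; rewrite derive1E.
  have := Hd y; rewrite ay (lt_le_trans yx xb) => /(_ isT) h; exact: derive_val.
move=> /(_ E); rewrite -EFinB => h.
have -> : itg a x f' = fine (f x - f a)%:E.
  rewrite -h (@integral_itv_bndoo _ a x _ true false)//.
  by apply: measurableT_comp => //; exact: ucont_meas (ucont_sub (lexx a) xb cf').
by rewrite /= addrC subrK.
Unshelve. all: by end_near. Qed.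

Lemma ucont_eq_of_itg a b f g : a < b -> ucont a b f -> ucont a b g ->
  (forall x, a <= x <= b -> itg a x f = itg a x g) ->
  forall x, a <= x <= b -> f x = g x.
Proof.
move=> ab cf cg H x /andP[ax xb]; apply/eqP; rewrite -subr_eq0.
apply/negPn/negP => h0; pose h y := f y - g y.
have ch : ucont a b h by exact: ucontB.
have e0 : 0 < `|h x| / 2 by rewrite divr_gt0// normr_gt0.
have [d d0 Hd] := ch _ e0.
(* On this neighbourhood of [x], clipped to [[a, b]], the integral of [h] vanishes although [h]
   stays within [|h x| / 2] of [h x]. *)
pose s := Num.max a (x - d / 2); pose t := Num.min b (x + d / 2).
have d20 : 0 < d / 2 by rewrite divr_gt0.
have xd : x - d / 2 < x by rewrite ltrBlDr ltrDl.
have dx : x < x + d / 2 by rewrite ltrDl.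
have sx : s <= x by rewrite ge_max ax ltW.
have xt : x <= t by rewrite le_min xb ltW.
have st : s < t.
  by rewrite lt_min !gt_max ab (lt_le_trans xd xb) (le_lt_trans ax dx) (lt_trans xd dx).
have as_ : a <= s by rewrite le_max lexx.
have tb : t <= b by rewrite ge_min lexx.
have Ih : L1 s t h by apply: (L1_sub as_ tb); exact: ucont_L1.
have Ih2 : L1 s t (fun y => h y - h x) by apply: L1B => //; exact: L1_cst.
have itgh : itg s t h = 0.
  have I u : a <= u -> u <= b -> itg a u h = 0.
    move=> au ub; rewrite /h itgB; [|exact: (L1_sub _ _ (ucont_L1 cf))|exact: (L1_sub _ _ (ucont_L1 cg))].
    by rewrite H ?au// subrr.
  have := @itg_split _ a t s h as_ (ltW st) (L1_sub (lexx a) tb (ucont_L1 ch)).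
  by rewrite !I ?add0r// ?(le_trans _ (ltW st)) ?(le_trans (ltW st)).
have : `|itg s t (fun y => h y - h x)| <= `|h x| / 2 * (t - s).
  apply: itg_abs_le; [exact: ltW|by []|] => y /andP[sy yt]; apply/ltW/Hd.
  - by rewrite (le_trans as_ (ltW sy)) (le_trans (ltW yt)).
  - by rewrite ax.
  have d2d : d / 2 < d by rewrite ltr_pdivrMr// ltr_pMr// ltr1n.
  have y1 : y < x + d / 2 by rewrite (lt_le_trans yt)// ge_min lexx orbT.
  have y2 : x - d / 2 < y by rewrite (le_lt_trans _ sy)// le_max lexx orbT.
  by rewrite ltr_norml; apply/andP; split; lra.
rewrite itgB//; last exact: L1_cst.
rewrite itgh itg_cst ?(ltW st)// sub0r normrN normrM (gtr0_norm (_ : 0 < t - s)) ?subr_gt0//.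
rewrite ler_pM2r ?subr_gt0// ler_pdivlMr// ger_pMr ?normr_gt0//.
by rewrite lern1.
Qed.

End AbsoluteContinuity.

(** * Weak derivatives *)

Section SmoothStep.
Context {R : realType}.
Implicit Types (f g : R -> R).

(** Existence of [k + 1] successive derivatives. The recursion peels the innermost derivative, so
    the rules for products and compositions become inductions on [k] for arbitrary functions. *)
Fixpoint diffn (k : nat) f : Prop :=
  (forall x : R, derivable f x 1) /\
  (if k is k'.+1 then diffn k' (derive1 f) else True).

Definition smooth f := forall k, diffn k f.

Lemma smooth_derivable f : smooth f -> forall n x, derivable (derive1n n f) x 1.
Proof.
move=> sf n; elim: n f sf => [|n IH] f sf x; first by have [] := sf 0%N.
rewrite derive1Sn; apply: IH => k; by have [] := sf k.+1.
Qed.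

Lemma derivable_derive1 f (x : R) : derivable f x 1 -> is_derive x 1 f (derive1 f x).
Proof. by move=> df; rewrite derive1E; exact: derivableP. Qed.

Lemma derive1_fun f f' : (forall x : R, is_derive x 1 f (f' x)) -> derive1 f = f'.
Proof.
by move=> H; apply/funext => x; rewrite derive1E; apply: (@derive_val _ _ _ _ _ _ _ (H x)).
Qed.

Lemma diffn0P f f' : (forall x : R, is_derive x 1 f (f' x)) -> diffn 0 f.
Proof. by move=> H; split => // x; apply: (@ex_derive _ _ _ _ _ _ _ (H x)). Qed.

Lemma diffnSP k f f' : (forall x : R, is_derive x 1 f (f' x)) ->
  diffn k f' -> diffn k.+1 f.
Proof.
move=> H Hf'; split; last by rewrite (derive1_fun H).
by move=> x; apply: (@ex_derive _ _ _ _ _ _ _ (H x)).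
Qed.

Lemma diffn_der k f : diffn k f -> forall x : R, is_derive x 1 f (derive1 f x).
Proof. by case: k => [|k] [df _] x; apply: derivable_derive1. Qed.

Lemma diffnW k f : diffn k.+1 f -> diffn k f.
Proof.
elim: k f => [|k IH] f [df Hf]; first by [].
by split; [exact: df|exact: IH].
Qed.

Lemma diffnD k f g : diffn k f -> diffn k g -> diffn k (fun x => f x + g x).
Proof.
elim: k f g => [|k IH] f g Hf Hg.
  exact: (diffn0P (fun x => is_deriveD (diffn_der Hf x) (diffn_der Hg x))).
apply: (diffnSP (fun x => is_deriveD (diffn_der Hf x) (diffn_der Hg x))).
by apply: IH; [case: Hf|case: Hg].
Qed.

Lemma diffnM k f g : diffn k f -> diffn k g -> diffn k (fun x => f x * g x).
Proof.
elim: k f g => [|k IH] f g Hf Hg.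
  exact: (diffn0P (fun x => is_deriveM (diffn_der Hf x) (diffn_der Hg x))).
apply: (diffnSP (fun x => is_deriveM (diffn_der Hf x) (diffn_der Hg x))).
apply: diffnD; apply: IH.
- exact: diffnW.
- by case: Hg.
- exact: diffnW.
- by case: Hf.
Qed.

Lemma diffn_comp k f g : diffn k f -> diffn k g -> diffn k (fun x => f (g x)).
Proof.
elim: k f g => [|k IH] f g Hf Hg.
  exact: (diffn0P (fun x => is_derive1_comp (diffn_der Hf (g x)) (diffn_der Hg x))).
apply: (diffnSP (fun x => is_derive1_comp (diffn_der Hf (g x)) (diffn_der Hg x))).
apply: diffnM; last by case: Hg.
by apply: IH; [case: Hf|exact: diffnW].
Qed.

Lemma smooth_cst (c : R) : smooth (fun=> c).
Proof.
move=> k; elim: k c => [|k IH] c.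
  exact: (diffn0P (fun x => is_derive_cst c x 1)).
exact: (diffnSP (fun x => is_derive_cst c x 1) (IH 0)).
Qed.

Lemma smooth_id : smooth id.
Proof.
case=> [|k]; first exact: (diffn0P (fun x => is_derive_id x 1)).
exact: (diffnSP (fun x => is_derive_id x 1) (smooth_cst 1 k)).
Qed.

Lemma smoothM f g : smooth f -> smooth g -> smooth (fun x => f x * g x).
Proof. by move=> sf sg k; exact: diffnM. Qed.

Lemma smoothD f g : smooth f -> smooth g -> smooth (fun x => f x + g x).
Proof. by move=> sf sg k; exact: diffnD. Qed.

Lemma smooth_comp f g : smooth f -> smooth g -> smooth (fun x => f (g x)).
Proof. by move=> sf sg k; exact: diffn_comp. Qed.

Lemma smooth_affine (k l : R) : smooth (fun x => k * x + l).
Proof.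
apply: smoothD; last exact: smooth_cst.
by apply: smoothM; [exact: smooth_cst|exact: smooth_id].
Qed.

Definition flat_exp (p : {poly R}) (x : R) : R :=
  if 0 < x then p.[x^-1] * expR (- x^-1) else 0.

(** Raise [y / (n + 1) <= exp (y / (n + 1))] to the power [n]; dividing by [n + 1] rather than [n]
    covers [n = 0]. *)
Lemma exprn_le_expR n (y : R) : 0 <= y -> y ^+ n <= n.+1%:R ^+ n * expR y.
Proof.
move=> y0; have n0 : (0 : R) < n.+1%:R by rewrite ltr0n.
have h : y / n.+1%:R <= expR (y / n.+1%:R).
  by rewrite (le_trans _ (expR_ge1Dx _))// lerDr.
have : (y / n.+1%:R) ^+ n <= expR (y / n.+1%:R) ^+ n.
  by rewrite lerXn2r// nnegrE ?expR_ge0// divr_ge0// ltW.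
have h2 : expR (y / n.+1%:R) ^+ n <= expR y.
  rewrite -expRM_natl ler_expR mulrCA.
  move: y0; rewrite le_eqVlt => /predU1P[<-|y0]; first by rewrite mul0r.
  by rewrite ger_pMr// ler_pdivrMr// mul1r ler_nat.
rewrite expr_div_n ler_pdivrMr ?exprn_gt0// => /le_trans; apply.
by rewrite mulrC ler_wpM2l// exprn_ge0// ltW.
Qed.

Lemma horner_le_expR (p : {poly R}) :
  exists2 C : R, 0 <= C & forall y, 0 <= y -> `|p.[y]| <= C * expR y.
Proof.
exists (\sum_(i < size p) `|p`_i| * i.+1%:R ^+ i).
  by apply: sumr_ge0 => i _; rewrite mulr_ge0// exprn_ge0.
move=> y y0; rewrite horner_coef (le_trans (ler_norm_sum _ _ _))// mulr_suml.
apply: ler_sum => i _; rewrite normrM (ger0_norm (exprn_ge0 _ y0)) -mulrA.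
by rewrite ler_wpM2l// exprn_le_expR.
Qed.

(** The exponential bound is applied to ['X^2 * p]; the two extra powers become the factor [x^2],
    which makes the difference quotient at 0 vanish. *)
Lemma flat_exp_le (p : {poly R}) :
  exists2 C : R, 0 <= C & forall x, `|flat_exp p x| <= C * x ^+ 2.
Proof.
have [C C0 HC] := horner_le_expR ('X^2 * p).
exists C => // x; rewrite /flat_exp; case: ltP => x0; last by rewrite normr0 mulr_ge0// sqr_ge0.
have y0 : 0 < x^-1 by rewrite invr_gt0.
have := HC _ (ltW y0); rewrite hornerM hornerXn normrM normrX (gtr0_norm y0) => h.
rewrite normrM (gtr0_norm (expR_gt0 _)) expRN ler_pdivrMr ?expR_gt0//.
rewrite mulrAC -ler_pdivrMr ?exprn_gt0// mulrC -exprVn//.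
Qed.

Lemma flat_exp_derive (p : {poly R}) (x : R) :
  is_derive x 1 (flat_exp p) (flat_exp ('X^2 * (p - p^`())) x).
Proof.
have [x0|x0|->] := ltgtP x 0.
- rewrite /flat_exp [in X in is_derive _ _ _ X]ltNge (ltW x0)/=.
  have : is_derive x 1 (fun _ : R => 0 : R) 0 by exact: is_derive_cst.
  apply: near_eq_is_derive; near=> y; rewrite ltNge ltW//=.
  by near: y; exact: lt_nbhsl.
- have xn0 : x != 0 by rewrite gt_eqF.
  rewrite /flat_exp [in X in is_derive _ _ _ X]x0.
  have D : is_derive x 1 (fun y : R => p.[y^-1] * expR (- y^-1))
     (('X^2 * (p - p^`())).[x^-1] * expR (- x^-1)).
    have d1 : is_derive x 1 (fun y : R => y^-1) (- x ^- 2).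
      have := @is_deriveV _ id x 1 1 xn0 (is_derive_id x 1).
      by rewrite /GRing.scale/= mulr1.
    have d2 : is_derive x 1 (fun y : R => p.[y^-1]) (p^`().[x^-1] * (- x ^- 2)).
      exact: (@is_derive1_comp R (horner p) _ x _ _ (is_derive_poly p (x^-1)) d1).
    have d3 : is_derive x 1 (fun y : R => expR (- y^-1)) (expR (- x^-1) * (- (- x ^- 2))).
      exact: (@is_derive1_comp R expR (fun y => - y^-1) x _ _ (is_derive_expR _) (is_deriveN d1)).
    have := is_deriveM d2 d3.
    rewrite /GRing.scale/= hornerM hornerXn hornerD hornerN exprVn.
    by congr (is_derive _ _ _ _); ring.
  move: D; apply: near_eq_is_derive; near=> y.
  rewrite ifT//; near: y; exact: lt_nbhsr.
have -> : flat_exp ('X^2 * (p - p^`())) 0 = 0 by rewrite /flat_exp ltxx.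
have [C C0 HC] := flat_exp_le p.
have lim0 : h^-1 *: (flat_exp p (h *: 1 + 0) - flat_exp p 0) @[h --> 0^'] --> (0 : R).
  apply/cvgrPdist_le => e e0; have C1 : 0 < C + 1 by rewrite ltr_wpDl.
  have ek : 0 < e / (C + 1) by rewrite divr_gt0.
  near=> h.
  have hn0 : h != 0 by near: h; exact: nbhs_dnbhs_neq.
  rewrite sub0r normrN /flat_exp ltxx subr0 -/(flat_exp p _) addr0.
  have -> : h *: (1 : R) = h by rewrite /GRing.scale/= mulr1.
  rewrite normrZ normfV ler_pdivrMl ?normr_gt0// (le_trans (HC h))//.
  rewrite -real_normK ?num_real// expr2 mulrCA ler_wpM2l//.
  have : `|h| <= e / (C + 1).
    near: h; exists (e / (C + 1)) => //=.
    by move=> z /=; rewrite sub0r normrN => /ltW.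
  rewrite ler_pdivlMr// mulrC; apply: le_trans.
  by rewrite ler_wpM2r// lerDl.
apply: DeriveDef; first by apply/cvg_ex; exists 0.
exact: cvg_lim lim0.
Unshelve. all: by end_near. Qed.

Lemma smooth_flat_exp (p : {poly R}) : smooth (flat_exp p).
Proof.
move=> k; elim: k p => [|k IH] p; first exact: (diffn0P (flat_exp_derive p)).
exact: (diffnSP (flat_exp_derive p) (IH _)).
Qed.

(* Composing two flat exponentials gives a function that is constant on both
   sides of a bounded interval. *)
Lemma smooth_step : exists psi : R -> R,
  [/\ smooth psi, forall x, x <= 0 -> psi x = 0 & forall x, 1 <= x -> psi x = 1].
Proof.
pose e := flat_exp 1.
have eE x : 0 < x -> e x = expR (- x^-1) by rewrite /e /flat_exp => ->; rewrite hornerC mul1r.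
have e1 : 0 < e 1 by rewrite eE// expR_gt0.
(* For [x <= 0] one has [e (1 - x) >= e 1], so the outer argument is nonpositive; for [x >= 1] the
   inner term is 0 and the value is the normalising constant [e (e 1)]. *)
exists (fun x => (e (e 1))^-1 * e (e 1 - e (1 - x))); split.
- apply: smoothM; first exact: smooth_cst.
  apply: (@smooth_comp e (fun x => e 1 - e (1 - x))); first exact: smooth_flat_exp.
  apply: smoothD; first exact: smooth_cst.
  have -> : (fun x => - e (1 - x)) = (fun x => (-1) * e ((-1) * x + 1)).
    by apply/funext => x; rewrite !mulN1r [- x + 1]addrC.
  apply: smoothM; first exact: smooth_cst.
  apply: (@smooth_comp e); first exact: smooth_flat_exp.
  exact: smooth_affine.
- move=> x x0; rewrite [e (e 1 - _)]/e /flat_exp ifF ?mulr0//; apply/negbTE.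
  rewrite -leNgt subr_le0 !eE//; last by rewrite subr_gt0 (le_lt_trans x0).
  rewrite ler_expR lerN2 invr1 invf_le1 ?subr_gt0 ?(le_lt_trans x0)//.
  by rewrite lerBrDr gerDl.
- move=> x x1; have -> : e (1 - x) = 0.
    by rewrite /e /flat_exp ifF//; apply/negbTE; rewrite -leNgt subr_le0.
  by rewrite subr0 mulVf// gt_eqF// eE// expR_gt0.
Qed.

End SmoothStep.

(** * Weak derivatives as primitives *)

Section WeakDerivative.
Context {R : realType}.
Local Notation mu := (@lebesgue_measure R).
Implicit Types (a b : R) (f g : R -> R).

Lemma smooth_is_derive f : smooth f -> forall x : R, is_derive x 1 f (derive1 f x).
Proof. by move=> sf; exact: diffn_der (sf 0%N). Qed.

Lemma smooth_derive1 f : smooth f -> smooth (derive1 f).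
Proof. by move=> sf k; have [] := sf k.+1. Qed.

Lemma continuous_ucont a b f : continuous f -> ucont a b f.
Proof. by move=> cf; apply: within_ucont; exact: continuous_subspaceT. Qed.

Lemma derivable_ucont a b f : (forall x : R, derivable f x 1) -> ucont a b f.
Proof.
move=> df; apply: continuous_ucont => x.
exact/differentiable_continuous/derivable1_diffP.
Qed.

Lemma smooth_ucont a b f : smooth f -> ucont a b f.
Proof. by move=> sf; apply: derivable_ucont; have [] := sf 0%N. Qed.

Lemma smooth_AC a b f : smooth f -> AC a b f (derive1 f).
Proof.
move=> sf; apply: AC_of_derive.
- exact: smooth_ucont.
- exact/smooth_ucont/smooth_derive1.
- by move=> x _; exact: smooth_is_derive.
Qed.

Lemma test_function_AC a b phi : test_function a b phi -> AC a b phi (derive1 phi).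
Proof.
move=> [dphi _]; apply: AC_of_derive.
- by apply: derivable_ucont => x; exact: (dphi 0%N).
- by apply: derivable_ucont => x; exact: (dphi 1%N).
- by move=> x _; apply: derivable_derive1; exact: (dphi 0%N).
Qed.

Lemma AC_weak_derivative a b f f' : a <= b -> AC a b f f' -> weak_derivative a b f f'.
Proof.
move=> ab Hf phi tphi; have Hphi := test_function_AC tphi.
have [_ [c [e [ac eb phi0]]]] := tphi.
have pa : phi a = 0 by apply: phi0; rewrite in_itv/= negb_and -ltNge ac.
have pb : phi b = 0 by apply: phi0; rewrite in_itv/= negb_and -!ltNge eb orbT.
rewrite -/(itg a b (fun x => f x * derive1 phi x)) -/(itg a b (fun x => f' x * phi x)).
by rewrite (itg_by_parts ab Hf Hphi) pa pb !mulr0 subrr sub0r opprK.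
Qed.

Lemma itg_supp a b s t f : a <= s -> s <= t -> t <= b -> L1 a b f ->
  (forall x, x <= s -> f x = 0) -> (forall x, t <= x -> f x = 0) ->
  itg a b f = itg s t f.
Proof.
move=> as_ st tb If fs ft.
rewrite (itg_split as_ (le_trans st tb) If) (itg_split st tb (L1_sub as_ (lexx b) If)).
have -> : itg a s f = 0.
  by rewrite -(itg0 a s); apply: itg_eq => x /andP[_ /ltW]; exact: fs.
have -> : itg t b f = 0.
  by rewrite -(itg0 t b); apply: itg_eq => x /andP[/ltW + _]; exact: ft.
by rewrite add0r addr0.
Qed.

Section Steps.
Variable psi : R -> R.
Hypotheses (spsi : smooth psi) (psi0 : forall x, x <= 0 -> psi x = 0)
  (psi1 : forall x, 1 <= x -> psi x = 1).

(** Rises from 0 to 1 across [[s, s + d]]. Its derivative is an approximate Dirac mass at [s], and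
    the difference of two such steps is a test function close to an indicator. *)
Let step (d s x : R) := psi (d^-1 * x + (- d^-1 * s)).

Let step_smooth d s : smooth (step d s).
Proof. exact: (smooth_comp spsi (smooth_affine _ _)). Qed.

Let step0 d s x : 0 < d -> x <= s -> step d s x = 0.
Proof.
move=> d0 xs; apply: psi0; rewrite mulNr -mulrBr.
by rewrite pmulr_rle0 ?invr_gt0// subr_le0.
Qed.

Let step1 d s x : 0 < d -> s + d <= x -> step d s x = 1.
Proof.
move=> d0 xs; apply: psi1; rewrite mulNr -mulrBr mulrC ler_pdivlMr// mul1r.
by rewrite lerBrDl.
Qed.

Let dstepE d s x : derive1 (step d s) x = d^-1 * derive1 psi (d^-1 * x + (- d^-1 * s)).
Proof.
have H1 : is_derive x 1 (fun y : R => d^-1 * y + (- d^-1 * s)) (d^-1).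
  have := is_deriveD (is_deriveM (is_derive_cst d^-1 x 1) (is_derive_id x 1)) (is_derive_cst (- d^-1 * s) x 1).
  by rewrite /GRing.scale/= mulr0 !addr0 mulr1.
have H2 := @is_derive1_comp R psi (fun y => d^-1 * y + (- d^-1 * s)) x _ _ (smooth_is_derive spsi _) H1.
rewrite derive1E mulrC; apply: (@derive_val _ _ _ _ _ _ _ H2).
Qed.

(** Strictly outside the unit interval [psi] is locally constant; at the two endpoints the
    derivative vanishes by continuity, as a limit of outside values. *)
Let dpsi_out x : x <= 0 \/ 1 <= x -> derive1 psi x = 0.
Proof.
have cont : continuous (derive1 psi).
  move=> y; apply/differentiable_continuous/derivable1_diffP.
  by have [] := smooth_derive1 spsi 0%N.
have out y : y < 0 \/ 1 < y -> derive1 psi y = 0.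
  move=> [y0|y1].
    rewrite derive1E; apply: (@derive_val _ _ _ _ _ _ _ _).
    have : is_derive y 1 (fun _ : R => 0 : R) 0 by exact: is_derive_cst.
    apply: near_eq_is_derive; near=> z; rewrite psi0// ltW//.
    by near: z; exact: lt_nbhsl.
  rewrite derive1E; apply: (@derive_val _ _ _ _ _ _ _ _).
  have : is_derive y 1 (fun _ : R => 1 : R) 0 by exact: is_derive_cst.
  apply: near_eq_is_derive; near=> z; rewrite psi1// ltW//.
  by near: z; exact: lt_nbhsr.
have unif := continuous_ucont (-1) 2 cont.
move=> x01.
have xin : x < 0 \/ x = 0 \/ x = 1 \/ 1 < x.
  case: x01; rewrite le_eqVlt.
    by move=> /predU1P[->|]; [right; left|left].
  by move=> /predU1P[<-|]; right; right; [left|right].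
have lim y z : (forall e : R, 0 < e -> exists2 w, (w < 0 \/ 1 < w) & -1 <= w <= 2 /\ `|y - w| < e) ->
   -1 <= y <= 2 -> z = y -> derive1 psi z = 0.
  move=> H yin ->; apply/eqP; rewrite -normr_le0; apply/ler_addgt0Pl => e e0; rewrite addr0.
  have [d d0 Hd] := unif e e0; have [w wo [win yw]] := H d d0.
  by have := Hd y w yin win yw; rewrite (out w wo) subr0 => /ltW.
case: xin => [xl|[xe|[xe|xg]]]; [exact: out (or_introl xl)| | |exact: out (or_intror xg)].
  apply: (lim 0) xe; last by lra.
  move=> e e0; exists (- Num.min 1 (e / 2)).
    by left; rewrite oppr_lt0 lt_min ltr01 divr_gt0.
  have m1 : Num.min 1 (e / 2) <= 1 by rewrite ge_min lexx.
  have m2 : Num.min 1 (e / 2) <= e / 2 by rewrite ge_min lexx orbT.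
  have m0 : 0 < Num.min 1 (e / 2) by rewrite lt_min ltr01 divr_gt0.
  split; first by apply/andP; split; lra.
  rewrite sub0r opprK gtr0_norm//; lra.
apply: (lim 1) xe; last by lra.
move=> e e0; exists (1 + Num.min 1 (e / 2)).
  by right; rewrite ltrDl lt_min ltr01 divr_gt0.
have m1 : Num.min 1 (e / 2) <= 1 by rewrite ge_min lexx.
have m2 : Num.min 1 (e / 2) <= e / 2 by rewrite ge_min lexx orbT.
have m0 : 0 < Num.min 1 (e / 2) by rewrite lt_min ltr01 divr_gt0.
split; first by apply/andP; split; lra.
rewrite opprD addrA subrr sub0r normrN gtr0_norm//; lra.
Unshelve. all: by end_near. Qed.

Let rho_bound : exists2 C : R, 0 < C & forall x, `|derive1 psi x| <= C.
Proof.
have [C C0 HC] := ucont_bounded (smooth_ucont 0 1 (smooth_derive1 spsi)).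
exists C => // x; case: (leP x 0) => x0.
  by rewrite (dpsi_out (or_introl x0)) normr0 ltW.
case: (leP 1 x) => x1; first by rewrite (dpsi_out (or_intror x1)) normr0 ltW.
by apply: HC; rewrite !ltW.
Qed.

Let psi_bound : exists2 C : R, 0 < C & forall x, `|psi x| <= C.
Proof.
have [C C0 HC] := ucont_bounded (smooth_ucont 0 1 spsi).
exists (C + 1); first by rewrite addr_gt0.
move=> x; case: (leP x 0) => x0; first by rewrite psi0// normr0 addr_ge0// ltW.
case: (leP 1 x) => x1; first by rewrite psi1// normr1 lerDr ltW.
by rewrite (le_trans (HC _ _)) ?lerDl// !ltW.
Qed.

(* Both sides of the weak formulation converge when the test function tends to
   the indicator of [s, t]. *)
Lemma weak_derivative_AC_aux a b f f' : ucont a b f -> L1 a b f' ->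
  weak_derivative a b f f' ->
  forall s t, a < s -> s < t -> t < b -> f t - f s = itg s t f'.
Proof.
move=> cf If H s t as_ st tb.
have [C C0 HC] := rho_bound; have [C' C'0 HC'] := psi_bound.
have ab : a <= b by rewrite ltW// (lt_trans as_)// (lt_trans st).
apply/eqP; rewrite -subr_eq0 -normr_le0; apply/ler_addgt0Pl => e e0; rewrite addr0.
have cF := AC_ucont (AC_primitive 0 (L1_abs If)).
(* Error budget: two errors [C (e / K)] from [key] and two errors [(C' + 1) (e / K)] from [key2] add
   up to [e]. *)
pose K := 2 * C + 2 * C' + 2.
have K0 : 0 < K by rewrite /K; lra.
have eK : 0 < e / K by rewrite divr_gt0.
have [d1 d10 H1] := cf _ eK; have [d2 d20 H2] := cF _ eK.
pose d := Num.min (Num.min (d1 / 2) (d2 / 2)) (Num.min (t - s) ((b - t) / 2)).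
have d0 : 0 < d.
  by rewrite !lt_min !divr_gt0 ?subr_gt0// st.
have dd1 : d < d1.
  have : d <= d1 / 2 by rewrite !ge_min lexx.
  by lra.
have dd2 : d < d2.
  have : d <= d2 / 2 by rewrite !ge_min lexx !orbT.
  by lra.
have dst : d <= t - s by rewrite !ge_min lexx !orbT.
have dbt : d < b - t.
  have : d <= (b - t) / 2 by rewrite !ge_min lexx !orbT.
  have : 0 < b - t by rewrite subr_gt0.
  by lra.
pose phi x := step d s x - step d t x.
have sphi : smooth phi.
  have -> : phi = (fun x => step d s x + (-1) * step d t x).
    by apply/funext => x; rewrite mulN1r.
  by apply: smoothD; [|apply: smoothM; [exact: smooth_cst|]].
have tphi : test_function a b phi.
  split; first exact: smooth_derivable.
  exists s, (t + d); split => //; first by rewrite -ltrBrDl.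
  move=> x; rewrite in_itv/= negb_and -!ltNge => /orP[xs|xt].
    by rewrite /phi !step0 ?subrr// ltW// (lt_trans xs).
  rewrite /phi !step1 ?subrr// ltW// (le_lt_trans _ xt)// lerD2r ltW//.
have dphiE x : derive1 phi x = derive1 (step d s) x - derive1 (step d t) x.
  rewrite [LHS]derive1E; apply: (@derive_val _ _ _ _ _ _ _ _).
  exact: (is_deriveB (smooth_is_derive (step_smooth d s) x) (smooth_is_derive (step_smooth d t) x)).
(* The derivative of the step has integral 1, is bounded by [C / d] and lives on an interval of
   length [d] where [f] oscillates by less than [e / K]. *)
have key u : a <= u -> u + d <= b ->
    `|itg a b (fun x => f x * derive1 (step d u) x) - f u| <= C * (e / K).
  move=> au ub; have cw := smooth_ucont a b (smooth_derive1 (step_smooth d u)).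
  have w0 x : x <= u -> derive1 (step d u) x = 0.
    move=> xu; rewrite dstepE dpsi_out ?mulr0//; left.
    by rewrite mulNr -mulrBr pmulr_rle0 ?invr_gt0// subr_le0.
  have w1 x : u + d <= x -> derive1 (step d u) x = 0.
    move=> xu; rewrite dstepE dpsi_out ?mulr0//; right.
    by rewrite mulNr -mulrBr mulrC ler_pdivlMr// mul1r lerBrDl.
  have ud : u <= u + d by rewrite lerDl ltW.
  rewrite (itg_supp au ud ub); first last.
  - by move=> x /w1 ->; rewrite mulr0.
  - by move=> x /w0 ->; rewrite mulr0.
  - by apply: ucont_L1; exact: ucontM.
  have I1 := AC_diff (smooth_AC u (u + d) (step_smooth d u)) (lexx u) ud (lexx _).
  have Iw : L1 u (u + d) (derive1 (step d u)).
    by apply: (L1_sub au ub); exact: ucont_L1.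
  have Ifw : L1 u (u + d) (fun x => f x * derive1 (step d u) x).
    by apply: (L1_sub au ub); apply: ucont_L1; exact: ucontM.
  have -> : f u = itg u (u + d) (fun x => f u * derive1 (step d u) x).
    by rewrite itgZ// -I1 step1// step0// subr0 mulr1.
  rewrite -itgB//; last exact: L1Z.
  have -> : C * (e / K) = (C * (e / K) / d) * (u + d - u).
    by rewrite addrC addKr divfK// gt_eqF.
  apply: itg_abs_le => //; first by apply: L1B => //; exact: L1Z.
  move=> x /andP[ux xu]; rewrite -mulrBl normrM mulrC dstepE normrM (gtr0_norm (_ : 0 < d^-1)) ?invr_gt0//.
  have -> : C * (e / K) / d = d^-1 * (C * (e / K)) by ring.
  rewrite -mulrA ler_pM2l ?invr_gt0// ler_pM//.
  apply/ltW/H1; rewrite ?(le_trans au (ltW ux)) ?(le_trans (ltW xu))// ?au ?(le_trans ud)//.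
  rewrite gtr0_norm ?subr_gt0// (lt_trans _ dd1)// ltrBlDl//.
have := H phi tphi.
rewrite -/(itg a b (fun x => f x * derive1 phi x)) -/(itg a b (fun x => f' x * phi x)) => Hphi.
have E1 : itg a b (fun x => f x * derive1 phi x) =
    itg a b (fun x => f x * derive1 (step d s) x) - itg a b (fun x => f x * derive1 (step d t) x).
  rewrite -itgB; last 2 first.
  - by apply: ucont_L1; apply: ucontM => //; exact/smooth_ucont/smooth_derive1.
  - by apply: ucont_L1; apply: ucontM => //; exact/smooth_ucont/smooth_derive1.
  by apply: itg_eq => x _; rewrite dphiE mulrBr.
have Ifs u : L1 a b (fun x => f' x * step d u x).
  by apply: L1_eq (L1M_ucont (smooth_ucont a b (step_smooth d u)) If) => x _; rewrite mulrC.
(* The step and the indicator of [[u, b]] differ only on [[u, u + d]], where the integral of [|f'|]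
   is small by continuity of its primitive. *)
have key2 u : a <= u -> u + d <= b ->
    `|itg a b (fun x => f' x * step d u x) - itg u b f'| <= (C' + 1) * (e / K).
  move=> au ub; have ud : u <= u + d by rewrite lerDl ltW.
  have ub' := le_trans ud ub; have aud := le_trans au ud.
  have J c1 c2 h : a <= c1 -> c2 <= b -> L1 a b h -> L1 c1 c2 h by exact: L1_sub.
  rewrite (itg_split au ub' (Ifs u)) (itg_split ud ub (J _ _ _ au (lexx b) (Ifs u))).
  rewrite (itg_split ud ub (J _ _ _ au (lexx b) If)).
  have -> : itg a u (fun x => f' x * step d u x) = 0.
    rewrite -(itg0 a u); apply: itg_eq => x /andP[_ xu].
    by rewrite step0 ?mulr0// ltW.
  have -> : itg (u + d) b (fun x => f' x * step d u x) = itg (u + d) b f'.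
    by apply: itg_eq => x /andP[ux _]; rewrite step1 ?mulr1// ltW.
  rewrite add0r opprD addrACA subrr addr0 -itgB; [|exact: J|exact: J].
  have Ia := J u (u + d) _ au ub (L1_abs If).
  have : itg u (u + d) (fun x => `|f' x|) <= e / K.
    have -> : itg u (u + d) (fun x => `|f' x|) =
        (0 + itg a (u + d) (fun x => `|f' x|)) - (0 + itg a u (fun x => `|f' x|)).
      by rewrite (itg_split au ud (J _ _ _ (lexx a) ub (L1_abs If))); ring.
    apply: le_trans (ler_norm _) _; apply/ltW/H2; rewrite ?au ?aud ?ub ?ub'//.
    by rewrite addrC addKr gtr0_norm.
  have C1 : 0 < C' + 1 by rewrite addr_gt0.
  rewrite -(ler_pM2l C1); apply: le_trans.
  have I3 : L1 u (u + d) (fun x => f' x * step d u x - f' x).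
    by apply: L1B; exact: J.
  rewrite -itgZ// (le_trans (itg_abs I3))//; apply: itg_le; [exact: L1_abs|exact: L1Z|].
  move=> x _; rewrite -{2}(mulr1 (f' x)) -mulrBr normrM mulrC ler_wpM2r//.
  by rewrite (le_trans (ler_normB _ _))// normr1 lerD2r HC'.
have E2 : itg a b (fun x => f' x * phi x) =
    itg a b (fun x => f' x * step d s x) - itg a b (fun x => f' x * step d t x).
  by rewrite -itgB//; apply: itg_eq => x _; rewrite mulrBr.
have sd : s + d <= b by rewrite (le_trans _ (ltW tb))// -lerBrDl.
have td : t + d <= b by rewrite -lerBrDl ltW.
have as' := ltW as_; have at' : a <= t := le_trans as' (ltW st).
have := key s as' sd; have := key t at' td; have := key2 s as' sd; have := key2 t at' td.
have -> : itg s t f' = itg s b f' - itg t b f'.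
  by rewrite (itg_split (ltW st) (ltW tb) (L1_sub as' (lexx b) If)) addrK.
have eE : e = 2 * (C * (e / K)) + 2 * ((C' + 1) * (e / K)).
  have Kn0 : K != 0 by rewrite gt_eqF.
  have -> : 2 * (C * (e / K)) + 2 * ((C' + 1) * (e / K)) = K * (e / K) by rewrite /K; ring.
  by rewrite mulrC divfK.
move: Hphi; rewrite E1 E2 !ler_norml.
move: (itg a b (fun x => f x * derive1 (step d s) x)) => As.
move: (itg a b (fun x => f x * derive1 (step d t) x)) => At.
move: (itg a b (fun x => f' x * step d s x)) => Bs.
move: (itg a b (fun x => f' x * step d t x)) => Bt.
move: (C * (e / K)) ((C' + 1) * (e / K)) (itg s b f') (itg t b f') eE => X Y Is It eE.
move=> h /andP[h1 h2] /andP[h3 h4] /andP[h5 h6] /andP[h7 h8].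
clear -eE h h1 h2 h3 h4 h5 h6 h7 h8; subst e; apply/andP; split; lra.
Qed.

End Steps.

(* du Bois-Reymond *)
Lemma weak_derivative_AC a b f f' : a < b -> ucont a b f -> L1 a b f' ->
  weak_derivative a b f f' -> AC a b f f'.
Proof.
move=> ab cf If H; have [psi [sp p0 p1]] := @smooth_step R.
have K := weak_derivative_AC_aux sp p0 p1 cf If H.
split => // x xab.
pose G y := f y - (0 + itg a y f').
have cG : ucont a b G by apply: ucontB => //; exact: AC_ucont (AC_primitive 0 If).
pose m := (a + b) / 2.
have am : a < m by rewrite /m; lra.
have mb : m < b by rewrite /m; lra.
have Gc s t : a < s -> s < t -> t < b -> G t = G s.
  move=> as_ st tb; have := K s t as_ st tb; rewrite /G !add0r.
  rewrite (itg_split (ltW as_) (ltW st) (L1_sub (lexx a) (ltW tb) If)); lra.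
have GE y : a <= y <= b -> G y = G m.
  move=> /andP[ay yb]; apply/eqP; rewrite -subr_eq0 -normr_le0; apply/ler_addgt0Pl => e e0.
  rewrite addr0; have [d d0 Hd] := cG e e0.
  pose k := Num.min (1 / 2) (d / (2 * (b - a))).
  have ba : 0 < b - a by rewrite subr_gt0.
  have k0 : 0 < k by rewrite lt_min !divr_gt0// mulr_gt0.
  have k1 : k <= 1 / 2 by rewrite ge_min lexx.
  have kd : k * (b - a) < d.
    have : k <= d / (2 * (b - a)) by rewrite ge_min lexx orbT.
    rewrite ler_pdivlMr ?mulr_gt0// => h.
    have : k * (2 * (b - a)) = 2 * (k * (b - a)) by ring.
    by lra.
  (* The constancy of [G] is known only in the interior, so [y] is pushed a small proportion [k]
     towards the midpoint, staying within its modulus of continuity. *)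
  pose z := y + k * (m - y).
  have az : a < z.
    have : 0 <= (1 - k) * (y - a) by rewrite mulr_ge0; lra.
    have : 0 < k * (m - a) by rewrite mulr_gt0// subr_gt0.
    by rewrite /z; lra.
  have zb : z < b.
    have : 0 <= (1 - k) * (b - y) by rewrite mulr_ge0; lra.
    have : 0 < k * (b - m) by rewrite mulr_gt0// subr_gt0.
    by rewrite /z; lra.
  have <- : G z = G m.
    by have [zm|mz|->] := ltgtP z m; [rewrite -(Gc z m)|rewrite (Gc m z)|].
  apply/ltW/Hd; rewrite ?ay ?(ltW az) ?(ltW zb)//.
  rewrite /z opprD addrA subrr sub0r normrN normrM gtr0_norm//.
  rewrite (le_lt_trans _ kd)// ler_pM2l//.
  by rewrite ler_norml /m; lra.
have := GE x xab; rewrite -(GE a); last by rewrite lexx ltW.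
rewrite /G [itg a a _]itg_nil// !add0r subr0 => <-.
by rewrite subrK.
Qed.

End WeakDerivative.

(** * The hidden regularity estimate for the semi-discrete wave equation *)

Section DiscreteSums.
Context {F : rcfType}.
Implicit Types (a b f g : nat -> F).

Lemma sum_CS (I : eqType) (s : seq I) (P : pred I) (u v : I -> F) :
  (\sum_(i <- s | P i) u i * v i) ^+ 2 <=
  (\sum_(i <- s | P i) u i ^+ 2) * (\sum_(i <- s | P i) v i ^+ 2).
Proof.
apply: sqr_le_of_form_ge0 => x y.
rewrite !mulr_sumr -!big_split/=; apply: sumr_ge0 => i _.
have -> : x ^+ 2 * u i ^+ 2 + 2 * (x * y) * (u i * v i) + y ^+ 2 * v i ^+ 2 =
  (x * u i + y * v i) ^+ 2 by ring.
exact: sqr_ge0.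
Qed.

Lemma sum_CS_sqrt (I : eqType) (s : seq I) (P : pred I) (u v : I -> F) :
  `|\sum_(i <- s | P i) u i * v i| <=
  Num.sqrt (\sum_(i <- s | P i) u i ^+ 2) * Num.sqrt (\sum_(i <- s | P i) v i ^+ 2).
Proof.
have p0 (w : I -> F) : 0 <= \sum_(i <- s | P i) w i ^+ 2.
  by apply: sumr_ge0 => i _; exact: sqr_ge0.
by rewrite -sqrtrM// -sqrtr_sqr ler_sqrt ?sqr_ge0 ?mulr_ge0// sum_CS.
Qed.

Lemma ler_sum_nat_sub (m n m' n' : nat) f : (m <= m')%N -> (n' <= n)%N ->
  (forall i, 0 <= f i) -> \sum_(m' <= i < n') f i <= \sum_(m <= i < n) f i.
Proof.
move=> mm nn f0; case: (leqP m' n') => [mn|/ltnW mn]; last first.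
  by rewrite big_geq// sumr_ge0.
rewrite (big_cat_nat mm (leq_trans mn nn))/= (big_cat_nat mn nn)/=.
by rewrite addrCA lerDl addr_ge0// sumr_ge0.
Qed.

(** Abel summation with the linear weight [L - n]. The weight dies at the upper end, so the value at
    [m] is isolated against the plain sum of the others, and no individual term at [L] has to be
    controlled. *)
Lemma sum_weighted_telescope (m L : nat) f : (m <= L)%N ->
  \sum_(m <= n < L) (L - n)%:R * (f n - f n.+1) =
  (L - m)%:R * f m - \sum_(m.+1 <= n < L.+1) f n.
Proof.
elim: L => [|L IH] mL.
  by move: mL; rewrite leqn0 => /eqP ->; rewrite !big_geq// subnn mul0r subr0.
move: mL; rewrite leq_eqVlt => /predU1P[->|mL].
  by rewrite !big_geq// subnn mul0r subr0.
rewrite ltnS in mL.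
rewrite big_nat_recr//= subSnn mul1r.
have -> : \sum_(m <= i < L) (L.+1 - i)%:R * (f i - f i.+1) =
    \sum_(m <= i < L) (L - i)%:R * (f i - f i.+1) + \sum_(m <= i < L) (f i - f i.+1).
  rewrite -big_split/=; apply: eq_big_nat => i /andP[_ iL].
  by rewrite subSn ?(ltnW iL)// -natr1; ring.
rewrite IH// [in RHS]big_nat_recr//= subSn// -natr1.
have -> : \sum_(m <= i < L) (f i - f i.+1) = f m - f L.
  rewrite -[RHS]opprB -telescope_sumr// -sumrN; apply: eq_bigr => i _; by rewrite opprB.
by ring.
Qed.

Lemma le_of_sqr_le_affine (x b c : F) : 0 <= b -> 0 <= c -> x ^+ 2 <= b * x + c ->
  x <= b + Num.sqrt c.
Proof.
move=> b0 c0 H; rewrite leNgt; apply/negP => xb.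
have s0 := sqrtr_ge0 c.
have : (b + Num.sqrt c) * x < x ^+ 2.
  by rewrite expr2 ltr_pM2r// (le_lt_trans _ xb)// addr_ge0.
have : c <= Num.sqrt c * x.
  rewrite -{1}(sqr_sqrtr c0) expr2 ler_wpM2l// ltW// (le_lt_trans _ xb)// lerDr//.
lra.
Qed.

End DiscreteSums.

(** * Correlations along a transport chain *)

Section Chain.
Context {R : realType}.
Local Notation mu := (@lebesgue_measure R).
Variables (T h : R) (M : nat) (s : R) (r F : nat -> R -> R) (Phi : R -> R) (S : R).
Hypotheses (T0 : 0 <= T) (h0 : 0 < h) (s1 : `|s| = 1).
Hypothesis Hr : forall n, (0 < n <= M)%N ->
  AC 0 T (r n) (fun t => s * (r n.+1 t - r n.-1 t) / h + F n t).
Hypotheses (Hr0 : L2 0 T (r 0%N)) (HrM : L2 0 T (r M.+1)).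
Hypothesis HF : forall n, (0 < n <= M)%N -> L1 0 T (F n).
Hypotheses (HPhi : L1 0 T Phi) (Phi0 : forall t, 0 < t < T -> 0 <= Phi t).
Hypothesis HFPhi : forall t, 0 < t < T -> h * \sum_(1 <= n < M.+1) F n t ^+ 2 <= Phi t ^+ 2.

Definition chain_energy (t : R) : R := h * \sum_(1 <= n < M.+1) r n t ^+ 2.
Local Notation e := chain_energy.

Hypothesis HS : forall t, 0 <= t <= T -> e t <= S.

Lemma chain_energy_ge0 t : 0 <= e t.
Proof.
by rewrite mulr_ge0 ?(ltW h0)// sumr_ge0// => n _; exact: sqr_ge0.
Qed.

Let S0 : 0 <= S.
Proof. by rewrite (le_trans (chain_energy_ge0 0))// HS// lexx. Qed.

Let phi := itg 0 T Phi.

Let phi0 : 0 <= phi. Proof. exact: itg_ge0. Qed.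

Lemma chain_L2 n : (n <= M.+1)%N -> L2 0 T (r n).
Proof.
case: n => [//|n]; rewrite ltnS => nM.
have [->//|nM'] := eqVneq n M.
by apply: ucont_L2; apply: AC_ucont; apply: Hr; rewrite /= ltn_neqAle nM'.
Qed.

Lemma chain_ucont n : (0 < n <= M)%N -> ucont 0 T (r n).
Proof. by move=> /Hr/AC_ucont. Qed.

Let sum_le_energy (m a b : nat) t (f : nat -> nat) : (forall i, f (i + a)%N = (i + m)%N) ->
  0 <= t <= T -> (0 < m)%N -> (b - a + m <= M.+1)%N ->
  \sum_(a <= i < b) r (f i) t ^+ 2 <= S / h.
Proof.
move=> fE tT m0 mn; rewrite ler_pdivlMr// mulrC (le_trans _ (HS tT))// ler_pM2l//.
rewrite -{1}(add0n a) big_addn.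
have -> : \sum_(0 <= i < b - a) r (f (i + a)%N) t ^+ 2 = \sum_(m <= i < b - a + m) r i t ^+ 2.
  rewrite -{1}(add0n m) big_addn addnK; apply: eq_big_nat => i _; by rewrite fE.
by apply: ler_sum_nat_sub => // i; exact: sqr_ge0.
Qed.

(** The flux of the correlation [r_n r_(n+d)]: without sources, [h] times its time derivative is [s]
    times the flux at [n + 1] minus the flux at [n]. *)
Definition chain_flux (d n : nat) (t : R) : R :=
  r n.-1 t * r (n + d)%N t + r n t * r (n + d).-1 t.

Lemma chain_flux_L1 d n : (0 < n)%N -> (n + d <= M.+1)%N -> L1 0 T (chain_flux d n).
Proof.
move=> n0 nd; apply: L1D; apply: L2M; apply: chain_L2; clear -n0 nd; lia.
Qed.

(** Sum the correlations with weights [h (L - n)]. The derivative of this sum [X] contains [L - n0]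
    times the wanted flux, balanced by the sum [Q] of all fluxes. The energy bounds [X] by [L S] and
    [Q] by [2 S / h]; the loss [1 / h] is affordable because [L] will be comparable to [1 / h]. The
    sign [s] allows the chain to be read backwards. *)
Lemma chain_flux_le (d n0 L : nat) : (0 < n0)%N -> (n0 <= L)%N -> (0 < d)%N -> (L + d <= M)%N ->
  (L - n0)%:R * `|itg 0 T (chain_flux d n0)| <=
  2 * L%:R * S + 2 * T * S / h + 2 * L%:R * (phi * Num.sqrt S).
Proof.
move=> n00 nL d0 Ld.
pose X t := \sum_(n0 <= n < L) (h * (L - n)%:R) * (r n t * r (n + d)%N t).
pose G t := \sum_(n0 <= n < L) (h * (L - n)%:R) *
  (F n t * r (n + d)%N t + r n t * F (n + d)%N t).
pose Q t := \sum_(n0.+1 <= n < L.+1) chain_flux d n t.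
have rng n : (n0 <= n < L)%N -> (0 < n <= M)%N /\ (0 < n + d <= M)%N by lia.
have ACX : AC 0 T X (fun t => G t + s * (Q t - (L - n0)%:R * chain_flux d n0 t)).
  have H0 : AC 0 T X (fun t => \sum_(n0 <= n < L) (h * (L - n)%:R) *
     ((s * (r n.+1 t - r n.-1 t) / h + F n t) * r (n + d)%N t +
      r n t * (s * (r (n + d).+1 t - r (n + d).-1 t) / h + F (n + d)%N t))).
    rewrite /X; under [X in AC _ _ X _]eq_fun do rewrite big_nat_cond.
    under [X in AC _ _ _ X]eq_fun do rewrite big_nat_cond.
    apply: AC_sum => n; rewrite andbT => /rng[n1 n2].
    by apply: ACZ; apply: ACM; exact: Hr.
  apply: AC_eqd H0 => t _.
  have -> : s * (Q t - (L - n0)%:R * chain_flux d n0 t) =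
      \sum_(n0 <= n < L) (- s) * ((L - n)%:R * (chain_flux d n t - chain_flux d n.+1 t)).
    by rewrite -mulr_sumr sum_weighted_telescope// mulNr -mulrN opprB.
  rewrite /G -big_split/=; apply: eq_bigr => n _.
  rewrite /chain_flux addSn /=.
  have hn : h != 0 by rewrite gt_eqF.
  by field.
have IG : L1 0 T G.
  rewrite /G; under eq_fun do rewrite big_nat_cond.
  apply: L1_sum => n _; rewrite andbT => /rng[n1 n2]; apply: L1Z; apply: L1D.
    by apply: L1_eq (L1M_ucont (chain_ucont n2) (HF n1)) => t _; rewrite mulrC.
  exact: (L1M_ucont (chain_ucont n1) (HF n2)).
have IQ : L1 0 T Q.
  rewrite /Q; under eq_fun do rewrite big_nat_cond.
  by apply: L1_sum => n _; rewrite andbT => nn; apply: chain_flux_L1; lia.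
have Ip := @chain_flux_L1 d n0 n00 ltac:(lia).
have XT : X T - X 0 = itg 0 T G + s * (itg 0 T Q - (L - n0)%:R * itg 0 T (chain_flux d n0)).
  rewrite (AC_diff ACX (lexx 0) T0 (lexx T)) itgD//; last exact/L1Z/(L1B IQ)/L1Z.
  by rewrite itgZ ?itgB ?itgZ//; [exact: L1Z|exact/(L1B IQ)/L1Z].
have bX t : 0 <= t <= T -> `|X t| <= L%:R * S.
  move=> tT; rewrite /X (le_trans (ler_norm_sum _ _ _))//.
  have : \sum_(n0 <= n < L) `|h * (L - n)%:R * (r n t * r (n + d)%N t)| <=
     \sum_(n0 <= n < L) h * L%:R / 2 * (r n t ^+ 2 + r (n + d)%N t ^+ 2).
    apply: ler_sum_nat => n /andP[n1 n2]; rewrite normrM ger0_norm ?mulr_ge0 ?(ltW h0)//.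
    apply: (@le_trans _ _ (h * L%:R * `|r n t * r (n + d)%N t|)).
      by rewrite ler_wpM2r// ler_pM2l// ler_nat leq_subr.
    rewrite -[h * L%:R / 2 * _]mulrA ler_wpM2l ?mulr_ge0 ?(ltW h0)//.
    rewrite normrM -[r n t ^+ 2]real_normK ?num_real// -[r (n + d)%N t ^+ 2]real_normK ?num_real//.
    have := sqr_ge0 (`|r n t| - `|r (n + d)%N t|); lra.
  move/le_trans; apply; rewrite -mulr_sumr big_split/=.
  have b1 : \sum_(n0 <= n < L) r n t ^+ 2 <= S / h.
    by apply: (@sum_le_energy n0 _ _ _ (fun n : nat => n)) => //; (try move=> i); clear -n00 nL d0 Ld; lia.
  have b2 : \sum_(n0 <= n < L) r (n + d)%N t ^+ 2 <= S / h.
    by apply: (@sum_le_energy (n0 + d) _ _ _ (fun n : nat => (n + d)%N)) => //; (try move=> i); clear -n00 nL d0 Ld; lia.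
  have hL : 0 <= h * L%:R / 2 by rewrite divr_ge0// mulr_ge0// ltW.
  rewrite (le_trans (ler_wpM2l hL (lerD b1 b2)))//.
  have -> : h * L%:R / 2 * (S / h + S / h) = L%:R * S.
    have hn : h != 0 by rewrite gt_eqF.
    by field.
  by [].
have bQ t : 0 < t < T -> `|Q t| <= 2 * S / h.
  move=> /andP[t1 t2]; have tT : 0 <= t <= T by rewrite !ltW.
  rewrite /Q (le_trans (ler_norm_sum _ _ _))//.
  have : \sum_(n0.+1 <= n < L.+1) `|chain_flux d n t| <=
      \sum_(n0.+1 <= n < L.+1) 2^-1 * (r n.-1 t ^+ 2 + r (n + d)%N t ^+ 2 + (r n t ^+ 2 + r (n + d).-1 t ^+ 2)).
    apply: ler_sum_nat => n _; rewrite /chain_flux (le_trans (ler_normD _ _))// !normrM.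
    rewrite -[r n t ^+ 2]real_normK ?num_real// -[r (n + d)%N t ^+ 2]real_normK ?num_real//.
    rewrite -[r n.-1 t ^+ 2]real_normK ?num_real// -[r (n + d).-1 t ^+ 2]real_normK ?num_real//.
    have := sqr_ge0 (`|r n t| - `|r (n + d).-1 t|).
    have := sqr_ge0 (`|r n.-1 t| - `|r (n + d)%N t|); lra.
  move/le_trans; apply; rewrite -mulr_sumr !big_split/=.
  have b1 : \sum_(n0.+1 <= n < L.+1) r n.-1 t ^+ 2 <= S / h.
    by apply: (@sum_le_energy n0 _ _ _ (fun n : nat => n.-1)) => //; (try move=> i); clear -n00 nL d0 Ld; lia.
  have b2 : \sum_(n0.+1 <= n < L.+1) r (n + d)%N t ^+ 2 <= S / h.
    by apply: (@sum_le_energy (n0.+1 + d) _ _ _ (fun n : nat => (n + d)%N)) => //; (try move=> i); clear -n00 nL d0 Ld; lia.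
  have b3 : \sum_(n0.+1 <= n < L.+1) r n t ^+ 2 <= S / h.
    by apply: (@sum_le_energy n0.+1 _ _ _ (fun n : nat => n)) => //; (try move=> i); clear -n00 nL d0 Ld; lia.
  have b4 : \sum_(n0.+1 <= n < L.+1) r (n + d).-1 t ^+ 2 <= S / h.
    apply: (@sum_le_energy (n0 + d) _ _ _ (fun n : nat => (n + d).-1%N)) => //.
    - by move=> i; rewrite addnS addSn /= addnA.
    - by rewrite addn_gt0 n00.
    - by clear -nL Ld; lia.
  rewrite -mulrA; lra.
have bG t : 0 < t < T -> `|G t| <= 2 * L%:R * Num.sqrt S * Phi t.
  move=> tT'; have /andP[t1 t2] := tT'; have tT : 0 <= t <= T by rewrite !ltW.
  (* Cauchy-Schwarz with the factor [h] shared as [sqrt h] between the source, bounded by [Phi], and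
     the chain, bounded by the energy. *)
  have half (u v : nat -> R) : h * \sum_(n0 <= n < L) u n ^+ 2 <= Phi t ^+ 2 ->
      \sum_(n0 <= n < L) v n ^+ 2 <= S / h ->
      h * \sum_(n0 <= n < L) `|u n| * `|v n| <= Phi t * Num.sqrt S.
    move=> hu hv.
    have cs := sum_CS_sqrt (index_iota n0 L) xpredT (fun n => `|u n|) (fun n => `|v n|).
    have sE (w : nat -> R) : \sum_(n0 <= n < L) `|w n| ^+ 2 = \sum_(n0 <= n < L) w n ^+ 2.
      by apply: eq_bigr => n _; rewrite real_normK ?num_real.
    rewrite !sE in cs.
    have h1 : Num.sqrt (\sum_(n0 <= n < L) u n ^+ 2) <= Phi t / Num.sqrt h.
      rewrite ler_pdivlMr ?sqrtr_gt0// -sqrtrM ?sumr_ge0// => [|n _]; last exact: sqr_ge0.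
      by rewrite -[leRHS](ger0_norm (Phi0 tT')) -sqrtr_sqr ler_wsqrtr// mulrC.
    have h2 : Num.sqrt (\sum_(n0 <= n < L) v n ^+ 2) <= Num.sqrt S / Num.sqrt h.
      by rewrite -sqrtrV ?(ltW h0)// -sqrtrM// ler_wsqrtr.
    have := le_trans (ler_norm _) (le_trans cs (ler_pM (sqrtr_ge0 _) (sqrtr_ge0 _) h1 h2)).
    rewrite -(ler_pM2l h0) => /le_trans; apply.
    rewrite -{1}(sqr_sqrtr (ltW h0)) expr2.
    have hn : Num.sqrt h != 0 by rewrite gt_eqF// sqrtr_gt0.
    by rewrite le_eqVlt; apply/orP; left; apply/eqP; field.
  have F1 : h * \sum_(n0 <= n < L) F n t ^+ 2 <= Phi t ^+ 2.
    rewrite (le_trans _ (HFPhi tT'))// ler_pM2l//.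
    by apply: ler_sum_nat_sub; [lia|lia|move=> i; exact: sqr_ge0].
  have F2 : h * \sum_(n0 <= n < L) F (n + d)%N t ^+ 2 <= Phi t ^+ 2.
    rewrite (le_trans _ (HFPhi tT'))// ler_pM2l//.
    have -> : \sum_(n0 <= n < L) F (n + d)%N t ^+ 2 = \sum_(n0 + d <= n < L + d) F n t ^+ 2.
      by rewrite [RHS]big_addn addnK.
    by apply: ler_sum_nat_sub; [lia|lia|move=> i; exact: sqr_ge0].
  have b1 : \sum_(n0 <= n < L) r n t ^+ 2 <= S / h.
    by apply: (@sum_le_energy n0 _ _ _ (fun n : nat => n)) => //; (try move=> i); clear -n00 nL d0 Ld; lia.
  have b2 : \sum_(n0 <= n < L) r (n + d)%N t ^+ 2 <= S / h.
    by apply: (@sum_le_energy (n0 + d) _ _ _ (fun n : nat => (n + d)%N)) => //; (try move=> i); clear -n00 nL d0 Ld; lia.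
  have K1 := half (F^~ t) (fun n => r (n + d)%N t) F1 b2.
  have K2 := half (fun n => F (n + d)%N t) (r^~ t) F2 b1.
  rewrite /G (le_trans (ler_norm_sum _ _ _))//.
  have : \sum_(n0 <= n < L) `|h * (L - n)%:R * (F n t * r (n + d)%N t + r n t * F (n + d)%N t)| <=
     L%:R * (h * \sum_(n0 <= n < L) `|F n t| * `|r (n + d)%N t| +
             h * \sum_(n0 <= n < L) `|F (n + d)%N t| * `|r n t|).
    rewrite -mulrDr -big_split/= mulrA mulr_sumr; apply: ler_sum_nat => n _.
    rewrite normrM ger0_norm ?mulr_ge0 ?(ltW h0)// [L%:R * h]mulrC; apply: ler_pM => //.
    - by rewrite mulr_ge0// ltW.
    - by rewrite ler_pM2l// ler_nat leq_subr.
    - by rewrite (le_trans (ler_normD _ _))// !normrM lerD2l mulrC.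
  move/le_trans; apply; rewrite (le_trans (ler_wpM2l (ler0n _ L) (lerD K1 K2)))//.
  by rewrite le_eqVlt; apply/orP; left; apply/eqP; ring.
have iG : `|itg 0 T G| <= 2 * L%:R * (phi * Num.sqrt S).
  rewrite (le_trans (itg_abs IG))//.
  have -> : 2 * L%:R * (phi * Num.sqrt S) = itg 0 T (fun t => 2 * L%:R * Num.sqrt S * Phi t).
    by rewrite itgZ// /phi; ring.
  by apply: itg_le => //; [exact: L1_abs|exact: L1Z].
have iQ : `|itg 0 T Q| <= 2 * T * S / h.
  have := itg_abs_le T0 IQ bQ; rewrite subr0 => /le_trans; apply.
  by rewrite le_eqVlt; apply/orP; left; apply/eqP; ring.
have E : (L - n0)%:R * itg 0 T (chain_flux d n0) =
   itg 0 T Q - s * (X T - X 0 - itg 0 T G).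
  have ss : s * s = 1 by rewrite -expr2 -[s ^+ 2]real_normK ?num_real// s1 expr1n.
  by rewrite XT [_ + s * _ - _]addrC addKr mulrA ss; ring.
rewrite -[X in X * `|_|]ger0_norm// -normrM E (le_trans (ler_normB _ _))// [X in _ + X]normrM s1 mul1r.
have := bX T; have := bX 0; rewrite !lexx T0 => /(_ isT) X0 /(_ isT) X1.
have : `|X T - X 0 - itg 0 T G| <= L%:R * S + L%:R * S + 2 * L%:R * (phi * Num.sqrt S).
  by rewrite (le_trans (ler_normB _ _))// lerD// (le_trans (ler_normB _ _))// lerD.
lra.
Qed.

End Chain.

(** * Descent from the bulk of the chain to its ends *)

Section ChainEstimate.
Context {R : realType}.

Section End.
Variables (T T1 h : R) (N : nat) (s : R) (r F : nat -> R -> R) (Phi : R -> R) (S : R).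
Hypotheses (T0 : 0 <= T) (TT1 : T <= T1) (hE : h = N.+1%:R^-1) (N3 : (3 <= N)%N) (s1 : `|s| = 1).
Let M := (2 * N).+1.
Hypothesis Hr : forall n, (0 < n <= M)%N ->
  AC 0 T (r n) (fun t => s * (r n.+1 t - r n.-1 t) / h + F n t).
Hypotheses (Hr0 : L2 0 T (r 0%N)) (HrM : L2 0 T (r M.+1)).
Hypothesis HF : forall n, (0 < n <= M)%N -> L1 0 T (F n).
Hypotheses (HPhi : L1 0 T Phi) (Phi0 : forall t, 0 < t < T -> 0 <= Phi t).
Hypothesis HFPhi : forall t, 0 < t < T -> h * \sum_(1 <= n < M.+1) F n t ^+ 2 <= Phi t ^+ 2.
Hypothesis HS : forall t, 0 <= t <= T -> chain_energy h M r t <= S.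

Let phi := itg 0 T Phi.
Let P := (4 + 8 * T1) * S + 4 * (phi * Num.sqrt S).
Let x (k : nat) := Num.sqrt (itg 0 T (fun t => r k t ^+ 2)).
(** The slope of the barrier [x_k <= k y]. It satisfies [P + 2 x_0 y <= y^2], which carries the
    barrier from [2k] down to [k], and [T1 S <= y^2], which starts it in the bulk. *)
Let y := Num.sqrt P + 2 * x 0 + Num.sqrt (T1 * S).

Let h0 : 0 < h. Proof. by rewrite hE invr_gt0. Qed.
Let T10 : 0 <= T1. Proof. exact: le_trans TT1. Qed.
Let S0 : 0 <= S.
Proof. by rewrite (le_trans (chain_energy_ge0 M r h0 0))// HS// lexx. Qed.
Let phi0 : 0 <= phi. Proof. exact: itg_ge0. Qed.
Let P0 : 0 <= P.
Proof.
by rewrite addr_ge0// mulr_ge0 ?addr_ge0 ?mulr_ge0 ?sqrtr_ge0.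
Qed.
Let rL2 n : (n <= M.+1)%N -> L2 0 T (r n). Proof. exact: (chain_L2 Hr Hr0 HrM). Qed.
Let sq0 k : 0 <= itg 0 T (fun t => r k t ^+ 2).
Proof. by apply: itg_ge0 => t _; exact: sqr_ge0. Qed.
Let xx k : x k ^+ 2 = itg 0 T (fun t => r k t ^+ 2).
Proof. by rewrite /x sqr_sqrtr. Qed.

(** Take [L = N] in [chain_flux_le]: then [N - n0 >= N / 2], and [1 / h = N + 1 <= 2 N], so dividing
    by [N / 2] leaves a bound free of [h]. *)
Let flux_le d n0 : (0 < n0)%N -> (2 * n0 <= N)%N -> (0 < d)%N -> (d <= N.+1)%N ->
  `|itg 0 T (chain_flux r d n0)| <= P.
Proof.
move=> n00 nN d0 dN.
have := @chain_flux_le R T h M s r F Phi S T0 h0 s1 Hr Hr0 HrM HF HPhi Phi0 HFPhi HS d n0 N n00.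
rewrite -/phi; set Z := `|_|.
have Z0 : 0 <= Z by rewrite normr_ge0.
move=> /(_ ltac:(clear -nN; lia) d0 ltac:(rewrite /M; clear -dN; lia)) H.
have Np : (0 : R) < N%:R by rewrite ltr0n; clear -N3; lia.
have h1 : N%:R / 2 * Z <= (N - n0)%:R * Z.
  rewrite ler_wpM2r// ler_pdivrMr// -natrM ler_nat; clear -nN; lia.
have h2 : 2 * T * S / h <= 4 * T1 * N%:R * S.
  rewrite hE invrK.
  have : (N.+1%:R : R) <= 2 * N%:R by rewrite -natrM ler_nat; clear -N3; lia.
  move=> n2; have : 2 * T * S * N.+1%:R <= 2 * T1 * S * (2 * N%:R).
    by apply: ler_pM => //; [rewrite !mulr_ge0|rewrite ler_wpM2r// ler_wpM2l].
  by move/le_trans; apply; rewrite le_eqVlt; apply/orP; left; apply/eqP; ring.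
have {h1 h2 H} : N%:R / 2 * Z <= N%:R / 2 * P.
  have E : N%:R / 2 * P = 2 * N%:R * S + 4 * T1 * N%:R * S + 2 * N%:R * (phi * Num.sqrt S).
    by rewrite /P; field.
  rewrite E (le_trans h1)// (le_trans H)// lerD2r lerD2l//.
by rewrite ler_pM2l// divr_gt0.
Qed.

(** The products [r_(k-i) r_(k+i)] and [r_(k-i-1) r_(k+i+1)] add up to the flux at [k - i] with gap
    [2i + 1]. Each step outward thus reverses the sign of the integral up to an error [P], and after
    [k] steps the boundary entry [r_0] is reached. *)
Let anti k i : (i <= k)%N -> (2 * k <= N)%N ->
  x k ^+ 2 <= i%:R * P + `|itg 0 T (fun t => r (k - i)%N t * r (k + i)%N t)|.
Proof.
elim: i => [_ kN|i IH ik kN].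
  rewrite mul0r add0r subn0 addn0 xx (le_trans (ler_norm _))//.
rewrite (le_trans (IH (ltnW ik) kN))// -natr1 mulrDl mul1r -addrA lerD2l.
have E : itg 0 T (fun t => r (k - i)%N t * r (k + i)%N t) =
    itg 0 T (chain_flux r (2 * i).+1 (k - i)) - itg 0 T (fun t => r (k - i.+1)%N t * r (k + i.+1)%N t).
  rewrite -itgB; last 2 first.
  - by apply: (chain_flux_L1 Hr Hr0 HrM); rewrite /M; clear -ik kN; lia.
  - by apply: L2M; apply: rL2; rewrite /M; clear -ik kN; lia.
  apply: itg_eq => t _; rewrite /chain_flux.
  have -> : (k - i).-1%N = (k - i.+1)%N by clear; lia.
  have -> : (k - i + (2 * i).+1)%N = (k + i.+1)%N by clear -ik; lia.
  have -> : (k + i.+1).-1%N = (k + i)%N by clear; lia.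
  by ring.
rewrite E (le_trans (ler_normB _ _))// lerD2r; apply: flux_le; clear -ik kN; lia.
Qed.

Let step k : (2 * k <= N)%N -> x k ^+ 2 <= k%:R * P + x 0 * x (2 * k).
Proof.
move=> kN; have := @anti k k (leqnn k) kN; rewrite subnn addnn -mul2n => /le_trans; apply.
by rewrite lerD2l; apply: itg_CS_sqrt; apply: rL2; rewrite /M; clear -kN; lia.
Qed.

Let y0 : 0 <= y.
Proof. by rewrite !addr_ge0 ?mulr_ge0 ?sqrtr_ge0. Qed.

Let yP : P + 2 * x 0 * y <= y ^+ 2.
Proof.
have p0 : 0 <= Num.sqrt P by rewrite sqrtr_ge0.
have q0 : 0 <= x 0 by rewrite sqrtr_ge0.
have c0 : 0 <= Num.sqrt (T1 * S) by rewrite sqrtr_ge0.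
rewrite -[X in X + _](sqr_sqrtr P0) /y -subr_ge0.
set p := Num.sqrt P; set q := x 0; set c := Num.sqrt (T1 * S).
have -> : (p + 2 * q + c) ^+ 2 - (p ^+ 2 + 2 * q * (p + 2 * q + c)) =
  2 * (p * q) + 2 * (p * c) + 2 * (c * q) + c ^+ 2 by ring.
by rewrite !addr_ge0 ?sqr_ge0// !mulr_ge0.
Qed.

Let yT : T1 * S <= y ^+ 2.
Proof.
rewrite -(sqr_sqrtr (mulr_ge0 T10 S0)) lerXn2r ?nnegrE ?sqrtr_ge0//.
by rewrite /y lerDr addr_ge0 ?mulr_ge0 ?sqrtr_ge0.
Qed.

(** A single entry is bounded by the energy only with the loss [1 / h = N + 1]; for [2 k > N] and
    [N >= 3] this loss is at most [k^2], which the barrier tolerates. *)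
Let bulk k : (N < 2 * k)%N -> (k <= N)%N -> x k <= k%:R * y.
Proof.
move=> Nk kN; have k0 : (0 : R) <= k%:R * y by rewrite mulr_ge0.
rewrite -(@ler_pXn2r _ 2)// ?nnegrE ?sqrtr_ge0// xx exprMn.
have b t : 0 < t < T -> r k t ^+ 2 <= S * N.+1%:R.
  move=> /andP[t1 t2]; have tT : 0 <= t <= T by rewrite !ltW.
  have := HS tT.
  rewrite /chain_energy mulrC -ler_pdivlMr// hE invrK; apply: le_trans.
  have -> : r k t ^+ 2 = \sum_(k <= n < k.+1) r n t ^+ 2 by rewrite big_nat1.
  by apply: ler_sum_nat_sub => [||i]; [clear -Nk; lia|rewrite /M; clear -kN; lia|exact: sqr_ge0].
have : itg 0 T (fun t => r k t ^+ 2) <= itg 0 T (fun=> S * N.+1%:R).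
  by apply: itg_le => //; [exact: (proj2 (@rL2 k ltac:(rewrite /M; clear -kN; lia)))|exact: L1_cst].
rewrite itg_cst// subr0 => /le_trans; apply.
apply: (@le_trans _ _ (T1 * S * N.+1%:R)).
  by rewrite mulrAC ler_wpM2r// mulrC ler_wpM2r.
rewrite mulrC; apply: ler_pM => //; first by rewrite mulr_ge0.
rewrite -natrX ler_nat; clear -Nk N3; nia.
Qed.

Let all_k j : forall k, (0 < k)%N -> (k <= N)%N -> (N - k <= j)%N -> x k <= k%:R * y.
Proof.
elim: j => [|j IH] k k0 kN kj; first by apply: bulk => //; clear -N3 k0 kN kj; lia.
case: (leqP (2 * k) N) => k2N; last exact: bulk.
have k20 : (0 < 2 * k)%N by clear -k0; lia.
have k2j : (N - 2 * k <= j)%N by clear -k0 kj k2N; lia.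
have := IH (2 * k)%N k20 k2N k2j => H2.
have ky : (0 : R) <= k%:R * y by rewrite mulr_ge0.
rewrite -(@ler_pXn2r _ 2)// ?nnegrE ?sqrtr_ge0// (le_trans (step k2N))// exprMn.
have k1 : (1 : R) <= k%:R by rewrite ler1n.
apply: (@le_trans _ _ (k%:R * (P + 2 * x 0 * y))).
  rewrite [leRHS]mulrDr; apply: lerD => //.
  have -> : k%:R * (2 * x 0 * y) = x 0 * ((2 * k)%:R * y) by rewrite natrM; ring.
  by rewrite ler_wpM2l ?sqrtr_ge0.
apply: ler_pM => //.
- by rewrite addr_ge0// !mulr_ge0 ?sqrtr_ge0.
- by rewrite expr2 ler_peMr.
Qed.

(* The interior norms obey x_k^2 <= k P + x_0 x_(2k) by transporting correlations
   along antidiagonals; descending from the bulk k ~ N, where the energy bounds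
   x_k, gives x_k <= k y. *)
Lemma chain_end :
  Num.sqrt (itg 0 T (fun t => r 1%N t ^+ 2)) <=
  Num.sqrt ((4 + 8 * T1) * S + 4 * (itg 0 T Phi * Num.sqrt S)) +
  2 * Num.sqrt (itg 0 T (fun t => r 0%N t ^+ 2)) + Num.sqrt (T1 * S).
Proof.
have h1 : (1 <= N)%N by clear -N3; lia.
have := @all_k N 1%N isT h1 (leq_subr _ _).
by rewrite mul1r.
Qed.

End End.

(** Closes a loop: the end entries are bounded through the maximal energy [S], and [S] through the
    work [B0 x1 + B1 xM] done at the ends. Both end bounds are linear in [sqrt S], so the energy
    inequality is quadratic in [sqrt S] with a linear right-hand side and can be solved. *)
Lemma chain_const_ineq (T1 e0 B0 B1 phi S x1 xM : R) : 0 <= T1 -> 0 <= e0 -> 0 <= B0 -> 0 <= B1 ->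
  0 <= phi -> 0 <= S ->
  x1 <= Num.sqrt ((4 + 8 * T1) * S + 4 * (phi * Num.sqrt S)) + 2 * B0 + Num.sqrt (T1 * S) ->
  xM <= Num.sqrt ((4 + 8 * T1) * S + 4 * (phi * Num.sqrt S)) + 2 * B1 + Num.sqrt (T1 * S) ->
  S <= e0 + 2 * (B0 * x1) + 2 * (B1 * xM) + 2 * (phi * Num.sqrt S) ->
  let c := Num.sqrt (6 + 8 * T1) + Num.sqrt T1 in
  let K := (c + 1) * (2 * c + 4) + 2 in
  [/\ Num.sqrt S <= K * (Num.sqrt e0 + B0 + B1 + phi),
      x1 <= K * (Num.sqrt e0 + B0 + B1 + phi) &
      xM <= K * (Num.sqrt e0 + B0 + B1 + phi)].
Proof.
move=> T10 e00 B00 B10 phi0 S0 h1 hM hS c K.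
set w := Num.sqrt S; have w0 : 0 <= w by rewrite sqrtr_ge0.
have SE : S = w ^+ 2 by rewrite sqr_sqrtr.
have c0 : 0 <= c by rewrite addr_ge0 ?sqrtr_ge0.
(* Passing from 4 to 6 leaves [2 w^2], which together with [4 phi^2] absorbs the cross term
   [4 phi w], since [2 (w - phi)^2 + 2 phi^2] remains. *)
have q : Num.sqrt ((4 + 8 * T1) * S + 4 * (phi * w)) <= Num.sqrt (6 + 8 * T1) * w + 2 * phi.
  have a0 : 0 <= Num.sqrt (6 + 8 * T1) by rewrite sqrtr_ge0.
  have rhs0 : 0 <= Num.sqrt (6 + 8 * T1) * w + 2 * phi by rewrite addr_ge0 ?mulr_ge0.
  rewrite -[leRHS](ger0_norm rhs0) -sqrtr_sqr ler_wsqrtr// sqrrD !exprMn sqr_sqrtr ?addr_ge0 ?mulr_ge0//.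
  rewrite SE.
  rewrite -subr_ge0; set a := Num.sqrt (6 + 8 * T1).
  have -> : (6 + 8 * T1) * w ^+ 2 + a * w * (2 * phi) *+ 2 + 2 ^+ 2 * phi ^+ 2 -
    ((4 + 8 * T1) * w ^+ 2 + 4 * (phi * w)) =
    2 * (w - phi) ^+ 2 + 2 * phi ^+ 2 + 4 * (a * w * phi) by ring.
  apply: addr_ge0; last by rewrite !mulr_ge0.
  by apply: addr_ge0; apply: mulr_ge0 => //; exact: sqr_ge0.
have q2 : Num.sqrt (T1 * S) = Num.sqrt T1 * w by rewrite sqrtrM.
have b1 : x1 <= c * w + 2 * phi + 2 * B0 by rewrite /c mulrDl; move: h1; rewrite q2; lra.
have bM : xM <= c * w + 2 * phi + 2 * B1 by rewrite /c mulrDl; move: hM; rewrite q2; lra.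
set B := B0 + B1; have B'0 : 0 <= B by rewrite addr_ge0.
have key : w ^+ 2 <= (2 * c * B + 2 * phi) * w + (Num.sqrt e0 + 2 * (B + phi)) ^+ 2.
  rewrite -SE (le_trans hS)//.
  have g1 := ler_wpM2l B00 b1; have g2 := ler_wpM2l B10 bM.
  have sq : 0 <= Num.sqrt e0 by rewrite sqrtr_ge0.
  have es : e0 = Num.sqrt e0 ^+ 2 by rewrite sqr_sqrtr.
  have p1 : 0 <= B0 * B1 by rewrite mulr_ge0.
  have p2 : 0 <= Num.sqrt e0 * (B + phi) by rewrite mulr_ge0// addr_ge0.
  have p3 : 0 <= (B0 + B1) * phi by rewrite mulr_ge0.
  have p4 : 0 <= phi ^+ 2 by rewrite sqr_ge0.
  have -> : (2 * c * B + 2 * phi) * w + (Num.sqrt e0 + 2 * (B + phi)) ^+ 2 =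
    Num.sqrt e0 ^+ 2 + 4 * (Num.sqrt e0 * (B + phi)) + 2 * (B0 * (c * w)) + 2 * (B1 * (c * w)) + 2 * (phi * w) +
    4 * (B0 ^+ 2 + 2 * (B0 * B1) + B1 ^+ 2) + 8 * ((B0 + B1) * phi) + 4 * phi ^+ 2 by rewrite /B; ring.
  rewrite -es; move: g1 g2.
  have -> : B0 * (c * w + 2 * phi + 2 * B0) = B0 * (c * w) + 2 * (B0 * phi) + 2 * B0 ^+ 2 by ring.
  have -> : B1 * (c * w + 2 * phi + 2 * B1) = B1 * (c * w) + 2 * (B1 * phi) + 2 * B1 ^+ 2 by ring.
  move: p3; rewrite mulrDl => p3 g1 g2; rewrite -/w; lra.
have d0 : 0 <= Num.sqrt e0 + 2 * (B + phi).
  by rewrite addr_ge0 ?sqrtr_ge0// mulr_ge0// addr_ge0.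
have := @le_of_sqr_le_affine _ w (2 * c * B + 2 * phi) _ _ (sqr_ge0 _) key.
rewrite sqrtr_sqr ger0_norm// => /(_ ltac:(by rewrite addr_ge0 ?mulr_ge0)) wle.
set D := Num.sqrt e0 + B0 + B1 + phi.
have D0 : 0 <= D by rewrite !addr_ge0 ?sqrtr_ge0.
have wD : w <= (2 * c + 4) * D.
  have p1 : 0 <= c * (Num.sqrt e0 + phi) by rewrite mulr_ge0// addr_ge0 ?sqrtr_ge0.
  have sq : 0 <= Num.sqrt e0 by rewrite sqrtr_ge0.
  have -> : (2 * c + 4) * D = 2 * (c * B) + 2 * (c * (Num.sqrt e0 + phi)) + 4 * (Num.sqrt e0 + B + phi) by rewrite /D /B; ring.
  rewrite (le_trans wle)//; lra.
have KD : K * D = c * ((2 * c + 4) * D) + (2 * c + 4) * D + 2 * D by rewrite /K; ring.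
have cD : 0 <= c * ((2 * c + 4) * D) by rewrite !mulr_ge0// addr_ge0// mulr_ge0.
have cwD := ler_wpM2l c0 wD.
have sq : 0 <= Num.sqrt e0 by rewrite sqrtr_ge0.
have D' : D = Num.sqrt e0 + B0 + B1 + phi by [].
have cD2 : 0 <= c * D by rewrite mulr_ge0.
have E4 : (2 * c + 4) * D = 2 * (c * D) + 4 * D by ring.
split; rewrite KD; lra.
Qed.

End ChainEstimate.

Section ChainTotal.
Context {R : realType}.

Lemma ucont_max a b (f : R -> R) : a <= b -> ucont a b f ->
  exists2 c, a <= c <= b & forall t, a <= t <= b -> f t <= f c.
Proof.
move=> ab /ucont_within cf.
have A0 : `[a, b]%classic !=set0 by exists a; rewrite /= in_itv/= lexx.
have [c cin Hc] := compact_EVT_max A0 (@segment_compact _ a b) cf.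
exists c; first by move: cin; rewrite inE/= in_itv.
by move=> t tab; apply: Hc; rewrite inE/= in_itv.
Qed.

Definition chain_const (T : R) : R :=
  let c := Num.sqrt (6 + 8 * T) + Num.sqrt T in (c + 1) * (2 * c + 4) + 2.

Variables (T T1 h : R) (N : nat) (r F : nat -> R -> R) (Phi : R -> R).
Hypotheses (T0 : 0 <= T) (TT1 : T <= T1) (hE : h = N.+1%:R^-1) (N3 : (3 <= N)%N).
Let M := (2 * N).+1.
Hypothesis Hr : forall n, (0 < n <= M)%N ->
  AC 0 T (r n) (fun t => (r n.+1 t - r n.-1 t) / h + F n t).
Hypotheses (Hr0 : L2 0 T (r 0%N)) (HrM : L2 0 T (r M.+1)).
Hypothesis HF : forall n, (0 < n <= M)%N -> L1 0 T (F n).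
Hypotheses (HPhi : L1 0 T Phi) (Phi0 : forall t, 0 < t < T -> 0 <= Phi t).
Hypothesis HFPhi : forall t, 0 < t < T -> h * \sum_(1 <= n < M.+1) F n t ^+ 2 <= Phi t ^+ 2.

Let h0 : 0 < h. Proof. by rewrite hE invr_gt0. Qed.
Let e := chain_energy h M r.
Let nrm n := Num.sqrt (itg 0 T (fun t => r n t ^+ 2)).
Let D := Num.sqrt (e 0) + nrm 0 + nrm M.+1 + itg 0 T Phi.

Let Hr1 n : (0 < n <= M)%N -> AC 0 T (r n) (fun t => 1 * (r n.+1 t - r n.-1 t) / h + F n t).
Proof. by move=> /Hr; apply: AC_eqd => t _; rewrite mul1r. Qed.

Let Hrev n : (0 < n <= M)%N -> AC 0 T (r (M.+1 - n)%N)
  (fun t => (-1) * (r (M.+1 - n.+1)%N t - r (M.+1 - n.-1)%N t) / h + F (M.+1 - n)%N t).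
Proof.
move=> nM; have := Hr (n := (M.+1 - n)%N) ltac:(clear -nM; lia).
have -> : (M.+1 - n).+1 = (M.+1 - n.-1)%N by clear -nM; lia.
have -> : (M.+1 - n).-1 = (M.+1 - n.+1)%N by clear -nM; lia.
by apply: AC_eqd => t _; rewrite mulN1r opprB.
Qed.

Let L2r n : (n <= M.+1)%N -> L2 0 T (r n). Proof. exact: (chain_L2 Hr1 Hr0 HrM). Qed.

Let ucont_r n : (0 < n <= M)%N -> ucont 0 T (r n).
Proof. by move=> /Hr/AC_ucont. Qed.

Lemma chain_energy_ucont : ucont 0 T e.
Proof.
apply: ucontZ; under eq_fun do rewrite big_nat_cond.
elim: (index_iota 1 M.+1) => [|i l IH].
  by apply: ucont_eq (ucont_cst 0 T 0) => t _; rewrite big_nil.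
case Pi : ((1 <= i < M.+1)%N && true).
  apply: (ucont_eq _ (ucontD (ucontM (ucont_r _) (ucont_r _)) IH)).
  - by move=> t _; rewrite big_cons Pi expr2.
  - by move: Pi; rewrite andbT.
  - by move: Pi; rewrite andbT.
by apply: ucont_eq IH => t _; rewrite big_cons Pi.
Qed.

(** The transport terms telescope, so that energy enters only through the two ends and the source;
    at each end it is a product of a boundary velocity and the neighbouring slope. *)
Lemma chain_energy_AC : AC 0 T e (fun t =>
  2 * (r M t * r M.+1 t - r 0%N t * r 1%N t) + 2 * (h * \sum_(1 <= n < M.+1) r n t * F n t)).
Proof.
have H0 : AC 0 T e (fun t => h * \sum_(1 <= n < M.+1)
   (((r n.+1 t - r n.-1 t) / h + F n t) * r n t + r n t * ((r n.+1 t - r n.-1 t) / h + F n t))).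
  apply: ACZ; under [X in AC _ _ X _]eq_fun do rewrite big_nat_cond.
  under [X in AC _ _ _ X]eq_fun do rewrite big_nat_cond.
  apply: AC_sum => n; rewrite andbT => nM.
  by apply: ACM; apply: Hr.
apply: AC_eqd H0 => t _.
have -> : r M t * r M.+1 t - r 0%N t * r 1%N t =
   \sum_(1 <= n < M.+1) (r n t * r n.+1 t - r n.-1 t * r n t).
  rewrite big_add1 /= (eq_bigr (fun i => (fun j => r j t * r j.+1 t) i.+1 - (fun j => r j t * r j.+1 t) i)) ?telescope_sumr//.
rewrite !mulr_sumr -big_split/=; apply: eq_bigr => n _.
have hn : h != 0 by rewrite gt_eqF.
by field.
Qed.

Lemma chain_estimate :
  [/\ forall t, 0 <= t <= T -> Num.sqrt (e t) <= chain_const T1 * D,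
      nrm 1 <= chain_const T1 * D & nrm M <= chain_const T1 * D].
Proof.
(* The energy at its time of maximum [ts] plays the role of [S]; the energy balance is written on
   [[0, ts]]. *)
have [ts tsT Hts] := ucont_max T0 chain_energy_ucont.
have e0 t : 0 <= e t by exact: chain_energy_ge0.
have X1 := @chain_end R T T1 h N 1 r F Phi (e ts) T0 TT1 hE N3 (normr1 _) Hr1 Hr0 HrM HF HPhi Phi0 HFPhi Hts.
have sumrev (g : nat -> R) : \sum_(1 <= n < M.+1) g (M.+1 - n)%N = \sum_(1 <= n < M.+1) g n.
  rewrite [RHS]big_nat_rev/=; apply: eq_big_nat => i iM; congr g; clear -iM; lia.
have XM : nrm M <= Num.sqrt ((4 + 8 * T1) * e ts + 4 * (itg 0 T Phi * Num.sqrt (e ts))) + 2 * nrm M.+1 + Num.sqrt (T1 * e ts).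
  (* The right end is the left end of the reversed chain, whose transport has the opposite sign. *)
  have := @chain_end R T T1 h N (-1) (fun n => r (M.+1 - n)%N) (fun n => F (M.+1 - n)%N) Phi (e ts) T0 TT1 hE N3.
  rewrite !subn0 subn1 /=; apply => //.
  - by rewrite normrN normr1.
  - by rewrite subnn.
  - by move=> n nM; apply: HF; clear -nM; lia.
  - by move=> t tT; rewrite (sumrev (fun n => F n t ^+ 2)); exact: HFPhi.
  - by move=> t tT; rewrite /chain_energy (sumrev (fun n => r n t ^+ 2)); exact: Hts.
have phi0 : 0 <= itg 0 T Phi by exact: itg_ge0.
have ES : e ts <= e 0 + 2 * (nrm 0 * nrm 1) + 2 * (nrm M.+1 * nrm M) + 2 * (itg 0 T Phi * Num.sqrt (e ts)).
  have /andP[ts0 tsT'] := tsT.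
  have [Ie _] := chain_energy_AC.
  have I1 : L1 0 T (fun t => r M t * r M.+1 t) by apply: L2M; apply: L2r.
  have I2 : L1 0 T (fun t => r 0%N t * r 1%N t) by apply: L2M; apply: L2r.
  have I12 := L1Z 2 (L1B I1 I2).
  have I3 : L1 0 T (fun t => 2 * (h * \sum_(1 <= n < M.+1) r n t * F n t)).
    by apply: L1_eq (L1B Ie I12) => t _; rewrite addrC addKr.
  have b3 t : 0 < t < T -> `|2 * (h * \sum_(1 <= n < M.+1) r n t * F n t)| <= 2 * Num.sqrt (e ts) * Phi t.
    move=> tT; have /andP[t1 t2] := tT.
    rewrite normrM (ger0_norm (_ : 0 <= 2))// -mulrA ler_wpM2l// normrM gtr0_norm//.
    have cs := sum_CS_sqrt (index_iota 1 M.+1) xpredT (r^~ t) (F^~ t).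
    have h1 : Num.sqrt h * Num.sqrt (\sum_(1 <= n < M.+1) r n t ^+ 2) <= Num.sqrt (e ts).
      by rewrite -sqrtrM ?(ltW h0)// ler_wsqrtr// Hts// !ltW.
    have h2 : Num.sqrt h * Num.sqrt (\sum_(1 <= n < M.+1) F n t ^+ 2) <= Phi t.
      rewrite -sqrtrM ?(ltW h0)// -[leRHS](ger0_norm (Phi0 tT)) -sqrtr_sqr.
      by rewrite ler_wsqrtr// HFPhi.
    have sh0 : 0 <= Num.sqrt h by rewrite sqrtr_ge0.
    apply: le_trans (ler_pM _ _ h1 h2); rewrite ?mulr_ge0 ?sqrtr_ge0//.
    by rewrite mulrACA -expr2 sqr_sqrtr ?(ltW h0)// ler_pM2l.
  have Ets := AC_diff chain_energy_AC (lexx 0) ts0 tsT'.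
  rewrite -!addrA -lerBlDl Ets.
  have sub g : L1 0 T g -> L1 0 ts g by exact: L1_sub.
  rewrite (itgD (sub _ I12) (sub _ I3)) (itgZ _ (sub _ (L1B I1 I2))) (itgB (sub _ I1) (sub _ I2)).
  have c1 : `|itg 0 ts (fun t => r M t * r M.+1 t)| <= nrm M.+1 * nrm M.
    apply: le_trans (itg_abs (sub _ I1)) _.
    apply: le_trans (itg_le_sub (lexx 0) ts0 tsT' (L1_abs I1) (fun t _ => normr_ge0 _)) _.
    have La n : (n <= M.+1)%N -> L2 0 T (fun t => `|r n t|).
      move=> nM; have [m1 m2] := L2r nM; split; first exact: measurableT_comp.
      by apply: L1_eq m2 => t _; rewrite real_normK ?num_real.
    have := itg_CS_sqrt (La M ltac:(by [])) (La M.+1 ltac:(by [])).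
    have E n : itg 0 T (fun t => `|r n t| ^+ 2) = itg 0 T (fun t => r n t ^+ 2).
      by apply: itg_eq => t _; rewrite real_normK ?num_real.
    rewrite !E mulrC; apply: le_trans; rewrite (le_trans _ (ler_norm _))//.
    by rewrite le_eqVlt; apply/orP; left; apply/eqP; apply: itg_eq => t _; rewrite normrM.
  have c2 : `|itg 0 ts (fun t => r 0%N t * r 1%N t)| <= nrm 0 * nrm 1.
    apply: le_trans (itg_abs (sub _ I2)) _.
    apply: le_trans (itg_le_sub (lexx 0) ts0 tsT' (L1_abs I2) (fun t _ => normr_ge0 _)) _.
    have La n : (n <= M.+1)%N -> L2 0 T (fun t => `|r n t|).
      move=> nM; have [m1 m2] := L2r nM; split; first exact: measurableT_comp.
      by apply: L1_eq m2 => t _; rewrite real_normK ?num_real.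
    have := itg_CS_sqrt (La 0%N ltac:(by [])) (La 1%N ltac:(by [])).
    have E n : itg 0 T (fun t => `|r n t| ^+ 2) = itg 0 T (fun t => r n t ^+ 2).
      by apply: itg_eq => t _; rewrite real_normK ?num_real.
    rewrite !E; apply: le_trans; rewrite (le_trans _ (ler_norm _))//.
    by rewrite le_eqVlt; apply/orP; left; apply/eqP; apply: itg_eq => t _; rewrite normrM.
  have c3 : itg 0 ts (fun t => 2 * (h * \sum_(1 <= n < M.+1) r n t * F n t)) <= 2 * (itg 0 T Phi * Num.sqrt (e ts)).
    apply: le_trans (ler_norm _) _; apply: le_trans (itg_abs (sub _ I3)) _.
    apply: le_trans (itg_le_sub (lexx 0) ts0 tsT' (L1_abs I3) (fun t _ => normr_ge0 _)) _.
    have -> : 2 * (itg 0 T Phi * Num.sqrt (e ts)) = itg 0 T (fun t => 2 * Num.sqrt (e ts) * Phi t).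
      by rewrite itgZ//; ring.
    by apply: itg_le => //; [exact: L1_abs|exact: L1Z].
  have := ler_norm (itg 0 ts (fun t => r M t * r M.+1 t)).
  have := ler_norm (- itg 0 ts (fun t => r 0%N t * r 1%N t)); rewrite normrN.
  move: c1 c2 c3.
  move: (itg 0 ts (fun t => r M t * r M.+1 t)) (itg 0 ts (fun t => r 0%N t * r 1%N t)) => a b.
  move: (itg 0 ts _) (_ * Num.sqrt (e ts)) (nrm 0 * nrm 1) (nrm M.+1 * nrm M) => c d k l; lra.
have T10 : 0 <= T1 by exact: le_trans TT1.
have [K1 K2 K3] := chain_const_ineq T10 (e0 0) (sqrtr_ge0 _) (sqrtr_ge0 _) phi0 (e0 ts) X1 XM ES.
split => // t tT; apply: le_trans K1; apply: ler_wsqrtr; exact: Hts.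
Qed.

End ChainTotal.

Section Gronwall.
Context {R : realType}.

(** Maximise [exp(-2 b t) u t]. At the maximum point the integral term is at most half of the
    left-hand side and is absorbed, which explains both factors 2. *)
Lemma gronwall (T a b : R) (u : R -> R) : 0 <= T -> 0 <= a -> 0 < b -> ucont 0 T u ->
  (forall t, 0 <= t <= T -> 0 <= u t) ->
  (forall t, 0 <= t <= T -> u t <= a + b * itg 0 t u) ->
  forall t, 0 <= t <= T -> u t <= 2 * a * expR (2 * b * T).
Proof.
move=> T0 a0 b0 cu u0 Hu t tT.
pose w s := expR (- (2 * b * s)) * u s.
have sexp (k : R) : AC 0 T (fun s => expR (k * s)) (fun s => k * expR (k * s)).
  have D (x : R) : is_derive x 1 (fun s : R => expR (k * s)) (k * expR (k * x)).
    have d1 : is_derive x 1 (fun s : R => k * s) k.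
      have := is_deriveM (is_derive_cst k x 1) (is_derive_id x 1).
      by rewrite /GRing.scale/= mulr0 addr0 mulr1.
    by have := @is_derive1_comp R expR (fun s => k * s) x _ _ (is_derive_expR _) d1; rewrite mulrC.
  have c1 : ucont 0 T (fun s => expR (k * s)).
    by apply: derivable_ucont => x; apply: (@ex_derive _ _ _ _ _ _ _ (D x)).
  by apply: AC_of_derive => //; exact: ucontZ.
have cexp k : ucont 0 T (fun s => expR (k * s)) by exact: AC_ucont (sexp k).
have cw : ucont 0 T w.
  by apply: ucontM => //; apply: ucont_eq (cexp (- (2 * b))) => s _; rewrite mulNr.
have [c cT Hc] := ucont_max T0 cw.
have /andP[c0 cT'] := cT.
have w0 s : 0 <= s <= T -> 0 <= w s by move=> sT; rewrite mulr_ge0 ?expR_ge0 ?u0.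
have uw s : u s = expR (2 * b * s) * w s.
  by rewrite /w mulrA -expRD subrr expR0 mul1r.
have b2 : 0 < 2 * b by rewrite mulr_gt0.
have key : itg 0 c u <= w c * ((expR (2 * b * c) - 1) / (2 * b)).
  have Iexp : L1 0 c (fun s => expR (2 * b * s)) by exact: L1_sub (ucont_L1 (cexp _)).
  apply: (@le_trans _ _ (itg 0 c (fun s => w c * expR (2 * b * s)))).
    apply: itg_le; [exact: L1_sub (ucont_L1 cu)|exact: L1Z|].
    move=> s /andP[s0 sc]; rewrite uw mulrC ler_wpM2r ?expR_ge0// Hc//.
    by rewrite (ltW s0) (le_trans (ltW sc)).
  rewrite itgZ// ler_wpM2l ?w0// ler_pdivlMr// mulrC -itgZ//.
  by rewrite -(AC_diff (sexp (2 * b)) (lexx 0) c0 cT') mulr0 expR0.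
have wc : w c <= 2 * a.
  have := Hu c cT; rewrite {1}uw => H1.
  have E0 : 0 < expR (2 * b * c) by rewrite expR_gt0.
  have E1 : 1 <= expR (2 * b * c) by rewrite -[leLHS]expR0 ler_expR mulr_ge0// ltW.
  have : expR (2 * b * c) * w c <= a + b * (w c * ((expR (2 * b * c) - 1) / (2 * b))).
    by rewrite (le_trans H1)// lerD2l ler_wpM2l// ltW.
  have -> : b * (w c * ((expR (2 * b * c) - 1) / (2 * b))) = w c * (expR (2 * b * c) - 1) / 2.
    have bn : b != 0 by rewrite gt_eqF.
    by field.
  have wc0 := w0 c cT; move: (expR _) E0 E1 => E E0 E1 H2.
  have H3 : E * w c <= 2 * a by move: H2; rewrite mulrBr mulr1 [w c * E]mulrC; lra.
  by rewrite (le_trans _ H3)// ler_peMl.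
rewrite uw mulrC; apply: ler_pM; rewrite ?w0 ?expR_ge0//.
  exact: le_trans (Hc t tT) wc.
by rewrite ler_expR ler_wpM2l ?(ltW b2)//; case/andP: tT.
Qed.

End Gronwall.

Section GridNorm.
Context {R : realType}.
Variable N : nat.
Implicit Types a b : nat -> R.

Definition l2n a : R := Num.sqrt (mesh N * \sum_(1 <= j < N.+1) a j ^+ 2).

Lemma mesh_gt0 : 0 < mesh N :> R. Proof. by rewrite invr_gt0. Qed.

Lemma mesh_le1 : mesh N <= 1 :> R.
Proof. by rewrite invf_le1// ler1n. Qed.

Lemma mesh_mul : mesh N * N.+1%:R = 1 :> R.
Proof. by rewrite mulVf// pnatr_eq0. Qed.

Let sum0 a : 0 <= mesh N * \sum_(1 <= j < N.+1) a j ^+ 2.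
Proof.
by rewrite mulr_ge0 ?(ltW mesh_gt0)// sumr_ge0// => j _; exact: sqr_ge0.
Qed.

Lemma l2n_ge0 a : 0 <= l2n a. Proof. exact: sqrtr_ge0. Qed.

Lemma l2n_sqr a : l2n a ^+ 2 = mesh N * \sum_(1 <= j < N.+1) a j ^+ 2.
Proof. by rewrite sqr_sqrtr. Qed.

Lemma l2n_le a (c : R) : 0 <= c ->
  mesh N * \sum_(1 <= j < N.+1) a j ^+ 2 <= c ^+ 2 -> l2n a <= c.
Proof. by move=> c0 H; rewrite -[leRHS](ger0_norm c0) -sqrtr_sqr ler_wsqrtr. Qed.

Lemma l2n_mono a b : (forall j, (1 <= j <= N)%N -> `|a j| <= `|b j|) -> l2n a <= l2n b.
Proof.
move=> ab; rewrite ler_wsqrtr// ler_pM2l ?mesh_gt0//; apply: ler_sum_nat => j jN.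
rewrite -[a j ^+ 2]real_normK ?num_real// -[b j ^+ 2]real_normK ?num_real//.
by rewrite lerXn2r ?nnegrE// ab.
Qed.

Lemma l2n_eq a b : (forall j, (1 <= j <= N)%N -> a j = b j) -> l2n a = l2n b.
Proof. by move=> ab; apply/le_anti; rewrite !l2n_mono// => j /ab ->. Qed.

Lemma l2nN a : l2n (fun j => - a j) = l2n a.
Proof. by apply/le_anti; rewrite !l2n_mono// => j _; rewrite normrN. Qed.

Lemma l2nD a b : l2n (fun j => a j + b j) <= l2n a + l2n b.
Proof.
apply: l2n_le; first by rewrite addr_ge0// l2n_ge0.
rewrite sqrrD !l2n_sqr.
have := sum_CS_sqrt (index_iota 1 N.+1) xpredT a b => cs.
have cs2 : mesh N * \sum_(1 <= j < N.+1) a j * b j <= l2n a * l2n b.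
  rewrite /l2n !sqrtrM ?(ltW mesh_gt0)// mulrACA -expr2 sqr_sqrtr ?(ltW mesh_gt0)//.
  by rewrite ler_pM2l ?mesh_gt0// (le_trans (ler_norm _)).
have -> : \sum_(1 <= j < N.+1) (a j + b j) ^+ 2 = \sum_(1 <= j < N.+1) a j ^+ 2 +
   2 * (\sum_(1 <= j < N.+1) a j * b j) + \sum_(1 <= j < N.+1) b j ^+ 2.
  rewrite mulr_sumr -!big_split/=; apply: eq_bigr => j _; ring.
rewrite !mulrDr lerD2r lerD2l mulrCA mulr2n; lra.
Qed.

Lemma l2nB a b : l2n (fun j => a j - b j) <= l2n a + l2n b.
Proof. by rewrite (le_trans (l2nD a (fun j => - b j)))// l2nN. Qed.

Lemma l2nZ (k : R) a : l2n (fun j => k * a j) = `|k| * l2n a.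
Proof.
rewrite /l2n -sqrtr_sqr -sqrtrM ?sqr_ge0//; congr Num.sqrt.
rewrite [RHS]mulrCA; congr (_ * _); rewrite mulr_sumr; apply: eq_bigr => j _; exact: exprMn.
Qed.

Lemma l2n_sup a (c : R) : 0 <= c -> (forall j, (1 <= j <= N)%N -> `|a j| <= c) -> l2n a <= c.
Proof.
move=> c0 H; apply: l2n_le => //.
have : \sum_(1 <= j < N.+1) a j ^+ 2 <= \sum_(1 <= j < N.+1) c ^+ 2.
  apply: ler_sum_nat => j jN; rewrite -[a j ^+ 2]real_normK ?num_real//.
  by rewrite lerXn2r ?nnegrE// H.
rewrite -(ler_pM2l mesh_gt0) => /le_trans; apply.
rewrite sumr_const_nat subSS subn0 -mulr_natr mulrCA ler_piMr ?sqr_ge0//.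
by rewrite -[leRHS]mesh_mul ler_pM2l ?mesh_gt0// ler_nat.
Qed.

End GridNorm.

Section Sqrt.
Context {R : realType}.

Lemma ucont_sqrt a b (f : R -> R) : (forall x, a <= x <= b -> 0 <= f x) ->
  ucont a b f -> ucont a b (fun x => Num.sqrt (f x)).
Proof.
move=> f0 cf e e0; have [d d0 H] := cf (e ^+ 2) (exprn_gt0 _ e0).
exists d => // x y xab yab xy; have := H x y xab yab xy.
rewrite -[f x in X in X -> _]sqr_sqrtr ?f0// -[f y in X in X -> _]sqr_sqrtr ?f0//.
set p := Num.sqrt (f x); set q := Num.sqrt (f y).
have p0 : 0 <= p by rewrite sqrtr_ge0.
have q0 : 0 <= q by rewrite sqrtr_ge0.
rewrite subr_sqr normrM => h; rewrite -(@ltr_pXn2r _ 2)// ?nnegrE ?(ltW e0)//.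
apply: le_lt_trans h; rewrite expr2 ler_wpM2l// [leRHS]ger0_norm ?addr_ge0//.
by rewrite ler_norml; apply/andP; split; lra.
Qed.

End Sqrt.

(** * Energy and last slope of the semi-discrete wave equation *)

Section DiscreteWave.
Context {R : realType}.

Definition wave_energy (N : nat) (w v : nat -> R) : R :=
  mesh N * (\sum_(1 <= j < N.+1) v j ^+ 2 +
            \sum_(0 <= j < N.+1) ((w j.+1 - w j) / mesh N) ^+ 2).

Lemma sum_odd_even (a : nat -> R) N :
  \sum_(1 <= n < (2 * N).+2) a n =
  \sum_(1 <= j < N.+1) a (2 * j)%N + \sum_(0 <= j < N.+1) a (2 * j).+1.
Proof.
elim: N => [|N IH]; first by rewrite !big_nat1 big_geq// add0r.
rewrite mulnS !addSn add0n big_nat_recr//= big_nat_recr//= IH.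
rewrite [in RHS]big_nat_recr//= [in X in _ = _ + X]big_nat_recr//=.
have -> : (2 * N.+1)%N = (2 * N).+2 by rewrite mulnS.
by rewrite -!addrA; congr (_ + _); rewrite addrCA.
Qed.

Lemma wave_energy_ge0 N w v : 0 <= wave_energy N w v.
Proof.
by rewrite mulr_ge0 ?(ltW (mesh_gt0 N))// addr_ge0// sumr_ge0// => j _; exact: sqr_ge0.
Qed.

(** Sum the increments from the left end and apply Cauchy-Schwarz: the [N + 1] cells have total
    length 1, so the constant does not depend on the mesh. *)
Lemma grid_sup_le N (w v : nat -> R) j : (j <= N.+1)%N ->
  `|w j| <= `|w 0%N| + Num.sqrt (wave_energy N w v).
Proof.
move=> jN; have h0 := @mesh_gt0 R N.
have E : w j = w 0%N + \sum_(0 <= i < j) mesh N * ((w i.+1 - w i) / mesh N).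
  rewrite (eq_bigr (fun i => w i.+1 - w i)) => [|i _]; last first.
    by rewrite mulrC divfK// gt_eqF.
  by rewrite telescope_sumr// addrC subrK.
rewrite {1}E (le_trans (ler_normD _ _))// lerD2l.
rewrite (le_trans (ler_norm_sum _ _ _))//.
have L : \sum_(0 <= i < j) `|mesh N * ((w i.+1 - w i) / mesh N)| <=
    mesh N * \sum_(0 <= i < N.+1) 1 * `|(w i.+1 - w i) / mesh N|.
  rewrite mulr_sumr; under eq_bigr do rewrite normrM (gtr0_norm h0).
  under [leRHS]eq_bigr do rewrite mul1r.
  by apply: ler_sum_nat_sub => // i; rewrite mulr_ge0// ltW.
rewrite (le_trans L)//.
have cs := le_trans (ler_norm _) (sum_CS_sqrt (index_iota 0 N.+1) xpredT (fun=> 1) (fun i => `|(w i.+1 - w i) / mesh N|)).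
rewrite (le_trans (ler_wpM2l (ltW h0) cs))//.
have -> : \sum_(0 <= i < N.+1) 1 ^+ 2 = N.+1%:R :> R.
  by under eq_bigr do rewrite expr1n; rewrite sumr_const_nat subn0.
have -> : \sum_(0 <= i < N.+1) `|(w i.+1 - w i) / mesh N| ^+ 2 = \sum_(0 <= i < N.+1) ((w i.+1 - w i) / mesh N) ^+ 2.
  by apply: eq_bigr => i _; rewrite real_normK ?num_real.
set s := \sum_(0 <= i < N.+1) _.
have s0 : 0 <= s by apply: sumr_ge0 => i _; exact: sqr_ge0.
have -> : mesh N * (Num.sqrt N.+1%:R * Num.sqrt s) = Num.sqrt (mesh N * s).
  rewrite -sqrtrM// -{1}[mesh N]ger0_norm ?(ltW h0)// -sqrtr_sqr -sqrtrM ?sqr_ge0//.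
  by congr Num.sqrt; rewrite expr2 -mulrA [mesh N * (_ * s)]mulrA mesh_mul mul1r.
rewrite ler_wsqrtr// ler_pM2l// lerDr sumr_ge0// => i _; exact: sqr_ge0.
Qed.

Lemma chain_const_ge0 (T : R) : 0 <= chain_const T.
Proof.
rewrite /chain_const; set c := _ + _.
have c0 : 0 <= c by rewrite addr_ge0 ?sqrtr_ge0.
by rewrite addr_ge0// mulr_ge0 ?addr_ge0 ?mulr_ge0.
Qed.

(** [K] comes from the chain estimate; [k] collects the data, including what the left boundary value
    feeds into the potential term; [c] is the resulting Gronwall bound for the energy; the last
    summand bounds the last slope, and the others serve the sup norm. *)
Definition wave_const (T m : R) : R :=
  let K := chain_const T in
  let k := 1 + m * T + m * T * Num.sqrt T in
  let c := 2 * (K * k) * expR (2 * (K * m + 1) * T) in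
  1 + Num.sqrt T + c + K * (k + m * T * c).

Section Estimate.
Variables (T m : R) (N : nat) (p : nat -> R) (w v f : nat -> R -> R) (Phi : R -> R).
Hypotheses (T0 : 0 < T) (m0 : 0 <= m) (N3 : (3 <= N)%N).
Hypothesis pm : forall j, (1 <= j <= N)%N -> `|p j| <= m.
Hypothesis ACw : forall j, (j <= N.+1)%N -> AC 0 T (w j) (v j).
Hypotheses (L2v0 : L2 0 T (v 0%N)) (L2vN : L2 0 T (v N.+1)).
Hypothesis L1f : forall j, (1 <= j <= N)%N -> L1 0 T (f j).
Hypothesis ACv : forall j, (1 <= j <= N)%N -> AC 0 T (v j)
  (fun t => laplacian_h N (fun l => w l t) j - p j * w j t + f j t).
Hypotheses (L1Phi : L1 0 T Phi)
  (fPhi : forall t, 0 < t < T -> l2n N (fun j => f j t) <= Phi t).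

Definition wave_data : R :=
  Num.sqrt (wave_energy N (fun j => w j 0) (fun j => v j 0)) + `|w 0%N 0| +
  Num.sqrt (itg 0 T (fun t => v 0%N t ^+ 2)) +
  Num.sqrt (itg 0 T (fun t => v N.+1 t ^+ 2)) + itg 0 T Phi.

Let h : R := mesh N.
Let M := (2 * N).+1.
(* Interleaving the velocities (even indices) with the slopes (odd indices)
   turns the wave equation into a transport chain. *)
Let r n t := if odd n then (w n./2.+1 t - w n./2 t) / h else v n./2 t.
Let F n t := if odd n then 0 else - (p n./2 * w n./2 t) + f n./2 t.
Let B0 := Num.sqrt (itg 0 T (fun t => v 0%N t ^+ 2)).
Let c0 := `|w 0%N 0|.
Let u t := Num.sqrt (wave_energy N (fun j => w j t) (fun j => v j t)).
Let h0 : 0 < h. Proof. exact: mesh_gt0. Qed.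

Let r_even j t : r (2 * j)%N t = v j t.
Proof. by rewrite /r mul2n odd_double doubleK. Qed.
Let r_odd j t : r (2 * j).+1 t = (w j.+1 t - w j t) / h.
Proof. by rewrite /r mul2n /= odd_double /= uphalf_double. Qed.
Let F_even j t : F (2 * j)%N t = - (p j * w j t) + f j t.
Proof. by rewrite /F mul2n odd_double doubleK. Qed.
Let F_odd j t : F (2 * j).+1 t = 0.
Proof. by rewrite /F mul2n /= odd_double. Qed.

Let energyE t : chain_energy h M r t = wave_energy N (fun j => w j t) (fun j => v j t).
Proof.
rewrite /chain_energy /wave_energy sum_odd_even.
by congr (_ * (_ + _)); apply: eq_bigr => j _; rewrite ?r_even ?r_odd.
Qed.

Let parity n : (0 < n <= M)%N -> (exists2 j, (1 <= j <= N)%N & n = (2 * j)%N) \/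
  (exists2 j, (j <= N)%N & n = (2 * j).+1).
Proof.
rewrite /M => nM; have := odd_double_half n; rewrite -mul2n; case: (odd n) => /= E.
  by right; exists n./2; clear -E nM; lia.
by left; exists n./2; clear -E nM; lia.
Qed.

Let ucw j : (j <= N.+1)%N -> ucont 0 T (w j). Proof. by move=> /ACw/AC_ucont. Qed.

Let L1F n : (0 < n <= M)%N -> L1 0 T (F n).
Proof.
move=> /parity[[j jN ->]|[j jN ->]].
  apply: (L1_eq _ (L1D (ucont_L1 (ucontN (ucontZ (p j) (ucw _)))) (L1f jN))).
    by move=> t _; rewrite F_even.
  by clear -jN; lia.
by apply: L1_eq (L1_cst 0 T 0) => t _; rewrite F_odd.
Qed.

Let ACr n : (0 < n <= M)%N -> AC 0 T (r n) (fun t => (r n.+1 t - r n.-1 t) / h + F n t).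
Proof.
move=> /parity[[j jN ->]|[j jN ->]].
  have /andP[j1 jN'] := jN; case: j j1 jN jN' => // j _ jN jN'.
  have E : (2 * j.+1).-1 = (2 * j).+1 by rewrite mulnS.
  have := ACv jN => H.
  apply: AC_eq (AC_eqd _ H) => t _; first by rewrite r_even.
  rewrite E F_even !r_odd /laplacian_h /=.
  have hn : h != 0 by rewrite gt_eqF.
  by rewrite -/h; field.
have H := ACZ h^-1 (ACB (ACw (_ : j.+1 <= N.+1)%N) (ACw (leqW jN))).
apply: AC_eq (AC_eqd _ (H _)) => // t _; first by rewrite r_odd mulrC.
rewrite F_odd addr0 /= r_even mulrC; congr ((_ - _) / _).
by have -> : (2 * j).+2 = (2 * j.+1)%N by rewrite mulnS.
Qed.

Let L2r0 : L2 0 T (r 0%N).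
Proof. by apply: L2_eq L2v0 => t _; exact: esym (r_even 0 t). Qed.

Let ME : M.+1 = (2 * N.+1)%N. Proof. by rewrite /M mulnS. Qed.

Let L2rM : L2 0 T (r M.+1).
Proof. by apply: L2_eq L2vN => t _; rewrite ME r_even. Qed.

Let u0 t : 0 <= u t. Proof. exact: sqrtr_ge0. Qed.

Let cB0 : 0 <= c0 + Num.sqrt T * B0.
Proof. by apply: addr_ge0; [exact: normr_ge0|apply: mulr_ge0; exact: sqrtr_ge0]. Qed.

Let ucu : ucont 0 T u.
Proof.
apply: ucont_sqrt => [t _|]; first exact: wave_energy_ge0.
apply: ucont_eq (chain_energy_ucont ACr); move=> t _; exact: energyE.
Qed.

Let w0_le t : 0 <= t <= T -> `|w 0%N t| <= c0 + Num.sqrt T * B0.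
Proof.
move=> /andP[t0 tT]; have [_ Hw] := ACw (leq0n N.+1).
rewrite (Hw t) ?t0// (le_trans (ler_normD _ _))// lerD2l.
have L2t : L2 0 t (v 0%N) := L2_sub (lexx 0) tT L2v0.
have := itg_sqr_le t0 L2t; rewrite subr0 => H.
rewrite -sqrtr_sqr /B0 -sqrtrM ?(ltW T0)// ler_wsqrtr// (le_trans H)//.
apply: ler_pM => //; first by apply: itg_ge0 => s _; exact: sqr_ge0.
by apply: itg_le_sub => //; [case: L2v0|move=> s _; exact: sqr_ge0].
Qed.

Let w_le j t : (j <= N.+1)%N -> 0 <= t <= T -> `|w j t| <= c0 + Num.sqrt T * B0 + u t.
Proof.
move=> jN tT; have := @grid_sup_le N (fun j => w j t) (fun j => v j t) j jN.
by move/le_trans; apply; rewrite lerD2r w0_le.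
Qed.

(** The potential term is treated as a source: [w] is bounded pointwise by its left boundary value
    plus the square root [u] of the energy. The occurrence of [u] is what calls for [gronwall]. *)
Let Psi t := Phi t + m * (c0 + Num.sqrt T * B0 + u t).

Let FPsi t : 0 < t < T -> h * \sum_(1 <= n < M.+1) F n t ^+ 2 <= Psi t ^+ 2.
Proof.
move=> tT; have tT' : 0 <= t <= T by case/andP: tT => ? ?; rewrite !ltW.
have -> : h * \sum_(1 <= n < M.+1) F n t ^+ 2 = l2n N (fun j => - (p j * w j t) + f j t) ^+ 2.
  rewrite l2n_sqr sum_odd_even; congr (_ * _).
  rewrite [X in _ + X]big1 ?addr0 => [|j _]; last by rewrite F_odd expr0n.
  by apply: eq_bigr => j _; rewrite F_even.
have c1 : 0 <= c0 + Num.sqrt T * B0 + u t by apply: addr_ge0.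
have P0 : 0 <= Phi t by rewrite (le_trans _ (fPhi tT))// l2n_ge0.
rewrite lerXn2r ?nnegrE ?l2n_ge0// ?addr_ge0 ?mulr_ge0//.
apply: (le_trans (@l2nD R N (fun j => - (p j * w j t)) (fun j => f j t))).
rewrite /Psi addrC; apply: lerD; first exact: fPhi.
have h1 : l2n N (fun j => - (p j * w j t)) <= l2n N (fun=> m * (c0 + Num.sqrt T * B0 + u t)).
  apply: l2n_mono => j jN; rewrite normrN normrM [leRHS]ger0_norm ?mulr_ge0//.
  by rewrite ler_pM ?pm ?w_le//; clear -jN; lia.
rewrite (le_trans h1)// l2n_le ?mulr_ge0//.
rewrite sumr_const_nat subSS subn0 -mulr_natr mulrCA ler_piMr ?sqr_ge0//.
by rewrite -[leRHS](@mesh_mul R N) ler_pM2l ?mesh_gt0// ler_nat.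
Qed.

Let L1Psi : L1 0 T Psi.
Proof. by apply: L1D => //; apply: ucont_L1; apply: ucontZ; apply: ucontD => //; exact: ucont_cst. Qed.

Let Psi0 t : 0 < t < T -> 0 <= Psi t.
Proof.
move=> tT; rewrite addr_ge0 ?(le_trans _ (fPhi tT)) ?l2n_ge0//.
by apply: mulr_ge0 => //; exact: addr_ge0.
Qed.

Let K := chain_const T.
Let k := 1 + m * T + m * T * Num.sqrt T.
Let d := wave_data.

Let d_ge : 0 <= d /\ c0 <= d /\ B0 <= d.
Proof.
have P0 : 0 <= itg 0 T Phi.
  by apply: itg_ge0 => t tT; rewrite (le_trans _ (fPhi tT))// l2n_ge0.
have s0 := sqrtr_ge0 (wave_energy N (fun j => w j 0) (fun j => v j 0)).
have s1 := sqrtr_ge0 (itg 0 T (fun t => v 0%N t ^+ 2)).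
have s2 := sqrtr_ge0 (itg 0 T (fun t => v N.+1 t ^+ 2)).
have s3 : 0 <= `|w 0%N 0| by [].
by rewrite /d /wave_data /c0 /B0; split; [|split]; lra.
Qed.

(** The chain estimate is applied on [[0, t]] with its constant taken at [T]; this uniformity in [t]
    is the reason for the second parameter [T1] there. *)
Let local t : 0 <= t <= T ->
  [/\ u t <= K * (k * d + m * itg 0 t u) &
      Num.sqrt (itg 0 t (fun s => r M s ^+ 2)) <= K * (k * d + m * itg 0 t u)].
Proof.
move=> /andP[t0 tT].
have K0 : 0 <= K by exact: chain_const_ge0.
have N0 : N.+1%:R^-1 = h by [].
have sub g : L1 0 T g -> L1 0 t g by exact: L1_sub.
have in_ s : 0 < s < t -> 0 < s < T by move=> /andP[-> /lt_le_trans]; apply.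
have [H1 _ H3] := @chain_estimate R t T h N r F Psi t0 tT (esym N0) N3
  (fun n nM => AC_sub (lexx 0) tT (ACr nM)) (L2_sub (lexx 0) tT L2r0) (L2_sub (lexx 0) tT L2rM)
  (fun n nM => sub _ (L1F nM)) (sub _ L1Psi) (fun s st => Psi0 (in_ s st)) (fun s st => FPsi (in_ s st)).
have IPsi : itg 0 t Psi <= itg 0 T Phi + m * T * (c0 + Num.sqrt T * B0) + m * itg 0 t u.
  rewrite /Psi itgD; [|exact: sub|by apply: sub; apply: ucont_L1; apply: ucontZ; apply: ucontD => //; exact: ucont_cst].
  rewrite -addrA lerD//.
    by apply: itg_le_sub => // s sT; rewrite (le_trans _ (fPhi sT))// l2n_ge0.
  rewrite itgZ; last by apply: sub; apply: ucont_L1; apply: ucontD => //; exact: ucont_cst.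
  rewrite itgD; [|exact: L1_cst|exact/sub/ucont_L1].
  rewrite itg_cst// subr0 mulrDr lerD2r -mulrA ler_wpM2l// mulrC ler_wpM2r//.
have mono n : L2 0 T (r n) -> Num.sqrt (itg 0 t (fun s => r n s ^+ 2)) <= Num.sqrt (itg 0 T (fun s => r n s ^+ 2)).
  by move=> Hn; rewrite ler_wsqrtr// itg_le_sub//; [case: Hn|move=> s _; exact: sqr_ge0].
have DD : Num.sqrt (chain_energy h M r 0) + Num.sqrt (itg 0 t (fun s => r 0%N s ^+ 2)) +
    Num.sqrt (itg 0 t (fun s => r M.+1 s ^+ 2)) + itg 0 t Psi <= k * d + m * itg 0 t u.
  have m1 := mono 0%N L2r0; have m2 := mono M.+1 L2rM.
  have E0 : itg 0 T (fun s => r 0%N s ^+ 2) = itg 0 T (fun s => v 0%N s ^+ 2).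
    by apply: itg_eq => s _; congr (_ ^+ 2); exact: (r_even 0 s).
  have E1 : itg 0 T (fun s => r M.+1 s ^+ 2) = itg 0 T (fun s => v N.+1 s ^+ 2).
    by apply: itg_eq => s _; rewrite ME r_even.
  rewrite E0 in m1; rewrite E1 in m2; rewrite energyE.
  have [dd [dc dB]] := d_ge.
  have q1 : m * T * (c0 + Num.sqrt T * B0) <= m * T * (d + Num.sqrt T * d).
    rewrite ler_wpM2l ?mulr_ge0 ?(ltW T0)// lerD// ler_wpM2l ?sqrtr_ge0//.
  have q2 : k * d = d + m * T * (d + Num.sqrt T * d) by rewrite /k; ring.
  have c00 : 0 <= c0 by rewrite normr_ge0.
  have dE : d = Num.sqrt (wave_energy N (fun j => w j 0) (fun j => v j 0)) + c0 + B0 +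
    Num.sqrt (itg 0 T (fun t => v N.+1 t ^+ 2)) + itg 0 T Phi by [].
  rewrite q2; move: IPsi q1 m1 m2 dE c00; rewrite -/B0.
  move: (m * itg 0 t u) (itg 0 t Psi) (m * T * (c0 + Num.sqrt T * B0)) (m * T * (d + Num.sqrt T * d)).
  move: (itg 0 T Phi) (Num.sqrt (wave_energy N (fun j => w j 0) (fun j => v j 0))) B0 c0.
  move: (Num.sqrt (itg 0 T (fun t => v N.+1 t ^+ 2))) (Num.sqrt (itg 0 t (fun s => r 0%N s ^+ 2))).
  move: (Num.sqrt (itg 0 t (fun s => r M.+1 s ^+ 2))) d => *; lra.
have in_t : 0 <= t <= t by rewrite t0 lexx.
split; last exact: le_trans H3 (ler_wpM2l K0 DD).
by have := le_trans (H1 t in_t) (ler_wpM2l K0 DD); rewrite energyE.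
Qed.

Lemma discrete_wave :
  [/\ forall t, 0 <= t <= T ->
        Num.sqrt (wave_energy N (fun j => w j t) (fun j => v j t)) <= wave_const T m * wave_data,
      forall t j, 0 <= t <= T -> (j <= N.+1)%N -> `|w j t| <= wave_const T m * wave_data &
      Num.sqrt (itg 0 T (fun t => dminus_h N (fun j => w j t) N.+1 ^+ 2)) <=
        wave_const T m * wave_data].
Proof.
have K0 : 0 <= K by exact: chain_const_ge0.
have [d0 [dc dB]] := d_ge.
have k0 : 0 <= k by rewrite !addr_ge0 ?mulr_ge0 ?sqrtr_ge0 ?(ltW T0).
(* Adding 1 keeps the rate positive, as [gronwall] asks, even when [m = 0]. *)
pose b := K * m + 1; have b0 : 0 < b by rewrite ltr_wpDl ?mulr_ge0.
have iu t : 0 <= t <= T -> 0 <= itg 0 t u by move=> _; apply: itg_ge0.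
have G := @gronwall R T (K * (k * d)) b u (ltW T0) _ b0 ucu (fun t _ => u0 t) _.
have {}G t : 0 <= t <= T -> u t <= 2 * (K * k) * expR (2 * b * T) * d.
  move=> tT; have -> : 2 * (K * k) * expR (2 * b * T) * d = 2 * (K * (k * d)) * expR (2 * b * T) by ring.
  apply: G => //; first by rewrite !mulr_ge0.
  move=> s sT; have [H _] := local sT; rewrite (le_trans H)// mulrDr lerD2l mulrA.
  by rewrite ler_wpM2r ?iu// lerDl.
set c := 2 * (K * k) * expR (2 * b * T) in G.
have c_0 : 0 <= c by rewrite !mulr_ge0 ?expR_ge0.
have sT0 := sqrtr_ge0 T.
have W : wave_const T m * d = d + Num.sqrt T * d + c * d + K * (k * d + m * T * c * d).
  by rewrite /wave_const -/K -/k -/b -/c; ring.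
have p1 : 0 <= Num.sqrt T * d by rewrite mulr_ge0.
have p2 : 0 <= c * d by rewrite mulr_ge0.
have p3 : 0 <= K * (k * d + m * T * c * d) by rewrite mulr_ge0// addr_ge0 ?mulr_ge0 ?(ltW T0).
rewrite -/d W; split.
- by move=> t tT; rewrite (le_trans (G t tT))//; lra.
- move=> t j tT jN; rewrite (le_trans (w_le jN tT))//.
  have := G t tT; have : Num.sqrt T * B0 <= Num.sqrt T * d by rewrite ler_wpM2l.
  lra.
have TT : 0 <= T <= T by rewrite lexx ltW.
have [_ H] := local TT.
have E : itg 0 T (fun t => dminus_h N (fun j => w j t) N.+1 ^+ 2) = itg 0 T (fun s => r M s ^+ 2).
  by apply: itg_eq => t _; rewrite /M r_odd.
have H2 : m * itg 0 T u <= m * T * c * d.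
  have -> : m * T * c * d = m * (c * d * T) by ring.
  rewrite ler_wpM2l//.
  have -> : c * d * T = itg 0 T (fun=> c * d) by rewrite itg_cst ?(ltW T0)// subr0.
  apply: itg_le; [exact: ucont_L1|exact: L1_cst|move=> t /andP[t1 t2]; apply: G].
  by rewrite !ltW.
have := ler_wpM2l K0 (lerD (lexx (k * d)) H2); rewrite E; move: H p1 p2 p3 d0.
move: (K * (k * d + m * itg 0 T u)) (K * (k * d + m * T * c * d)) (Num.sqrt T * d) (c * d) d.
move: (Num.sqrt (itg 0 T _)) => *; lra.
Qed.

End Estimate.
End DiscreteWave.

(** * Norms and density *)

Section L2norm.
Context {R : realType}.
Local Notation mu := (@lebesgue_measure R).
Implicit Types (a b c d k : R) (f g : R -> R).

Definition nL2 a b f : R := Num.sqrt (itg a b (fun x => f x ^+ 2)).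

Lemma itg_sqr_ge0 a b f : 0 <= itg a b (fun x => f x ^+ 2).
Proof. by apply: itg_ge0 => x _; exact: sqr_ge0. Qed.

Lemma nL2_ge0 a b f : 0 <= nL2 a b f. Proof. exact: sqrtr_ge0. Qed.

Lemma nL2_sqr a b f : nL2 a b f ^+ 2 = itg a b (fun x => f x ^+ 2).
Proof. by rewrite sqr_sqrtr// itg_sqr_ge0. Qed.

Lemma nL2_eq a b f g : (forall x, a < x < b -> f x = g x) -> nL2 a b f = nL2 a b g.
Proof. by move=> fg; congr Num.sqrt; apply: itg_eq => x /fg ->. Qed.

Lemma nL2_le a b f k : 0 <= k -> itg a b (fun x => f x ^+ 2) <= k ^+ 2 -> nL2 a b f <= k.
Proof. by move=> k0 H; rewrite -[leRHS](ger0_norm k0) -sqrtr_sqr ler_wsqrtr. Qed.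

Lemma nL2_mono a b f g : L2 a b f -> L2 a b g ->
  (forall x, a < x < b -> `|f x| <= `|g x|) -> nL2 a b f <= nL2 a b g.
Proof.
move=> [_ Hf] [_ Hg] fg; rewrite ler_wsqrtr// itg_le// => x xab.
rewrite -[f x ^+ 2]real_normK ?num_real// -[g x ^+ 2]real_normK ?num_real//.
by rewrite lerXn2r ?nnegrE// fg.
Qed.

Lemma nL2D a b f g : L2 a b f -> L2 a b g ->
  nL2 a b (fun x => f x + g x) <= nL2 a b f + nL2 a b g.
Proof.
move=> Hf Hg; apply: nL2_le; first by rewrite addr_ge0// nL2_ge0.
rewrite sqrrD !nL2_sqr; have cs := le_trans (ler_norm _) (itg_CS_sqrt Hf Hg).
have I1 := L2M Hf Hg.
have -> : itg a b (fun x => (f x + g x) ^+ 2) = itg a b (fun x => f x ^+ 2) +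
   2 * itg a b (fun x => f x * g x) + itg a b (fun x => g x ^+ 2).
  rewrite -itgZ// -itgD; [|by case: Hf|exact: L1Z].
  rewrite -itgD; [|by apply: L1D; [case: Hf|exact: L1Z]|by case: Hg].
  by apply: itg_eq => x _; ring.
rewrite lerD2r lerD2l -[leRHS]mulr_natl ler_pM2l//.
Qed.

Lemma nL2Z a b k f : L2 a b f -> nL2 a b (fun x => k * f x) = `|k| * nL2 a b f.
Proof.
move=> [_ Hf]; rewrite /nL2 -sqrtr_sqr -sqrtrM ?sqr_ge0// -itgZ//.
by congr Num.sqrt; apply: itg_eq => x _; rewrite exprMn.
Qed.

Lemma nL2N a b f : nL2 a b (fun x => - f x) = nL2 a b f.
Proof. by congr Num.sqrt; apply: itg_eq => x _; rewrite sqrrN. Qed.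

Lemma L2N a b f : L2 a b f -> L2 a b (fun x => - f x).
Proof. by move=> Hf; apply: L2_eq (L2Z (-1) Hf) => x _; rewrite mulN1r. Qed.

Lemma nL2B a b f g : L2 a b f -> L2 a b g ->
  nL2 a b (fun x => f x - g x) <= nL2 a b f + nL2 a b g.
Proof. by move=> Hf Hg; rewrite (le_trans (nL2D Hf (L2N Hg)))// nL2N. Qed.

Lemma nL2_triangle a b f g (k : R -> R) : L2 a b f -> L2 a b g -> L2 a b k ->
  nL2 a b (fun x => f x - k x) <= nL2 a b (fun x => f x - g x) + nL2 a b (fun x => g x - k x).
Proof.
move=> Hf Hg Hk; have := nL2D (L2B Hf Hg) (L2B Hg Hk).
by rewrite (@nL2_eq _ _ _ (fun x => f x - k x))// => x _; rewrite subrKA.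
Qed.

Lemma nL2_sub a b c d f : a <= c -> c <= d -> d <= b -> L2 a b f -> nL2 c d f <= nL2 a b f.
Proof.
move=> ac cd db [_ Hf]; rewrite ler_wsqrtr// itg_le_sub// => x _; exact: sqr_ge0.
Qed.

Lemma nL2_sup a b f k : a <= b -> 0 <= k -> L2 a b f -> (forall x, a < x < b -> `|f x| <= k) ->
  nL2 a b f <= Num.sqrt (b - a) * k.
Proof.
move=> ab k0 [_ Hf] fk; apply: nL2_le; first by rewrite mulr_ge0 ?sqrtr_ge0.
rewrite exprMn sqr_sqrtr ?subr_ge0// mulrC -itg_cst//; apply: itg_le => //.
  exact: L1_cst.
move=> x xab; rewrite -[f x ^+ 2]real_normK ?num_real// lerXn2r ?nnegrE//; exact: fk.
Qed.

Lemma itg_le_nL2 a b f : a <= b -> L2 a b f -> `|itg a b f| <= Num.sqrt (b - a) * nL2 a b f.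
Proof.
move=> ab Hf; have := itg_sqr_le ab Hf; rewrite -nL2_sqr => H.
rewrite -sqrtr_sqr (le_trans (ler_wsqrtr H))//.
by rewrite sqrtrM ?subr_ge0// sqrtr_sqr ger0_norm ?nL2_ge0.
Qed.

Lemma itg_abs_le_nL2 a b f : a <= b -> L2 a b f ->
  itg a b (fun x => `|f x|) <= Num.sqrt (b - a) * nL2 a b f.
Proof.
move=> ab Hf; have Ha : L2 a b (fun x => `|f x|).
  case: Hf => mf Hf; split; first exact: measurableT_comp.
  by apply: L1_eq Hf => x _; rewrite real_normK ?num_real.
have := le_trans (ler_norm _) (itg_le_nL2 ab Ha); congr (_ <= _ * _).
by congr Num.sqrt; apply: itg_eq => x _; rewrite real_normK ?num_real.
Qed.

End L2norm.

(** * Extended norms, integrals and point values *)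

Section LebesgueInterface.
Context {R : realType}.
Local Notation mu := (@lebesgue_measure R).
Implicit Types (a b c k : R) (f g : R -> R).

Lemma Lp2_norm_sqr (d : measure_display) (X : measurableType d) (nu : {measure set X -> \bar R})
    (D : set X) (f : X -> R) : measurable D ->
  Lp_norm nu 2%:E D f = ((\int[nu]_(x in D) (f x ^+ 2)%:E) `^ 2^-1)%E.
Proof.
move=> mD; rewrite /Lp_norm unlock; congr (_ `^ _)%E; rewrite [RHS]integral_mkcond.
apply: eq_integral => x _; rewrite !patchE /=; case: ifPn => [xD|xD].
  by rewrite patchE xD /= powR_mulrn// real_normK ?num_real.
by rewrite patchE (negbTE xD) normr0 powR0.
Qed.

Lemma Lp2_norm_le (d : measure_display) (X : measurableType d) (nu : {measure set X -> \bar R})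
    (D : set X) (f : X -> R) (k : R) : measurable D -> 0 <= k ->
  (\int[nu]_(x in D) (f x ^+ 2)%:E <= (k ^+ 2)%:E)%E -> (Lp_norm nu 2%:E D f <= k%:E)%E.
Proof.
move=> mD k0 H; rewrite Lp2_norm_sqr//.
have -> : k%:E = ((k ^+ 2)%:E `^ 2^-1)%E.
  by rewrite poweR_EFin powR12_sqrt ?sqr_ge0// sqrtr_sqr ger0_norm.
have I0 : (0 <= \int[nu]_(x in D) (f x ^+ 2)%:E)%E.
  by apply: integral_ge0 => x _; rewrite lee_fin sqr_ge0.
rewrite gt0_ler_poweR// in_itv/= leey ?I0 ?lee_fin ?sqr_ge0//.
Qed.

Lemma integral_itg a b f : L1 a b f -> (\int[mu]_(x in `]a, b[) (f x)%:E)%E = (itg a b f)%:E.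
Proof. by move=> Hf; rewrite /itg /Rintegral fineK//; exact: integrable_fin_num. Qed.

Lemma L2_normE a b f : L2 a b f -> L2_norm a b f = (nL2 a b f)%:E.
Proof.
move=> [_ Hf]; rewrite /L2_norm Lp2_norm_sqr// integral_itg// poweR_EFin powR12_sqrt//.
exact: itg_sqr_ge0.
Qed.

Lemma in_L2E a b f : in_Lp mu 2%:E `]a, b[ f <-> L2 a b f.
Proof.
split => [H|H].
  have := Lfun2_integrable_sqr H; move: H; rewrite /in_Lp inE => /andP[]; rewrite inE/= => mf _ I.
  split.
    have := measurable_restrictT f (@measurable_itv R `]a, b[); tauto.
  rewrite /L1 integrable_mkcond//; apply: eq_integrable I => // x _.
  by rewrite /= !patchE; case: ifP => // _; rewrite expr0n.
rewrite /in_Lp inE; apply/andP; split; rewrite inE/=.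
  have := measurable_restrictT f (@measurable_itv R `]a, b[); case: H; tauto.
by rewrite /finite_norm -/(Lp_norm _ _ _ _) -/(L2_norm _ _ _) L2_normE// ltry.
Qed.

Lemma in_L1E a b f : in_Lp mu 1%:E `]a, b[ f -> L1 a b f.
Proof.
move/Lfun1_integrable => H; rewrite /L1 integrable_mkcond//; apply: eq_integrable H => // x _.
by rewrite /= !patchE; case: ifP.
Qed.

Lemma Sobolev2_L2 (k : nat) a b (u : nat -> R -> R) i : Sobolev k 2%:E a b u -> (i <= k)%N -> L2 a b (u i).
Proof. by move=> [H _] ik; apply/in_L2E/H. Qed.

Lemma Sobolev2_AC (k : nat) a b (u : nat -> R -> R) i : a < b -> Sobolev k 2%:E a b u -> (i < k)%N ->
  AC a b (u i) (u i.+1).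
Proof.
move=> ab S ik; have [cu wu] := S.2 i ik.
by apply: weak_derivative_AC => //; [exact: within_ucont|exact: L2_L1 (Sobolev2_L2 S _)].
Qed.

Lemma Sobolev1_AC a b (u : nat -> R -> R) : a < b -> Sobolev 1 1%:E a b u -> AC a b (u 0%N) (u 1%N).
Proof.
move=> ab [H /(_ 0%N isT)[cu wu]].
by apply: weak_derivative_AC => //; [exact: within_ucont|apply/in_L1E/H].
Qed.

Lemma L2_norm_ge0 a b f : (0 <= L2_norm a b f)%E. Proof. exact: Lnorm_ge0. Qed.

Lemma Hnorm_ge (k : nat) a b (u : nat -> R -> R) i : (i <= k)%N -> (L2_norm a b (u i) <= Hnorm k a b u)%E.
Proof.
move=> ik; have ge0 j : (0 <= L2_norm a b (u j))%E by exact: L2_norm_ge0.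
have E : L2_norm a b (u i) = (((L2_norm a b (u i)) ^+ 2) `^ 2^-1)%E.
  move: (ge0 i); case: (L2_norm a b (u i)) => [x| |]//=.
    by rewrite lee_fin => x0; rewrite -expr2 powR12_sqrt ?sqr_ge0// sqrtr_sqr ger0_norm.
  by rewrite invr_eq0 pnatr_eq0.
rewrite E /Hnorm gt0_ler_poweR// ?in_itv/= ?leey ?andbT ?expe_ge0 ?sume_ge0//.
- by rewrite mule_ge0.
- by move=> j _; rewrite mule_ge0.
- rewrite (bigD1 (Ordinal (ik : (i < k.+1)%N)))//= leeDl// sume_ge0// => j _; exact: mule_ge0.
Qed.

Lemma Hnorm_le (k : nat) a b (u : nat -> R -> R) (c : R) :
  (forall i, (i <= k)%N -> (L2_norm a b (u i) <= c%:E)%E) ->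
  (Hnorm k a b u <= (Num.sqrt k.+1%:R * c)%:E)%E.
Proof.
move=> H; have c0 : 0 <= c by have := le_trans (L2_norm_ge0 _ _ _) (H 0%N isT); rewrite lee_fin.
have -> : (Num.sqrt k.+1%:R * c)%:E = ((k.+1%:R * c ^+ 2)%:E `^ 2^-1)%E.
  by rewrite poweR_EFin powR12_sqrt ?mulr_ge0 ?sqr_ge0// sqrtrM// sqrtr_sqr ger0_norm.
have S0 : (0 <= \sum_(i < k.+1) (L2_norm a b (u i)) ^+ 2)%E.
  by apply: sume_ge0 => j _; apply: expe_ge0; exact: L2_norm_ge0.
rewrite /Hnorm gt0_ler_poweR// ?in_itv/= ?leey ?andbT ?lee_fin ?mulr_ge0 ?sqr_ge0//.
have -> : (k.+1%:R * c ^+ 2)%:E = (\sum_(i < k.+1) (c ^+ 2)%:E)%E.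
  by rewrite sumEFin sumr_const card_ord mulr_natl.
apply: lee_sum => i _; have h := H i (ltn_ord i : (i <= k)%N).
by rewrite EFin_expe !expe2; apply: lee_pmul => //; exact: L2_norm_ge0.
Qed.

(** Write the value at [x] as the mean of [u] plus the mean of [u x - u y] over [y]; the interval
    has length 1, so both constants are 1. *)
Lemma H1_sup (u : nat -> R -> R) x : AC 0 1 (u 0%N) (u 1%N) -> L2 0 1 (u 1%N) -> 0 <= x <= 1 ->
  `|u 0%N x| <= nL2 0 1 (u 0%N) + nL2 0 1 (u 1%N).
Proof.
move=> A L x01; have cu := AC_ucont A; have L1u := ucont_L1 cu.
have osc y : 0 <= y <= 1 -> `|u 0%N x - u 0%N y| <= nL2 0 1 (u 1%N).
  wlog xy : x y x01 / y <= x => [W|] y01.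
    by case: (leP y x) => [xy|/ltW xy]; [exact: W|rewrite distrC; exact: W].
  have /andP[x0 x1] := x01; have /andP[y0 y1] := y01.
  rewrite (AC_diff A)//; have L' : L2 y x (u 1%N) by exact: L2_sub L.
  rewrite (le_trans (itg_le_nL2 xy L'))//.
  have N1 := nL2_sub y0 xy x1 L.
  have s1 : Num.sqrt (x - y) <= 1 by rewrite -(sqrtr1 R) ler_wsqrtr//; lra.
  by have := ler_pM (sqrtr_ge0 _) (nL2_ge0 _ _ _) s1 N1; rewrite mul1r.
have E : u 0%N x = itg 0 1 (fun y => u 0%N x - u 0%N y) + itg 0 1 (u 0%N).
  by rewrite itgB//; [rewrite itg_cst// subr0 mulr1 subrK|exact: L1_cst].
rewrite E (le_trans (ler_normD _ _))// addrC lerD//.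
  have := itg_le_nL2 ler01 (ucont_L2 cu); by rewrite subr0 sqrtr1 mul1r.
have := @itg_abs_le R 0 1 (fun y => u 0%N x - u 0%N y) (nL2 0 1 (u 1%N)) ler01.
rewrite subr0 mulr1; apply; first by apply: L1B => //; exact: L1_cst.
by move=> y /andP[y0 y1]; apply: osc; rewrite !ltW.
Qed.

Lemma H1_holder (v v' : R -> R) x y : AC 0 1 v v' -> L2 0 1 v' -> 0 <= x <= 1 -> 0 <= y <= 1 ->
  `|v x - v y| <= Num.sqrt `|x - y| * nL2 0 1 v'.
Proof.
wlog xy : x y / y <= x => [W|] A L x01 y01.
  case: (leP y x) => [xy|/ltW xy]; first exact: W.
  by rewrite distrC [`|x - y|]distrC; exact: W.
have /andP[x0 x1] := x01; have /andP[y0 y1] := y01.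
rewrite (AC_diff A)//; have L' : L2 y x v' by exact: L2_sub L.
rewrite (le_trans (itg_le_nL2 xy L'))// ger0_norm ?subr_ge0//.
by rewrite ler_wpM2l ?sqrtr_ge0// nL2_sub.
Qed.

End LebesgueInterface.

Section Vanishing.
Context {R : realType}.
Implicit Types x y : nat -> R.

(* One-sided: used for sequences that are nonnegative. *)
Definition vanish x := forall e : R, 0 < e -> exists n0, forall n, (n0 <= n)%N -> x n <= e.

Lemma vanish_le x y : vanish y -> (exists n0, forall n, (n0 <= n)%N -> x n <= y n) -> vanish x.
Proof.
move=> vy [n1 H] e e0; have [n0 Hn] := vy e e0; exists (maxn n0 n1) => n.
by rewrite geq_max => /andP[h1 h2]; rewrite (le_trans (H n h2))// Hn.
Qed.

Lemma vanish_leq x y : vanish y -> (forall n, x n <= y n) -> vanish x.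
Proof. by move=> vy H; apply: vanish_le vy _; exists 0%N. Qed.

Lemma vanish0 : vanish (fun=> 0). Proof. by move=> e e0; exists 0%N => n _; exact: ltW. Qed.

Lemma vanishD x y : vanish x -> vanish y -> vanish (fun n => x n + y n).
Proof.
move=> vx vy e e0; have e2 : 0 < e / 2 by rewrite divr_gt0.
have [n1 H1] := vx _ e2; have [n2 H2] := vy _ e2; exists (maxn n1 n2) => n.
by rewrite geq_max => /andP[h1 h2]; rewrite (splitr e) lerD ?H1 ?H2.
Qed.

Lemma vanishZ (k : R) x : 0 <= k -> vanish x -> vanish (fun n => k * x n).
Proof.
move=> k0 vx e e0; have k1 : 0 < k + 1 by rewrite ltr_wpDl.
have [n0 H] := vx _ (divr_gt0 e0 k1); exists n0 => n /H h.
rewrite (le_trans (ler_wpM2l k0 h))// mulrCA ler_piMr ?(ltW e0)//.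
by rewrite ler_pdivrMr// mul1r lerDl.
Qed.

Lemma vanish_mesh : vanish (fun n => mesh n).
Proof.
move=> e e0; have ei : 0 <= e^-1 by rewrite invr_ge0 ltW.
have Hn := archi_boundP ei; exists (Num.bound e^-1) => n hn.
rewrite /mesh -[e]invrK lef_pV2 ?posrE ?invr_gt0 ?ltr0n// (le_trans (ltW Hn))// ler_nat.
exact: leqW.
Qed.

End Vanishing.

Section AE.
Context {R : realType}.
Local Notation mu := (@lebesgue_measure R).
Implicit Types P Q : R -> Prop.

Let fae := @ae_filter_ringOfSetsType _ (measurableTypeR R) _ mu.

Lemma ae_all P : (forall x, P x) -> {ae mu, forall x, P x}.
Proof. by move=> H; apply: (@nearW _ _ _ fae). Qed.

Lemma ae_mono P Q : (forall x, P x -> Q x) -> {ae mu, forall x, P x} -> {ae mu, forall x, Q x}.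
Proof. by move=> PQ; exact: (@filterS _ _ fae). Qed.

Lemma ae_and P Q : {ae mu, forall x, P x} -> {ae mu, forall x, Q x} -> {ae mu, forall x, P x /\ Q x}.
Proof. by move=> HP HQ; exact: (@filterI _ _ fae). Qed.

Lemma ae_neq (c : R) : {ae mu, forall x : R, x != c}.
Proof.
exists [set c]; split => //; first exact: lebesgue_measure_set1.
by move=> x /= /negP; rewrite negbK => /eqP.
Qed.

End AE.

Section Density.
Context {R : realType}.
Local Notation mu := (@lebesgue_measure R).
Implicit Types (a b c k : R) (f g : R -> R).

Lemma vanish_cvg (x : nat -> R) : vanish (fun n => `|x n|) <-> x @ \oo --> (0 : R).
Proof.
split=> [vx|/cvgrPdist_le cx e e0].
  apply/cvgrPdist_le => e e0; have [n0 H] := vx e e0.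
  by exists n0 => // n /= /H; rewrite sub0r normrN.
have [n0 _ H] := cx e e0; exists n0 => n /H; by rewrite /= sub0r normrN.
Qed.

Lemma itg_dominated a b (F : nat -> R -> R) (G : R -> R) :
  (forall n, L1 a b (F n)) -> L1 a b G ->
  {ae mu, forall x, a < x < b -> forall n, `|F n x| <= G x} ->
  {ae mu, forall x, a < x < b -> vanish (fun n => `|F n x|)} ->
  vanish (fun n => itg a b (fun x => `|F n x|)).
Proof.
move=> HF HG bd cv.
have dc := @dominated_convergence _ _ R mu `]a, b[ (measurable_itv _)
  (fun n x => (F n x)%:E) (cst 0%E) (EFin \o G)
  (fun n => measurable_int _ (HF n)) (measurable_cst _) _ HG.
have {}H : (fun n => (itg a b (fun x => `|F n x|))%:E) @ \oo --> (0 : R)%:E.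
  have E : (fun n => (itg a b (fun x => `|F n x|))%:E) =
    [sequence (\int[mu]_(x in `]a, b[) `|(F n x)%:E - cst 0 x|)%E]_n.
    apply/funext => n /=; rewrite -integral_itg; last exact: L1_abs.
    by apply: eq_integral => x _; rewrite /= subr0.
  have [||_ H _] := dc; rewrite ?E//.
    apply: ae_mono cv => x /= Hx; rewrite in_itv/= => /Hx /vanish_cvg.
    by move=> h; apply/fine_cvgP; split; [exact: nearW|exact: h].
  apply: ae_mono bd => x /= Hx n; rewrite in_itv/= => /Hx; by rewrite lee_fin.
move/fine_cvg : H => /= H; have /vanish_cvg := H.
by move/vanish_leq; apply => n; rewrite ler_norm.
Qed.

(** Truncation to [[-k, k]]. It upgrades density in [L^1] to density in [L^2], and it replaces an
    essentially bounded potential by one that is bounded everywhere. *)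
Definition clip k (y : R) := Num.max (- k) (Num.min k y).

Lemma clip_le k y : 0 <= k -> `|clip k y| <= k.
Proof.
move=> k0; rewrite /clip ler_norml le_max lexx /= ge_max ge_min lexx /=.
by rewrite andbT; lra.
Qed.

Lemma clip_id k y : `|y| <= k -> clip k y = y.
Proof.
rewrite ler_norml => /andP[h1 h2]; rewrite /clip min_r// max_r//.
Qed.

Lemma clip_dist k y z : `|clip k y - clip k z| <= `|y - z|.
Proof.
move: (ler_norm (y - z)) (ler_norm (z - y)); rewrite (distrC z y); move: (`|y - z|) => d d1 d2.
rewrite /clip ler_norml /Num.max /Num.min.
by case: (ltP k y) => ?; case: (ltP k z) => ?; case: ltP => ?; case: ltP => ?;
  apply/andP; split; lra.
Qed.

Lemma clip_sub k y : 0 <= k -> `|y - clip k y| <= `|y|.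
Proof.
move=> k0; case: (leP `|y| k) => [h|h]; first by rewrite clip_id// subrr normr0.
have := clip_le y k0; rewrite ler_norml => /andP[h1 h2].
case: (leP 0 y) => y0.
  rewrite ger0_norm// in h *; rewrite /clip min_l; last exact: ltW.
  rewrite max_r; last lra.
  by rewrite ger0_norm; lra.
rewrite ltr0_norm// in h *; rewrite /clip min_r; last lra.
rewrite max_l; last lra.
by rewrite ler0_norm; lra.
Qed.

Lemma clip_ucont a b k f : ucont a b f -> ucont a b (fun x => clip k (f x)).
Proof.
move=> cf e e0; have [d d0 H] := cf e e0; exists d => // x y xab yab xy.
exact: le_lt_trans (clip_dist _ _ _) (H _ _ xab yab xy).
Qed.

Lemma L2_clip a b k f : 0 <= k -> measurable_fun `]a, b[ f -> L2 a b (fun x => clip k (f x)).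
Proof.
move=> k0 mf; apply: (@L2_bounded _ _ _ _ k) => [|x _]; last exact: clip_le.
apply: measurable_maxr; first exact: measurable_cst.
by apply: measurable_minr => //; exact: measurable_cst.
Qed.

Lemma L1_dense a b f : L1 a b f -> forall e : R, 0 < e ->
  exists2 g, continuous g & itg a b (fun x => `|f x - g x|) <= e.
Proof.
move=> Hf e e0; have mI := @measurable_itv R `]a, b[.
have [g [cg Ig cv]] := approximation_continuous_integrable mI (mu_oo_fin a b) Hf.
have /vanish_cvg : (fun n => itg a b (fun x => `|f x - g n x|)) @ \oo --> (0 : R).
  rewrite [X in X @ _](_ : _ = fine \o
    (fun n => \int[mu]_(z in `]a, b[) `|(f z - g n z)%:E|)%E); first exact: fine_cvg cv.
  by [].
move=> /(_ e e0)[n0 /(_ n0 (leqnn _)) H]; exists (g n0) => //.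
exact: le_trans (ler_norm _) H.
Qed.

(** Truncate [f], approximate the truncation in [L^1] by a continuous function, and truncate that as
    well: a difference of two truncations is at most [2 k], so its square is controlled by its
    absolute value. *)
Lemma L2_dense a b f : L2 a b f -> forall e : R, 0 < e ->
  exists2 g, ucont a b g & nL2 a b (fun x => f x - g x) <= e.
Proof.
move=> Hf e e0; have [mf If] := Hf; have e2 : 0 < e / 2 by rewrite divr_gt0.
pose F n x := (f x - clip n%:R (f x)) ^+ 2.
have LF n : L2 a b (fun x => f x - clip n%:R (f x)) by apply: L2B => //; exact: L2_clip.
have vF : vanish (fun n => itg a b (fun x => `|F n x|)).
  apply: (itg_dominated (G := fun x => f x ^+ 2)) => //.
  - by move=> n; case: (LF n).
  - apply: ae_all => x _ n; rewrite /F normrX -[leRHS]real_normK ?num_real//.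
    by rewrite lerXn2r ?nnegrE// clip_sub.
  - apply: ae_all => x _ d d0; exists (Num.bound `|f x|) => n hn.
    have := archi_boundP (normr_ge0 (f x)) => h.
    rewrite /F clip_id ?subrr ?expr0n ?normr0 ?ltW//.
    by rewrite (lt_le_trans h)// ler_nat.
have [n0 /(_ n0 (leqnn _))] := vF _ (exprn_gt0 2 e2).
set n := n0.+1%:R : R => Hn.
pose k : R := n0%:R; have k0 : 0 <= k by [].
have H1 : nL2 a b (fun x => f x - clip k (f x)) <= e / 2.
  apply: nL2_le; first exact: ltW.
  rewrite (le_trans _ Hn)// le_eqVlt; apply/orP; left; apply/eqP/itg_eq => x _.
  by rewrite /F ger0_norm ?sqr_ge0.
have d0 : 0 < (e / 2) ^+ 2 / (2 * (k + 1)) by rewrite divr_gt0 ?exprn_gt0 ?mulr_gt0 ?ltr_wpDl.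
have Hc := L2_clip k0 mf.
have [g cg Hg] := L1_dense (L2_L1 Hc) d0.
have cug : ucont a b (fun x => clip k (g x)) by apply: clip_ucont; exact: continuous_ucont.
exists (fun x => clip k (g x)) => //.
have L2g := ucont_L2 cug.
rewrite (le_trans (nL2_triangle Hf Hc L2g))// [leRHS]splitr lerD//.
apply: nL2_le; first exact: ltW.
have L1g : L1 a b g by apply: ucont_L1; exact: continuous_ucont.
have Ld := L1_abs (L1B (L2_L1 Hc) L1g).
have S : itg a b (fun x => (clip k (f x) - clip k (g x)) ^+ 2) <=
    itg a b (fun x => (2 * (k + 1)) * `|clip k (f x) - g x|).
  apply: itg_le; [by case: (L2B Hc L2g)|exact: L1Z|move=> x _].
  rewrite -real_normK ?num_real// expr2 ler_pM//.
    rewrite (le_trans (ler_normB _ _))//; have := clip_le (f x) k0; have := clip_le (g x) k0.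
    by move: (`|clip _ _|) (`|clip _ _|) => *; lra.
  by rewrite -{1}[clip k (f x)](@clip_id k) ?clip_dist// clip_le.
rewrite (le_trans S)// itgZ// (le_trans (ler_wpM2l _ Hg))//.
  by rewrite mulr_ge0 ?addr_ge0.
by rewrite mulrC divfK// gt_eqF// mulr_gt0// ltr_wpDl.
Qed.

(** Uniform boundedness plus convergence on a dense set. [S n f] stands for the norm of an
    approximation error, for instance of a time or a grid average. *)
Lemma L2_vanish_of_dense a b (S : nat -> (R -> R) -> R) (c : R) : 0 <= c ->
  (forall n f g, L2 a b f -> L2 a b g -> S n f <= S n (fun x => f x - g x) + S n g) ->
  (forall n f, L2 a b f -> S n f <= c * nL2 a b f) ->
  (forall g, ucont a b g -> vanish (S ^~ g)) ->
  forall f, L2 a b f -> vanish (S ^~ f).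
Proof.
move=> c0 Ssub Sle Sc f Hf e e0; have e2 : 0 < e / 2 by rewrite divr_gt0.
have c1 : 0 < c + 1 by rewrite ltr_wpDl.
have [g cg Hg] := L2_dense Hf (divr_gt0 e2 c1).
have [n0 Hn] := Sc g cg _ e2; exists n0 => n /Hn h.
have Lg := ucont_L2 cg; rewrite (le_trans (Ssub n f g Hf Lg))// [leRHS]splitr lerD//.
rewrite (le_trans (Sle _ _ (L2B Hf Lg)))// (le_trans (ler_wpM2l c0 Hg))//.
rewrite mulrCA ler_piMr ?(ltW e2)// ler_pdivrMr// mul1r; lra.
Qed.

Lemma L1_vanish_of_dense a b (S : nat -> (R -> R) -> R) (c : R) : 0 <= c ->
  (forall n f g, L1 a b f -> L1 a b g -> S n f <= S n (fun x => f x - g x) + S n g) ->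
  (forall n f, L1 a b f -> S n f <= c * itg a b (fun x => `|f x|)) ->
  (forall g, ucont a b g -> vanish (S ^~ g)) ->
  forall f, L1 a b f -> vanish (S ^~ f).
Proof.
move=> c0 Ssub Sle Sc f Hf e e0; have e2 : 0 < e / 2 by rewrite divr_gt0.
have c1 : 0 < c + 1 by rewrite ltr_wpDl.
have [g cg Hg] := L1_dense Hf (divr_gt0 e2 c1).
have cug : ucont a b g by exact: continuous_ucont.
have [n0 Hn] := Sc g cug _ e2; exists n0 => n /Hn h.
have Lg := ucont_L1 cug; rewrite (le_trans (Ssub n f g Hf Lg))// [leRHS]splitr lerD//.
rewrite (le_trans (Sle _ _ (L1B Hf Lg)))// (le_trans (ler_wpM2l c0 Hg))//.
rewrite mulrCA ler_piMr ?(ltW e2)// ler_pdivrMr// mul1r; lra.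
Qed.

End Density.

(** * Time averages *)

Section Minkowski.
Context {R : realType}.

(** Minkowski by duality: test the vector of integrals against itself, exchange sum and integral,
    and apply Cauchy-Schwarz at each time; one factor [sqrt S] then cancels. *)
Lemma sqrt_sum_itg_le (h : R) (r : seq nat) (f : nat -> R -> R) (a b : R) (Phi : R -> R) :
  0 <= h -> a <= b -> (forall i, i \in r -> L1 a b (f i)) -> L1 a b Phi ->
  (forall t, a < t < b -> Num.sqrt (h * \sum_(i <- r) f i t ^+ 2) <= Phi t) ->
  Num.sqrt (h * \sum_(i <- r) itg a b (f i) ^+ 2) <= itg a b Phi.
Proof.
move=> h0 ab Lf LP H.
pose c i := itg a b (f i); set S := h * \sum_(i <- r) c i ^+ 2.
have S0 : 0 <= S by rewrite mulr_ge0// sumr_ge0// => i _; exact: sqr_ge0.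
have P0 : 0 <= itg a b Phi by apply: itg_ge0 => t tT; exact: le_trans (sqrtr_ge0 _) (H t tT).
have E : S = itg a b (fun t => h * \sum_(i <- r) c i * f i t).
  rewrite itgZ; last by apply: L1_sum => i ir _; exact/L1Z/Lf.
  rewrite /S itg_sum//; last by move=> i ir _; exact/L1Z/Lf.
  by congr (_ * _); apply: eq_big_seq => i ir; rewrite itgZ ?expr2//; exact: Lf.
have B : S <= Num.sqrt S * itg a b Phi.
  rewrite {1}E -itgZ//; apply: itg_le.
  - by apply: L1Z; apply: L1_sum => i ir _; exact/L1Z/Lf.
  - exact: L1Z.
  move=> t tT.
  have cs := le_trans (ler_norm _) (sum_CS_sqrt r xpredT c (f ^~ t)).
  rewrite (le_trans (ler_wpM2l h0 cs))//.
  have -> : h * (Num.sqrt (\sum_(i <- r) c i ^+ 2) * Num.sqrt (\sum_(i <- r) f i t ^+ 2)) =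
    Num.sqrt S * Num.sqrt (h * \sum_(i <- r) f i t ^+ 2).
    by rewrite /S !sqrtrM// mulrACA -expr2 sqr_sqrtr.
  by rewrite ler_wpM2l ?sqrtr_ge0 ?H.
have [->|S1] := eqVneq (Num.sqrt S) 0; first exact: P0.
have Sp : 0 < Num.sqrt S by rewrite lt0r S1 sqrtr_ge0.
by move: B; rewrite -{1}(sqr_sqrtr S0) expr2 ler_pM2l.
Qed.

Lemma l2n_itg (N : nat) (f : nat -> R -> R) (a b : R) (Phi : R -> R) : a <= b ->
  (forall j, (1 <= j <= N)%N -> L1 a b (f j)) -> L1 a b Phi ->
  (forall t, a < t < b -> l2n N (fun j => f j t) <= Phi t) ->
  l2n N (fun j => itg a b (f j)) <= itg a b Phi.
Proof.
move=> ab Lf LP H; apply: sqrt_sum_itg_le => //; first exact/ltW/mesh_gt0.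
by move=> j; rewrite mem_index_iota => jN; apply: Lf; rewrite -ltnS.
Qed.

End Minkowski.

Section TimeAverage.
Context {R : realType}.

(** Affine change of variables for a continuous derivative: on a short interval both sides are
    compared with the value of [f'] at the left end, and [eq_of_small_increments] removes the
    error. *)
Lemma AC_affine (a b c d k l : R) (f f' : R -> R) : 0 <= k ->
  ucont c d f' -> AC c d f f' -> (forall t, a <= t <= b -> c <= k * t + l <= d) ->
  AC a b (fun t => f (k * t + l)) (fun t => k * f' (k * t + l)).
Proof.
move=> k0 cf' Hf rg.
have cg : ucont a b (fun t => f' (k * t + l)) by apply: ucont_affine cf' rg.
have ck : ucont a b (fun t => k * f' (k * t + l)) by exact: ucontZ.
split=> [|x /andP[ax xb]]; first exact: ucont_L1.
pose Phi t := f (k * t + l) - itg a t (fun t => k * f' (k * t + l)).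
suff : Phi x = Phi a by rewrite /Phi [itg a a _]itg_nil// subr0 => <-; rewrite subrK.
apply: (@eq_of_small_increments R a x Phi (fun t => 2 * k * t) ax) => e e0.
have [del del0 H] := cg e e0.
exists del => // s t as_ st tx ts.
have inab y : s <= y <= t -> a <= y <= b.
  by move=> /andP[h1 h2]; rewrite (le_trans as_ h1) (le_trans h2 (le_trans tx xb)).
have sab : a <= s <= b by apply: inab; rewrite lexx.
have tab : a <= t <= b by apply: inab; rewrite lexx andbT.
have kst : k * s + l <= k * t + l by rewrite lerD2r ler_wpM2l.
have /andP[cs sd] := rg s sab; have /andP[ct td] := rg t tab.
have /andP[_ tb] := tab.
have A1 := AC_diff Hf cs kst td.
have A2 : itg a t (fun t => k * f' (k * t + l)) - itg a s (fun t => k * f' (k * t + l)) =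
    itg s t (fun t => k * f' (k * t + l)).
  rewrite (@itg_split _ a t s)//; first by rewrite addrC addKr.
  exact: ucont_L1 (ucont_sub (lexx a) tb ck).
pose v := f' (k * s + l).
have L1f : L1 (k * s + l) (k * t + l) f' by exact: L1_sub cs td (ucont_L1 cf').
have L1g : L1 s t (fun t => k * f' (k * t + l)) by exact: L1_sub as_ tb (ucont_L1 ck).
have kt0 : 0 <= k * (t - s) by rewrite mulr_ge0// subr_ge0.
have B1 : `|itg (k * s + l) (k * t + l) f' - v * (k * (t - s))| <= e * (k * (t - s)).
  have -> : k * (t - s) = (k * t + l) - (k * s + l) by ring.
  rewrite -itg_cst// -itgB//; last exact: L1_cst.
  apply: itg_abs_le => //; first by apply: L1B => //; exact: L1_cst.
  move=> y /andP[h1 h2].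
  have k1 : 0 < k.
    by rewrite lt0r k0 andbT; apply/negP => /eqP kz; move: h1 h2; rewrite kz !mul0r; lra.
  have -> : y = k * ((y - l) / k) + l by rewrite mulrC divfK ?gt_eqF// subrK.
  have h3 : s <= (y - l) / k by rewrite ler_pdivlMr//; lra.
  have h4 : (y - l) / k <= t by rewrite ler_pdivrMr//; lra.
  have h34 : s <= (y - l) / k <= t by rewrite h3.
  apply/ltW/H => //; first exact: inab.
  by rewrite ger0_norm ?subr_ge0// (le_lt_trans _ ts)// lerD2r.
have B2 : `|itg s t (fun t => k * f' (k * t + l)) - k * v * (t - s)| <= k * e * (t - s).
  rewrite -itg_cst// -itgB//; last exact: L1_cst.
  apply: itg_abs_le => //; first by apply: L1B => //; exact: L1_cst.
  move=> y /andP[h1 h2]; rewrite -mulrBr normrM (ger0_norm k0) ler_wpM2l//.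
  have := H y s; rewrite inab ?(ltW h1) ?(ltW h2)// => /(_ isT sab) h5; apply/ltW/h5.
  by rewrite ger0_norm ?subr_ge0 ?ltW// (lt_trans _ ts)// ltrD2r.
have -> : Phi t - Phi s = (f (k * t + l) - f (k * s + l)) -
  (itg a t (fun t => k * f' (k * t + l)) - itg a s (fun t => k * f' (k * t + l))).
  by rewrite /Phi; ring.
rewrite A1 A2.
have -> : itg (k * s + l) (k * t + l) f' - itg s t (fun t0 => k * f' (k * t0 + l)) =
  (itg (k * s + l) (k * t + l) f' - v * (k * (t - s))) -
  (itg s t (fun t => k * f' (k * t + l)) - k * v * (t - s)) by ring.
rewrite (le_trans (ler_normB _ _))// (le_trans (lerD B1 B2))//.
by rewrite le_eqVlt; apply/orP; left; apply/eqP; ring.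
Qed.

Fact half_bounds (e : R) : 0 < e -> 2 * e <= 1 -> [/\ 0 <= 1 - e, e <= 1, 1 - e <= 1 & 1 <= 2 * (1 - e)].
Proof. by move=> e0 e1; split; lra. Qed.

Variables (T e : R).
Hypotheses (T0 : 0 < T) (e0 : 0 < e) (e1 : 2 * e <= 1).
Let hb := half_bounds e0 e1.

Definition dlt (f : R -> R) (t : R) : R := f ((1 - e) * t + e * T) - f ((1 - e) * t).
Definition tavg (f : R -> R) (t : R) : R :=
  (e * T)^-1 * itg ((1 - e) * t) ((1 - e) * t + e * T) f.

Lemma tavg_range (t : R) : 0 <= t <= T ->
  [/\ 0 <= (1 - e) * t, (1 - e) * t <= (1 - e) * t + e * T & (1 - e) * t + e * T <= T].
Proof.
move=> /andP[t0 tT]; have [h0 _ _ _] := hb.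
have h : 0 <= (1 - e) * (T - t) by rewrite mulr_ge0// subr_ge0.
have h1 : 0 <= (1 - e) * t by rewrite mulr_ge0.
have h2 : 0 < e * T by rewrite mulr_gt0.
by split; lra.
Qed.

Lemma tavg_eq (f g : R -> R) (t : R) : 0 <= t <= T -> (forall s, 0 < s < T -> f s = g s) ->
  tavg f t = tavg g t.
Proof.
move=> /tavg_range[h1 h2 h3] fg; congr (_ * _); apply: itg_eq => s /andP[s1 s2].
by apply: fg; rewrite (le_lt_trans h1 s1) (lt_le_trans s2 h3).
Qed.

Lemma tavg_deriv (f f' : R -> R) (t : R) : 0 <= t <= T -> AC 0 T f f' ->
  tavg f' t = (e * T)^-1 * dlt f t.
Proof. by move=> /tavg_range[h1 h2 h3] Hf; rewrite /tavg /dlt (AC_diff Hf). Qed.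

Lemma tavg_primitive (f : R -> R) (t : R) : 0 <= t <= T -> L1 0 T f ->
  tavg f t = (e * T)^-1 * dlt (fun s => 0 + itg 0 s f) t.
Proof. by move=> tT Hf; apply: tavg_deriv => //; exact: AC_primitive. Qed.

Let r1 (t : R) : 0 <= t <= T -> 0 <= (1 - e) * t + e * T <= T.
Proof. by move=> /tavg_range[h1 h2 h3]; rewrite h3 (le_trans h1 h2). Qed.

Let r2 (t : R) : 0 <= t <= T -> 0 <= (1 - e) * t + 0 <= T.
Proof. by move=> /tavg_range[h1 h2 h3]; rewrite addr0 h1 (le_trans h2 h3). Qed.

Let lam0 : 0 <= 1 - e. Proof. by case: hb. Qed.

Lemma dlt_ucont (f : R -> R) : ucont 0 T f -> ucont 0 T (dlt f).
Proof.
move=> cf; apply: ucontB; first by apply: ucont_affine cf _ => t /r1.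
apply: (ucont_eq _ (ucont_affine cf r2)) => t _; by rewrite addr0.
Qed.

Lemma dlt_AC (f f' : R -> R) : ucont 0 T f' -> AC 0 T f f' ->
  AC 0 T (dlt f) (fun t => (1 - e) * dlt f' t).
Proof.
move=> cf' Hf; have A1 := AC_affine lam0 cf' Hf r1; have A2 := AC_affine lam0 cf' Hf r2.
apply: AC_eq (AC_eqd _ (ACB A1 A2)) => t _; first by rewrite addr0.
by rewrite addr0 /dlt; ring.
Qed.

Lemma tavg_ucont (f : R -> R) : L1 0 T f -> ucont 0 T (tavg f).
Proof.
move=> Hf; apply: (ucont_eq (f := fun t => (e * T)^-1 * dlt (fun s => 0 + itg 0 s f) t)).
  by move=> t tT; rewrite tavg_primitive.
by apply/ucontZ/dlt_ucont; exact: AC_ucont (AC_primitive _ Hf).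
Qed.

Lemma tavg_AC (f : R -> R) : ucont 0 T f ->
  AC 0 T (tavg f) (fun t => (e * T)^-1 * ((1 - e) * dlt f t)).
Proof.
move=> cf; apply: (AC_eq (f := fun t => (e * T)^-1 * dlt (fun s => 0 + itg 0 s f) t)).
  by move=> t tT; rewrite tavg_primitive//; exact: ucont_L1.
by apply/ACZ/dlt_AC => //; exact: AC_primitive (ucont_L1 cf).
Qed.

Let sub (f : R -> R) (t : R) : 0 <= t <= T -> L1 0 T f -> L1 ((1 - e) * t) ((1 - e) * t + e * T) f.
Proof. by move=> /tavg_range[h1 h2 h3]; exact: L1_sub. Qed.

Let eT0 : 0 < e * T. Proof. by rewrite mulr_gt0. Qed.

Lemma tavgB (f g : R -> R) (t : R) : 0 <= t <= T -> L1 0 T f -> L1 0 T g ->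
  tavg (fun s => f s - g s) t = tavg f t - tavg g t.
Proof. by move=> tT Hf Hg; rewrite /tavg itgB ?mulrBr//; exact: sub. Qed.

Lemma tavgZ (k : R) (f : R -> R) (t : R) : 0 <= t <= T -> L1 0 T f ->
  tavg (fun s => k * f s) t = k * tavg f t.
Proof. by move=> tT Hf; rewrite /tavg itgZ 1?mulrCA//; exact: sub. Qed.

Lemma tavg_cst (k t : R) : tavg (fun=> k) t = k.
Proof.
rewrite /tavg itg_cst; last by rewrite lerDl ltW.
by rewrite addrC addKr mulrC mulfK// gt_eqF.
Qed.

Lemma tavg_le (f g : R -> R) (t : R) : 0 <= t <= T -> L1 0 T f -> L1 0 T g ->
  (forall s, 0 < s < T -> f s <= g s) -> tavg f t <= tavg g t.
Proof.
move=> tT Hf Hg fg; have [h1 h2 h3] := tavg_range tT.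
rewrite ler_pM2l ?invr_gt0//; apply: itg_le; [exact: sub|exact: sub|move=> s /andP[s1 s2]].
by apply: fg; rewrite (le_lt_trans h1 s1) (lt_le_trans s2 h3).
Qed.

Lemma tavg_abs (f : R -> R) (t : R) : 0 <= t <= T -> L1 0 T f ->
  `|tavg f t| <= tavg (fun s => `|f s|) t.
Proof.
move=> tT Hf; rewrite /tavg normrM gtr0_norm ?invr_gt0// ler_pM2l ?invr_gt0//.
by apply: itg_abs; exact: sub.
Qed.

Lemma tavg_sqr (f : R -> R) (t : R) : 0 <= t <= T -> L2 0 T f ->
  tavg f t ^+ 2 <= tavg (fun s => f s ^+ 2) t.
Proof.
move=> tT Hf; have [h1 h2 h3] := tavg_range tT.
have H := itg_sqr_le h2 (L2_sub h1 h3 Hf); rewrite /tavg exprMn.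
have Et : (1 - e) * t + e * T - (1 - e) * t = e * T by ring.
rewrite Et in H.
rewrite expr2 -mulrA ler_pM2l ?invr_gt0// mulrC ler_pdivrMr//.
by rewrite [leRHS]mulrC.
Qed.

(** With [F] a primitive of [f] and [G] one of [F], the integral of [dlt F] is [(1 - e)^-1] times a
    combination of four values of [G], at most [e T F(T)] since [F] is nondecreasing and
    nonnegative. The factor 2 bounds [(1 - e)^-1]. *)
Lemma itg_tavg_le (f : R -> R) : L1 0 T f -> (forall s, 0 < s < T -> 0 <= f s) ->
  itg 0 T (tavg f) <= 2 * itg 0 T f.
Proof.
move=> Hf f0; pose F s := 0 + itg 0 s f; have HF := AC_primitive 0 Hf; have cF := AC_ucont HF.
have L1s (s : R) : s <= T -> L1 0 s f by move=> sT; exact: L1_sub Hf.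
have HG := AC_primitive 0 (ucont_L1 cF); set G := (fun x => 0 + itg 0 x _) in HG.
have dG := dlt_AC cF HG.
have T00 : 0 <= T := ltW T0.
have DE := AC_diff dG (lexx 0) T00 (lexx T).
rewrite itgZ in DE; last exact: ucont_L1 (dlt_ucont cF).
have E : itg 0 T (tavg f) = (e * T)^-1 * itg 0 T (dlt (fun s => 0 + itg 0 s f)).
  rewrite -itgZ; last exact: ucont_L1 (dlt_ucont cF).
  by apply: itg_eq => s /andP[s1 s2]; rewrite tavg_primitive// !ltW.
rewrite E; set I := itg 0 T (dlt _) in DE *.
have F0 (s : R) : 0 <= s <= T -> 0 <= F s.
  move=> /andP[s0 sT]; rewrite /F add0r itg_ge0// => x /andP[x0 xs].
  by apply: f0; rewrite x0 (lt_le_trans xs).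
have FT (s : R) : 0 <= s <= T -> F s <= F T.
  move=> /andP[s0 sT]; rewrite /F !add0r; apply: itg_le_sub => //.
have e0' : 0 <= e := ltW e0.
have eTT : e * T <= T by rewrite ler_piMl//; case: hb.
have I1 : 0 <= G (e * T) - G 0.
  rewrite (AC_diff HG)// ?(ltW eT0)//; apply: itg_ge0 => s /andP[s0 s1].
  by apply: F0; rewrite ltW// (le_trans (ltW s1)).
have lT : 0 <= (1 - e) * T by rewrite mulr_ge0.
have I2 : G T - G ((1 - e) * T) <= F T * (e * T).
  have h4 : (1 - e) * T <= T by rewrite ler_piMl//; case: hb.
  rewrite (AC_diff HG)//; have -> : F T * (e * T) = itg ((1 - e) * T) T (fun=> F T).
    by rewrite itg_cst//; ring.
  apply: itg_le; [exact: L1_sub (ucont_L1 cF)|exact: L1_cst|move=> s /andP[s0 s1]].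
  by apply: FT; rewrite (le_trans lT)// ltW.
have I3 : (1 - e) * I <= F T * (e * T).
  rewrite -DE /dlt mulr0 add0r; have -> : (1 - e) * T + e * T = T by ring.
  by move: I1 I2; move: (G T) (G 0) (G _) (G _) (F T * _) => *; lra.
have I0 : 0 <= I.
  apply: itg_ge0 => s /andP[s0 s1]; have sT : 0 <= s <= T by rewrite !ltW.
  have [h1 h2 h3] := tavg_range sT; rewrite /dlt (AC_diff HF)//.
  apply: itg_ge0 => x /andP[x0 x1]; apply: f0.
  by rewrite (le_lt_trans h1 x0) (lt_le_trans x1 h3).
have I4 : I <= 2 * (F T * (e * T)).
  have : I <= 2 * ((1 - e) * I).
    by rewrite mulrA ler_peMl//; case: hb.
  by move/le_trans; apply; rewrite ler_pM2l.
rewrite mulrC ler_pdivrMr//; apply: (le_trans I4); rewrite /F add0r.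
by rewrite -[leRHS]mulrA.
Qed.

Lemma itg_abs_tavg_le (f : R -> R) : L1 0 T f ->
  itg 0 T (fun t => `|tavg f t|) <= 2 * itg 0 T (fun t => `|f t|).
Proof.
move=> Hf; rewrite (le_trans _ (itg_tavg_le (L1_abs Hf) _))//.
apply: itg_le.
- exact/L1_abs/ucont_L1/tavg_ucont.
- exact/ucont_L1/tavg_ucont/L1_abs.
by move=> t /andP[t0 tT]; rewrite tavg_abs// !ltW.
Qed.

Lemma nL2_tavg_le (f : R -> R) : L2 0 T f -> nL2 0 T (tavg f) <= 2 * nL2 0 T f.
Proof.
move=> Hf; apply: nL2_le; first by rewrite mulr_ge0// nL2_ge0.
have L1f := Hf.2; have L2t := ucont_L2 (tavg_ucont (L2_L1 Hf)).
have A : itg 0 T (fun x => tavg f x ^+ 2) <= itg 0 T (tavg (fun s => f s ^+ 2)).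
  apply: itg_le; [by case: L2t|exact/ucont_L1/tavg_ucont|move=> t /andP[t0 tT]].
  by apply: tavg_sqr; rewrite // !ltW.
have B : itg 0 T (tavg (fun s => f s ^+ 2)) <= 2 * itg 0 T (fun s => f s ^+ 2).
  by apply: itg_tavg_le => // s _; exact: sqr_ge0.
rewrite (le_trans A)// (le_trans B)// exprMn nL2_sqr ler_wpM2r ?itg_sqr_ge0//; lra.
Qed.

Lemma l2n_tavg (N : nat) (f : nat -> R -> R) (Phi : R -> R) (t : R) : 0 <= t <= T ->
  (forall j, (1 <= j <= N)%N -> L1 0 T (f j)) -> L1 0 T Phi ->
  (forall t, 0 < t < T -> l2n N (fun j => f j t) <= Phi t) ->
  l2n N (fun j => tavg (f j) t) <= tavg Phi t.
Proof.
move=> tT Lf LP H; have [h1 h2 h3] := tavg_range tT.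
rewrite /tavg l2nZ gtr0_norm ?invr_gt0// ler_pM2l ?invr_gt0//.
apply: l2n_itg => //; [by move=> j jN; apply: sub => //; exact: Lf|exact: sub|move=> s /andP[s1 s2]].
by apply: H; rewrite (le_lt_trans h1 s1) (lt_le_trans s2 h3).
Qed.

Lemma tavg_osc (f : R -> R) (k d t : R) : ucont 0 T f -> e * T < d -> 0 <= t <= T ->
  (forall s, 0 <= s <= T -> `|s - t| < d -> `|f s - f t| <= k) -> `|tavg f t - f t| <= k.
Proof.
move=> cf ed tT H; have [h1 h2 h3] := tavg_range tT; have Lf := ucont_L1 cf.
have {1}-> : f t = tavg (fun=> f t) t by rewrite tavg_cst.
rewrite -tavgB//; last exact: L1_cst.
rewrite /tavg normrM gtr0_norm ?invr_gt0// mulrC ler_pdivrMr//.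
have LL : L1 ((1 - e) * t) ((1 - e) * t + e * T) (fun s => f s - f t).
  by apply: sub => //; apply: L1B => //; exact: L1_cst.
have := itg_abs_le h2 LL; have -> : (1 - e) * t + e * T - (1 - e) * t = e * T by ring.
apply => s /andP[s1 s2]; apply: H.
  by rewrite (le_trans h1 (ltW s1)) (le_trans (ltW s2) h3).
have [t0 tT'] := andP tT; have et : e * t <= e * T by rewrite ler_wpM2l// ltW.
have et0 : 0 <= e * t by rewrite mulr_ge0// ltW.
move: s1 s2 et et0 ed; rewrite mulrBl mul1r; move: (e * t) (e * T) => x y *.
by rewrite ltr_norml; apply/andP; split; lra.
Qed.

End TimeAverage.

Section AverageLimits.
Context {R : realType}.

(** The shift by 2 ensures [2 eps <= 1] for every [n], as the averaging lemmas require. *)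
Definition eps (n : nat) : R := n.+2%:R^-1.

Lemma eps_gt0 n : 0 < eps n. Proof. by rewrite invr_gt0. Qed.

Lemma eps_half n : 2 * eps n <= 1.
Proof. by rewrite /eps ler_pdivrMr// mul1r ler_nat. Qed.

Lemma vanish_eps : vanish eps.
Proof.
apply: vanish_leq vanish_mesh _ => n; rewrite /eps /mesh lef_pV2 ?posrE ?ltr0n// ler_nat.
exact: leqW.
Qed.

Lemma eps_mul_lt (T d : R) : 0 < T -> 0 < d -> exists n0, forall n, (n0 <= n)%N -> eps n * T < d.
Proof.
move=> T0 d0; have h : 0 < d / (2 * T) by rewrite divr_gt0// mulr_gt0.
have [n0 H] := vanish_eps h; exists n0 => n /H.
rewrite -(ler_pM2r T0) => /le_lt_trans; apply.
have -> : d / (2 * T) * T = d / 2 by rewrite invfM mulrA divfK// gt_eqF.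
by rewrite ltr_pdivrMr// ltr_pMr//; lra.
Qed.

Variable T : R.
Hypothesis T0 : 0 < T.
Let T00 : 0 <= T := ltW T0.

(** One average for each of the two time derivatives that the nodal velocities lack. *)
Definition tavg2 (n : nat) (f : R -> R) : R -> R := tavg T (eps n) (tavg T (eps n) f).

Local Notation e0 := (eps_gt0 _).
Local Notation e1 := (eps_half _).

Lemma tavg2_ucont n (f : R -> R) : L1 0 T f -> ucont 0 T (tavg2 n f).
Proof. by move=> Hf; apply: (tavg_ucont T0 e0 e1); exact/ucont_L1/(tavg_ucont T0 e0 e1). Qed.

Let L1t n (f : R -> R) : L1 0 T f -> L1 0 T (tavg T (eps n) f).
Proof. by move=> Hf; exact/ucont_L1/(tavg_ucont T0 e0 e1). Qed.

Lemma tavg2_eq n (f g : R -> R) (t : R) : 0 <= t <= T -> (forall s, 0 <= s <= T -> f s = g s) ->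
  tavg2 n f t = tavg2 n g t.
Proof.
move=> tT fg; apply: (tavg_eq T0 e0 e1 tT) => s /andP[s0 sT].
apply: (tavg_eq T0 e0 e1) => [|x /andP[x0 xT]]; first by rewrite !ltW.
by apply: fg; rewrite !ltW.
Qed.

Lemma tavg2B n (f g : R -> R) (t : R) : 0 <= t <= T -> L1 0 T f -> L1 0 T g ->
  tavg2 n (fun s => f s - g s) t = tavg2 n f t - tavg2 n g t.
Proof.
move=> tT Hf Hg; rewrite /tavg2 -(tavgB T0 e0 e1 tT (L1t n Hf) (L1t n Hg)).
apply: (tavg_eq T0 e0 e1 tT) => s /andP[s0 sT]; by apply: (tavgB T0 e0 e1) => //; rewrite !ltW.
Qed.

Lemma tavg2_l2n n (N : nat) (f : nat -> R -> R) (k t : R) : 0 <= t <= T ->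
  (forall j, (1 <= j <= N)%N -> L1 0 T (f j)) ->
  (forall s, 0 < s < T -> l2n N (fun j => f j s) <= k) -> l2n N (fun j => tavg2 n (f j) t) <= k.
Proof.
have H (g : nat -> R -> R) (s : R) : 0 <= s <= T -> (forall j, (1 <= j <= N)%N -> L1 0 T (g j)) ->
    (forall s, 0 < s < T -> l2n N (fun j => g j s) <= k) -> l2n N (fun j => tavg T (eps n) (g j) s) <= k.
  move=> sT Hg gk; have := @l2n_tavg R T (eps n) T0 e0 e1 N g (fun=> k) s sT Hg (L1_cst _ _ _) gk.
  by rewrite (tavg_cst T0 e0).
move=> tT Hf fk; apply: (H) => //; first by move=> j jN; apply: L1t; exact: Hf.
by move=> s /andP[s0 sT]; apply: (H) => //; rewrite !ltW.
Qed.

Lemma tavg2_l2n_itg n (N : nat) (f : nat -> R -> R) (Phi : R -> R) :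
  (forall j, (1 <= j <= N)%N -> L1 0 T (f j)) -> L1 0 T Phi ->
  (forall s, 0 < s < T -> l2n N (fun j => f j s) <= Phi s) ->
  [/\ L1 0 T (tavg2 n Phi), itg 0 T (tavg2 n Phi) <= 4 * itg 0 T Phi &
   forall t, 0 < t < T -> l2n N (fun j => tavg2 n (f j) t) <= tavg2 n Phi t].
Proof.
move=> Hf HP H.
have P0 s : 0 < s < T -> 0 <= Phi s by move=> /H; apply: le_trans; exact: l2n_ge0.
have t0 s : 0 < s < T -> 0 <= tavg T (eps n) Phi s.
  move=> /andP[s0 sT]; rewrite -(tavg_cst T0 (e0 : 0 < eps n) 0 s).
  by apply: (tavg_le T0 e0 e1) => //; [rewrite !ltW|exact: L1_cst].
split; first exact/L1t/L1t.
  rewrite (le_trans (itg_tavg_le T0 e0 e1 (L1t n HP) t0))//.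
  have := itg_tavg_le T0 (e0 : 0 < eps n) e1 HP P0; lra.
move=> t /andP[t1 tT]; apply: (l2n_tavg T0 e0 e1).
- by rewrite !ltW.
- by move=> j jN; apply: L1t; exact: Hf.
- exact: L1t.
by move=> s /andP[s0 sT]; apply: (l2n_tavg T0 e0 e1) => //; rewrite !ltW.
Qed.

Lemma tavg2_unif (f : R -> R) : ucont 0 T f -> forall k : R, 0 < k ->
  exists n0, forall n, (n0 <= n)%N -> forall t, 0 <= t <= T -> `|tavg2 n f t - f t| <= k.
Proof.
move=> cf k k0; have k2 : 0 < k / 2 by rewrite divr_gt0.
have [d d0 H] := cf _ k2; have [n0 Hn] := eps_mul_lt T0 d0; exists n0 => n /Hn ed t tT.
have A (s : R) : 0 <= s <= T -> `|tavg T (eps n) f s - f s| <= k / 2.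
  by move=> sT; apply: (tavg_osc T0 e0 e1 cf ed sT) => x xT xs; exact/ltW/H.
have Lf := ucont_L1 cf; have L1tf := L1t n Lf.
have -> : tavg2 n f t - f t = tavg T (eps n) (fun s => tavg T (eps n) f s - f s) t +
    (tavg T (eps n) f t - f t).
  by rewrite (tavgB T0 e0 e1)//; rewrite /tavg2; ring.
rewrite (le_trans (ler_normD _ _))// (splitr k) lerD ?A//.
rewrite (le_trans (tavg_abs T0 e0 e1 tT (L1B L1tf Lf)))//.
rewrite -[leRHS](tavg_cst T0 (e0 : 0 < eps n) (k / 2) t).
apply: (tavg_le T0 e0 e1 tT); [exact/L1_abs/L1B|exact: L1_cst|move=> s /andP[s0 sT]].
by apply: A; rewrite !ltW.
Qed.

Lemma tavg2_cvg_L1 (f : R -> R) : L1 0 T f -> vanish (fun n => itg 0 T (fun t => `|tavg2 n f t - f t|)).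
Proof.
(* Each average at most doubles the norm, whence the constant [5 = 2 * 2 + 1]. *)
apply: (L1_vanish_of_dense (c := 5) (S := fun n f => itg 0 T (fun t => `|tavg2 n f t - f t|))) => //.
- move=> n g1 g2 H1 H2; have L n' g' : L1 0 T g' -> L1 0 T (tavg2 n' g') by move=> ?; exact/ucont_L1/tavg2_ucont.
  have H12 := L1B H1 H2.
  rewrite -itgD; [|by apply/L1_abs/L1B => //; exact: L|by apply/L1_abs/L1B => //; exact: L].
  apply: itg_le.
  - by apply/L1_abs/L1B => //; exact: L.
  - by apply: L1D; apply/L1_abs/L1B => //; exact: L.
  move=> t /andP[t0 tT]; rewrite tavg2B//; last by rewrite !ltW.
  rewrite (le_trans _ (ler_normD _ _))// le_eqVlt; apply/orP; left; apply/eqP; congr `|_|; ring.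
- move=> n g1 H1; have L2' := tavg2_ucont n H1.
  have Lt := L1t n H1; have B1 := itg_abs_tavg_le T0 (e0 : 0 < eps n) e1 H1.
  have B2 := itg_abs_tavg_le T0 (e0 : 0 < eps n) e1 Lt.
  have : itg 0 T (fun t => `|tavg2 n g1 t - g1 t|) <= itg 0 T (fun t => `|tavg2 n g1 t| + `|g1 t|).
    apply: itg_le; [by apply/L1_abs/L1B => //; exact: ucont_L1| |by move=> t _; exact: ler_normB].
    by apply: L1D; apply: L1_abs => //; exact: ucont_L1.
  rewrite itgD; [|exact/L1_abs/ucont_L1|exact: L1_abs]; rewrite /tavg2; lra.
- move=> g cg k k0; have [n0 H] := tavg2_unif cg (divr_gt0 k0 T0); exists n0 => n /H h.
  have L2' := tavg2_ucont n (ucont_L1 cg).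
  have -> : k = itg 0 T (fun=> k / T) by rewrite itg_cst// subr0 divfK// gt_eqF.
  apply: itg_le; [by apply/L1_abs/L1B; exact: ucont_L1|exact: L1_cst|move=> t /andP[t0 tT]].
  by apply: h; rewrite !ltW.
Qed.

Lemma tavg2_cvg_L2 (f : R -> R) : L2 0 T f -> vanish (fun n => nL2 0 T (fun t => tavg2 n f t - f t)).
Proof.
have L n' g' : L2 0 T g' -> L2 0 T (tavg2 n' g') by move=> ?; exact/ucont_L2/tavg2_ucont/L2_L1.
apply: (L2_vanish_of_dense (c := 5) (S := fun n f => nL2 0 T (fun t => tavg2 n f t - f t))) => //.
- move=> n g1 g2 H1 H2; have H12 := L2B H1 H2.
  rewrite (le_trans _ (nL2D (L2B (L n _ H12) H12) (L2B (L n _ H2) H2)))//.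
  rewrite le_eqVlt; apply/orP; left; apply/eqP/nL2_eq => t /andP[t0 tT].
  rewrite tavg2B//; [ring|by rewrite !ltW|exact: L2_L1|exact: L2_L1].
- move=> n g1 H1; have Lt : L2 0 T (tavg T (eps n) g1) by exact/ucont_L2/(tavg_ucont T0 e0 e1)/L2_L1.
  have B1 := nL2_tavg_le T0 (e0 : 0 < eps n) e1 H1.
  have B2 := nL2_tavg_le T0 (e0 : 0 < eps n) e1 Lt.
  rewrite (le_trans (nL2B (L n _ H1) H1))//.
  have -> : 5 * nL2 0 T g1 = 2 * (2 * nL2 0 T g1) + nL2 0 T g1 by ring.
  by rewrite lerD2r (le_trans B2)// ler_pM2l.
- move=> g cg k k0; have sT : 0 < Num.sqrt T by rewrite sqrtr_gt0.
  have [n0 H] := tavg2_unif cg (divr_gt0 k0 sT); exists n0 => n /H h.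
  have L2' := tavg2_ucont n (ucont_L1 cg).
  have := @nL2_sup R 0 T (fun t => tavg2 n g t - g t) (k / Num.sqrt T) T00.
  rewrite subr0 [_ * (k / _)]mulrC divfK ?gt_eqF//; apply.
  + by rewrite divr_ge0// ltW.
  + by apply: L2B; exact: ucont_L2.
  by move=> t /andP[t0 tT]; apply: h; rewrite !ltW.
Qed.

End AverageLimits.

(** * Averages on the grid *)

Section Grid.
Context {R : realType}.
Local Notation mu := (@lebesgue_measure R).
Implicit Types (f g u : R -> R).

Lemma itg_ae_eq (a b : R) f g : L1 a b f -> L1 a b g ->
  {ae mu, forall x : R, a < x < b -> f x = g x} -> itg a b f = itg a b g.
Proof.
move=> Hf Hg H; rewrite /itg /Rintegral; congr fine; apply: ae_eq_integral => //.
- exact: measurable_int Hf.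
- exact: measurable_int Hg.
by apply: ae_mono H => x /= Hx; rewrite in_itv/= => /Hx ->.
Qed.

Lemma itg_chain (c : nat -> R) f (n : nat) : (forall i, (i < n)%N -> c i <= c i.+1) ->
  L1 (c 0%N) (c n) f ->
  itg (c 0%N) (c n) f = \sum_(0 <= i < n) itg (c i) (c i.+1) f /\
  c 0%N <= c n.
Proof.
elim: n => [|n IH] mc Hf; first by rewrite big_geq// itg_nil.
have mc' i : (i < n)%N -> c i <= c i.+1 by move=> /leqW/mc.
have c0n : c 0%N <= c n.
  by clear -mc'; elim: n mc' => // n IH mc; rewrite (le_trans (IH _))// => [i /leqW/mc|]; [|exact: mc].
have Hf' : L1 (c 0%N) (c n) f by exact: L1_sub (lexx _) (mc _ (ltnSn n)) Hf.
have [E _] := IH mc' Hf'.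
rewrite big_nat_recr//= -E -(itg_split c0n (mc _ (ltnSn n)) Hf); split=> //.
exact: le_trans c0n (mc _ (ltnSn n)).
Qed.

Variable N : nat.
Local Notation h := (mesh N : R).

Definition node (j : nat) : R := j%:R * mesh N.

Lemma node0 : node 0 = 0. Proof. by rewrite /node mul0r. Qed.
Lemma nodeN : node N.+1 = 1. Proof. by rewrite /node mulrC mesh_mul. Qed.
Lemma nodeS j : node j.+1 = node j + h.
Proof. by rewrite /node -[j.+1]addn1 natrD mulrDl mul1r. Qed.
Lemma nodeP j : (0 < j)%N -> node j.-1 = node j - h.
Proof. by case: j => // j _; rewrite nodeS addrK. Qed.
Lemma node_leS j : node j <= node j.+1.
Proof. by rewrite nodeS lerDl ltW// mesh_gt0. Qed.
Lemma node_ge0 j : 0 <= node j. Proof. by rewrite /node mulr_ge0// ltW// mesh_gt0. Qed.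
Lemma node_le1 j : (j <= N.+1)%N -> node j <= 1.
Proof. by move=> jN; rewrite -nodeN /node ler_pM2r ?mesh_gt0// ler_nat. Qed.
Lemma node_in j : (j <= N.+1)%N -> 0 <= node j <= 1.
Proof. by move=> jN; rewrite node_ge0 node_le1. Qed.

Let h0 : 0 < h. Proof. exact: mesh_gt0. Qed.

(* The mean of [f] against the hat function at node [j], the weight for which
   [havg_lap] is exact. *)
Definition havg f (j : nat) : R := (h ^+ 2)^-1 *
  (itg (node j.-1) (node j) (fun x => (x - node j.-1) * f x) +
   itg (node j) (node j.+1) (fun x => (node j.+1 - x) * f x)).

Section Piece.
Variable j : nat.
Hypothesis jN : (1 <= j <= N)%N.

Let j0 : (0 < j)%N. Proof. by case/andP: jN. Qed.
Let n1 : node j.-1 <= node j. Proof. by rewrite nodeP// gerBl ltW. Qed.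
Let n2 : node j <= node j.+1. Proof. exact: node_leS. Qed.
Let m1 : node j <= 1. Proof. by apply: node_le1; case/andP: jN => _ /leqW. Qed.
Let m2 : node j.+1 <= 1. Proof. by apply: node_le1; case/andP: jN. Qed.

Let sub1 f : L1 0 1 f -> L1 (node j.-1) (node j) f.
Proof. by apply: L1_sub => //; exact: node_ge0. Qed.
Let sub2 f : L1 0 1 f -> L1 (node j) (node j.+1) f.
Proof. by apply: L1_sub => //; exact: node_ge0. Qed.

Let cw1 (a b : R) : ucont a b (fun x => x - node j.-1).
Proof. by apply: ucontD; [exact: AC_ucont (AC_id a b)|exact: ucont_cst]. Qed.
Let cw2 (a b : R) : ucont a b (fun x => node j.+1 - x).
Proof. by apply: ucontB; [exact: ucont_cst|exact: AC_ucont (AC_id a b)]. Qed.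

Let I1 f : L1 0 1 f -> L1 (node j.-1) (node j) (fun x => (x - node j.-1) * f x).
Proof. by move=> Hf; apply: L1M_ucont => //; exact: sub1. Qed.
Let I2 f : L1 0 1 f -> L1 (node j) (node j.+1) (fun x => (node j.+1 - x) * f x).
Proof. by move=> Hf; apply: L1M_ucont => //; exact: sub2. Qed.

Lemma havgD f g : L1 0 1 f -> L1 0 1 g -> havg (fun x => f x + g x) j = havg f j + havg g j.
Proof.
move=> Hf Hg; rewrite /havg -mulrDr addrACA; congr (_ * (_ + _)).
  by rewrite -itgD; [|exact: I1|exact: I1]; apply: itg_eq => x _; ring.
by rewrite -itgD; [|exact: I2|exact: I2]; apply: itg_eq => x _; ring.
Qed.

Lemma havgZ (k : R) f : L1 0 1 f -> havg (fun x => k * f x) j = k * havg f j.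
Proof.
move=> Hf; rewrite /havg [RHS]mulrCA [in RHS]mulrDr; congr (_ * (_ + _)).
  by rewrite -itgZ; [|exact: I1]; apply: itg_eq => x _; ring.
by rewrite -itgZ; [|exact: I2]; apply: itg_eq => x _; ring.
Qed.

Lemma havgB f g : L1 0 1 f -> L1 0 1 g -> havg (fun x => f x - g x) j = havg f j - havg g j.
Proof.
move=> Hf Hg; rewrite -mulN1r -havgZ// -havgD//; last exact: L1Z.
by congr (_ * (_ + _)); apply: itg_eq => x _; rewrite mulN1r.
Qed.

(** Integrate by parts on the two cells around the node: the boundary terms at the node cancel
    because both halves of the hat have the same height there, and the difference of the two
    increments remains. *)
Lemma havg_lap u u' u'' : AC 0 1 u u' -> AC 0 1 u' u'' ->
  laplacian_h N (fun l => u (node l)) j = havg u'' j.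
Proof.
move=> Hu Hu'; have ge0 := node_ge0.
have A1 := AC_sub (ge0 _) m1 Hu; have A1' := AC_sub (ge0 _) m1 Hu'.
have A2 := AC_sub (ge0 _) m2 Hu; have A2' := AC_sub (ge0 _) m2 Hu'.
have W1 : AC (node j.-1) (node j) (fun x => x - node j.-1) (fun=> 1 - 0).
  by apply: ACB; [exact: AC_id|exact: AC_cst].
have W2 : AC (node j) (node j.+1) (fun x => node j.+1 - x) (fun=> 0 - 1).
  by apply: ACB; [exact: AC_cst|exact: AC_id].
have B1 := itg_by_parts n1 W1 (A1' _); have B2 := itg_by_parts n2 W2 (A2' _).
have C1 : itg (node j.-1) (node j) (fun x => (x - node j.-1) * u'' x) =
    (node j - node j.-1) * u' (node j) - itg (node j.-1) (node j) (fun x => (1 - 0) * u' x).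
  by rewrite B1; ring.
have C2 : itg (node j) (node j.+1) (fun x => (node j.+1 - x) * u'' x) =
    - (node j.+1 - node j) * u' (node j) - itg (node j) (node j.+1) (fun x => (0 - 1) * u' x).
  by rewrite B2; ring.
rewrite /havg C1 C2 /laplacian_h mulrC.
have -> : itg (node j.-1) (node j) (fun x => (1 - 0) * u' x) = u (node j) - u (node j.-1).
  rewrite (AC_diff (A1 _) (lexx _) n1 (lexx _)); apply: itg_eq => x _; by rewrite subr0 mul1r.
have -> : itg (node j) (node j.+1) (fun x => (0 - 1) * u' x) = - (u (node j.+1) - u (node j)).
  rewrite (AC_diff (A2 _) (lexx _) n2 (lexx _)) -itgN; last exact: L1_sub (ge0 _) m2 (proj1 Hu).
  by apply: itg_eq => x _; rewrite sub0r mulN1r.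
by rewrite nodeS nodeP//; congr (_ * _); ring.
Qed.

Lemma havg_abs_le f (k : R) : L1 0 1 f ->
  (forall x, node j.-1 < x < node j.+1 -> `|f x| <= k) -> `|havg f j| <= k.
Proof.
move=> Hf fk.
have W1 : itg (node j.-1) (node j) (fun x => x - node j.-1) = h ^+ 2 / 2.
  have A : AC (node j.-1) (node j) (fun x => (x - node j.-1) * (x - node j.-1))
     (fun x => (1 - 0) * (x - node j.-1) + (x - node j.-1) * (1 - 0)).
    by apply: ACM; apply: ACB; (exact: AC_id || exact: AC_cst).
  have := AC_diff A (lexx _) n1 (lexx _).
  have -> : itg (node j.-1) (node j) (fun x => (1 - 0) * (x - node j.-1) + (x - node j.-1) * (1 - 0)) =
    2 * itg (node j.-1) (node j) (fun x => x - node j.-1).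
    rewrite -itgZ; last exact: ucont_L1; apply: itg_eq => x _; ring.
  rewrite subrr mul0r subr0 nodeP// opprB addrC subrK; lra.
have W2 : itg (node j) (node j.+1) (fun x => node j.+1 - x) = h ^+ 2 / 2.
  have A : AC (node j) (node j.+1) (fun x => (node j.+1 - x) * (node j.+1 - x))
     (fun x => (0 - 1) * (node j.+1 - x) + (node j.+1 - x) * (0 - 1)).
    by apply: ACM; apply: ACB; (exact: AC_id || exact: AC_cst).
  have := AC_diff A (lexx _) n2 (lexx _).
  have -> : itg (node j) (node j.+1) (fun x => (0 - 1) * (node j.+1 - x) + (node j.+1 - x) * (0 - 1)) =
    - 2 * itg (node j) (node j.+1) (fun x => node j.+1 - x).
    rewrite -itgZ; last exact: ucont_L1; apply: itg_eq => x _; ring.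
  rewrite subrr mul0r sub0r nodeS addrC addKr; lra.
have B1 : `|itg (node j.-1) (node j) (fun x => (x - node j.-1) * f x)| <= k * (h ^+ 2 / 2).
  rewrite -W1 -itgZ; last exact: ucont_L1.
  rewrite (le_trans (itg_abs (I1 Hf)))//; apply: itg_le; [exact/L1_abs/I1|exact/L1Z/ucont_L1|].
  move=> x /andP[x1 x2]; have p0 : 0 <= x - node j.-1 by rewrite subr_ge0 ltW.
  rewrite normrM ger0_norm// mulrC ler_wpM2r// fk// x1; exact: lt_le_trans x2 n2.
have B2 : `|itg (node j) (node j.+1) (fun x => (node j.+1 - x) * f x)| <= k * (h ^+ 2 / 2).
  rewrite -W2 -itgZ; last exact: ucont_L1.
  rewrite (le_trans (itg_abs (I2 Hf)))//; apply: itg_le; [exact/L1_abs/I2|exact/L1Z/ucont_L1|].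
  move=> x /andP[x1 x2]; have p0 : 0 <= node j.+1 - x by rewrite subr_ge0 ltW.
  rewrite normrM ger0_norm// mulrC ler_wpM2r// fk// x2 andbT; exact: le_lt_trans n1 x1.
rewrite /havg normrM gtr0_norm ?invr_gt0 ?exprn_gt0// mulrC ler_pdivrMr ?exprn_gt0//.
rewrite (le_trans (ler_normD _ _))// (le_trans (lerD B1 B2))//.
by rewrite -mulrDr -splitr.
Qed.

Lemma havg_cst (k : R) : havg (fun=> k) j = k.
Proof.
(* Normalisation is read off from [havg_lap] for the square function, whose second difference is
   exactly 2. *)
have A : AC 0 1 (fun x : R => x * x) (fun x => 1 * x + x * 1) by apply: ACM; exact: AC_id.
have A' : AC 0 1 (fun x : R => 1 * x + x * 1) (fun=> 1 + 1).
  apply: (AC_eq (f := fun x => x + x)); first by move=> x _; rewrite mul1r mulr1.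
  by apply: ACD; exact: AC_id.
have E := havg_lap A A'.
have -> : havg (fun=> k) j = k / 2 * havg (fun=> 1 + 1) j.
  rewrite -havgZ; last exact: L1_cst.
  by congr (_ * (_ + _)); apply: itg_eq => x _; congr (_ * _); field.
rewrite -E /laplacian_h nodeS nodeP//; field; exact: lt0r_neq0.
Qed.

Lemma havg_osc f (c k : R) : L1 0 1 f ->
  (forall x, node j.-1 < x < node j.+1 -> `|f x - c| <= k) -> `|havg f j - c| <= k.
Proof.
move=> Hf fk; rewrite -{1}(havg_cst c) -havgB//; last exact: L1_cst.
by apply: havg_abs_le => //; apply: L1B => //; exact: L1_cst.
Qed.

Lemma havg_ae f g : L1 0 1 f -> L1 0 1 g ->
  {ae mu, forall x : R, 0 < x < 1 -> f x = g x} -> havg f j = havg g j.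
Proof.
move=> Hf Hg fg; congr (_ * (_ + _)); apply: itg_ae_eq; [exact: I1|exact: I1| |exact: I2|exact: I2| ].
  apply: ae_mono fg => x H /andP[x1 x2]; rewrite H// (le_lt_trans _ x1) ?node_ge0//.
  exact: lt_le_trans x2 m1.
apply: ae_mono fg => x H /andP[x1 x2]; rewrite H// (le_lt_trans _ x1) ?node_ge0//.
exact: lt_le_trans x2 m2.
Qed.

Lemma havg_sqr f : L2 0 1 f -> h * havg f j ^+ 2 <=
  2 * (itg (node j.-1) (node j) (fun x => f x ^+ 2) + itg (node j) (node j.+1) (fun x => f x ^+ 2)).
Proof.
move=> Hf; have ge0 := node_ge0.
have Hf1 := L2_sub (ge0 _) m1 Hf; have Hf2 := L2_sub (ge0 _) m2 Hf.
have S1 := itg_CS (ucont_L2 (cw1 _ _)) (Hf1 j.-1).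
have S2 := itg_CS (ucont_L2 (cw2 _ _)) (Hf2 j).
set A := itg (node j.-1) (node j) (fun x => f x ^+ 2) in S1 *.
set B := itg (node j) (node j.+1) (fun x => f x ^+ 2) in S2 *.
have A0 : 0 <= A by apply: itg_sqr_ge0.
have B0 : 0 <= B by apply: itg_sqr_ge0.
have Q1 : itg (node j.-1) (node j) (fun x => (x - node j.-1) ^+ 2) <= h ^+ 3.
  have -> : h ^+ 3 = itg (node j.-1) (node j) (fun=> h ^+ 2) by rewrite itg_cst// nodeP//; ring.
  apply: itg_le; [by have [] := ucont_L2 (cw1 (node j.-1) (node j))|exact: L1_cst|].
  move=> x /andP[x1 x2]; rewrite nodeP// in x1 *; rewrite lerXn2r ?nnegrE ?(ltW h0)//; lra.
have Q2 : itg (node j) (node j.+1) (fun x => (node j.+1 - x) ^+ 2) <= h ^+ 3.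
  have -> : h ^+ 3 = itg (node j) (node j.+1) (fun=> h ^+ 2) by rewrite itg_cst// nodeS; ring.
  apply: itg_le; [by have [] := ucont_L2 (cw2 (node j) (node j.+1))|exact: L1_cst|].
  move=> x /andP[x1 x2]; rewrite nodeS in x2 *; rewrite lerXn2r ?nnegrE ?(ltW h0)//; lra.
have {S1}S1 := le_trans S1 (ler_wpM2r A0 Q1).
have {S2}S2 := le_trans S2 (ler_wpM2r B0 Q2).
rewrite /havg; move: (itg _ _ _) (itg _ _ _) S1 S2 => b a S1 S2.
have -> : h * ((h ^+ 2)^-1 * (a + b)) ^+ 2 = (a + b) ^+ 2 / h ^+ 3.
  by field; exact: lt0r_neq0.
rewrite ler_pdivrMr ?exprn_gt0//.
have Q : (a + b) ^+ 2 <= 2 * (a ^+ 2 + b ^+ 2).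
  have := sqr_ge0 (a - b); rewrite sqrrB sqrrD; lra.
rewrite (le_trans Q)// -mulrA ler_pM2l// mulrDl [A * _]mulrC [B * _]mulrC.
exact: lerD.
Qed.

End Piece.

Lemma itg_cells f : L1 0 1 f -> itg 0 1 f = \sum_(0 <= j < N.+1) itg (node j) (node j.+1) f.
Proof.
move=> Hf; have := @itg_chain node f N.+1 (fun j _ => node_leS j).
by rewrite node0 nodeN => /(_ Hf)[].
Qed.

Lemma l2n_havg_le f : L2 0 1 f -> l2n N (havg f) <= 2 * nL2 0 1 f.
Proof.
move=> Hf; apply: l2n_le; first by rewrite mulr_ge0// nL2_ge0.
have L1f := Hf.2; pose J j := itg (node j) (node j.+1) (fun x => f x ^+ 2).
have J0 j : 0 <= J j by exact: itg_sqr_ge0.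
have E : nL2 0 1 f ^+ 2 = \sum_(0 <= j < N.+1) J j by rewrite nL2_sqr itg_cells.
rewrite exprMn E mulr_sumr.
have : \sum_(1 <= j < N.+1) h * havg f j ^+ 2 <= \sum_(1 <= j < N.+1) 2 * (J j.-1 + J j).
  apply: ler_sum_nat => j jN; have := havg_sqr jN Hf.
  by have /andP[j0 _] := jN; rewrite /J prednK.
move/le_trans; apply; rewrite -mulr_sumr big_split/= mulrDr.
have P1 : \sum_(1 <= j < N.+1) J j.-1 <= \sum_(0 <= j < N.+1) J j.
  by rewrite big_add1/= [leRHS]big_nat_recr//= lerDl.
have P2 : \sum_(1 <= j < N.+1) J j <= \sum_(0 <= j < N.+1) J j.
  by rewrite [leRHS]big_nat_recl//= big_add1/= lerDr.
have -> : 2 ^+ 2 * (\sum_(0 <= j < N.+1) J j) = 2 * (\sum_(0 <= j < N.+1) J j) + 2 * (\sum_(0 <= j < N.+1) J j) :> R by ring.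
by rewrite lerD// ler_pM2l.
Qed.

Lemma grad_nodes_le u u' : AC 0 1 u u' -> L2 0 1 u' ->
  Num.sqrt (h * \sum_(0 <= j < N.+1) ((u (node j.+1) - u (node j)) / h) ^+ 2) <= nL2 0 1 u'.
Proof.
move=> Hu Lu; rewrite ler_wsqrtr// itg_cells; last by case: Lu.
rewrite mulr_sumr; apply: ler_sum_nat => j /= jN.
have jN1 : (j.+1 <= N.+1)%N by [].
rewrite (AC_diff Hu (node_ge0 _) (node_leS j) (node_le1 jN1)).
have := itg_sqr_le (node_leS j) (L2_sub (node_ge0 _) (node_le1 jN1) Lu).
have hE : node j.+1 - node j = h by rewrite nodeS addrC addKr.
rewrite hE => H.
rewrite expr_div_n; set I := itg _ _ _; have -> : h * (I ^+ 2 / h ^+ 2) = I ^+ 2 / h.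
  by field; exact: lt0r_neq0.
by rewrite ler_pdivrMr// mulrC.
Qed.

End Grid.

Section ExtConst.
Context {R : realType}.
Local Notation mu := (@lebesgue_measure R).
Variable N : nat.
Local Notation h := (mesh N : R).
Let h0 : 0 < h. Proof. exact: mesh_gt0. Qed.

(** Left end of the dual cell of node [j]. The dual cells of the interior nodes leave a half cell at
    each end of [[0, 1]], where [ext_const] is 0. *)
Definition cell (j : nat) : R := (j%:R - 2^-1) * h.

Lemma cell_node j : cell j = node N j - h / 2.
Proof. by rewrite /cell /node mulrBl [2^-1 * _]mulrC. Qed.
Lemma cellS j : cell j.+1 = node N j + h / 2.
Proof. by rewrite cell_node nodeS; lra. Qed.
Lemma cellSS j : cell j.+1 = cell j + h.
Proof. by rewrite !cell_node nodeS; lra. Qed.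
Lemma cell_leS j : cell j <= cell j.+1.
Proof. by rewrite cellSS lerDl ltW. Qed.
Lemma cell_mono i j : (i <= j)%N -> cell i <= cell j.
Proof. by move=> ij; rewrite /cell ler_pM2r// lerD2r ler_nat. Qed.
Lemma cell1_ge0 : 0 <= cell 1. Proof. by rewrite cellS node0 add0r divr_ge0// ltW. Qed.
Lemma cellN_le1 : cell N.+1 <= 1.
Proof. by rewrite cell_node nodeN gerBl divr_ge0// ltW. Qed.

Lemma ext_const_cell (a : nat -> R) j x : (1 <= j <= N)%N -> cell j <= x < cell j.+1 ->
  ext_const N a x = a j.
Proof.
move=> jN /andP[x1 x2]; rewrite /ext_const (bigD1_seq j)/= ?mem_index_iota ?iota_uniq//.
have E i : (i%:R + 2^-1) * h = cell i.+1 by rewrite cellS /node; lra.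
rewrite big1 => [|i ij]; rewrite E -/(cell _) indicE.
  by rewrite mem_set ?mulr1 ?addr0//= in_itv/= x1.
rewrite memNset ?mulr0//= in_itv/= => /andP[y1 y2].
case: (ltngtP i j) ij => // ij _.
  by have := le_lt_trans (cell_mono ij) (le_lt_trans x1 y2); rewrite ltxx.
by have := le_lt_trans (cell_mono ij) (le_lt_trans y1 x2); rewrite ltxx.
Qed.

Lemma ext_const_out (a : nat -> R) x : x < cell 1 \/ cell N.+1 <= x -> ext_const N a x = 0.
Proof.
move=> H; rewrite /ext_const big_nat big1// => j /andP[j0 jN].
have E i : (i%:R + 2^-1) * h = cell i.+1 by rewrite cellS /node; lra.
rewrite E -/(cell _) indicE memNset ?mulr0//= in_itv/= => /andP[y1 y2]; case: H => H.
  by have := le_lt_trans (le_trans (cell_mono j0) y1) H; rewrite ltxx.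
by have := le_lt_trans H (lt_le_trans y2 (cell_mono jN)); rewrite ltxx.
Qed.

Lemma ext_const_linear (a b : nat -> R) (k : R) x :
  ext_const N (fun j => a j + k * b j) x = ext_const N a x + k * ext_const N b x.
Proof.
rewrite /ext_const mulr_sumr -big_split/=; apply: eq_bigr => j _; by rewrite mulrDl mulrA.
Qed.

Lemma ext_constB (a b : nat -> R) x :
  ext_const N (fun j => a j - b j) x = ext_const N a x - ext_const N b x.
Proof.
have := ext_const_linear a b (-1) x; rewrite mulN1r => <-.
by apply: eq_bigr => j _; rewrite mulN1r.
Qed.

Lemma ext_const_meas (a : nat -> R) : measurable_fun setT (ext_const N a).
Proof.
rewrite (_ : ext_const N a = fun x => \sum_(1 <= j < N.+1) a j * \1_(`[cell j, (j%:R + 2^-1) * h[%classic) x)//.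
apply: measurable_sum => j; apply: measurable_funM; first exact: measurable_cst.
exact: measurable_indic.
Qed.

Lemma ext_const_L2 (a : nat -> R) (c d : R) : L2 c d (ext_const N a).
Proof.
apply: (@L2_bounded _ _ _ _ (\sum_(1 <= j < N.+1) `|a j|)).
  by apply: measurable_funS (ext_const_meas a).
move=> x _; rewrite (le_trans (ler_norm_sum _ _ _))//; apply: ler_sum => j _.
rewrite normrM ler_piMr// indicE; case: (_ \in _); rewrite ?normr1 ?normr0//.
Qed.

Lemma itg_ext_cells (F : R -> R) : L1 0 1 F ->
  itg 0 1 F = itg 0 (cell 1) F + \sum_(1 <= j < N.+1) itg (cell j) (cell j.+1) F + itg (cell N.+1) 1 F.
Proof.
move=> HF; have c1N : cell 1 <= cell N.+1 by exact: cell_mono.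
rewrite (itg_split cell1_ge0 (le_trans c1N cellN_le1) HF).
have HF1 : L1 (cell 1) 1 F by exact: L1_sub cell1_ge0 (lexx _) HF.
rewrite (itg_split c1N cellN_le1 HF1) addrA; congr (_ + _ + _).
have HF2 : L1 (cell 1) (cell N.+1) F by exact: L1_sub cell1_ge0 cellN_le1 HF.
have [-> _] := @itg_chain R (fun i => cell i.+1) F N (fun j _ => cell_leS j.+1) HF2.
by rewrite big_add1.
Qed.

Lemma itg_ext_const (a : nat -> R) (F : R -> R -> R) : (forall x, F 0 x = 0) ->
  L1 0 1 (fun x => F (ext_const N a x) x) ->
  itg 0 1 (fun x => F (ext_const N a x) x) = \sum_(1 <= j < N.+1) itg (cell j) (cell j.+1) (F (a j)).
Proof.
move=> F0 HF; rewrite itg_ext_cells//.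
rewrite [X in X + _ + _](_ : _ = 0) ?[X in _ + _ + X](_ : _ = 0) ?add0r ?addr0.
- apply: eq_big_nat => j jN; apply: itg_eq => x /andP[x1 x2].
  by rewrite (ext_const_cell _ jN)// ltW.
- apply: (etrans _ (itg0 (cell N.+1) 1)); apply: itg_eq => x /andP[x1 _].
  by rewrite ext_const_out//; right; exact: ltW.
- apply: (etrans _ (itg0 0 (cell 1))); apply: itg_eq => x /andP[_ x1].
  by rewrite ext_const_out//; left.
Qed.

Lemma nL2_ext_const (a : nat -> R) : nL2 0 1 (ext_const N a) = l2n N a.
Proof.
congr Num.sqrt; have [_ H] := ext_const_L2 a 0 1.
rewrite (itg_ext_const (F := fun y _ => y ^+ 2))//; last by move=> _; rewrite expr0n.
rewrite mulr_sumr; apply: eq_big_nat => j jN.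
by rewrite itg_cst ?cell_leS// cellSS addrC addKr mulrC.
Qed.

End ExtConst.

Section GridLimits.
Context {R : realType}.
Implicit Types (f g : R -> R).

Lemma vanish_sqrt_mesh : vanish (fun N => Num.sqrt (mesh N) : R).
Proof.
move=> e e0; have [n0 H] := vanish_mesh (exprn_gt0 2 e0); exists n0 => n /H h.
by rewrite -[leRHS](ger0_norm (ltW e0)) -sqrtr_sqr ler_wsqrtr.
Qed.

Lemma mesh_lt (d : R) : 0 < d -> exists n0, forall N, (n0 <= N)%N -> mesh N < d.
Proof.
move=> d0; have d2 : 0 < d / 2 by rewrite divr_gt0.
have [n0 H] := vanish_mesh d2; exists n0 => n /H /le_lt_trans; apply.
by rewrite ltr_pdivrMr// ltr_pMr//; lra.
Qed.

(** Density argument, the constant 3 being 2 for the hat averages plus 1 for [f]. It is the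
    convergence of the discrete potentials, and it also compares step extensions with hat averages
    of the data. *)
Lemma ext_const_havg_cvg f : L2 0 1 f ->
  vanish (fun N => nL2 0 1 (fun x => ext_const N (havg N f) x - f x)).
Proof.
apply: (L2_vanish_of_dense (c := 3) (S := fun N f => nL2 0 1 (fun x => ext_const N (havg N f) x - f x))) => //.
- move=> N g1 g2 H1 H2; have H12 := L2B H1 H2.
  have E x : ext_const N (havg N (fun x => g1 x - g2 x)) x = ext_const N (havg N g1) x - ext_const N (havg N g2) x.
    rewrite -ext_constB; apply: eq_big_nat => j jN; rewrite havgB//; exact: L2_L1.
  rewrite (le_trans _ (nL2D (L2B (ext_const_L2 _ _ _ _) H12) (L2B (ext_const_L2 _ _ _ _) H2)))//.
  rewrite le_eqVlt; apply/orP; left; apply/eqP/nL2_eq => x _; rewrite E; ring.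
- move=> N g1 H1; rewrite (le_trans (nL2B (ext_const_L2 _ _ _ _) H1))// nL2_ext_const.
  have := @l2n_havg_le R N g1 H1; lra.
- move=> g cg k k0; have [M M0 gM] := ucont_bounded cg.
  have k2 : 0 < k / 2 by rewrite divr_gt0.
  have [d d0 Hd] := cg _ k2; have d2 : 0 < d / 2 by rewrite divr_gt0.
  have [n1 Hn1] := mesh_lt d2.
  (* On the two end half cells the extension is 0 and [g] is merely bounded by [M]; this mesh size
     makes their total contribution [M^2 h] at most [(k / 2)^2]. *)
  have kM : 0 < (k / (2 * M)) ^+ 2 by rewrite exprn_gt0// divr_gt0// mulr_gt0.
  have [n2 Hn2] := mesh_lt kM.
  exists (maxn n1 n2) => N; rewrite geq_max => /andP[/Hn1 h1 /Hn2 h2].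
  have Lg := ucont_L2 cg.
  have [_ L1d] := L2B (ext_const_L2 N (havg N g) 0 1) Lg.
  apply: nL2_le; first exact: ltW.
  rewrite (itg_ext_cells N L1d).
  have c1 := @cell1_ge0 R N; have c2 := @cellN_le1 R N; have h0 := @mesh_gt0 R N.
  have cm := @cell_mono R N.
  have Lsub (c e : R) : 0 <= c -> e <= 1 -> L1 c e (fun x => (ext_const N (havg N g) x - g x) ^+ 2).
    by move=> c0 e1; exact: L1_sub c0 e1 L1d.
  have gM2 x : 0 <= x <= 1 -> g x ^+ 2 <= M ^+ 2.
    by move=> /gM; rewrite -real_normK ?num_real// => ?; rewrite lerXn2r ?nnegrE ?(ltW M0).
  have A1 : itg 0 (cell N 1) (fun x => (ext_const N (havg N g) x - g x) ^+ 2) <= M ^+ 2 * (mesh N / 2).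
    have -> : M ^+ 2 * (mesh N / 2) = itg 0 (cell N 1) (fun=> M ^+ 2).
      by rewrite itg_cst// cellS node0 add0r subr0.
    apply: itg_le; [by apply: Lsub => //; exact: le_trans (cm 1%N N.+1 isT) c2|exact: L1_cst|].
    move=> x /andP[x1 x2]; rewrite ext_const_out ?sub0r ?sqrrN ?gM2//; last by left.
    by rewrite ltW// (le_trans (ltW x2))// (le_trans (cm 1%N N.+1 isT) c2).
  have A3 : itg (cell N N.+1) 1 (fun x => (ext_const N (havg N g) x - g x) ^+ 2) <= M ^+ 2 * (mesh N / 2).
    have -> : M ^+ 2 * (mesh N / 2) = itg (cell N N.+1) 1 (fun=> M ^+ 2).
      by rewrite itg_cst// cell_node nodeN opprB addrC subrK.
    have cN0 : (0 : R) <= cell N N.+1 by exact: le_trans c1 (cm 1%N N.+1 isT).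
    apply: itg_le; [exact: Lsub|exact: L1_cst|].
    move=> x /andP[x1 x2]; rewrite ext_const_out ?sub0r ?sqrrN ?gM2//; last by right; exact: ltW.
    by rewrite (le_trans cN0 (ltW x1)) ltW.
  have A2 : \sum_(1 <= j < N.+1) itg (cell N j) (cell N j.+1) (fun x => (ext_const N (havg N g) x - g x) ^+ 2) <=
      (k / 2) ^+ 2.
    have : \sum_(1 <= j < N.+1) itg (cell N j) (cell N j.+1) (fun x => (ext_const N (havg N g) x - g x) ^+ 2) <=
       \sum_(1 <= j < N.+1) (k / 2) ^+ 2 * mesh N.
      apply: ler_sum_nat => j jN; have jN' : (1 <= j <= N)%N by [].
      have -> : (k / 2) ^+ 2 * mesh N = itg (cell N j) (cell N j.+1) (fun=> (k / 2) ^+ 2).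
        by rewrite itg_cst ?cell_leS// cellSS [_ - _]addrC addKr.
      have /andP[j1 jN1] := jN'.
      have cj0 : (0 : R) <= cell N j by exact: le_trans c1 (cm _ _ j1).
      have cj1 : cell N j.+1 <= (1 : R) by exact: le_trans (cm _ _ (jN1 : (j < N.+1)%N)) c2.
      apply: itg_le; [exact: Lsub|exact: L1_cst|move=> x /andP[x1 x2]].
      rewrite (ext_const_cell _ jN'); last by rewrite ltW.
      rewrite -real_normK ?num_real// lerXn2r ?nnegrE ?(ltW k2)//.
      apply: havg_osc => //; first exact: ucont_L1.
      have n0 := @node_ge0 R N j.-1; have n1' := @node_le1 R N j.+1 jN1.
      move=> y /andP[y1 y2]; apply/ltW/Hd.
      + by rewrite (le_trans n0 (ltW y1)) (le_trans (ltW y2) n1').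
      + by rewrite (le_trans cj0 (ltW x1)) (le_trans (ltW x2) cj1).
      rewrite cell_node in x1; rewrite cellS in x2; rewrite nodeP// in y1; rewrite nodeS in y2.
      clear -x1 x2 y1 y2 h1 h0.
      by rewrite ltr_norml; apply/andP; split; lra.
    move/le_trans; apply; rewrite sumr_const_nat subSS subn0 -[_ *+ N]mulr_natr -mulrA ler_piMr ?sqr_ge0//.
    by rewrite -[leRHS](@mesh_mul R N) ler_pM2l// ler_nat.
  have A4 : M ^+ 2 * mesh N <= (k / 2) ^+ 2.
    rewrite (le_trans (ler_wpM2l (sqr_ge0 M) (ltW h2)))//.
    by rewrite -exprMn le_eqVlt; apply/orP; left; apply/eqP; congr (_ ^+ 2); field; exact: lt0r_neq0.
  have A5 : (k / 2) ^+ 2 + (k / 2) ^+ 2 <= k ^+ 2.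
    by have := sqr_ge0 k; rewrite expr_div_n; lra.
  move: A1 A2 A3 A4 A5; clear; move: (itg _ _ _) (itg _ _ _) (\sum_(1 <= j < N.+1) _) ((k / 2) ^+ 2) (k ^+ 2).
  by move: (M ^+ 2) (mesh N) => *; lra.
Qed.

Definition cavg (N : nat) f (j : nat) : R := (mesh N)^-1 * itg (node N j) (node N j.+1) f.

Lemma cavg_osc N f (c k : R) j : (j <= N)%N -> L1 0 1 f ->
  (forall x, node N j < x < node N j.+1 -> `|f x - c| <= k) -> `|cavg N f j - c| <= k.
Proof.
move=> jN Hf fk; have h0 := @mesh_gt0 R N.
have Hs : L1 (node N j) (node N j.+1) f by apply: L1_sub Hf; [exact: node_ge0|exact: node_le1].
have hE : node N j.+1 - node N j = mesh N :> R by rewrite nodeS addrC addKr.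
have {1}-> : c = (mesh N)^-1 * itg (node N j) (node N j.+1) (fun=> c).
  by rewrite itg_cst ?node_leS// hE mulrC mulfK// gt_eqF.
rewrite /cavg -mulrBr -itgB//; last exact: L1_cst.
rewrite normrM gtr0_norm ?invr_gt0// mulrC ler_pdivrMr// -hE.
by apply: itg_abs_le; [exact: node_leS|apply: L1B => //; exact: L1_cst|].
Qed.

Lemma cavgE N u u' j : AC 0 1 u u' -> (j <= N)%N ->
  (u (node N j.+1) - u (node N j)) / mesh N = cavg N u' j.
Proof.
by move=> Hu jN; rewrite (AC_diff Hu (node_ge0 _ _) (node_leS _ j) (node_le1 _)) 1?mulrC.
Qed.

(** Continuity of translations in [L^2], on the grid. It absorbs the mismatch between step
    extensions and affine interpolants in the estimate of the initial velocity. *)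
Lemma shift_cavg_cvg f : L2 0 1 f ->
  vanish (fun N => l2n N (fun j => cavg N f j - cavg N f j.-1)).
Proof.
have bound N f1 : L2 0 1 f1 ->
    mesh N * \sum_(0 <= j < N.+1) cavg N f1 j ^+ 2 <= nL2 0 1 f1 ^+ 2.
  move=> H1; have A := AC_primitive 0 (L2_L1 H1); have G := grad_nodes_le N A H1.
  have : Num.sqrt (mesh N * \sum_(0 <= j < N.+1) ((0 + itg 0 (node N j.+1) f1 - (0 + itg 0 (node N j) f1)) /
      mesh N) ^+ 2) ^+ 2 <= nL2 0 1 f1 ^+ 2.
    by rewrite lerXn2r ?nnegrE ?sqrtr_ge0 ?nL2_ge0.
  rewrite sqr_sqrtr; last first.
    by rewrite mulr_ge0 ?(ltW (mesh_gt0 N))// sumr_ge0// => j _; exact: sqr_ge0.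
  congr (_ * _ <= _); apply: eq_big_nat => j /= jN; congr (_ ^+ 2); by rewrite -(cavgE A (jN : (j <= N)%N)).
apply: (L2_vanish_of_dense (c := 2) (S := fun N f => l2n N (fun j => cavg N f j - cavg N f j.-1))) => //.
- move=> N g1 g2 H1 H2; rewrite (le_trans _ (l2nD _ _ _))// le_eqVlt; apply/orP; left; apply/eqP/l2n_eq => j /andP[j0 jN].
  have sub g i : L2 0 1 g -> (i <= N)%N -> L1 (node N i) (node N i.+1) g.
    by move=> Hg iN; apply: L1_sub (L2_L1 Hg); [exact: node_ge0|exact: node_le1].
  have E i : (i <= N)%N -> cavg N (fun x => g1 x - g2 x) i = cavg N g1 i - cavg N g2 i.
    by move=> iN; rewrite /cavg itgB ?mulrBr//; exact: sub.
  rewrite !E//; last by rewrite (leq_trans (leq_pred _)).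
  ring.
- move=> N g1 H1; have B := bound N g1 H1.
  have S a : l2n N a <= nL2 0 1 g1 -> l2n N a <= nL2 0 1 g1 by [].
  have h0 := @mesh_gt0 R N.
  have C1 : l2n N (cavg N g1) <= nL2 0 1 g1.
    apply: l2n_le; first exact: nL2_ge0.
    rewrite (le_trans _ B)// ler_pM2l// [leRHS]big_nat_recl//= big_add1/= lerDr; exact: sqr_ge0.
  have C2 : l2n N (fun j => cavg N g1 j.-1) <= nL2 0 1 g1.
    apply: l2n_le; first exact: nL2_ge0.
    by rewrite (le_trans _ B)// ler_pM2l// big_add1/= [leRHS]big_nat_recr//= lerDl; exact: sqr_ge0.
  rewrite (le_trans (l2nB _ _ _))//; lra.
- move=> g cg k k0; have k2 : 0 < k / 2 by rewrite divr_gt0.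
  have [d d0 Hd] := cg _ k2; have [n1 Hn1] := mesh_lt d0.
  exists n1 => N /Hn1 h1; have h0 := @mesh_gt0 R N.
  apply: l2n_sup; first exact: ltW.
  move=> j /andP[j0 jN]; have nj := @node_in R N j (leqW jN).
  have E : cavg N g j - cavg N g j.-1 = (cavg N g j - g (node N j)) - (cavg N g j.-1 - g (node N j)) by ring.
  rewrite E (le_trans (ler_normB _ _))// [leRHS]splitr lerD//.
    apply: cavg_osc => //; first exact: ucont_L1.
    move=> x /andP[x1 x2]; apply/ltW/Hd => //.
      by rewrite (le_trans (node_ge0 _ _) (ltW x1)) (le_trans (ltW x2))// node_le1.
    rewrite nodeS in x2; clear -x1 x2 h1 h0; by rewrite ltr_norml; apply/andP; split; lra.
  apply: cavg_osc; [by rewrite (leq_trans (leq_pred _))|exact: ucont_L1|].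
  rewrite prednK// => x /andP[x1 x2]; apply/ltW/Hd => //.
    by rewrite (le_trans (node_ge0 _ _) (ltW x1)) (le_trans (ltW x2))// node_le1// leqW.
  rewrite nodeP// in x1; clear -x1 x2 h1 h0; by rewrite ltr_norml; apply/andP; split; lra.
Qed.

End GridLimits.

Section DiscreteGradient.
Context {R : realType}.
Variable N : nat.
Local Notation h := (mesh N : R).
Implicit Types (a b e w v psi : nat -> R).
Let h0 : 0 < h. Proof. exact: mesh_gt0. Qed.
Let hn : h != 0. Proof. exact: lt0r_neq0. Qed.

Definition gradn w : R := Num.sqrt (h * \sum_(0 <= j < N.+1) ((w j.+1 - w j) / h) ^+ 2).

Let sum0 (s : nat -> R) m n : 0 <= h * \sum_(m <= j < n) s j ^+ 2.
Proof. by rewrite mulr_ge0 ?(ltW h0)// sumr_ge0// => j _; exact: sqr_ge0. Qed.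

Lemma gradn_ge0 w : 0 <= gradn w. Proof. exact: sqrtr_ge0. Qed.

Lemma gradn_sqr w : gradn w ^+ 2 = h * \sum_(0 <= j < N.+1) ((w j.+1 - w j) / h) ^+ 2.
Proof. by rewrite sqr_sqrtr. Qed.

Lemma gradn_eq w v : (forall j, (j <= N.+1)%N -> w j = v j) -> gradn w = gradn v.
Proof.
move=> wv; congr (Num.sqrt (_ * _)); apply: eq_big_nat => j /= jN.
by rewrite !wv// ltnW.
Qed.

Lemma gradnZ (k : R) w : gradn (fun j => k * w j) = `|k| * gradn w.
Proof.
rewrite /gradn -sqrtr_sqr -sqrtrM ?sqr_ge0//; congr Num.sqrt.
rewrite [RHS]mulrCA; congr (_ * _); rewrite mulr_sumr; apply: eq_bigr => j _.
by rewrite -mulrBr -mulrA exprMn.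
Qed.

Lemma gradnD w v : gradn (fun j => w j + v j) <= gradn w + gradn v.
Proof.
pose p j := (w j.+1 - w j) / h; pose q j := (v j.+1 - v j) / h.
have cs := le_trans (ler_norm _) (sum_CS_sqrt (index_iota 0 N.+1) xpredT p q).
have cs2 : h * \sum_(0 <= j < N.+1) p j * q j <= gradn w * gradn v.
  rewrite /gradn !sqrtrM ?(ltW h0)// mulrACA -expr2 sqr_sqrtr ?(ltW h0)//.
  by rewrite ler_pM2l.
have n0 : 0 <= gradn w + gradn v by rewrite addr_ge0// gradn_ge0.
rewrite -[leRHS](ger0_norm n0) -sqrtr_sqr ler_wsqrtr// sqrrD !gradn_sqr.
have -> : \sum_(0 <= j < N.+1) ((w j.+1 + v j.+1 - (w j + v j)) / h) ^+ 2 =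
   \sum_(0 <= j < N.+1) p j ^+ 2 + 2 * (\sum_(0 <= j < N.+1) p j * q j) + \sum_(0 <= j < N.+1) q j ^+ 2.
  rewrite mulr_sumr -!big_split/=; apply: eq_bigr => j _; rewrite /p /q; ring.
rewrite !mulrDr lerD2r lerD2l mulrCA -[leRHS]mulr_natl ler_pM2l//.
Qed.

Lemma sqrt_energy_le w v : Num.sqrt (wave_energy N w v) <= l2n N v + gradn w.
Proof.
have n0 : 0 <= l2n N v + gradn w by rewrite addr_ge0 ?gradn_ge0 ?l2n_ge0.
rewrite -[leRHS](ger0_norm n0) -sqrtr_sqr ler_wsqrtr// sqrrD l2n_sqr gradn_sqr.
by rewrite /wave_energy mulrDr lerD2r lerDl mulrn_wge0// mulr_ge0 ?l2n_ge0 ?gradn_ge0.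
Qed.

Lemma gradn_sup w j : w 0%N = 0 -> (j <= N.+1)%N -> `|w j| <= gradn w.
Proof.
move=> w0 jN; have := grid_sup_le w (fun=> 0) jN; rewrite w0 normr0 add0r.
rewrite /wave_energy big1 ?add0r// => i _; exact: expr0n.
Qed.

Lemma l2n_CS a b : `|h * \sum_(1 <= j < N.+1) a j * b j| <= l2n N a * l2n N b.
Proof.
rewrite normrM (gtr0_norm h0) /l2n !sqrtrM ?(ltW h0)// mulrACA -expr2 sqr_sqrtr ?(ltW h0)//.
by rewrite ler_pM2l//; exact: sum_CS_sqrt.
Qed.

Lemma sum_by_parts psi b : psi 0%N = 0 -> psi N.+1 = 0 ->
  \sum_(1 <= j < N.+1) psi j * (b j.+1 - 2 * b j + b j.-1) =
  - \sum_(0 <= j < N.+1) (psi j.+1 - psi j) * (b j.+1 - b j).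
Proof.
move=> p0 pN; apply/eqP; rewrite -addr_eq0; apply/eqP.
have H n : \sum_(1 <= j < n.+1) psi j * (b j.+1 - 2 * b j + b j.-1) +
    \sum_(0 <= j < n.+1) (psi j.+1 - psi j) * (b j.+1 - b j) =
    psi n.+1 * (b n.+1 - b n) - psi 0%N * (b 1%N - b 0%N).
  elim: n => [|n IH]; first by rewrite big_geq// big_nat1; ring.
  rewrite big_nat_recr//= [X in _ + X]big_nat_recr//= addrACA IH; ring.
by rewrite H p0 pN; ring.
Qed.

(** Subtracts the affine function with the same end values: the result vanishes at both ends and has
    the same second differences. *)
Definition unlift e j : R := e j - (e 0%N + (e N.+1 - e 0%N) * node N j).

Lemma unlift0 e : unlift e 0 = 0. Proof. by rewrite /unlift node0; ring. Qed.
Lemma unliftN e : unlift e N.+1 = 0. Proof. by rewrite /unlift nodeN; ring. Qed.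
Lemma unlift_slope e j : (e j.+1 - e j) / h = (unlift e j.+1 - unlift e j) / h + (e N.+1 - e 0%N).
Proof. by rewrite /unlift nodeS; field. Qed.
Lemma unlift_lap e j : (0 < j)%N -> laplacian_h N (unlift e) j = laplacian_h N e j.
Proof. by move=> j0; rewrite /laplacian_h /unlift nodeS nodeP//; congr (_ / _); ring. Qed.

Lemma gradn_unlift e : gradn e <= gradn (unlift e) + `|e N.+1 - e 0%N|.
Proof.
have E : gradn (fun j => (e N.+1 - e 0%N) * node N j) = `|e N.+1 - e 0%N|.
  rewrite gradnZ -[RHS]mulr1; congr (_ * _); rewrite /gradn -sqrtr1; congr Num.sqrt.
  under eq_bigr do rewrite nodeS addrC addKr divff// expr1n.
  by rewrite sumr_const_nat subn0 mesh_mul.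
rewrite -E (le_trans _ (gradnD _ _))// le_eqVlt; apply/orP; left; apply/eqP.
by congr (Num.sqrt (_ * _)); apply: eq_bigr => j _; rewrite /unlift; congr ((_ / _) ^+ 2); ring.
Qed.

(** Summation by parts expresses the squared gradient [G^2] as a pairing of [unlift] with the second
    differences; since [unlift] is bounded by [G] at every node, one factor [G] cancels. *)
Lemma gradn_unlift_le_lap e : gradn (unlift e) <= l2n N (laplacian_h N e).
Proof.
set G := gradn _; have G0 : 0 <= G by exact: gradn_ge0.
have S : G ^+ 2 = - (h * \sum_(1 <= j < N.+1) unlift e j * laplacian_h N e j).
  have := sum_by_parts (unlift e) (unlift0 e) (unliftN e) => P.
  have -> : \sum_(1 <= j < N.+1) unlift e j * laplacian_h N e j =
     (h ^+ 2)^-1 * \sum_(1 <= j < N.+1) unlift e j * (unlift e j.+1 - 2 * unlift e j + unlift e j.-1).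
    rewrite mulr_sumr; apply: eq_big_nat => j /andP[j0 jN].
    by rewrite -unlift_lap// /laplacian_h mulrA [LHS]mulrC.
  rewrite P gradn_sqr mulrN mulrN opprK; congr (_ * _); rewrite mulr_sumr.
  by apply: eq_bigr => j _; field.
have B : G ^+ 2 <= G * l2n N (laplacian_h N e).
  rewrite S (le_trans (ler_norm _))// normrN (le_trans (l2n_CS _ _))//.
  rewrite ler_wpM2r ?l2n_ge0// l2n_sup// => j /andP[j0 jN].
  by apply: gradn_sup; [exact: unlift0|exact: leqW].
have [->|Gn] := eqVneq G 0; first exact: l2n_ge0.
by move: B; rewrite expr2 ler_pM2l// lt0r Gn.
Qed.

Lemma grid_sup_lap e j : (j <= N.+1)%N ->
  `|e j| <= 2 * `|e 0%N| + `|e N.+1| + l2n N (laplacian_h N e).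
Proof.
move=> jN; have H := le_trans (gradn_sup (unlift0 e) jN) (gradn_unlift_le_lap e).
have E : e j = unlift e j + (e 0%N + (e N.+1 - e 0%N) * node N j) by rewrite /unlift; ring.
rewrite E (le_trans (ler_normD _ _))// addrC lerD//.
have /andP[n0 n1] := @node_in R N j jN.
rewrite (le_trans (ler_normD _ _))// normrM.
have A : `|e N.+1 - e 0%N| * `|node N j| <= `|e N.+1| + `|e 0%N|.
  rewrite (le_trans _ (ler_normB _ _))// ler_piMr// ger0_norm//.
by move: A; move: (`|e 0%N|) (`|e N.+1|) (_ * _) => *; lra.
Qed.

End DiscreteGradient.

(** * Convergence of the data *)

Section InitialPosition.
Context {R : realType}.

Lemma ecvg0_vanish (x : nat -> \bar R) (y : nat -> R) : (forall N, (y N)%:E <= x N)%E ->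
  x @ \oo --> 0%E -> vanish y.
Proof.
move=> yx /fine_cvgP[[n1 _ fin] /vanish_cvg H] e e0; have [n0 Hn] := H e e0.
exists (maxn n0 n1) => n; rewrite geq_max => /andP[h0 h1].
have := yx n; rewrite -(fineK (fin n h1)) lee_fin => /le_trans; apply.
exact: le_trans (ler_norm _) (Hn n h0).
Qed.

Lemma lap_initial_cvg (b : nat -> nat -> R) (u : nat -> R -> R) : L2 0 1 (u 2%N) ->
  L2_norm 0 1 (fun x => ext_const N (laplacian_h N (b N)) x - u 2%N x) @[N --> \oo] --> 0%E ->
  vanish (fun N => l2n N (fun j => laplacian_h N (b N) j - havg N (u 2%N) j)).
Proof.
move=> Lu cv.
have v1 : vanish (fun N => nL2 0 1 (fun x => ext_const N (laplacian_h N (b N)) x - u 2%N x)).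
  apply: ecvg0_vanish cv => N; rewrite L2_normE//; apply: L2B => //; exact: ext_const_L2.
apply: vanish_leq (vanishD v1 (ext_const_havg_cvg Lu)) _ => N.
rewrite -nL2_ext_const; have L1 := ext_const_L2 N (laplacian_h N (b N)) 0 1.
have L3 := ext_const_L2 N (havg N (u 2%N)) 0 1.
rewrite (@nL2_eq _ _ _ _ (fun x => ext_const N (laplacian_h N (b N)) x - ext_const N (havg N (u 2%N)) x)); last first.
  by move=> x _; rewrite ext_constB.
rewrite (le_trans (nL2_triangle L1 Lu L3))// lerD2l -nL2N.
by rewrite le_eqVlt; apply/orP; left; apply/eqP/nL2_eq => x _; rewrite opprB.
Qed.

End InitialPosition.

(** * Affine interpolants as test functions for the dual norm *)

Section InitialVelocity.
Context {R : realType}.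

Lemma itg_affine (a b c p q : R) : a <= b ->
  itg a b (fun x => p + q * (x - c)) = p * (b - a) + q * ((b - c) ^+ 2 - (a - c) ^+ 2) / 2.
Proof.
move=> ab.
have A0 : AC a b (fun x : R => x - c) (fun=> 1 - 0) by apply: ACB; [exact: AC_id|exact: AC_cst].
have A := ACD (ACZ p (AC_id a b)) (ACZ (q / 2) (ACM A0 A0)).
have := AC_diff A (lexx _) ab (lexx _) => H.
rewrite (itg_eq (g := fun x => p * 1 + q / 2 * ((1 - 0) * (x - c) + (x - c) * (1 - 0)))).
  by rewrite -H; ring.
by move=> x _; field.
Qed.

Variables (N : nat) (psi : nat -> R).
Local Notation h := (mesh N : R).
Hypotheses (psi0 : psi 0%N = 0) (psiN : psi N.+1 = 0).
Let h0 : 0 < h. Proof. exact: mesh_gt0. Qed.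
Let hn : h != 0. Proof. exact: lt0r_neq0. Qed.
Let s j : R := (psi j.+1 - psi j) / h.

(** The interpolant is introduced through its slopes and then integrated, so its absolute continuity
    is immediate and only its values on cells have to be computed. *)
Definition interp' (x : R) : R :=
  \sum_(0 <= j < N.+1) (psi j.+1 - psi j) / h * \1_(`[node N j, node N j.+1[%classic) x.
Definition interp (x : R) : R := 0 + itg 0 x interp'.

Let node_mono i j : (i <= j)%N -> node N i <= node N j :> R.
Proof. by move=> ij; rewrite /node ler_pM2r// ler_nat. Qed.

Lemma interp'_cell j x : (j <= N)%N -> node N j <= x < node N j.+1 -> interp' x = s j.
Proof.
move=> jN /andP[x1 x2]; rewrite /interp' (bigD1_seq j) ?mem_index_iota ?iota_uniq//=.
rewrite big1 => [|i ij]; rewrite indicE.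
  by rewrite mem_set ?mulr1 ?addr0//= in_itv/= x1.
rewrite memNset ?mulr0//= in_itv/= => /andP[y1 y2].
case: (ltngtP i j) ij => // ij _.
  by have := le_lt_trans (node_mono ij) (le_lt_trans x1 y2); rewrite ltxx.
by have := le_lt_trans (node_mono ij) (le_lt_trans y1 x2); rewrite ltxx.
Qed.

Lemma interp'_L2 : L2 0 1 interp'.
Proof.
apply: (@L2_bounded _ _ _ _ (\sum_(0 <= j < N.+1) `|s j|)).
  apply: (@measurable_funS _ _ _ _ setT) => //; apply: measurable_sum => j.
  apply: measurable_funM; [exact: measurable_cst|exact: measurable_indic].
move=> x _; rewrite (le_trans (ler_norm_sum _ _ _))//; apply: ler_sum => j _.
rewrite normrM ler_piMr// indicE; case: (_ \in _); rewrite ?normr1 ?normr0//.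
Qed.

Lemma interp_AC : AC 0 1 interp interp'.
Proof. by apply: AC_primitive; exact: L2_L1 interp'_L2. Qed.

Lemma nL2_interp' : nL2 0 1 interp' = gradn N psi.
Proof.
congr Num.sqrt; have [_ H] := interp'_L2; rewrite (itg_cells N H) mulr_sumr.
apply: eq_big_nat => j /= jN.
have -> : h * ((psi j.+1 - psi j) / h) ^+ 2 = itg (node N j) (node N j.+1) (fun=> s j ^+ 2).
  by rewrite itg_cst ?node_leS// nodeS [_ - node N j]addrC addKr mulrC.
by apply: itg_eq => x /andP[x1 x2]; rewrite (@interp'_cell j)// ltW.
Qed.

Lemma interp_cell j x : (j <= N)%N -> node N j <= x <= node N j.+1 ->
  interp x = psi j + s j * (x - node N j).
Proof.
move=> jN /andP[x1 x2].
have step i y : (i <= N)%N -> node N i <= y -> y <= node N i.+1 ->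
    interp y - interp (node N i) = s i * (y - node N i).
  move=> iN y1 y2; rewrite (AC_diff interp_AC (node_ge0 N i) y1 (le_trans y2 (node_le1 _)))//.
  rewrite -itg_cst//; apply: itg_eq => z /andP[z1 z2].
  by rewrite (@interp'_cell i)// (ltW z1) (lt_le_trans z2).
have nd i : (i <= N.+1)%N -> interp (node N i) = psi i.
  elim: i => [_|i IH iN]; first by rewrite /interp node0 itg_nil// addr0 psi0.
  have := step i (node N i.+1) iN (node_leS N i) (lexx _); rewrite IH ?(ltnW iN)//.
  rewrite nodeS [node N i + _ - _]addrC addKr /s divfK// => /eqP; rewrite subr_eq subrK => /eqP.
  by rewrite -nodeS.
by have := step j x jN x1 x2; rewrite nd ?leqW// => /eqP; rewrite subr_eq addrC => /eqP.
Qed.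

Let fam : nat -> R -> R := fun k => if k is 0%N then interp else interp'.

Lemma interp0 : interp 0 = 0. Proof. by rewrite /interp itg_nil// addr0. Qed.

Lemma interp1 : interp 1 = 0.
Proof.
have := @interp_cell N 1 (leqnn N); rewrite nodeN lexx node_le1// => /(_ isT) ->.
have E1 : 1 - node N N = h by rewrite -[1](@nodeN R N) nodeS [LHS]addrC addKr.
by rewrite E1 /s divfK// psiN; ring.
Qed.

(** The function vanishes at 0, so its [L^2] norm is bounded by that of its slope; both are at most
    [1/2], and the [H^1] norm is at most [sqrt 2 / 2]. *)
Lemma interp_H10 : gradn N psi <= 2^-1 -> H10 fam /\ (Hnorm 1 0 1 fam <= 1)%E.
Proof.
move=> G1; have A := interp_AC; have L := interp'_L2; have cI := AC_ucont A.
split.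
  split; [|exact: interp0|exact: interp1].
  split=> [[|[|]]//= _|[|]//= _].
  - exact/in_L2E/ucont_L2.
  - exact/in_L2E.
  - by split; [exact: ucont_within|exact: AC_weak_derivative].
have s2 : Num.sqrt 2 * 2^-1 <= 1 :> R.
  have : Num.sqrt 2 <= 2 :> R.
    rewrite -[leRHS](ger0_norm (_ : 0 <= 2))// -sqrtr_sqr ler_wsqrtr//.
    by rewrite expr2 ler_peMr// ler1n.
  lra.
have G2 : (Hnorm 1 0 1 fam <= (Num.sqrt 2%:R * 2^-1)%:E)%E.
  apply: Hnorm_le => -[|[|]]//= _.
    rewrite L2_normE ?lee_fin; last exact: ucont_L2.
    apply: (@le_trans _ _ (Num.sqrt (1 - 0) * 2^-1)); last by rewrite subr0 sqrtr1 mul1r.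
    apply: nL2_sup => //; first exact: ucont_L2.
    move=> x /andP[x1 x2]; have x01 : 0 <= x <= 1 by rewrite !ltW.
    have z01 : 0 <= (0 : R) <= 1 by rewrite lexx ler01.
    have := H1_holder A L x01 z01; rewrite interp0 !subr0 nL2_interp'.
    move/le_trans; apply; rewrite (le_trans _ G1)// ler_piMl ?gradn_ge0//.
    by rewrite -sqrtr1 ler_wsqrtr// ger0_norm// ltW.
  by rewrite L2_normE// lee_fin nL2_interp'.
by rewrite (le_trans G2)// lee_fin.
Qed.

(** The dual cell sees half of each adjacent affine piece. The correction in [h^2 / 8] measures the
    kink at the node and is what separates the [H^{-1}] pairing from the discrete one. *)
Lemma interp_itg_cell j : (1 <= j <= N)%N ->
  itg (cell N j) (cell N j.+1) interp = h * psi j + h ^+ 2 / 8 * (s j - s j.-1).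
Proof.
case: j => // j /= jN; have /andP[n0 n1] := @node_in R N j.+1 (leqW jN).
have c1 : cell N j.+1 <= node N j.+1 :> R by rewrite cell_node gerBl divr_ge0// ltW.
have c2 : node N j.+1 <= cell N j.+2 :> R by rewrite cellS lerDl divr_ge0// ltW.
have c3 : node N j <= cell N j.+1 :> R by rewrite cellS lerDl divr_ge0// ltW.
have c4 : cell N j.+2 <= node N j.+2 :> R by rewrite cell_node gerBl divr_ge0// ltW.
have cI := AC_ucont interp_AC.
have L : L1 (cell N j.+1) (cell N j.+2) interp.
  by apply: L1_sub (ucont_L1 cI); [exact: le_trans (node_ge0 _ _) c3|exact: le_trans c4 (node_le1 _)].
rewrite (itg_split c1 c2 L).
rewrite (itg_eq (g := fun x => psi j.+1 + s j * (x - node N j.+1)) (b := node N j.+1)); last first.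
  move=> x /andP[x1 x2]; rewrite (@interp_cell j x (ltnW jN)); last by rewrite (le_trans c3 (ltW x1)) ltW.
  by rewrite nodeS /s; field.
rewrite (itg_eq (g := fun x => psi j.+1 + s j.+1 * (x - node N j.+1)) (b := cell N j.+2)); last first.
  by move=> x /andP[x1 x2]; rewrite (@interp_cell j.+1)// (ltW x1) (le_trans (ltW x2) c4).
by rewrite !itg_affine// cell_node cellS; field.
Qed.

Lemma interp_pairing (a : nat -> R) (u u' : R -> R) : AC 0 1 u u' -> L2 0 1 u' ->
  itg 0 1 (fun x => ext_const N a x * interp x) + itg 0 1 (fun x => u' x * interp' x) =
  \sum_(1 <= j < N.+1) a j * (h * psi j + h ^+ 2 / 8 * (s j - s j.-1)) +
  \sum_(0 <= j < N.+1) s j * (u (node N j.+1) - u (node N j)).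
Proof.
move=> Hu Lu; have cI := AC_ucont interp_AC; congr (_ + _).
  rewrite (itg_ext_const (F := fun y x => y * interp x)).
  - apply: eq_big_nat => j jN; rewrite itgZ ?interp_itg_cell//.
    have /andP[j1 jN1] := (jN : (1 <= j <= N)%N).
    apply: L1_sub (ucont_L1 cI).
      by rewrite (le_trans (cell1_ge0 N))// cell_mono.
    by rewrite (le_trans _ (cellN_le1 N))// cell_mono.
  - by move=> x; rewrite mul0r.
  - exact: L2M (ext_const_L2 _ _ _ _) (ucont_L2 cI).
rewrite (itg_cells N (L2M Lu interp'_L2)); apply: eq_big_nat => j /= jN.
rewrite (AC_diff Hu (node_ge0 N j) (node_leS N j) (node_le1 _))// -itgZ; last first.
  by apply: L1_sub (L2_L1 Lu); [exact: node_ge0|exact: node_le1].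
by apply: itg_eq => x /andP[x1 x2]; rewrite (@interp'_cell j) ?(ltW x1)// mulrC.
Qed.

End InitialVelocity.

(** * Functions of time and space: measurability and Fubini *)

Section Box.
Context {R : realType}.
Local Notation mu := (@lebesgue_measure R).
Variable T : R.
Implicit Types (H W : R -> R -> R).

Let C : set (measurableTypeR R * measurableTypeR R) := cylinder T.
Let m : {sigma_finite_measure set (measurableTypeR R) -> \bar R} := mu.
Let mC : measurable C. Proof. by apply: measurableX; exact: measurable_itv. Qed.

Let memC (t x : R) : ((t, x) \in C) = (0 < t < T) && (0 < x < 1).
Proof.
apply/idP/idP => [/set_mem[]|/andP[h1 h2]]; first by rewrite /= !in_itv/= => -> ->.
by apply/mem_set; split; rewrite /= in_itv.
Qed.

Definition box_meas H : Prop := measurable_fun C (fun tx => H tx.1 tx.2).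

(** Extension by zero to the whole plane, so that the product-measure theorems apply on the full
    space. *)
Definition box_cut H : measurableTypeR R * measurableTypeR R -> R :=
  (fun tx => H tx.1 tx.2) \_ C.

Lemma box_cutE H (t x : R) :
  box_cut H (t, x) = if (0 < t < T) && (0 < x < 1) then H t x else 0.
Proof. by rewrite /box_cut patchE memC. Qed.

Lemma box_cut_meas H : box_meas H -> measurable_fun setT (box_cut H).
Proof. by move/(measurable_restrictT _ mC). Qed.

Lemma box_section H (t : R) : box_meas H -> 0 < t < T -> measurable_fun `](0 : R), 1[ (H t).
Proof.
move=> mH tT; have m1 : measurable_fun setT (fun x : measurableTypeR R => box_cut H (t, x)).
  by apply: (measurableT_comp (box_cut_meas mH)).
have mI := @measurable_itv R `](0 : R), 1[.
apply: (eq_measurable_fun (fun x => box_cut H (t, x))).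
  by move=> x; rewrite inE/= in_itv/= => x01; rewrite box_cutE tT x01.
exact: measurable_funS m1.
Qed.

Let int_cut (Q : R -> \bar R) H (t : R) : Q 0 = 0%E -> 0 < t < T ->
  (\int[mu]_x Q (box_cut H (t, x)) = \int[mu]_(x in `]0%R, 1%R[) Q (H t x))%E.
Proof.
move=> Q0 tT; rewrite [RHS]integral_mkcond; apply: eq_integral => x _.
rewrite patchE box_cutE tT mem_setE in_itv/=; case: ifP => //.
Qed.

Lemma sqr_int_meas H : box_meas H ->
  measurable_fun `]0, T[ (fun t => (\int[mu]_(x in `]0%R, 1%R[) (H t x ^+ 2)%:E)%E).
Proof.
move=> mH; pose f tx := (box_cut H tx ^+ 2)%:E.
have mf : measurable_fun setT f.
  by apply/measurable_EFinP; apply: measurable_funX; exact: box_cut_meas.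
have f0 tx : (0 <= f tx)%E by rewrite lee_fin sqr_ge0.
have mF := @measurable_fun_fubini_tonelli_F _ _ (measurableTypeR R) (measurableTypeR R) R m f mf f0.
apply: (eq_measurable_fun (fubini_F mu f)).
  move=> t; rewrite inE/= in_itv/= => tT; rewrite /fubini_F /f.
  by rewrite (int_cut (Q := fun y => (y ^+ 2)%:E))// expr0n.
exact: measurable_funS mF.
Qed.

Lemma L2_norm_meas H : box_meas H -> measurable_fun `]0, T[ (fun t => L2_norm 0 1 (H t)).
Proof.
move=> mH; apply: (eq_measurable_fun (fun t => (\int[mu]_(x in `]0%R, 1%R[) (H t x ^+ 2)%:E) `^ 2^-1)%E).
  by move=> t _; rewrite /L2_norm Lp2_norm_sqr//; exact: measurable_itv.
exact: (measurableT_comp (measurable_poweR _)) (sqr_int_meas mH).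
Qed.

Lemma nL2_fine (f : R -> R) : nL2 0 1 f = fine (L2_norm 0 1 f).
Proof.
rewrite /L2_norm Lp2_norm_sqr; last exact: measurable_itv.
have : (0 <= \int[mu]_(x in `]0%R, 1%R[) (f x ^+ 2)%:E)%E.
  by apply: integral_ge0 => x _; rewrite lee_fin sqr_ge0.
rewrite /nL2 /itg /Rintegral; case: (\int[mu]_(x in `]0%R, 1%R[) _)%E => [r| |]//= r0.
  by rewrite powR12_sqrt.
by rewrite invr_eq0 pnatr_eq0/= sqrtr0.
Qed.

Lemma L2_of_norm (f : R -> R) : measurable_fun `](0 : R), 1[ f -> (L2_norm 0 1 f < +oo)%E -> L2 0 1 f.
Proof.
move=> mf H; apply/in_L2E; rewrite /in_Lp inE; apply/andP; split; rewrite inE/=.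
  by have := measurable_restrictT f (@measurable_itv R `]0, 1[); tauto.
exact: H.
Qed.

Section Finite.
Variable H : R -> R -> R.
Hypotheses (mH : box_meas H) (fH : (L1L2_norm T H < +oo)%E).
Let mI : measurable (`]0, T[%classic : set (measurableTypeR R)).
Proof. exact: measurable_itv. Qed.

Let intH : mu.-integrable `]0, T[ (fun t => L2_norm 0 1 (H t)).
Proof.
apply/integrableP; split; first exact: L2_norm_meas.
by under eq_integral do rewrite gee0_abs ?L2_norm_ge0//.
Qed.

Lemma box_ae_L2 : {ae mu, forall t : R, 0 < t < T -> L2 0 1 (H t)}.
Proof.
have A : {ae mu, forall t : R, `]0, T[%classic t -> L2_norm 0 1 (H t) \is a fin_num} := integrable_ae mI intH.
apply: ae_mono A => t Ht tT.
apply: L2_of_norm; first exact: box_section.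
by have := Ht; rewrite /= in_itv/= tT => /(_ isT); rewrite fin_numElt => /andP[].
Qed.

Lemma box_L1_nL2 : L1 0 T (fun t => nL2 0 1 (H t)) /\ (itg 0 T (fun t => nL2 0 1 (H t)))%:E = L1L2_norm T H.
Proof.
have E : (EFin \o (fun t => nL2 0 1 (H t))) = EFin \o fine \o (fun t => L2_norm 0 1 (H t)).
  by apply/funext => t /=; rewrite nL2_fine.
have m1 : measurable_fun (`]0, T[%classic : set (measurableTypeR R)) (EFin \o (fun t => nL2 0 1 (H t))).
  rewrite E; apply/measurable_EFinP; apply: (measurableT_comp (fine_measurable _)) => //.
  exact: L2_norm_meas.
have L : L1 0 T (fun t => nL2 0 1 (H t)).
  apply: (le_integrable mI m1 _ intH) => t _; rewrite /= nL2_fine [leRHS]gee0_abs ?L2_norm_ge0//.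
  by rewrite ger0_norm ?fine_ge0 ?L2_norm_ge0//; have := L2_norm_ge0 0 1 (H t); case: (L2_norm _ _ _) => //= *; rewrite leey.
split=> //; rewrite -(integral_itg L); apply: ae_eq_integral => //; first exact: L2_norm_meas.
by apply: ae_mono box_ae_L2 => t Ht; rewrite /= in_itv/= => /Ht h; rewrite L2_normE.
Qed.

(** At each time the [L^1] norm over the unit interval is at most the [L^2] norm, whose time
    integral is finite. *)
Lemma box_integrable : (mu \x mu)%E.-integrable setT (EFin \o box_cut H).
Proof.
have mf : measurable_fun setT (EFin \o box_cut H) by apply/measurable_EFinP; exact: box_cut_meas.
apply: (@integrable12ltyP _ _ (measurableTypeR R) (measurableTypeR R) R m m (EFin \o box_cut H) mf).2.
apply: (le_lt_trans _ fH).
rewrite /L1L2_norm [leRHS]integral_mkcond; apply: ge0_le_integral => //.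
- by move=> t _; apply: integral_ge0.
- apply: (@measurable_fun_fubini_tonelli_F _ _ (measurableTypeR R) (measurableTypeR R) R m (abse \o (EFin \o box_cut H))).
    exact: measurableT_comp.
  by move=> tx; exact: abse_ge0.
- by have := L2_norm_meas mH; move/(measurable_restrictT _ mI).
move=> t _; rewrite patchE mem_setE in_itv/=; case: ifPn => tT; last first.
  rewrite integral0_eq// => x _ /=; by rewrite box_cutE (negbTE tT) normr0.
rewrite (int_cut (Q := fun y => `|y%:E|%E))//=; last by rewrite normr0.
have [fin|] := ltP (L2_norm 0 1 (H t)) +oo%E; last by rewrite leye_eq => /eqP ->; exact: leey.
have L := L2_of_norm (box_section mH tT) fin.
rewrite L2_normE// integral_itg ?lee_fin; last exact/L1_abs/L2_L1.
by have := itg_abs_le_nL2 ler01 L; rewrite subr0 sqrtr1 mul1r.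
Qed.

End Finite.

Lemma box_fubini W : (mu \x mu)%E.-integrable setT (EFin \o box_cut W) ->
  [/\ L1 0 T (fun t => itg 0 1 (W t)), L1 0 1 (fun x => itg 0 T (W^~ x)) &
   itg 0 T (fun t => itg 0 1 (W t)) = itg 0 1 (fun x => itg 0 T (W^~ x))].
Proof.
move=> HW; set f := EFin \o box_cut W.
have IF := @integrable_fubini_F _ _ (measurableTypeR R) (measurableTypeR R) R m m f HW.
have mf := measurable_int _ HW.
have IG : mu.-integrable setT (fubini_G mu f).
  have ma : measurable_fun setT (abse \o f) by exact: measurableT_comp.
  have mG := @measurable_fun_fubini_tonelli_G _ _ (measurableTypeR R) (measurableTypeR R) R m (abse \o f) ma (fun=> abse_ge0 _).
  have IA : mu.-integrable setT (fubini_G mu (abse \o f)).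
    apply/integrableP; split => //.
    rewrite (eq_integral (fubini_G mu (abse \o f))); last first.
      by move=> x _; (apply/esym/gee0_abs || apply/gee0_abs); apply: integral_ge0 => t _; exact: abse_ge0.
    exact: (@integrable21ltyP _ _ (measurableTypeR R) (measurableTypeR R) R m m f mf).1 HW.
  apply: (le_integrable measurableT (@measurable_fubini_G _ _ (measurableTypeR R) (measurableTypeR R) R m m f HW) _ IA).
  move=> x _; rewrite [leRHS]gee0_abs; last by apply: integral_ge0 => t _; exact: abse_ge0.
  apply: le_abse_integral => //.
  exact: (measurableT_comp mf).
have F_eq (t : R) : (0 < t < T) -> itg 0 1 (W t) = fine (fubini_F mu f t).
  by move=> tT; rewrite /fubini_F (int_cut (Q := EFin)).
have F_out (t : R) : ~~ (0 < t < T) -> fubini_F mu f t = 0%E.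
  by move=> tT; rewrite /fubini_F integral0_eq// => x _; rewrite /f /= box_cutE (negbTE tT).
have G_eq (x : R) : (0 < x < 1) -> itg 0 T (W^~ x) = fine (fubini_G mu f x).
  move=> x01; rewrite /fubini_G /itg /Rintegral; congr fine.
  rewrite [LHS]integral_mkcond; apply: eq_integral => t _.
  by rewrite /f /= patchE box_cutE x01 andbT mem_setE in_itv/=; case: ifP.
have G_out (x : R) : ~~ (0 < x < 1) -> fubini_G mu f x = 0%E.
  by move=> tT; rewrite /fubini_G integral0_eq// => t _; rewrite /f /= box_cutE (negbTE tT) andbF.
have gen (a b : R) (F : R -> \bar R) (w : R -> R) : mu.-integrable setT F ->
    (forall t, a < t < b -> w t = fine (F t)) -> (forall t, ~~ (a < t < b) -> F t = 0%E) ->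
    L1 a b w /\ (itg a b w)%:E = (\int[mu]_x F x)%E.
  move=> IFF wF F0; have mI : measurable (`]a, b[%classic : set (measurableTypeR R)) by exact: measurable_itv.
  have IF' : mu.-integrable `]a, b[ F by exact: integrableS IFF.
  have mF := measurable_int _ IF'.
  have mw : measurable_fun (`]a, b[%classic : set (measurableTypeR R)) (EFin \o w).
    apply/measurable_EFinP; apply: (eq_measurable_fun (fine \o F)).
      by move=> t; rewrite inE/= in_itv/= => /wF ->.
    exact: (measurableT_comp (fine_measurable _)).
  have L : L1 a b w.
    apply: (le_integrable mI mw _ IF') => t; rewrite /= in_itv/= => /wF ->.
    case: (F t) => //= *; by rewrite ?normr0 leey.
  split=> //; rewrite -integral_itg//.
  transitivity (\int[mu]_(x in `]a, b[) F x)%E.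
    apply: ae_eq_integral => //.
    apply: ae_mono (integrable_ae mI IF') => t Ht; rewrite /= => tab.
    rewrite wF; last by move: tab; rewrite in_itv.
    by rewrite fineK//; exact: Ht.
  rewrite integral_mkcond; apply: eq_integral => t _.
  by rewrite patchE mem_setE in_itv/=; case: ifPn => // /F0.
have [L1' E1] := gen 0 T _ _ IF F_eq F_out.
have [L2' E2] := gen 0 1 _ _ IG G_eq G_out.
split=> //; apply: EFin_inj; rewrite E1 E2; exact: (@Fubini _ _ (measurableTypeR R) (measurableTypeR R) R m m f HW).
Qed.

Lemma box_ae_L1 W : (mu \x mu)%E.-integrable setT (EFin \o box_cut W) ->
  {ae mu, forall x : R, 0 < x < 1 -> L1 0 T (W^~ x)}.
Proof.
move=> HW; have A := @ae_integrable2 _ _ (measurableTypeR R) (measurableTypeR R) R m m (EFin \o box_cut W) HW.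
apply: (@ae_mono R _ _ _ A) => x Hx x01.
have mI : measurable (`]0, T[%classic : set (measurableTypeR R)) by exact: measurable_itv.
have H1 : mu.-integrable (`]0, T[%classic : set (measurableTypeR R)) (fun t => (EFin \o box_cut W) (t, x)).
  by apply: integrableS Hx.
apply: eq_integrable H1 => // t; rewrite inE/= in_itv/= => tT.
by rewrite box_cutE tT x01.
Qed.

Lemma box_weighted H (theta k : R -> R) (K : R) : box_meas H -> (L1L2_norm T H < +oo)%E ->
  ucont 0 T theta -> measurable_fun `](0 : R), 1[ k -> (forall x, 0 < x < 1 -> `|k x| <= K) ->
  (mu \x mu)%E.-integrable setT (EFin \o box_cut (fun t x => theta t * (k x * H t x))).
Proof.
move=> mH fH ct mk kK; have [M M0 tM] := ucont_bounded ct.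
have IH := box_integrable mH fH.
have mI := @measurable_itv R `](0 : R), 1[; have mJ := @measurable_itv R `]0, T[.
have mW : box_meas (fun t x => theta t * (k x * H t x)).
  have m1 : measurable_fun C (fun tx : measurableTypeR R * measurableTypeR R => theta tx.1).
    apply: (@measurable_comp _ _ _ _ _ _ (`]0, T[%classic : set (measurableTypeR R)) theta _ (fst : measurableTypeR R * measurableTypeR R -> measurableTypeR R)) => //.
    + by move=> _ [tx [h _] <-].
    + exact: ucont_meas.
    + exact: measurable_funS (measurable_fst).
  have m2 : measurable_fun C (fun tx : measurableTypeR R * measurableTypeR R => k tx.2).
    apply: (@measurable_comp _ _ _ _ _ _ (`]0%R, 1%R[%classic : set (measurableTypeR R)) k _ (snd : measurableTypeR R * measurableTypeR R -> measurableTypeR R)) => //.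
    + by move=> _ [tx [_ h] <-].
    + exact: measurable_funS (measurable_snd).
  by apply: measurable_funM => //; exact: measurable_funM.
have mc : measurable_fun setT (EFin \o box_cut (fun t x => theta t * (k x * H t x))).
  by apply/measurable_EFinP; exact: box_cut_meas.
apply: (le_integrable measurableT mc _ (integrableZl measurableT (M * K) IH)) => -[t x] _.
rewrite /= !box_cutE; case: ifP => [/andP[/andP[t0 tT] x01]|_]; last by rewrite mulr0.
rewrite lee_fin !normrM mulrA ler_wpM2r// ler_pM//.
  by rewrite (le_trans (tM t _)) ?ler_norm// !ltW.
by rewrite (le_trans (kK x x01)) ?ler_norm.
Qed.

End Box.

(** * Hat averages of the source and their time derivative *)

Section Source.
Context {R : realType}.
Local Notation mu := (@lebesgue_measure R).

Lemma measurable_sqrt (D : set (measurableTypeR R)) (f : R -> R) : measurable_fun D f ->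
  measurable_fun D (fun t => Num.sqrt (f t)).
Proof.
move=> mf; apply: (@measurableT_comp _ _ _ _ _ _ (fun x : R => Num.sqrt x)) => //.
by apply: continuous_measurable_fun; exact: sqrt_continuous.
Qed.

Lemma l2n_le_sum N (a : nat -> R) : l2n N a <= \sum_(1 <= j < N.+1) `|a j|.
Proof.
have s0 r : 0 <= \sum_(j <- r) `|a j| by apply: sumr_ge0.
apply: l2n_le; first exact: s0.
have H r : \sum_(j <- r) a j ^+ 2 <= (\sum_(j <- r) `|a j|) ^+ 2.
  elim: r => [|j r IH]; first by rewrite !big_nil expr0n.
  rewrite !big_cons sqrrD real_normK ?num_real// -addrA lerD2l (le_trans IH)// lerDr.
  by rewrite mulrn_wge0// mulr_ge0.
apply: le_trans (H _); rewrite ler_piMl ?mesh_le1//.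
by apply: sumr_ge0 => j _; exact: sqr_ge0.
Qed.

Lemma itg_indic (c d : R) (f : R -> R) : 0 <= c -> d <= 1 ->
  itg c d f = itg 0 1 (fun x => \1_(`]c, d[%classic) x * f x).
Proof.
move=> c0 d1; rewrite /itg /Rintegral [in LHS]integral_mkcond [in RHS]integral_mkcond.
congr fine; apply: eq_integral => x _.
rewrite !patchE /= indicE !mem_setE !in_itv/=; case: (boolP (c < x < d)) => [/andP[h1 h2]|h].
  by rewrite (le_lt_trans c0 h1) (lt_le_trans h2 d1) mul1r.
by rewrite mul0r; case: ifP.
Qed.

Variables (T : R) (g : nat -> R -> R -> R).
Hypotheses (T0 : 0 < T) (hg : W11L2 T g).

Let mg i : (i <= 1)%N -> box_meas T (g i). Proof. by move=> /(hg.1 i)[]. Qed.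
Let fg i : (i <= 1)%N -> (L1L2_norm T (g i) < +oo)%E. Proof. by move=> /(hg.1 i)[]. Qed.

Section Weight.
Variables (c d : R) (w : R -> R).
Hypotheses (c0 : 0 <= c) (d1 : d <= 1) (cw : ucont c d w).
Hypothesis w1 : forall x, c < x < d -> `|w x| <= 1.

Let k x := \1_(`]c, d[%classic) x * w x.

Let mk : measurable_fun `](0 : R), 1[ k.
Proof.
have mI := @measurable_itv R `]c, d[.
have -> : k = w \_ `]c, d[%classic.
  by apply/funext => x; rewrite /k patchE indicE; case: (_ \in _); rewrite ?mul1r ?mul0r.
apply: (@measurable_funS _ _ _ _ setT) => //.
by apply/(measurable_restrictT _ mI); exact: ucont_meas.
Qed.

Let kb x : 0 < x < 1 -> `|k x| <= 1.
Proof.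
move=> _; rewrite /k indicE mem_setE in_itv/=; case: (boolP (c < x < d)) => h; first by rewrite mul1r w1.
by rewrite mul0r normr0.
Qed.

Let E (f : R -> R) : itg c d (fun x => w x * f x) = itg 0 1 (fun x => k x * f x).
Proof. by rewrite itg_indic//; apply: itg_eq => x _; rewrite mulrA. Qed.

Lemma weight_L1 i : (i <= 1)%N -> L1 0 T (fun t => itg c d (fun x => w x * g i t x)).
Proof.
move=> i1; have [L _ _] := box_fubini (box_weighted (mg i1) (fg i1) (ucont_cst 0 T 1) mk kb).
by apply: L1_eq L => t _; rewrite E; apply: itg_eq => x _; rewrite mul1r.
Qed.

(** The weak derivative of the source is given for almost every [x]; multiplying by the weight,
    integrating in [x] and exchanging the integrals turns it into a scalar statement for the
    weighted averages. *)
Lemma weight_weak : weak_derivative 0 T (fun t => itg c d (fun x => w x * g 0%N t x))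
  (fun t => itg c d (fun x => w x * g 1%N t x)).
Proof.
move=> phi tphi; have A := test_function_AC tphi.
have cphi : ucont 0 T phi := AC_ucont A.
have cphi' : ucont 0 T (derive1 phi).
  by apply: derivable_ucont => x; have [H _] := tphi; exact: (H 1%N).
pose W (i : nat) (th : R -> R) t x := th t * (k x * g i t x).
have F i (th : R -> R) : (i <= 1)%N -> ucont 0 T th ->
    itg 0 T (fun t => itg c d (fun x => w x * g i t x) * th t) =
    itg 0 1 (fun x => itg 0 T ((W i th)^~ x)) /\ L1 0 1 (fun x => itg 0 T ((W i th)^~ x)).
  move=> i1 cth; have BW := box_weighted (mg i1) (fg i1) cth mk kb.
  have [L L' Eq] := box_fubini BW; split=> //; rewrite -Eq.
  apply: itg_ae_eq => //.
    by apply: L1_eq (L1M_ucont cth (weight_L1 i1)) => t _; rewrite mulrC.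
  apply: ae_mono (box_ae_L2 (mg i1) (fg i1)) => t Ht tT.
  rewrite E mulrC -itgZ//; have Lg := L2_L1 (Ht tT).
  apply: (L1_le _ _ (L1_abs Lg)); first by apply: measurable_funM => //; exact: L1_meas.
  by move=> x x01; rewrite normrM ler_piMl// kb.
have [E0 L0] := F 0%N _ isT cphi'; have [E1 L1'] := F 1%N _ isT cphi.
rewrite -!/(itg _ _ _) E0 E1 -itgN//; apply: itg_ae_eq => //; first exact: L1N.
have B0 := box_ae_L1 (box_weighted (mg (isT : (0 <= 1)%N)) (fg (isT : (0 <= 1)%N)) (ucont_cst 0 T 1) (measurable_cst (1 : R)) (K := 1) (fun x _ => _)).
have B1 := box_ae_L1 (box_weighted (mg (isT : (1 <= 1)%N)) (fg (isT : (1 <= 1)%N)) (ucont_cst 0 T 1) (measurable_cst (1 : R)) (K := 1) (fun x _ => _)).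
have n1 : `|1 : R| <= 1 by rewrite normr1.
apply: ae_mono (ae_and (ae_and (B0 _) (B1 _)) (hg.2 phi tphi)) => // x [[H0 H1] Hx] x01.
have G0 : L1 0 T (g 0%N ^~ x) by apply: L1_eq (H0 x01) => t _; rewrite !mul1r.
have G1 : L1 0 T (g 1%N ^~ x) by apply: L1_eq (H1 x01) => t _; rewrite !mul1r.
have := Hx; rewrite in_itv/= => /(_ x01); rewrite -!/(itg _ _ _) => Hw.
have P0 : itg 0 T ((W 0%N (derive1 phi))^~ x) = k x * itg 0 T (fun t => g 0%N t x * derive1 phi t).
  rewrite -itgZ; first by apply: itg_eq => t _; rewrite /W; ring.
  by apply: L1_eq (L1M_ucont cphi' G0) => t _; rewrite mulrC.
have P1 : itg 0 T ((W 1%N phi)^~ x) = k x * itg 0 T (fun t => g 1%N t x * phi t).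
  rewrite -itgZ; first by apply: itg_eq => t _; rewrite /W; ring.
  by apply: L1_eq (L1M_ucont cphi G1) => t _; rewrite mulrC.
by rewrite P0 P1 Hw mulrN.
Qed.

End Weight.

Section Node.
Variables (N j : nat).
Hypothesis jN : (1 <= j <= N)%N.
Let a0 : 0 <= node N j.-1 :> R. Proof. exact: node_ge0. Qed.
Let b0 : 0 <= node N j :> R. Proof. exact: node_ge0. Qed.
Let b1 : node N j <= 1 :> R. Proof. by apply: node_le1; case/andP: jN => _ /leqW. Qed.
Let c1 : node N j.+1 <= 1 :> R. Proof. by apply: node_le1; case/andP: jN. Qed.
Let j0 : (0 < j)%N. Proof. by case/andP: jN. Qed.
Let m1 : mesh N <= 1 :> R. Proof. exact: mesh_le1. Qed.

Let u1 : ucont (node N j.-1) (node N j) (fun x : R => x - node N j.-1).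
Proof. by apply: ucontD; [exact: AC_ucont (AC_id _ _)|exact: ucont_cst]. Qed.
Let u2 : ucont (node N j) (node N j.+1) (fun x : R => node N j.+1 - x).
Proof. by apply: ucontB; [exact: ucont_cst|exact: AC_ucont (AC_id _ _)]. Qed.
Let w1 (x : R) : node N j.-1 < x < node N j -> `|x - node N j.-1| <= 1.
Proof.
rewrite nodeP// => /andP[h1 h2]; have := m1; rewrite ger0_norm; last by lra.
lra.
Qed.
Let w2 (x : R) : node N j < x < node N j.+1 -> `|node N j.+1 - x| <= 1.
Proof.
rewrite nodeS// => /andP[h1 h2]; have := m1; rewrite ger0_norm; last by lra.
lra.
Qed.

Lemma havg_source_L1 i : (i <= 1)%N -> L1 0 T (fun t => havg N (g i t) j).
Proof.
by move=> i1; apply/L1Z/L1D; [exact: weight_L1 a0 b1 u1 w1 i i1|exact: weight_L1 b0 c1 u2 w2 i i1].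
Qed.

(** The averages of [g] have no reason to be continuous as given, being meaningful for almost every
    time only; the primitive property is therefore stated for a continuous representative [G]. *)
Lemma havg_source_AC (G : R -> R) : ucont 0 T G ->
  {ae mu, forall t : R, 0 < t < T -> G t = havg N (g 0%N t) j} ->
  AC 0 T G (fun t => havg N (g 1%N t) j).
Proof.
move=> cG GE; have L0 := havg_source_L1 (isT : (0 <= 1)%N).
apply: weak_derivative_AC => //; first exact: havg_source_L1.
move=> phi tphi; rewrite -!/(itg _ _ _).
have A := test_function_AC tphi; have cphi := AC_ucont A.
have cphi' : ucont 0 T (derive1 phi).
  by apply: derivable_ucont => x; have [H _] := tphi; exact: (H 1%N).
have I1 i := weight_L1 a0 b1 u1 w1 (i := i); have I2 i := weight_L1 b0 c1 u2 w2 (i := i).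
have D1 := weight_weak a0 b1 u1 w1 tphi; have D2 := weight_weak b0 c1 u2 w2 tphi.
rewrite -!/(itg _ _ _) in D1 D2.
have M (f th : R -> R) : L1 0 T f -> ucont 0 T th -> L1 0 T (fun t => f t * th t).
  by move=> Lf cth; apply: L1_eq (L1M_ucont cth Lf) => t _; rewrite mulrC.
have X i (th : R -> R) : (i <= 1)%N -> ucont 0 T th -> itg 0 T (fun t => havg N (g i t) j * th t) =
    (mesh N ^+ 2)^-1 * (itg 0 T (fun t => itg (node N j.-1) (node N j) (fun x => (x - node N j.-1) * g i t x) * th t) +
     itg 0 T (fun t => itg (node N j) (node N j.+1) (fun x => (node N j.+1 - x) * g i t x) * th t)).
  move=> i1 cth; rewrite -itgD; [|exact: M (I1 i i1) cth|exact: M (I2 i i1) cth].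
  rewrite -itgZ; last by apply: L1D; [exact: M (I1 i i1) cth|exact: M (I2 i i1) cth].
  by apply: itg_eq => t _; rewrite /havg -mulrA mulrDl.
transitivity (itg 0 T (fun t => havg N (g 0%N t) j * derive1 phi t)).
  apply: itg_ae_eq; [by apply: M => //; exact: ucont_L1|exact: M|].
  by apply: ae_mono GE => t Ht /Ht ->.
by rewrite !X// D1 D2; ring.
Qed.

End Node.

End Source.

Section VelocityConvergence.
Context {R : realType}.
Local Notation mu := (@lebesgue_measure R).

(** Test the dual norm with the affine interpolant of the error itself, rescaled by [c]. The pairing
    is [-c G^2] plus the kink correction [c / 8 (D^2 + X)]. As [D <= 2 G], the part in [D^2]
    consumes at most half of [c G^2], and [X] is controlled by the increments [Q] of cell averages.
    With [c = 1 / (2 G)] this reads [G / 2 <= Hm + G / 4 + Q / 8]. *)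
Lemma velocity_bound N (b : nat -> R) (y1 : nat -> R -> R) (Hm : R) :
  AC 0 1 (y1 0%N) (y1 1%N) -> L2 0 1 (y1 1%N) ->
  (Hm1_norm (fun phi => fun_Hm1 (ext_const N (laplacian_h N b)) phi - dxx_Hm1 y1 phi)%R <= Hm%:E)%E ->
  gradn N (unlift N (fun j => b j - y1 0%N (node N j))) <=
    4 * Hm + l2n N (fun j => cavg N (y1 1%N) j - cavg N (y1 1%N) j.-1) / 2.
Proof.
move=> Hy Ly HH; set e := fun j => b j - y1 0%N (node N j); set G := gradn N _.
set Q := l2n N _; have h0 := @mesh_gt0 R N; have hn : mesh N != 0 :> R by exact: lt0r_neq0.
have G0 : 0 <= G by exact: gradn_ge0.
have Q0 : 0 <= Q by exact: l2n_ge0.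
pose a j := laplacian_h N b j; pose u j := y1 0%N (node N j).
pose P psi := \sum_(1 <= j < N.+1) a j * (mesh N * psi j + mesh N ^+ 2 / 8 *
    ((psi j.+1 - psi j) / mesh N - (psi j.-1.+1 - psi j.-1) / mesh N)) +
  \sum_(0 <= j < N.+1) (psi j.+1 - psi j) / mesh N * (u j.+1 - u j).
have test (psi : nat -> R) : psi 0%N = 0 -> psi N.+1 = 0 -> gradn N psi <= 2^-1 -> `|P psi| <= Hm.
  move=> p0 pN pG; have [fH fn] := interp_H10 p0 pN pG.
  rewrite -lee_fin; apply: le_trans HH; apply: ereal_sup_ubound.
  exists (fun k => if k is 0%N then interp N psi else interp' N psi); first by split.
  rewrite /fun_Hm1 /dxx_Hm1 opprK; congr ((`|_|)%:E).
  exact: (@interp_pairing R N psi p0 a _ _ Hy Ly).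
pose c : R := if G == 0 then 0 else (2 * G)^-1.
have cG : c * G <= 2^-1.
  rewrite /c; case: eqVneq => [->|Gn]; first by rewrite mul0r invr_ge0.
  by rewrite invfM -mulrA mulVf// mulr1.
have c0 : 0 <= c by rewrite /c; case: eqVneq => // _; rewrite invr_ge0 mulr_ge0.
pose e' := unlift N e; pose d j := (e' j.+1 - e' j) / mesh N.
pose q j := (u j.+1 - u j) / mesh N.
have e0 : c * e' 0%N = 0 by rewrite /e' unlift0 mulr0.
have eN : c * e' N.+1 = 0 by rewrite /e' unliftN mulr0.
have := test (fun j => c * e' j) e0 eN.
rewrite gradnZ ger0_norm// => /(_ cG).
pose kap := e N.+1 - e 0%N.
pose D := l2n N (fun j => d j - d j.-1).
pose X := mesh N * \sum_(1 <= j < N.+1) (q j - q j.-1) * (d j - d j.-1).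
have dE j : b j.+1 - b j = mesh N * (d j + kap + q j).
  have := @unlift_slope R N e j; rewrite -/e' -/(d j) -/kap => H.
  rewrite -H /q /e /u; field; exact: hn.
have PE : P (fun j => c * e' j) = - (c * G ^+ 2) + c / 8 * (D ^+ 2 + X).
  have S1 : \sum_(1 <= j < N.+1) a j * (mesh N * (c * e' j)) =
      - \sum_(0 <= j < N.+1) (c * e' j.+1 - c * e' j) / mesh N * (b j.+1 - b j).
    have := @sum_by_parts R N (fun j => c * e' j) b e0 eN => H.
    transitivity ((mesh N)^-1 * \sum_(1 <= j < N.+1) c * e' j * (b j.+1 - 2 * b j + b j.-1)).
      rewrite mulr_sumr; apply: eq_bigr => j _; rewrite /a /laplacian_h; field; exact: hn.
    rewrite H mulrN mulr_sumr; congr (- _); apply: eq_bigr => j _; ring.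
  (* The boundary mismatch [kap] is a constant slope, hence orthogonal to the slopes of a function
     vanishing at both ends: it drops out of the main term. *)
  have S2 : \sum_(0 <= j < N.+1) d j = 0.
    rewrite -mulr_suml telescope_sumr// /e' unlift0 unliftN subrr mul0r//.
  have S3 : \sum_(1 <= j < N.+1) a j * (mesh N ^+ 2 / 8 * ((c * e' j.+1 - c * e' j) / mesh N -
      (c * e' j.-1.+1 - c * e' j.-1) / mesh N)) = c / 8 * (D ^+ 2 + X).
    rewrite /D l2n_sqr /X -mulrDr -big_split/= mulrA mulr_sumr; apply: eq_big_nat => j /andP[j1 jN].
    have aE : a j = (d j - d j.-1 + (q j - q j.-1)) / mesh N.
      have E1 := dE j; have E2 := dE j.-1; rewrite prednK// in E2.
      have -> : a j = ((b j.+1 - b j) - (b j - b j.-1)) / mesh N ^+ 2.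
        by rewrite /a /laplacian_h; congr (_ / _); ring.
      rewrite E1 E2; field; exact: hn.
    have dd : (c * e' j.+1 - c * e' j) / mesh N - (c * e' j.-1.+1 - c * e' j.-1) / mesh N =
      c * (d j - d j.-1) by rewrite /d; ring.
    rewrite dd aE; field; exact: hn.
  rewrite /P.
  have -> : \sum_(1 <= j < N.+1) a j * (mesh N * (c * e' j) + mesh N ^+ 2 / 8 *
      ((c * e' j.+1 - c * e' j) / mesh N - (c * e' j.-1.+1 - c * e' j.-1) / mesh N)) =
    \sum_(1 <= j < N.+1) a j * (mesh N * (c * e' j)) +
    \sum_(1 <= j < N.+1) a j * (mesh N ^+ 2 / 8 * ((c * e' j.+1 - c * e' j) / mesh N -
      (c * e' j.-1.+1 - c * e' j.-1) / mesh N)).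
    by rewrite -big_split/=; apply: eq_bigr => j _; rewrite mulrDr.
  rewrite S3 S1 addrAC; congr (_ + _).
  have -> : c * G ^+ 2 = \sum_(0 <= j < N.+1) c * mesh N * (d j ^+ 2 + kap * d j).
    rewrite -mulr_sumr big_split/= -mulr_sumr S2 mulr0 addr0 /G gradn_sqr mulrA.
    by congr (_ * _); apply: eq_bigr.
  rewrite -!sumrN -big_split/=; apply: eq_bigr => j _.
  have dj : (c * e' j.+1 - c * e' j) / mesh N = c * d j by rewrite /d; ring.
  have uj : u j.+1 - u j = mesh N * q j by rewrite /q; field; exact: hn.
  by rewrite dE dj uj; ring.
have Xle : `|X| <= Q * D.
  have := l2n_CS N (fun j => q j - q j.-1) (fun j => d j - d j.-1); rewrite -/X => /le_trans; apply.
  rewrite /D ler_wpM2r ?l2n_ge0// le_eqVlt; apply/orP; left; apply/eqP/l2n_eq => j /andP[j1 jN].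
  have qE i : (i <= N)%N -> q i = cavg N (y1 1%N) i by exact: cavgE.
  by rewrite !qE// (leq_trans (leq_pred _)).
have D2 : D ^+ 2 <= 4 * G ^+ 2.
  rewrite /D l2n_sqr /G gradn_sqr mulrCA ler_pM2l//.
  have T1 : \sum_(1 <= j < N.+1) (d j - d j.-1) ^+ 2 <= \sum_(1 <= j < N.+1) (2 * d j ^+ 2 + 2 * d j.-1 ^+ 2).
    by apply: ler_sum => j _; have := sqr_ge0 (d j + d j.-1); rewrite sqrrD sqrrB; lra.
  rewrite (le_trans T1)// big_split/= -!mulr_sumr.
  have T2 : \sum_(1 <= j < N.+1) d j ^+ 2 <= \sum_(0 <= j < N.+1) d j ^+ 2.
    by rewrite [leRHS]big_nat_recl//= big_add1/= lerDr sqr_ge0.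
  have T3 : \sum_(1 <= j < N.+1) d j.-1 ^+ 2 <= \sum_(0 <= j < N.+1) d j ^+ 2.
    by rewrite big_add1/= [leRHS]big_nat_recr//= lerDl sqr_ge0.
  rewrite -/(d _); move: T2 T3; move: (\sum_(1 <= j < N.+1) d j ^+ 2) (\sum_(1 <= j < N.+1) d j.-1 ^+ 2).
  by rewrite /d; move: (\sum_(0 <= j < N.+1) _) => *; lra.
have DG : D <= 2 * G.
  by rewrite -(@ler_pXn2r _ 2)// ?nnegrE ?l2n_ge0 ?mulr_ge0// exprMn (le_trans D2)//; lra.
move=> HP; have [Gz|Gn] := eqVneq G 0.
  by rewrite Gz addr_ge0 ?divr_ge0 ?mulr_ge0// (le_trans (normr_ge0 _) HP).
have cE : c = (2 * G)^-1 by rewrite /c (negbTE Gn).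
have L : - (P (fun j => c * e' j)) <= Hm by rewrite (le_trans _ HP)// -normrN ler_norm.
have X2 : X <= Q * (2 * G).
  by rewrite (le_trans (ler_norm _))// (le_trans Xle)// ler_wpM2l.
have U : c / 8 * (D ^+ 2 + X) <= c / 8 * (4 * G ^+ 2 + Q * (2 * G)).
  by rewrite ler_wpM2l ?divr_ge0// lerD.
have U2 : c / 8 * (4 * G ^+ 2 + Q * (2 * G)) = G / 4 + Q / 8 by rewrite cE; field.
have U3 : c * G ^+ 2 = G / 2 by rewrite cE; field.
rewrite U2 in U; rewrite PE U3 in L; move: (c / 8 * _) L U => *; lra.
Qed.

Lemma velocity_cvg (b : nat -> nat -> R) (y1 : nat -> R -> R) :
  AC 0 1 (y1 0%N) (y1 1%N) -> L2 0 1 (y1 1%N) ->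
  Hm1_norm (fun phi => fun_Hm1 (ext_const N (laplacian_h N (b N))) phi - dxx_Hm1 y1 phi)
      @[N --> \oo] --> 0%E ->
  vanish (fun N => `|b N 0%N - y1 0%N 0|) -> vanish (fun N => `|b N N.+1 - y1 0%N 1|) ->
  vanish (fun N => gradn N (fun j => b N j - y1 0%N (node N j))).
Proof.
move=> Hy Ly cv v0 v1.
pose Q N := l2n N (fun j => cavg N (y1 1%N) j - cavg N (y1 1%N) j.-1).
pose e N j := b N j - y1 0%N (node N j).
have vG : vanish (fun N => (gradn N (unlift N (e N)) - Q N / 2) / 4).
  apply: ecvg0_vanish cv => N; set x := Hm1_norm _.
  (* The dual norm is an extended real. The bound by every real majorant settles the finite case,
     the case of plus infinity is trivial, and minus infinity would put a real below itself minus
     1. *)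
  have K (Hm : R) : (x <= Hm%:E)%E -> (gradn N (unlift N (e N)) - Q N / 2) / 4 <= Hm.
    by move=> h; have := velocity_bound Hy Ly h; rewrite -/(e N) -/(Q N); lra.
  case: x K => [r| |] K; [by rewrite lee_fin; exact: K|exact: leey|].
  by exfalso; have := K ((gradn N (unlift N (e N)) - Q N / 2) / 4 - 1) (leNye _); lra.
have vQ := shift_cavg_cvg Ly.
have p4 : 0 <= 4 :> R by []. have p2 : 0 <= 2^-1 :> R by rewrite invr_ge0.
apply: vanish_leq (vanishD (vanishD (vanishZ p4 vG) (vanishZ p2 vQ)) (vanishD v1 v0)) _ => N.
have := @gradn_unlift R N (e N).
have -> : e N 0%N = b N 0%N - y1 0%N 0 by rewrite /e node0.
have -> : e N N.+1 = b N N.+1 - y1 0%N 1 by rewrite /e nodeN.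
rewrite -/(Q N) => H.
have := ler_normB (b N N.+1 - y1 0%N 1) (b N 0%N - y1 0%N 0).
rewrite -/(e N); lra.
Qed.

End VelocityConvergence.

Section SourceConvergence.
Context {R : realType}.
Local Notation mu := (@lebesgue_measure R).
Variables (T : R) (g : nat -> R -> R -> R) (i : nat) (gh : nat -> nat -> R -> R).
Hypotheses (T0 : 0 < T) (hg : W11L2 T g) (i1 : (i <= 1)%N).
Hypothesis Lgh : forall N j, (1 <= j <= N)%N -> L1 0 T (gh N j).
Hypothesis cvg_g : L1L2_norm T (fun t x => ext_const N (fun j => gh N j t) x - g i t x)
  @[N --> \oo] --> 0%E.

Let diff N t x := ext_const N (fun j => gh N j t) x - g i t x.
Let lam N t := l2n N (fun j => gh N j t - havg N (g i t) j).

Let mg : box_meas T (g i). Proof. by case: (hg.1 i i1). Qed.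
Let fg : (L1L2_norm T (g i) < +oo)%E. Proof. by case: (hg.1 i i1). Qed.

Lemma source_diff_meas N : box_meas T (diff N).
Proof.
apply: measurable_funB; last exact: mg.
have -> : (fun tx : measurableTypeR R * measurableTypeR R => ext_const N (fun j => gh N j tx.1) tx.2) =
   (fun tx => \sum_(j <- index_iota 1 N.+1) (if (1 <= j <= N)%N then gh N j tx.1 else 0) *
     \1_(`[(j%:R - 2^-1) * mesh N, (j%:R + 2^-1) * mesh N[%classic) tx.2).
  by apply/funext => tx; rewrite /ext_const; apply: eq_big_nat => j jN; rewrite jN.
apply: measurable_sum => j; apply: measurable_funM.
  case: (boolP (1 <= j <= N)%N) => jN; last exact: measurable_cst.
  apply: (@measurable_comp _ _ _ _ _ _ (`]0, T[%classic : set (measurableTypeR R)) (gh N j) _ (fst : measurableTypeR R * measurableTypeR R -> measurableTypeR R)) => //.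
  - by move=> _ [tx [h _] <-].
  - exact: (L1_meas (Lgh jN)).
  - exact: measurable_funS (measurable_fst).
apply: (measurableT_comp (measurable_indic _)); first exact: measurable_itv.
exact: measurable_funS (measurable_snd).
Qed.

Lemma lam_L1 N : L1 0 T (lam N).
Proof.
have La j : (1 <= j <= N)%N -> L1 0 T (fun t => gh N j t - havg N (g i t) j).
  by move=> jN; apply: L1B; [exact: Lgh|exact: havg_source_L1].
apply: (L1_le (g := fun t => \sum_(1 <= j < N.+1) `|gh N j t - havg N (g i t) j|)).
- apply: measurable_sqrt; apply: measurable_funM; first exact: measurable_cst.
  rewrite (_ : (fun t => _) = (fun t => \sum_(j <- index_iota 1 N.+1)
     (if (1 <= j <= N)%N then gh N j t - havg N (g i t) j else 0) ^+ 2)).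
    apply: measurable_sum => j; apply: measurable_funX.
    by case: (boolP (1 <= j <= N)%N) => jN; [exact: (L1_meas (La _ jN))|exact: measurable_cst].
  by apply/funext => t; apply: eq_big_nat => j jN; rewrite jN.
- by move=> t _; rewrite ger0_norm ?l2n_ge0// l2n_le_sum.
- by apply: L1_sum => j; rewrite mem_index_iota => jN _; apply: L1_abs; exact: La.
Qed.

Lemma source_cvg : vanish (fun N => itg 0 T (lam N)).
Proof.
have ae2 := box_ae_L2 mg fg.
have [Ln _] := box_L1_nL2 mg fg.
pose pN N t := nL2 0 1 (diff N t).
have mI : measurable (`]0, T[%classic : set (measurableTypeR R)) by exact: measurable_itv.
have mp N : measurable_fun `]0, T[ (pN N).
  have -> : pN N = fine \o (fun t => L2_norm 0 1 (diff N t)) by apply/funext => t; rewrite /pN nL2_fine.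
  by apply: (measurableT_comp (fine_measurable _)) => //; apply: L2_norm_meas; exact: source_diff_meas.
(* The part of [lam] not explained by the continuous norm [pN] is dominated by [3 nL2 (g i t)] and
   tends to 0 for almost every time, so dominated convergence applies; [pN] itself is integrable
   only once the assumed norm is finite. *)
pose rest N t := Num.max (lam N t - pN N t) 0.
have rest_ge0 N t : 0 <= rest N t by rewrite le_max lexx orbT.
have lam_le N t : lam N t <= pN N t + rest N t by rewrite addrC -lerBlDr le_max lexx.
have Lr N : L1 0 T (rest N).
  apply: (L1_le _ _ (lam_L1 N)).
    by apply: measurable_maxr; [apply: measurable_funB => //; exact: L1_meas (lam_L1 N)|exact: measurable_cst].
  move=> t _; rewrite ger0_norm// ge_max l2n_ge0 andbT gerBl; exact: nL2_ge0.
have bound N t : L2 0 1 (g i t) ->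
    rest N t <= nL2 0 1 (fun x => ext_const N (havg N (g i t)) x - g i t x).
  move=> Lg; rewrite ge_max nL2_ge0 andbT lerBlDl /lam -nL2_ext_const.
  have A1 := ext_const_L2 N (fun j => gh N j t) 0 1; have A2 := ext_const_L2 N (havg N (g i t)) 0 1.
  rewrite (@nL2_eq _ _ _ _ (fun x => ext_const N (fun j => gh N j t) x - ext_const N (havg N (g i t)) x)); last first.
    by move=> x _; rewrite ext_constB.
  rewrite (le_trans (nL2_triangle A1 Lg A2))// lerD2l -nL2N.
  by rewrite le_eqVlt; apply/orP; left; apply/eqP/nL2_eq => x _; rewrite opprB.
have vr : vanish (fun N => itg 0 T (fun t => `|rest N t|)).
  apply: (itg_dominated (G := fun t => 3 * nL2 0 1 (g i t))) => //; first exact: L1Z.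
    apply: ae_mono ae2 => t Ht tT N; have Lg := Ht tT; rewrite ger0_norm// (le_trans (bound N t Lg))//.
    rewrite (le_trans (nL2B (ext_const_L2 _ _ _ _) Lg))// nL2_ext_const.
    have := @l2n_havg_le R N _ Lg; lra.
  apply: ae_mono ae2 => t Ht tT; have Lg := Ht tT.
  apply: vanish_leq (ext_const_havg_cvg Lg) _ => N; rewrite ger0_norm//; exact: bound.
move=> e e0; have e2 : 0 < e / 2 by rewrite divr_gt0.
have [n1 Hr] := vr _ e2.
have /fine_cvgP[[n2 _ fin] /vanish_cvg Hv] := cvg_g; have [n3 H3] := Hv _ e2.
exists (maxn n1 (maxn n2 n3)) => N; rewrite !geq_max => /and3P[h1 h2 h3].
have fN : (L1L2_norm T (diff N) < +oo)%E by have := fin N h2; rewrite fin_numElt => /andP[].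
have [Lp Ep] := box_L1_nL2 (source_diff_meas N) fN.
have P2 : itg 0 T (pN N) <= e / 2.
  have -> : itg 0 T (pN N) = fine (L1L2_norm T (diff N)) by rewrite -Ep.
  exact: le_trans (ler_norm _) (H3 N h3).
have : itg 0 T (lam N) <= itg 0 T (pN N) + itg 0 T (fun t => `|rest N t|).
  rewrite -itgD//; last exact: L1_abs.
  apply: itg_le => //; [exact: lam_L1|by apply: L1D => //; exact: L1_abs|].
  by move=> t _; rewrite ger0_norm.
by have := Hr N h1; lra.
Qed.

End SourceConvergence.

(** * The continuous solution *)

Section LocalAverages.
Context {R : realType}.

Lemma lam_gt0 n : 0 < 1 - eps n :> R.
Proof. by move: (@eps_gt0 R n) (@eps_half R n); move: (eps n) => e *; lra. Qed.

Variable T : R.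
Hypothesis T0 : 0 < T.

(** Common form of [l2n] and [gradn], so that averages at the initial time are estimated once for
    both. *)
Let qn (h : R) (r : seq nat) (a : nat -> R) : R := Num.sqrt (h * \sum_(i <- r) a i ^+ 2).

Let tavg_loc n (h : R) (r : seq nat) (f : nat -> R -> R) (k d t : R) : 0 <= h -> 0 <= t <= T ->
  (forall i, i \in r -> L1 0 T (f i)) ->
  (forall s, 0 <= s <= T -> s <= t + eps n * T -> qn h r (fun i => f i s) <= k) ->
  qn h r (fun i => tavg T (eps n) (f i) t) <= k.
Proof.
move=> h0 tT Lf H; have e0 := @eps_gt0 R n; have e1 := @eps_half R n.
have [h1 h2 h3] := tavg_range T0 e0 e1 tT; have eT : 0 < eps n * T by rewrite mulr_gt0.
have sub i : i \in r -> L1 ((1 - eps n) * t) ((1 - eps n) * t + eps n * T) (f i).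
  by move=> /Lf; exact: L1_sub.
have st s : s < (1 - eps n) * t + eps n * T -> s <= t + eps n * T.
  move=> hs; rewrite (le_trans (ltW hs))// lerD2r ler_piMl//; first by case/andP: tT.
  by rewrite gerBl ltW.
have M := @sqrt_sum_itg_le R h r f _ _ (fun=> k) h0 h2 sub (L1_cst _ _ _) _.
have {}M : qn h r (fun i => itg ((1 - eps n) * t) ((1 - eps n) * t + eps n * T) (f i)) <= k * (eps n * T).
  have -> : k * (eps n * T) = itg ((1 - eps n) * t) ((1 - eps n) * t + eps n * T) (fun=> k).
    by rewrite itg_cst//; ring.
  apply: M => s /andP[s1 s2]; apply: H; last exact: st.
  by rewrite (le_trans h1 (ltW s1)) (le_trans (ltW s2) h3).
have -> : qn h r (fun i => tavg T (eps n) (f i) t) = (eps n * T)^-1 *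
    qn h r (fun i => itg ((1 - eps n) * t) ((1 - eps n) * t + eps n * T) (f i)).
  have E : (eps n * T)^-1 = Num.sqrt ((eps n * T)^-1 ^+ 2) by rewrite sqrtr_sqr ger0_norm// invr_ge0 ltW.
  rewrite [X in _ = X * _]E /qn /tavg -sqrtrM ?sqr_ge0//.
  congr Num.sqrt; rewrite [RHS]mulrCA; congr (_ * _); rewrite mulr_sumr; apply: eq_bigr => i _.
  exact: exprMn.
by rewrite mulrC ler_pdivrMr.
Qed.

Let tavg2_loc n (h : R) (r : seq nat) (f : nat -> R -> R) (k : R) : 0 <= h ->
  (forall i, i \in r -> L1 0 T (f i)) ->
  (forall s, 0 <= s <= T -> s <= 2 * (eps n * T) -> qn h r (fun i => f i s) <= k) ->
  qn h r (fun i => tavg2 T n (f i) 0) <= k.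
Proof.
move=> h0 Lf H; have z : 0 <= (0 : R) <= T by rewrite lexx ltW.
have Lt i : i \in r -> L1 0 T (tavg T (eps n) (f i)).
  by move=> /Lf Hf; exact/ucont_L1/(tavg_ucont T0 (eps_gt0 n) (eps_half n)).
apply: tavg_loc => // s sT s1; apply: tavg_loc => // x xT x1; apply: H => //.
by rewrite add0r in s1; move: s1 x1; move: (eps n * T) => *; lra.
Qed.

(** At [t = 0] two nested windows only see times up to [2 eps T], so smallness near the initial time
    is enough. *)
Lemma tavg2_l2n0 n N (f : nat -> R -> R) (k : R) :
  (forall j, (1 <= j <= N)%N -> L1 0 T (f j)) ->
  (forall s, 0 <= s <= T -> s <= 2 * (eps n * T) -> l2n N (fun j => f j s) <= k) ->
  l2n N (fun j => tavg2 T n (f j) 0) <= k.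
Proof.
move=> Lf H; apply: tavg2_loc => //; first exact/ltW/mesh_gt0.
by move=> j; rewrite mem_index_iota => jN; apply: Lf; rewrite -ltnS.
Qed.

Lemma tavg2_gradn0 n N (f : nat -> R -> R) (k : R) :
  (forall j, (j <= N.+1)%N -> L1 0 T (f j)) ->
  (forall s, 0 <= s <= T -> s <= 2 * (eps n * T) -> gradn N (fun j => f j s) <= k) ->
  gradn N (fun j => tavg2 T n (f j) 0) <= k.
Proof.
move=> Lf H; have z : 0 <= (0 : R) <= T by rewrite lexx ltW.
pose q j s := (f j.+1 s - f j s) / mesh N.
have -> : gradn N (fun j => tavg2 T n (f j) 0) = qn (mesh N) (index_iota 0 N.+1) (fun j => tavg2 T n (q j) 0).
  congr (Num.sqrt (_ * _)); apply: eq_big_nat => j /= jN; congr (_ ^+ 2).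
  have L1j := Lf _ (jN : (j.+1 <= N.+1)%N); have L0j := Lf _ (ltnW jN).
  have LL := L1B L1j L0j.
  rewrite -(tavg2B T0 n z L1j L0j).
  have e0 := @eps_gt0 R n; have e1 := @eps_half R n.
  have Z (f1 : R -> R) (s : R) : 0 <= s <= T -> L1 0 T f1 ->
      tavg T (eps n) (fun s => f1 s / mesh N) s = tavg T (eps n) f1 s / mesh N.
    move=> sT Lf1; rewrite -mulrC -(tavgZ T0 e0 e1 _ sT Lf1).
    by apply: (tavg_eq T0 e0 e1 sT) => x _; rewrite mulrC.
  rewrite /tavg2 -(Z _ _ z); last exact/ucont_L1/(tavg_ucont T0 e0 e1).
  by apply: (tavg_eq T0 e0 e1 z) => x /andP[x0 xT]; rewrite /q -Z ?(ltW x0) ?(ltW xT).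
apply: tavg2_loc => //; first exact/ltW/mesh_gt0.
move=> j; rewrite mem_index_iota => /= jN; apply: (L1_eq _ (L1Z (mesh N)^-1 (L1B (Lf _ (jN : (j.+1 <= N.+1)%N)) (Lf _ (ltnW jN))))).
by move=> s _; rewrite mulrC.
Qed.

(** The inner average of [f2] is a difference of [f1], and [(1 - eps)] times that difference is the
    derivative of the difference of [f]; the outer average therefore yields a second difference
    divided by [1 - eps]. *)
Lemma tavg2_second_diff n (f f1 f2 : R -> R) (t : R) : 0 <= t <= T ->
  ucont 0 T f1 -> AC 0 T f f1 -> AC 0 T f1 f2 ->
  tavg2 T n f2 t = (1 - eps n)^-1 * ((eps n * T) ^+ 2)^-1 * dlt T (eps n) (dlt T (eps n) f) t.
Proof.
move=> tT c1 H1 H2; have e0 := @eps_gt0 R n; have e1 := @eps_half R n.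
have l0 := lam_gt0 n.
have E : tavg2 T n f2 t = tavg T (eps n) (fun s => (eps n * T)^-1 * dlt T (eps n) f1 s) t.
  by apply: (tavg_eq T0 e0 e1 tT) => s /andP[s0 sT]; rewrite (tavg_deriv T0 e0 e1 _ H2)// !ltW.
have cd := dlt_ucont T0 e0 e1 c1.
rewrite E (tavgZ T0 e0 e1)//; last exact: ucont_L1.
have A := dlt_AC T0 e0 e1 c1 H1.
have := tavg_deriv T0 e0 e1 tT A; rewrite (tavgZ T0 e0 e1)//; last exact: ucont_L1.
move=> E2; have -> : tavg T (eps n) (dlt T (eps n) f1) t =
   (1 - eps n)^-1 * ((eps n * T)^-1 * dlt T (eps n) (dlt T (eps n) f) t).
  by rewrite -E2 mulrA mulVf ?mul1r// gt_eqF.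
by rewrite -exprVn; ring.
Qed.

(* If [u'] is the derivative of [u], then [moll1 n u] and [moll2 n u'] are the
   first two derivatives of [tavg2 T n u']. *)
Definition moll1 n (u : R -> R) t := (1 - eps n) * ((eps n * T) ^+ 2)^-1 * dlt T (eps n) (dlt T (eps n) u) t.
Definition moll2 n (u' : R -> R) t := (1 - eps n) ^+ 3 * ((eps n * T) ^+ 2)^-1 * dlt T (eps n) (dlt T (eps n) u') t.

Lemma moll_AC1 n (u u' : R -> R) : ucont 0 T u' -> AC 0 T u u' ->
  AC 0 T (tavg2 T n u') (moll1 n u).
Proof.
move=> c1 H1; have e0 := @eps_gt0 R n; have e1 := @eps_half R n.
have cd := dlt_ucont T0 e0 e1 (AC_ucont H1).
have A := ACZ (eps n * T)^-1 (tavg_AC T0 e0 e1 cd).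
apply: AC_eq (AC_eqd _ A) => t tT; last by rewrite /moll1 -exprVn; ring.
rewrite -(tavgZ T0 e0 e1)//; last exact: ucont_L1.
by apply: (tavg_eq T0 e0 e1 tT) => s /andP[s0 sT]; rewrite (tavg_deriv T0 e0 e1 _ H1)// !ltW.
Qed.

Lemma moll_AC2 n (u u' : R -> R) : ucont 0 T u' -> AC 0 T u u' ->
  AC 0 T (moll1 n u) (moll2 n u').
Proof.
move=> c1 H1; have e0 := @eps_gt0 R n; have e1 := @eps_half R n.
have cd := dlt_ucont T0 e0 e1 c1.
have A := dlt_AC T0 e0 e1 c1 H1.
have A2 := dlt_AC T0 e0 e1 (ucontZ (1 - eps n) cd) A.
apply: AC_eqd (ACZ ((1 - eps n) * ((eps n * T) ^+ 2)^-1) A2) => t _.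
rewrite /moll2 {1}/dlt -mulrBr -/(dlt T (eps n) (dlt T (eps n) u') t); ring.
Qed.

(** Averaging and differentiating commute only up to powers of [1 - eps]: both sides are multiples
    of the same second difference, with coefficients proportional to [1 - eps] and to its
    inverse. *)
Lemma moll1E n (u u1 u2 : R -> R) (t : R) : 0 <= t <= T ->
  ucont 0 T u1 -> AC 0 T u u1 -> AC 0 T u1 u2 ->
  moll1 n u t = (1 - eps n) ^+ 2 * tavg2 T n u2 t.
Proof.
move=> tT c1 H1 H2; rewrite (tavg2_second_diff n tT c1 H1 H2) /moll1.
have e0 := @eps_gt0 R n; have e1 := @eps_half R n.
have l0 : 1 - eps n != 0 := lt0r_neq0 (lam_gt0 n).
have T1 : T != 0 by rewrite gt_eqF.
have e2 : eps n != 0 := lt0r_neq0 e0.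
by field; rewrite l0 T1 e2.
Qed.

(** The window averages of [f1] and [f2] are both the same difference quotients of [f], and double
    averages converge in [L^2]; no differentiation theorem is involved. *)
Lemma AC_ae_unique (f f1 f2 : R -> R) : L2 0 T f1 -> L2 0 T f2 ->
  AC 0 T f f1 -> AC 0 T f f2 -> nL2 0 T (fun t => f1 t - f2 t) = 0.
Proof.
move=> L1f L2f H1 H2; have Ld := L2B L1f L2f.
apply/le_anti; rewrite nL2_ge0 andbT; apply/ler_addgt0Pl => e e0; rewrite addr0.
have [n Hn] := tavg2_cvg_L2 T0 Ld e0; have := Hn n (leqnn n).
rewrite (@nL2_eq R 0 T _ (fun t => - (f1 t - f2 t))) ?nL2N// => t /andP[t0 tT].
have ep := @eps_gt0 R n; have e1 := @eps_half R n.
have Z (s : R) : 0 <= s <= T -> tavg T (eps n) (fun s => f1 s - f2 s) s = 0.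
  move=> sT; rewrite (tavgB T0 ep e1 sT (L2_L1 L1f) (L2_L1 L2f)).
  by rewrite (tavg_deriv T0 ep e1 sT H1) (tavg_deriv T0 ep e1 sT H2) subrr.
have -> : tavg2 T n (fun s => f1 s - f2 s) t = 0.
  rewrite /tavg2 (tavg_eq T0 ep e1 (g := fun=> 0)) ?(tavg_cst T0 ep)// ?(ltW t0) ?(ltW tT)//.
  by move=> s /andP[s0 sT]; rewrite Z// !ltW.
by rewrite sub0r.
Qed.

End LocalAverages.

Section DerivativeLimit.
Context {R : realType}.

(** The classical [C^1] case. It receives the time derivatives of the solution, given in norm, once
    these are evaluated at a point or tested against a hat. *)
Lemma AC_of_quotients (a b : R) (f f' : R -> R) : a <= b -> ucont a b f' ->
  (forall t, a <= t <= b -> forall e : R, 0 < e -> exists2 d : R, 0 < d &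
     forall s, a <= s <= b -> s != t -> `|s - t| < d -> `|(f s - f t) / (s - t) - f' t| <= e) ->
  AC a b f f'.
Proof.
move=> ab cf' H.
have loc t : a <= t <= b -> forall e : R, 0 < e -> exists2 d : R, 0 < d &
    forall s, a <= s <= b -> `|s - t| < d -> `|f s - f t| < e.
  move=> tab e e0; have [d d0 Hd] := H t tab 1 ltr01.
  have k0 : 0 < `|f' t| + 1 by rewrite ltr_wpDl.
  exists (Num.min d (e / (`|f' t| + 1))); first by rewrite lt_min d0 divr_gt0.
  move=> s sab; rewrite lt_min => /andP[s1 s2].
  have [->|st] := eqVneq s t; first by rewrite subrr normr0.
  have st0 : s - t != 0 by rewrite subr_eq0.
  have Q : `|(f s - f t) / (s - t)| <= `|f' t| + 1.
    have -> : (f s - f t) / (s - t) = f' t + ((f s - f t) / (s - t) - f' t) by ring.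
    by rewrite (le_trans (ler_normD _ _))// lerD2l Hd.
  have -> : f s - f t = (f s - f t) / (s - t) * (s - t) by rewrite divfK.
  rewrite normrM (le_lt_trans (ler_wpM2r (normr_ge0 _) Q))//.
  by move: s2; rewrite ltr_pdivlMr// mulrC.
apply: AC_of_derive => //.
  apply: (segment_unif_cont (d := fun s t => `|f s - f t|)) => //.
  move=> s t u _ _ _; rewrite -(subrKA (f u)).
  by rewrite (le_trans (ler_normD _ _))// lerD2l distrC.
move=> t /andP[at_ tb]; have tab : a <= t <= b by rewrite !ltW.
have lim : (fun h : R => h^-1 *: (f (h *: 1 + t) - f t)) @ 0^' --> f' t.
  apply/cvgrPdist_le => e e0; have [d d0 Hd] := H t tab e e0.
  have m0 : 0 < Num.min d (Num.min (t - a) (b - t)) by rewrite !lt_min d0 !subr_gt0 at_ tb.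
  exists (Num.min d (Num.min (t - a) (b - t))) => //= h /=; rewrite sub0r normrN !lt_min => /and3P[h1 h2 h3] hn.
  have hE : h *: (1 : R) + t = t + h by rewrite /GRing.scale /= mulr1 addrC.
  rewrite distrC hE.
  have sab : a <= t + h <= b.
    have := ler_norm h; have := ler_norm (- h); rewrite normrN => *.
    by apply/andP; split; lra.
  have := Hd (t + h) sab; rewrite [t + h - t]addrC addKr => /(_ _ h1).
  rewrite [_ / h]mulrC; apply; first by rewrite -subr_eq0 [t + h - t]addrC addKr.
by apply: DeriveDef; [apply/cvg_ex; exists (f' t)|exact: cvg_lim lim].
Qed.

End DerivativeLimit.

(** * Point values and hat averages of the continuous solution *)

Section WaveSolution.
Context {R : realType}.
Local Notation mu := (@lebesgue_measure R).
Variables (T m : R) (p y0 y1 : R -> R) (g : nat -> R -> R -> R) (g0 g1 : nat -> R -> R).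
Variable y : nat -> nat -> R -> R -> R.
Hypothesis T0 : 0 < T.
Hypotheses (mp : measurable_fun `](0 : R), 1[ p) (pm : forall x, `|p x| <= m).
Hypothesis hg : W11L2 T g.
Hypothesis (hg0 : Sobolev 2 2%:E 0 T g0) (hg1 : Sobolev 2 2%:E 0 T g1).
Hypothesis sol : wave_solution T p y0 y1 (g 0%N) (g0 0%N) (g1 0%N) y.

Let in01 : (0 : R) < 1 := ltr01.

Lemma wave_L2 i k t : (i + k <= 2)%N -> 0 <= t <= T -> L2 0 1 (y i k t).
Proof.
move=> ik tT; have [S _ _ _ _] := sol.
have i2 : (i <= 2)%N by rewrite (leq_trans _ ik)// leq_addr.
have := S i t i2; rewrite in_itv/= => /(_ tT) H.
by apply: (Sobolev2_L2 H); rewrite leq_subRL.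
Qed.

Lemma wave_AC i k t : (i + k < 2)%N -> 0 <= t <= T -> AC 0 1 (y i k t) (y i k.+1 t).
Proof.
move=> ik tT; have [S _ _ _ _] := sol.
have i2 : (i <= 2)%N by rewrite ltnW// (leq_ltn_trans _ ik)// leq_addr.
have := S i t i2; rewrite in_itv/= => /(_ tT) H.
by apply: (Sobolev2_AC in01 H); rewrite ltn_subRL.
Qed.

Let near_within (P : R -> Prop) (t : R) : (\forall s \near within `[0, T] (nbhs t), P s) ->
  exists2 d : R, 0 < d & forall s, 0 <= s <= T -> `|s - t| < d -> P s.
Proof.
move=> [d /= d0 H]; exists d => // s sT st; apply: H => /=; first by rewrite distrC.
by rewrite in_itv.
Qed.

Let near_within' (P : R -> Prop) (t : R) : (\forall s \near within `[0, T] t^', P s) ->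
  exists2 d : R, 0 < d & forall s, 0 <= s <= T -> s != t -> `|s - t| < d -> P s.
Proof.
move=> [d /= d0 H]; exists d => // s sT st1 st; apply: H => //=; by rewrite distrC.
Qed.

Let ecvg0_eps (F : set_system R) {FF : Filter F} (x : R -> \bar R) : x @ F --> 0%E ->
  forall e : R, 0 < e -> \forall s \near F, (x s <= e%:E)%E.
Proof.
move=> /fine_cvgP[fin /cvgrPdist_le cv] e e0.
near=> s.
have fs : x s \is a fin_num by near: s.
have cs : `|0 - (fine \o x) s| <= e by near: s; exact: cv.
rewrite -(fineK fs) lee_fin (le_trans (ler_norm _))//.
by move: cs; rewrite sub0r normrN.
Unshelve. all: by end_near. Qed.

(** Heine-Cantor for functions of time with values in [L^2(0,1)], by [segment_unif_cont] with the
    norm of the difference as pseudo-distance. *)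
Lemma wave_cont i k : (i + k <= 2)%N -> forall e : R, 0 < e -> exists2 d : R, 0 < d &
  forall s t, 0 <= s <= T -> 0 <= t <= T -> `|s - t| < d -> nL2 0 1 (fun x => y i k s x - y i k t x) < e.
Proof.
move=> ik; have L t := @wave_L2 i k t ik.
apply: (segment_unif_cont (d := fun s t => nL2 0 1 (fun x => y i k s x - y i k t x))).
  move=> s t u sT tT uT; rewrite (le_trans (nL2_triangle (L s sT) (L u uT) (L t tT)))// lerD2l -nL2N.
  by rewrite le_eqVlt; apply/orP; left; apply/eqP/nL2_eq => x _; rewrite opprB.
move=> t tT e e0; have [_ C _ _ _] := sol.
have i2 : (i <= 2)%N by rewrite (leq_trans _ ik)// leq_addr.
have := C i t i2; rewrite in_itv/= => /(_ tT)/ecvg0_eps.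
have e2 : 0 < e / 2 by rewrite divr_gt0.
move=> /(_ (e / 2) e2)/near_within[d d0 H]; exists d => // s sT st.
have k2 : (k <= 2 - i)%N by rewrite leq_subRL.
have := le_trans (Hnorm_ge 0 1 (fun k x => y i k s x - y i k t x) k2) (H s sT st).
rewrite L2_normE; last by apply: L2B; exact: wave_L2.
by rewrite lee_fin => /le_lt_trans; apply; rewrite ltr_pdivrMr// ltr_pMr//; lra.
Qed.

Lemma wave_norm_ucont i k : (i + k <= 2)%N -> ucont 0 T (fun t => nL2 0 1 (y i k t)).
Proof.
move=> ik e e0; have [d d0 H] := wave_cont ik e0; exists d => // s t sT tT st.
apply: le_lt_trans (H s t sT tT st); have Ls := wave_L2 ik sT; have Lt := wave_L2 ik tT.
have A := nL2D (L2B Ls Lt) Lt; have B := nL2D (L2N (L2B Ls Lt)) Ls; rewrite nL2N in B.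
rewrite ler_norml; apply/andP; split.
  rewrite lerNl opprB lerBlDr.
  move: B; rewrite (@nL2_eq _ 0 1 _ (y i k t)); last by move=> x _; rewrite opprB subrK.
  by [].
move: A; rewrite (@nL2_eq _ 0 1 _ (y i k s)); last by move=> x _; rewrite subrK.
by rewrite lerBlDr.
Qed.

Lemma wave_bound i k : (i + k <= 2)%N -> exists2 M : R, 0 < M &
  forall t, 0 <= t <= T -> nL2 0 1 (y i k t) <= M.
Proof.
move=> ik; have [M M0 H] := ucont_bounded (wave_norm_ucont ik); exists M => // t tT.
by have := H t tT; rewrite ger0_norm// nL2_ge0.
Qed.

Lemma wave_diff i k (t : R) : (i + k < 2)%N -> 0 <= t <= T -> forall e : R, 0 < e -> exists2 d : R, 0 < d &
  forall s, 0 <= s <= T -> s != t -> `|s - t| < d ->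
   nL2 0 1 (fun x => (y i k s x - y i k t x) / (s - t) - y i.+1 k t x) <= e.
Proof.
move=> ik tT e e0; have [_ _ D _ _] := sol.
have i2 : (i < 2)%N by rewrite (leq_ltn_trans _ ik)// leq_addr.
have := D i t i2; rewrite in_itv/= => /(_ tT)/ecvg0_eps.
move=> /(_ e e0)/near_within'[d d0 H]; exists d => // s sT sn st.
have k2 : (k <= 2 - i.+1)%N by rewrite leq_subRL// addSn.
have := le_trans (Hnorm_ge 0 1 (fun k x => (y i k s x - y i k t x) / (s - t) - y i.+1 k t x) k2) (H s sT sn st).
rewrite L2_normE ?lee_fin//; apply: L2B; last by apply: wave_L2 => //; rewrite addSn.
apply: (L2_eq _ (L2Z (s - t)^-1 (L2B (wave_L2 (ltnW ik) sT) (wave_L2 (ltnW ik) tT)))).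
by move=> x _; rewrite mulrC.
Qed.

Lemma wave_point_ucont i (x : R) : (i < 2)%N -> 0 <= x <= 1 -> ucont 0 T (fun t => y i 0%N t x).
Proof.
move=> i2 x01 e e0; have e2 : 0 < e / 2 by rewrite divr_gt0.
have i0 : (i + 0 < 2)%N by rewrite addn0. have i1 : (i + 1 <= 2)%N by rewrite addn1.
have [d1 d10 H1] := wave_cont (ltnW i0) e2; have [d2 d20 H2] := wave_cont i1 e2.
exists (Num.min d1 d2); first by rewrite lt_min d10 d20.
move=> s t sT tT; rewrite lt_min => /andP[h1 h2].
have A := ACB (wave_AC i0 sT) (wave_AC i0 tT).
have L := L2B (wave_L2 i1 sT) (wave_L2 i1 tT).
have := @H1_sup R (fun k x => y i k s x - y i k t x) x A L x01.
move/le_lt_trans; apply; rewrite (splitr e) ltrD//; [exact: H1|exact: H2].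
Qed.

(** The difference quotients of [y] converge in [H^1(0,1)], hence at each point by [H1_sup]. The
    velocity is differentiable in time with values in [L^2] only, so its point values get no such
    statement. *)
Lemma wave_point_AC (x : R) : 0 <= x <= 1 -> AC 0 T (fun t => y 0%N 0%N t x) (fun t => y 1%N 0%N t x).
Proof.
move=> x01; apply: AC_of_quotients; first exact: ltW.
  exact: wave_point_ucont.
move=> t tT e e0; have e2 : 0 < e / 2 by rewrite divr_gt0.
have [d1 d10 H1] := @wave_diff 0 0 t isT tT _ e2; have [d2 d20 H2] := @wave_diff 0 1 t isT tT _ e2.
exists (Num.min d1 d2); first by rewrite lt_min d10 d20.
move=> s sT sn; rewrite lt_min => /andP[h1 h2].
have Z (f f' : R -> R) : AC 0 1 f f' -> AC 0 1 (fun x => f x / (s - t)) (fun x => f' x / (s - t)).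
  by move=> A; apply: AC_eq (AC_eqd _ (ACZ (s - t)^-1 A)) => z _; rewrite mulrC.
have A := ACB (Z _ _ (ACB (@wave_AC 0 0 s isT sT) (@wave_AC 0 0 t isT tT))) (@wave_AC 1 0 t isT tT).
have L : L2 0 1 (fun x => (y 0%N 1%N s x - y 0%N 1%N t x) / (s - t) - y 1%N 1%N t x).
  apply: L2B; last exact: wave_L2.
  apply: (L2_eq _ (L2Z (s - t)^-1 (L2B (@wave_L2 0 1 s isT sT) (@wave_L2 0 1 t isT tT)))) => z _.
  by rewrite mulrC.
have := @H1_sup R (fun k x => (y 0%N k s x - y 0%N k t x) / (s - t) - y 1%N k t x) x A L x01.
move/le_trans; apply; rewrite (splitr e) lerD//; [exact: H1|exact: H2].
Qed.

Lemma wave_slope_ucont : ucont 0 T (fun t => y 0%N 1%N t 1).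
Proof.
move=> e e0; have e2 : 0 < e / 2 by rewrite divr_gt0.
have [d1 d10 H1] := @wave_cont 0 1 isT _ e2; have [d2 d20 H2] := @wave_cont 0 2 isT _ e2.
exists (Num.min d1 d2); first by rewrite lt_min d10 d20.
move=> s t sT tT; rewrite lt_min => /andP[h1 h2].
have A := ACB (@wave_AC 0 1 s isT sT) (@wave_AC 0 1 t isT tT).
have L := L2B (@wave_L2 0 2 s isT sT) (@wave_L2 0 2 t isT tT).
have x01 : 0 <= (1 : R) <= 1 by rewrite ler01 lexx.
have := @H1_sup R (fun k x => y 0%N k.+1 s x - y 0%N k.+1 t x) 1 A L x01.
move/le_lt_trans; apply; rewrite (splitr e) ltrD//; [exact: H1|exact: H2].
Qed.

Section Averages.
Variables (N j : nat).
Hypothesis jN : (1 <= j <= N)%N.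

(** The constant blows up with the mesh, which is harmless: [N] is fixed here, and only continuity
    and differentiability in time are transferred from [L^2] norms to the average at one node. *)
Let havg_abs (f : R -> R) : L2 0 1 f -> `|havg N f j| <= 2 / Num.sqrt (mesh N) * nL2 0 1 f.
Proof.
move=> Lf; have h0 := @mesh_gt0 R N; have s0 : 0 < Num.sqrt (mesh N) :> R by rewrite sqrtr_gt0.
rewrite mulrAC ler_pdivlMr// (le_trans _ (l2n_havg_le N Lf))//.
have -> : `|havg N f j| * Num.sqrt (mesh N) = Num.sqrt (mesh N * havg N f j ^+ 2).
  by rewrite sqrtrM ?(ltW h0)// sqrtr_sqr mulrC.
rewrite ler_wsqrtr// ler_pM2l//.
have [j1 jN1] := andP jN.
rewrite (bigD1_seq j) ?mem_index_iota ?iota_uniq//= lerDl sumr_ge0// => i _; exact: sqr_ge0.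
Qed.

Section Weighted.
Variables (q : R -> R) (mq : R).
Hypotheses (mesq : measurable_fun `](0 : R), 1[ q) (qm : forall x, `|q x| <= mq).

Lemma weighted_L2 (f : R -> R) : L2 0 1 f ->
  L2 0 1 (fun x => q x * f x) /\ nL2 0 1 (fun x => q x * f x) <= mq * nL2 0 1 f.
Proof.
move=> Lf; have [mf If] := Lf; have mq0 : 0 <= mq by exact: le_trans (qm 0).
have Lqf : L2 0 1 (fun x => q x * f x).
  split; first exact: measurable_funM.
  apply: (L1_le _ _ (L1Z (mq ^+ 2) If)); first by apply: measurable_funX; exact: measurable_funM.
  move=> x x01; rewrite normrX normrM exprMn [`|f x| ^+ 2]real_normK ?num_real//.
  by rewrite ler_wpM2r ?sqr_ge0// lerXn2r ?nnegrE.
split=> //; rewrite -[mq]ger0_norm// -nL2Z//; apply: nL2_mono => //; first exact: L2Z.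
by move=> x x01; rewrite !normrM ler_wpM2r// (ger0_norm mq0).
Qed.

Let havgq_abs (f : R -> R) : L2 0 1 f ->
  `|havg N (fun x => q x * f x) j| <= 2 / Num.sqrt (mesh N) * (mq * nL2 0 1 f).
Proof.
move=> Lf; have [Lqf H] := weighted_L2 Lf; rewrite (le_trans (havg_abs Lqf))//.
by rewrite ler_wpM2l// divr_ge0// sqrtr_ge0.
Qed.

Let c0 : 0 < 2 / Num.sqrt (mesh N) * (mq + 1).
Proof.
by rewrite mulr_gt0 ?divr_gt0 ?sqrtr_gt0 ?mesh_gt0// ltr_wpDl// (le_trans (normr_ge0 _) (qm 0)).
Qed.

Let havgq_lt (f : R -> R) (e : R) : L2 0 1 f -> 0 < e ->
  nL2 0 1 f < e / (2 / Num.sqrt (mesh N) * (mq + 1)) -> `|havg N (fun x => q x * f x) j| < e.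
Proof.
move=> Lf e0; rewrite ltr_pdivlMr// mulrC => /(le_lt_trans _); apply.
rewrite (le_trans (havgq_abs Lf))// -[leRHS]mulrA ler_wpM2l ?divr_ge0 ?sqrtr_ge0//.
by rewrite mulrDl lerDl mul1r nL2_ge0.
Qed.

Let havgq_diff (f1 f2 : R -> R) : L2 0 1 f1 -> L2 0 1 f2 ->
  havg N (fun x => q x * f1 x) j - havg N (fun x => q x * f2 x) j = havg N (fun x => q x * (f1 x - f2 x)) j.
Proof.
move=> H1 H2; have [L1q _] := weighted_L2 H1; have [L2q _] := weighted_L2 H2.
rewrite -(havgB jN (L2_L1 L1q) (L2_L1 L2q)).
by congr (_ * (_ + _)); apply: itg_eq => x _; ring.
Qed.

Lemma wave_havgq_ucont i : (i <= 2)%N -> ucont 0 T (fun t => havg N (fun x => q x * y i 0%N t x) j).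
Proof.
move=> i2 e e0; have i0 : (i + 0 <= 2)%N by rewrite addn0.
have [d d0 H] := wave_cont i0 (divr_gt0 e0 c0); exists d => // s t sT tT st.
have Ls := wave_L2 i0 sT; have Lt := wave_L2 i0 tT.
by rewrite havgq_diff//; apply: havgq_lt => //; [exact: L2B|exact: H].
Qed.

Lemma wave_havgq_AC i : (i < 2)%N -> AC 0 T (fun t => havg N (fun x => q x * y i 0%N t x) j)
  (fun t => havg N (fun x => q x * y i.+1 0%N t x) j).
Proof.
move=> i2; apply: AC_of_quotients; [exact: ltW|exact: wave_havgq_ucont|].
move=> t tT e e0; have i0 : (i + 0 < 2)%N by rewrite addn0.
have i1 : (i.+1 + 0 <= 2)%N by rewrite addn0.
have ec : 0 < e / (2 / Num.sqrt (mesh N) * (mq + 1)) / 2 by rewrite !divr_gt0.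
have [d d0 H] := wave_diff i0 tT ec; exists d => // s sT sn st.
have Ls := wave_L2 (ltnW i0) sT; have Lt := wave_L2 (ltnW i0) tT; have L' := wave_L2 i1 tT.
have LB := L2B Ls Lt; have LZ := L2Z (s - t)^-1 LB; have [LqB _] := weighted_L2 LB.
rewrite havgq_diff// mulrC -(havgZ jN _ (L2_L1 LqB)).
rewrite (_ : havg N (fun x => (s - t)^-1 * (q x * (y i 0%N s x - y i 0%N t x))) j =
   havg N (fun x => q x * ((s - t)^-1 * (y i 0%N s x - y i 0%N t x))) j); last first.
  by congr (_ * (_ + _)); apply: itg_eq => x _; ring.
rewrite havgq_diff//; apply/ltW/havgq_lt => //; first exact: L2B.
rewrite (@nL2_eq _ 0 1 _ (fun x => (y i 0%N s x - y i 0%N t x) / (s - t) - y i.+1 0%N t x)); last first.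
  by move=> x _; rewrite mulrC.
rewrite (le_lt_trans (H s sT sn st))// ltr_pdivrMr// ltr_pMr ?divr_gt0//; lra.
Qed.

End Weighted.

Let one_le : forall x : R, `|(fun=> 1 : R) x| <= 1. Proof. by move=> x; rewrite normr1. Qed.

Let havg1 (f : R -> R) : havg N (fun x => 1 * f x) j = havg N f j.
Proof. by congr (_ * (_ + _)); apply: itg_eq => x _; rewrite mul1r. Qed.

Lemma wave_havg_ucont i : (i <= 2)%N -> ucont 0 T (fun t => havg N (y i 0%N t) j).
Proof.
move=> i2; apply: (ucont_eq _ (wave_havgq_ucont (q := fun=> 1) (measurable_cst _) one_le i2)).
by move=> t _; rewrite havg1.
Qed.

Lemma wave_havg_AC i : (i < 2)%N -> AC 0 T (fun t => havg N (y i 0%N t) j) (fun t => havg N (y i.+1 0%N t) j).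
Proof.
move=> i2; apply: (AC_eq _ (AC_eqd _ (wave_havgq_AC (q := fun=> 1) (measurable_cst _) one_le i2))).
  by move=> t _; rewrite havg1.
by move=> t _; rewrite havg1.
Qed.

(* The continuous representative of the average of the source. *)
Definition wave_source t := havg N (y 2%N 0%N t) j - laplacian_h N (fun l => y 0%N 0%N t (node N l)) j +
  havg N (fun x => p x * y 0%N 0%N t x) j.

Let lapE t : 0 <= t <= T -> laplacian_h N (fun l => y 0%N 0%N t (node N l)) j = havg N (y 0%N 2%N t) j.
Proof. by move=> tT; apply: havg_lap => //; exact: wave_AC. Qed.

Lemma wave_lap_AC : AC 0 T (fun t => laplacian_h N (fun l => y 0%N 0%N t (node N l)) j)
  (fun t => laplacian_h N (fun l => y 1%N 0%N t (node N l)) j).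
Proof.
have P l : (l <= N.+1)%N -> AC 0 T (fun t => y 0%N 0%N t (node N l)) (fun t => y 1%N 0%N t (node N l)).
  by move=> lN; apply: wave_point_AC; exact: node_in.
have [j1 jN1] := andP jN.
have A := ACZ (mesh N ^+ 2)^-1 (ACD (ACB (P _ (jN1 : (j.+1 <= N.+1)%N)) (ACZ 2 (P _ (leqW jN1))))
  (P _ (leq_trans (leq_pred j) (leqW jN1)))).
by apply: (AC_eq _ (AC_eqd _ A)) => t _; rewrite /laplacian_h mulrC.
Qed.

Lemma wave_source_ae : {ae mu, forall t : R, 0 < t < T -> wave_source t = havg N (g 0%N t) j}.
Proof.
have [_ _ _ E _] := sol.
have [mg fg] := hg.1 0%N isT.
apply: ae_mono (ae_and E (box_ae_L2 mg fg)) => t [Et Lg] tT.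
have tT' : 0 <= t <= T by case/andP: tT => *; rewrite !ltW.
have := Et; rewrite in_itv/= => /(_ tT) ex.
have L20 := @wave_L2 2 0 t isT tT'; have L02 := @wave_L2 0 2 t isT tT'.
have [Lp0 _] := weighted_L2 mp pm (@wave_L2 0 0 t isT tT').
have S := L2B L20 L02.
rewrite /wave_source lapE// -(havgB jN (L2_L1 L20) (L2_L1 L02)) -(havgD jN (L2_L1 S) (L2_L1 Lp0)).
apply: (havg_ae jN); [exact: L2_L1 (L2D S Lp0)|exact: L2_L1 (Lg tT)|].
by apply: ae_mono ex => x Ex x01; apply: Ex; rewrite in_itv.
Qed.

(** The average of [d_tt y] alone is only continuous in time; the equation makes this combination a
    representative of the averaged source, which inherits a derivative from [g]. *)
Lemma wave_source_AC : AC 0 T wave_source (fun t => havg N (g 1%N t) j).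
Proof.
apply: (havg_source_AC T0 hg jN) wave_source_ae.
apply: ucontD; last exact: wave_havgq_ucont.
by apply: ucontB; [exact: wave_havg_ucont|exact: AC_ucont wave_lap_AC].
Qed.

(** The hat average of the equation, differentiated in time and averaged twice. The third time
    derivative of [y], which does not exist as a function, is replaced by a second difference of the
    averages of [d_t y]. *)
Lemma wave_lap_deriv n t : 0 <= t <= T ->
  tavg2 T n (fun t => laplacian_h N (fun l => y 1%N 0%N t (node N l)) j) t =
  (1 - eps n)^-1 * ((eps n * T) ^+ 2)^-1 * dlt T (eps n) (dlt T (eps n) (fun t => havg N (y 1%N 0%N t) j)) t +
  tavg2 T n (fun t => havg N (fun x => p x * y 1%N 0%N t x) j) t - tavg2 T n (fun t => havg N (g 1%N t) j) t.
Proof.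
move=> tT; have e0 := @eps_gt0 R n; have e1 := @eps_half R n.
have A1 := wave_havg_AC (isT : (1 < 2)%N); have A0 := wave_havg_AC (isT : (0 < 2)%N).
have cA1 := wave_havg_ucont (isT : (1 <= 2)%N); have cA2 := wave_havg_ucont (isT : (2 <= 2)%N).
have Ap := wave_havgq_AC mp pm (isT : (0 < 2)%N).
have As := wave_source_AC; have Al := wave_lap_AC.
have e2 : eps n * T != 0 by rewrite lt0r_neq0// mulr_gt0.
have l0 := lt0r_neq0 (@lam_gt0 R n).
have D1 : tavg2 T n (fun t => laplacian_h N (fun l => y 1%N 0%N t (node N l)) j) t =
   tavg T (eps n) (fun s => (eps n * T)^-1 * (dlt T (eps n) (fun t => havg N (y 2%N 0%N t) j) s +
     dlt T (eps n) (fun t => havg N (fun x => p x * y 0%N 0%N t x) j) s - dlt T (eps n) wave_source s)) t.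
  apply: (tavg_eq T0 e0 e1 tT) => s /andP[s0 sT]; rewrite (tavg_deriv T0 e0 e1 _ Al) ?(ltW s0) ?(ltW sT)//.
  by rewrite /dlt /wave_source; ring.
rewrite D1.
have c2 := dlt_ucont T0 e0 e1 cA2.
have cp := dlt_ucont T0 e0 e1 (AC_ucont Ap); have cs := dlt_ucont T0 e0 e1 (AC_ucont As).
rewrite (tavgZ T0 e0 e1 _ tT); last by apply/ucont_L1/ucontB => //; exact: ucontD.
rewrite (tavgB T0 e0 e1 tT); [|exact/ucont_L1/ucontD|exact: ucont_L1].
have tavgD (f1 f2 : R -> R) : ucont 0 T f1 -> ucont 0 T f2 ->
    tavg T (eps n) (fun s => f1 s + f2 s) t = tavg T (eps n) f1 t + tavg T (eps n) f2 t.
  move=> k1 k2; have := tavgB T0 e0 e1 tT (ucont_L1 (ucontD k1 k2)) (ucont_L1 k2).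
  rewrite (tavg_eq T0 e0 e1 tT (g := f1)); last by move=> s _; rewrite addrK.
  by move=> ->; rewrite subrK.
rewrite tavgD//.
have B2 := tavg_deriv T0 e0 e1 tT (dlt_AC T0 e0 e1 cA2 A1).
rewrite (tavgZ T0 e0 e1 _ tT) in B2; last exact: ucont_L1.
have Bp : tavg2 T n (fun t => havg N (fun x => p x * y 1%N 0%N t x) j) t =
   (eps n * T)^-1 * tavg T (eps n) (dlt T (eps n) (fun t => havg N (fun x => p x * y 0%N 0%N t x) j)) t.
  rewrite -(tavgZ T0 e0 e1 _ tT); last exact: ucont_L1.
  by apply: (tavg_eq T0 e0 e1 tT) => s /andP[s0 sT]; rewrite (tavg_deriv T0 e0 e1 _ Ap)// !ltW.
have Bs : tavg2 T n (fun t => havg N (g 1%N t) j) t = (eps n * T)^-1 * tavg T (eps n) (dlt T (eps n) wave_source) t.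
  rewrite -(tavgZ T0 e0 e1 _ tT); last exact: ucont_L1.
  by apply: (tavg_eq T0 e0 e1 tT) => s /andP[s0 sT]; rewrite (tavg_deriv T0 e0 e1 _ As)// !ltW.
have B2' : tavg T (eps n) (dlt T (eps n) (fun t => havg N (y 2%N 0%N t) j)) t =
   (1 - eps n)^-1 * ((eps n * T)^-1 * dlt T (eps n) (dlt T (eps n) (fun t => havg N (y 1%N 0%N t) j)) t).
  by rewrite -B2 mulKf.
by rewrite Bp Bs B2' -exprVn; ring.
Qed.

End Averages.
End WaveSolution.

(** * Traces and the semi-discrete solution *)

Section TwoParameters.
Context {R : realType}.
Implicit Types x y : nat -> nat -> R.

(* Smallness for a first parameter large, then a second one large depending on it. *)
Definition vanish2 x := forall e : R, 0 < e -> exists n0, forall n, (n0 <= n)%N ->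
  exists N0, forall N, (N0 <= N)%N -> x n N <= e.

Lemma vanish2_le x y : vanish2 y -> (forall n, exists N0, forall N, (N0 <= N)%N -> x n N <= y n N) ->
  vanish2 x.
Proof.
move=> vy H e e0; have [n0 Hn] := vy e e0; exists n0 => n /Hn[N0 HN].
have [N1 H1] := H n; exists (maxn N0 N1) => N; rewrite geq_max => /andP[h0 h1].
by rewrite (le_trans (H1 N h1))// HN.
Qed.

Lemma vanish2D x y : vanish2 x -> vanish2 y -> vanish2 (fun n N => x n N + y n N).
Proof.
move=> vx vy e e0; have e2 : 0 < e / 2 by rewrite divr_gt0.
have [n1 H1] := vx _ e2; have [n2 H2] := vy _ e2; exists (maxn n1 n2) => n.
rewrite geq_max => /andP[/H1[N1 K1] /H2[N2 K2]]; exists (maxn N1 N2) => N.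
by rewrite geq_max => /andP[h1 h2]; rewrite (splitr e) lerD ?K1 ?K2.
Qed.

Lemma vanish2Z (k : R) x : 0 <= k -> vanish2 x -> vanish2 (fun n N => k * x n N).
Proof.
move=> k0 vx e e0; have k1 : 0 < k + 1 by rewrite ltr_wpDl.
have [n0 H] := vx _ (divr_gt0 e0 k1); exists n0 => n /H[N0 h]; exists N0 => N /h hN.
rewrite (le_trans (ler_wpM2l k0 hN))// mulrCA ler_piMr ?(ltW e0)//.
by rewrite ler_pdivrMr// mul1r lerDl.
Qed.

Lemma vanish2_1 (x : nat -> R) : vanish x -> vanish2 (fun n _ => x n).
Proof. by move=> vx e e0; have [n0 H] := vx e e0; exists n0 => n /H h; exists 0%N. Qed.

Lemma vanish2_2 x : (forall n, vanish (x n)) -> vanish2 x.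
Proof. by move=> vx e e0; exists 0%N => n _; exact: vx. Qed.

End TwoParameters.

Section Misc.
Context {R : realType}.
Local Notation mu := (@lebesgue_measure R).

Lemma AC_ae (a b : R) (f f1 f2 : R -> R) : AC a b f f1 -> L1 a b f2 ->
  {ae mu, forall t : R, a < t < b -> f1 t = f2 t} -> AC a b f f2.
Proof.
move=> [L1f Hf] L2f E; split=> // x /andP[ax xb]; rewrite Hf ?ax//; congr (_ + _).
apply: itg_ae_eq; [exact: L1_sub L1f|exact: L1_sub L2f|].
by apply: ae_mono E => t Et /andP[t1 t2]; apply: Et; rewrite t1 (lt_le_trans t2).
Qed.

Lemma itg_le_ae (a b : R) (f g : R -> R) : L1 a b f -> L1 a b g ->
  {ae mu, forall t : R, a < t < b -> f t <= g t} -> itg a b f <= itg a b g.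
Proof.
move=> Lf Lg H; have mf := L1_meas Lf; have mg := L1_meas Lg.
pose k t := Num.min (f t) (g t).
have Lk : L1 a b k.
  apply: (L1_le _ _ (L1D (L1_abs Lf) (L1_abs Lg))); first exact: measurable_minr.
  move=> t _; rewrite /k minEle; case: ifP => _; by [rewrite lerDl|rewrite lerDr].
rewrite (itg_ae_eq Lf Lk); first by apply: itg_le => // t _; rewrite ge_min lexx orbT.
by apply: ae_mono H => t Ht /Ht h; rewrite /k minEle h.
Qed.

Lemma l2n_L1 N (a b : R) (f : nat -> R -> R) : (forall j, (1 <= j <= N)%N -> L1 a b (f j)) ->
  L1 a b (fun t => l2n N (fun j => f j t)).
Proof.
move=> Lf; apply: (L1_le (g := fun t => \sum_(1 <= j < N.+1) `|f j t|)).
- apply: measurable_sqrt; apply: measurable_funM; first exact: measurable_cst.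
  rewrite (_ : (fun t => _) = (fun t => \sum_(j <- index_iota 1 N.+1)
     (if (1 <= j <= N)%N then f j t else 0) ^+ 2)).
    apply: measurable_sum => j; apply: measurable_funX.
    by case: (boolP (1 <= j <= N)%N) => jN; [exact: (L1_meas (Lf _ jN))|exact: measurable_cst].
  by apply/funext => t; apply: eq_big_nat => j jN; rewrite jN.
- by move=> t _; rewrite ger0_norm ?l2n_ge0// l2n_le_sum.
- by apply: L1_sum => j; rewrite mem_index_iota => jN _; apply: L1_abs; exact: Lf.
Qed.

(** The initial value differs from the value at time [t] by at most the integral of the derivative;
    averaging over [t] gives the trace bound. *)
Lemma l2n_initial_le (T : R) N (f f' : nat -> R -> R) : 0 < T ->
  (forall j, (1 <= j <= N)%N -> AC 0 T (f j) (f' j)) ->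
  l2n N (fun j => f j 0) <= T^-1 * itg 0 T (fun t => l2n N (fun j => f j t)) +
    itg 0 T (fun t => l2n N (fun j => f' j t)).
Proof.
move=> T0 A; have Lf j : (1 <= j <= N)%N -> L1 0 T (f j) by move=> /A/AC_ucont/ucont_L1.
have Lf' j : (1 <= j <= N)%N -> L1 0 T (f' j) by move=> /A[].
have Ln := l2n_L1 Lf; have Ln' := l2n_L1 Lf'.
set I := itg 0 T (fun t => l2n N (fun j => f' j t)).
have H t : 0 < t < T -> l2n N (fun j => f j 0) <= l2n N (fun j => f j t) + I.
  move=> /andP[t0 tT].
  rewrite (@l2n_eq _ _ _ (fun j => f j t - itg 0 t (f' j))); last first.
    move=> j /A[_ Hf]; rewrite (Hf t) ?(ltW t0) ?(ltW tT)//; ring.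
  rewrite (le_trans (l2nB _ _ _))// lerD2l (le_trans (@l2n_itg R N f' 0 t (fun t => l2n N (fun j => f' j t)) (ltW t0) _ _ _))//.
  - by move=> j jN; apply: L1_sub (Lf' j jN) => //; exact: ltW.
  - by apply: L1_sub Ln' => //; exact: ltW.
  by apply: itg_le_sub; rewrite ?(ltW t0) ?(ltW tT)// => s _; exact: l2n_ge0.
have K : l2n N (fun j => f j 0) * T <= itg 0 T (fun t => l2n N (fun j => f j t)) + I * T.
  have -> : l2n N (fun j => f j 0) * T = itg 0 T (fun=> l2n N (fun j => f j 0)).
    by rewrite itg_cst ?(ltW T0)// subr0.
  have -> : I * T = itg 0 T (fun=> I) by rewrite itg_cst ?(ltW T0)// subr0.
  rewrite -itgD//; last exact: L1_cst.
  by apply: itg_le; [exact: L1_cst|apply: L1D => //; exact: L1_cst|exact: H].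
by rewrite -(ler_pM2r T0) mulrDl mulrAC mulVf ?gt_eqF// mul1r.
Qed.

End Misc.

Section Semidiscrete.
Context {R : realType}.
Local Notation mu := (@lebesgue_measure R).
Variables (T : R) (N : nat) (p y0h y1h : nat -> R) (gh : nat -> nat -> R -> R).
Variables (g0h g1h : nat -> R -> R) (y : nat -> nat -> R -> R).
Hypothesis T0 : 0 < T.
Hypothesis hgh : forall j, (1 <= j <= N)%N -> AC 0 T (gh j 0%N) (gh j 1%N).
Hypotheses (hg0h : Sobolev 2 2%:E 0 T g0h) (hg1h : Sobolev 2 2%:E 0 T g1h).
Hypothesis sol : semidiscrete_solution T N p y0h y1h (fun j => gh j 0%N) (g0h 0%N) (g1h 0%N) y.

Lemma semi_AC j i : (j <= N.+1)%N -> (i < 2)%N -> AC 0 T (y j i) (y j i.+1).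
Proof. by move=> jN i2; have [S _ _ _ _] := sol; exact: Sobolev2_AC T0 (S j jN) i2. Qed.

Lemma semi_L2 j i : (j <= N.+1)%N -> (i <= 2)%N -> L2 0 T (y j i).
Proof. by move=> jN i2; have [S _ _ _ _] := sol; exact: Sobolev2_L2 (S j jN) i2. Qed.

Definition semi_acc j t := laplacian_h N (fun l => y l 0%N t) j - p j * y j 0%N t + gh j 0%N t.

(** A representative of [d_tt y_h]. At interior nodes the right-hand side of the equation is used
    because it is absolutely continuous and has an initial value; at the two boundary nodes only an
    [L^2] function of time is available. *)
Definition semi_vel' j := if (1 <= j <= N)%N then semi_acc j else y j 2%N.

Let lap_AC i j : (i < 2)%N -> (1 <= j <= N)%N ->
  AC 0 T (fun t => laplacian_h N (fun l => y l i t) j) (fun t => laplacian_h N (fun l => y l i.+1 t) j).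
Proof.
move=> i2 /andP[j1 jN].
have A := ACZ (mesh N ^+ 2)^-1 (ACD (ACB (semi_AC (jN : (j.+1 <= N.+1)%N) i2) (ACZ 2 (semi_AC (leqW jN) i2)))
  (semi_AC (leq_trans (leq_pred j) (leqW jN)) i2)).
by apply: (AC_eq _ (AC_eqd _ A)) => t _; rewrite /laplacian_h mulrC.
Qed.

Lemma semi_acc_AC j : (1 <= j <= N)%N -> AC 0 T (semi_acc j)
  (fun t => laplacian_h N (fun l => y l 1%N t) j - p j * y j 1%N t + gh j 1%N t).
Proof.
move=> jN; have jN1 : (j <= N.+1)%N by case/andP: jN => _ /leqW.
apply: ACD; last exact: hgh.
by apply: ACB; [exact: lap_AC|apply: ACZ; exact: semi_AC].
Qed.

Lemma semi_vel_AC j : (j <= N.+1)%N -> AC 0 T (y j 1%N) (semi_vel' j).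
Proof.
move=> jN; rewrite /semi_vel'; case: ifPn => jN1; last exact: semi_AC.
apply: AC_ae (semi_AC jN (isT : (1 < 2)%N)) _ _.
  exact: ucont_L1 (AC_ucont (semi_acc_AC jN1)).
have [_ E _ _ _] := sol; apply: ae_mono E => t Et tT.
have := Et; rewrite in_itv/= => /(_ tT j jN1); rewrite /semi_acc => <-; ring.
Qed.

Lemma semi_vel'_ae : {ae mu, forall t : R, 0 < t < T -> forall j, (1 <= j <= N)%N -> y j 2%N t = semi_vel' j t}.
Proof.
have [_ E _ _ _] := sol; apply: ae_mono E => t Et tT j jN.
have := Et; rewrite in_itv/= => /(_ tT j jN) E2; rewrite /semi_vel' jN /semi_acc -E2; ring.
Qed.

(** First derivatives agree at every time since both are continuous; second derivatives are
    determined up to a null set, so their agreement is expressed by an [L^2] norm. *)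
Let bdry (j : nat) (G : nat -> R -> R) : (j <= N.+1)%N -> Sobolev 2 2%:E 0 T G ->
  (forall t, t \in `[0, T] -> y j 0%N t = G 0%N t) ->
  (forall t, 0 <= t <= T -> y j 1%N t = G 1%N t) /\ nL2 0 T (fun t => y j 2%N t - G 2%N t) = 0.
Proof.
move=> jN SG E; have A0 := semi_AC jN (isT : (0 < 2)%N); have A1 := semi_AC jN (isT : (1 < 2)%N).
have B0 := Sobolev2_AC T0 SG (isT : (0 < 2)%N); have B1 := Sobolev2_AC T0 SG (isT : (1 < 2)%N).
have E' t : 0 <= t <= T -> y j 0%N t = G 0%N t by move=> tT; apply: E; rewrite in_itv.
have E1 : forall t, 0 <= t <= T -> y j 1%N t = G 1%N t.
  apply: (ucont_eq_of_itg T0 (AC_ucont A1) (AC_ucont B1)) => x xT.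
  have z : 0 <= (0 : R) <= T by rewrite lexx ltW.
  have := (A0.2 x xT); rewrite (E' x xT) (E' 0 z) (B0.2 x xT).
  by move=> /(congr1 (fun a => - G 0%N 0 + a)); rewrite !addKr.
split=> //; apply: (AC_ae_unique T0 (f := G 1%N)) => //.
- exact: semi_L2.
- exact: Sobolev2_L2 SG _.
- by apply: AC_eq A1.
Qed.

Lemma semi_left : (forall t, 0 <= t <= T -> y 0%N 1%N t = g0h 1%N t) /\
  nL2 0 T (fun t => y 0%N 2%N t - g0h 2%N t) = 0.
Proof. by have [_ _ E _ _] := sol; apply: bdry. Qed.

Lemma semi_right : (forall t, 0 <= t <= T -> y N.+1 1%N t = g1h 1%N t) /\
  nL2 0 T (fun t => y N.+1 2%N t - g1h 2%N t) = 0.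
Proof. by have [_ _ _ E _] := sol; apply: bdry. Qed.

Lemma semi_init0 j : (j <= N.+1)%N -> y j 0%N 0 = with_boundary N (g0h 0%N 0) y0h (g1h 0%N 0) j.
Proof.
have [_ _ El Er I] := sol; have z : (0 : R) \in `[0, T] by rewrite in_itv/= lexx ltW.
move=> jN; rewrite /with_boundary; case: eqVneq => [->|j0]; first exact: El.
case: eqVneq => [->|jN1]; first exact: Er.
by have [] := I j; [rewrite lt0n j0 -ltnS ltn_neqAle jN1|].
Qed.

Lemma semi_init1 j : (j <= N.+1)%N -> y j 1%N 0 = with_boundary N (g0h 1%N 0) y1h (g1h 1%N 0) j.
Proof.
have [_ _ _ _ I] := sol; have z : 0 <= (0 : R) <= T by rewrite lexx ltW.
move=> jN; rewrite /with_boundary; case: eqVneq => [->|j0]; first by case: semi_left => ->.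
case: eqVneq => [->|jN1]; first by case: semi_right => ->.
by have [] := I j; [rewrite lt0n j0 -ltnS ltn_neqAle jN1|].
Qed.

End Semidiscrete.

Section TimeAverageLinear.
Context {R : realType}.
Variable T : R.
Hypothesis T0 : 0 < T.
Local Notation e0 := (@eps_gt0 R _).
Local Notation e1 := (@eps_half R _).

Lemma tavg2_lin n (f g : R -> R) (k t : R) : 0 <= t <= T -> L1 0 T f -> L1 0 T g ->
  tavg2 T n (fun s => f s + k * g s) t = tavg2 T n f t + k * tavg2 T n g t.
Proof.
have H (f1 f2 : R -> R) (s : R) : 0 <= s <= T -> L1 0 T f1 -> L1 0 T f2 ->
    tavg T (eps n) (fun s => f1 s + k * f2 s) s = tavg T (eps n) f1 s + k * tavg T (eps n) f2 s.
  move=> sT L1f L2f; rewrite (tavg_eq T0 e0 e1 (g := fun s => f1 s - (- k) * f2 s) sT); last first.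
    by move=> x _; ring.
  rewrite (tavgB T0 e0 e1 sT L1f (L1Z (- k) L2f)) (tavgZ T0 e0 e1 (- k) sT L2f); ring.
have L1t (f1 : R -> R) : L1 0 T f1 -> L1 0 T (tavg T (eps n) f1).
  by move=> L1f; exact/ucont_L1/(tavg_ucont T0 e0 e1).
move=> tT Lf Lg; rewrite /tavg2 -(H _ _ t tT (L1t _ Lf) (L1t _ Lg)).
by apply: (tavg_eq T0 e0 e1 tT) => s /andP[s0 sT]; rewrite H// !ltW.
Qed.

Lemma tavg2_cst n (k t : R) : tavg2 T n (fun=> k) t = k.
Proof.
rewrite /tavg2 (_ : tavg T (eps n) (fun=> k) = fun=> k) ?(tavg_cst T0 e0)//.
by apply/funext => s; rewrite (tavg_cst T0 e0).
Qed.

Lemma tavg2_sum n (s : seq nat) (f : nat -> R -> R) (k : nat -> R) (t : R) : 0 <= t <= T ->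
  (forall i, i \in s -> L1 0 T (f i)) ->
  tavg2 T n (fun t => \sum_(i <- s) k i * f i t) t = \sum_(i <- s) k i * tavg2 T n (f i) t.
Proof.
move=> tT; elim: s => [|i s IH] H.
  rewrite big_nil (tavg2_eq T0 n (g := fun=> 0) tT) ?tavg2_cst// => x _; by rewrite big_nil.
have Hs j : j \in s -> L1 0 T (f j) by move=> js; apply: H; rewrite inE js orbT.
rewrite big_cons -IH// (tavg2_eq T0 n (g := fun x => \sum_(i <- s) k i * f i x + k i * f i x) tT); last first.
  by move=> x _; rewrite big_cons addrC.
rewrite tavg2_lin// 1?addrC//; last by apply: H; rewrite mem_head.
by apply: L1_sum => j js _; apply: L1Z; exact: Hs.
Qed.

Lemma tavg2_lap n N (f : nat -> R -> R) j (t : R) : 0 <= t <= T -> (1 <= j <= N)%N ->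
  (forall l, (l <= N.+1)%N -> L1 0 T (f l)) ->
  laplacian_h N (fun l => tavg2 T n (f l) t) j = tavg2 T n (fun s => laplacian_h N (fun l => f l s) j) t.
Proof.
move=> tT /andP[j1 jN] H; have c : (0 : R) <= 0 by [].
have La := H _ (jN : (j.+1 <= N.+1)%N); have Lb := H _ (leqW jN).
have Lc := H _ (leq_trans (leq_pred j) (leqW jN)).
rewrite (tavg2_eq T0 n (g := fun s => ((0 + (mesh N ^+ 2)^-1 * f j.+1 s) + (- 2 / mesh N ^+ 2) * f j s) +
  (mesh N ^+ 2)^-1 * f j.-1 s) tT); last by move=> s _; rewrite /laplacian_h; ring.
have L0 : L1 0 T (fun=> 0 : R) by exact: L1_cst.
rewrite tavg2_lin//; last by apply: L1D; [apply: L1D => //; exact: L1Z|exact: L1Z].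
rewrite tavg2_lin//; last by apply: L1D => //; exact: L1Z.
rewrite (tavg2_lin n _ tT L0 La) tavg2_cst /laplacian_h.
by move: (tavg2 T n (f j.+1) t) (tavg2 T n (f j) t) (tavg2 T n (f j.-1) t) (mesh N ^+ 2)^-1 => *; ring.
Qed.

Lemma ddlt_le n (f : R -> R) (k t : R) : 0 <= t <= T -> (forall s, 0 <= s <= T -> `|f s| <= k) ->
  `|dlt T (eps n) (dlt T (eps n) f) t| <= 4 * k.
Proof.
have H (f1 : R -> R) (k1 s : R) : (forall s, 0 <= s <= T -> `|f1 s| <= k1) -> 0 <= s <= T ->
    `|dlt T (eps n) f1 s| <= 2 * k1.
  move=> fk sT; have [a b c] := tavg_range T0 (@eps_gt0 R n) (@eps_half R n) sT.
  have F1 : `|f1 ((1 - eps n) * s + eps n * T)| <= k1 by apply: fk; rewrite c (le_trans a b).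
  have F2 : `|f1 ((1 - eps n) * s)| <= k1 by apply: fk; rewrite a (le_trans b c).
  by rewrite /dlt (le_trans (ler_normB _ _))// (le_trans (lerD F1 F2))// -mulr2n mulr_natl.
move=> tT fk; rewrite (_ : 4 = 2 * 2) -?mulrA; last by rewrite -natrM.
by apply: (H) => // s sT; apply: (H).
Qed.

Lemma ddltB n (f g : R -> R) t : dlt T (eps n) (dlt T (eps n) (fun s => f s - g s)) t =
  dlt T (eps n) (dlt T (eps n) f) t - dlt T (eps n) (dlt T (eps n) g) t.
Proof. by rewrite /dlt; ring. Qed.

(** The outer difference is the integral over a window of the derivative of the inner one, which
    gains the factor [eps T]. *)
Lemma ddlt_l2n n N (f f' : nat -> R -> R) (k t : R) : 0 <= t <= T ->
  (forall j, (1 <= j <= N)%N -> ucont 0 T (f' j) /\ AC 0 T (f j) (f' j)) ->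
  (forall s, 0 <= s <= T -> l2n N (fun j => dlt T (eps n) (f' j) s) <= k) ->
  l2n N (fun j => dlt T (eps n) (dlt T (eps n) (f j)) t) <= eps n * T * k.
Proof.
move=> tT A K; have ep := @eps_gt0 R n; have ep2 := @eps_half R n; have l0 := @lam_gt0 R n.
have l1 : 1 - eps n <= 1 :> R by rewrite gerBl ltW.
have [a b c] := tavg_range T0 ep ep2 tT.
set s1 := (1 - eps n) * t in a b c *.
have k0 : 0 <= k by apply: le_trans (K t tT); exact: l2n_ge0.
rewrite (@l2n_eq _ _ _ (fun j => itg s1 (s1 + eps n * T) (fun s => (1 - eps n) * dlt T (eps n) (f' j) s))); last first.
  move=> j jN; have [u' Af] := A j jN; have Ad := dlt_AC T0 ep ep2 u' Af.
  by rewrite {1}/dlt (AC_diff Ad a b c).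
rewrite (le_trans (@l2n_itg R N _ s1 (s1 + eps n * T) (fun=> k) b _ (L1_cst _ _ _) _))//.
- move=> j jN; have [u' Af] := A j jN; apply: (L1_sub a c).
  by apply: L1Z; exact/ucont_L1/(dlt_ucont T0 ep ep2).
- move=> s /andP[p q]; have sT : 0 <= s <= T by rewrite (le_trans a (ltW p)) (le_trans (ltW q) c).
  rewrite l2nZ gtr0_norm// (le_trans _ (K s sT))// ler_piMl//; exact: l2n_ge0.
by rewrite itg_cst// mulrC; set z := s1 + _ - _; have -> : z = eps n * T by rewrite /z; ring.
Qed.

End TimeAverageLinear.

Section Traces.
Context {R : realType}.

Lemma AC_derivative_unique (T : R) (f f1 k k1 : R -> R) : 0 < T ->
  AC 0 T f f1 -> AC 0 T k k1 -> ucont 0 T f1 -> ucont 0 T k1 ->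
  (forall t, 0 <= t <= T -> f t = k t) -> forall t, 0 <= t <= T -> f1 t = k1 t.
Proof.
move=> T0 A0 B0 uf uk E'; apply: (ucont_eq_of_itg T0 uf uk) => x xT.
have z : 0 <= (0 : R) <= T by rewrite lexx ltW.
have := (A0.2 x xT); rewrite (E' x xT) (E' 0 z) (B0.2 x xT).
by move=> /(congr1 (fun a => - k 0 + a)); rewrite !addKr.
Qed.

Lemma ucont_eq_closed (T : R) (f k : R -> R) : 0 < T -> ucont 0 T f -> ucont 0 T k ->
  (forall t, 0 < t < T -> f t = k t) -> forall t, 0 <= t <= T -> f t = k t.
Proof.
move=> T0 uf uk E; apply: (ucont_eq_of_itg T0 uf uk) => x /andP[_ xT].
by apply: itg_eq => t /andP[t0 tx]; apply: E; rewrite t0 (lt_le_trans tx xT).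
Qed.

Lemma initial_le (T : R) (f f' : R -> R) : 0 < T -> AC 0 T f f' -> L2 0 T f' ->
  `|f 0| <= T^-1 * (Num.sqrt T * nL2 0 T f) + Num.sqrt T * nL2 0 T f'.
Proof.
move=> T0 A L2f'; have T00 := ltW T0.
have L2f : L2 0 T f by exact: ucont_L2 (AC_ucont A).
have i1 := itg_abs_le_nL2 T00 L2f; have i2 := itg_abs_le_nL2 T00 L2f'.
move: i1 i2; rewrite subr0 => i1 i2.
set I := itg 0 T (fun x => `|f' x|) in i2.
have L1f := L1_abs (L2_L1 L2f); have L1f' := L1_abs (L2_L1 L2f').
have H t : 0 < t < T -> `|f 0| <= `|f t| + I.
  move=> /andP[t0 tT]; have -> : f 0 = f t - itg 0 t f'.
    by rewrite (A.2 t) ?(ltW t0) ?(ltW tT)//; ring.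
  rewrite (le_trans (ler_normB _ _))// lerD2l (le_trans (itg_abs (L1_sub (lexx 0) (ltW tT) (L2_L1 L2f'))))//.
  by apply: itg_le_sub; rewrite ?(ltW t0) ?(ltW tT).
have K : `|f 0| * T <= itg 0 T (fun t => `|f t|) + I * T.
  have -> : `|f 0| * T = itg 0 T (fun=> `|f 0|) by rewrite itg_cst// subr0.
  have -> : I * T = itg 0 T (fun=> I) by rewrite itg_cst// subr0.
  rewrite -itgD//; last exact: L1_cst.
  by apply: itg_le; [exact: L1_cst|apply: L1D => //; exact: L1_cst|exact: H].
have K2 : `|f 0| * T <= Num.sqrt T * nL2 0 T f + (Num.sqrt T * nL2 0 T f') * T.
  by apply: le_trans K _; apply: lerD => //; rewrite ler_pM2r.
rewrite -(ler_pM2r T0) mulrDl (mulrAC T^-1) mulVf ?gt_eqF// mul1r//.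
Qed.

Section Boundary.
Variables (T : R) (G : nat -> R -> R) (Gh : nat -> nat -> R -> R).
Hypotheses (T0 : 0 < T) (SG : Sobolev 2 2%:E 0 T G) (SGh : forall N, Sobolev 2 2%:E 0 T (Gh N)).
Hypothesis cv : Hnorm 2 0 T (fun i t => Gh N i t - G i t) @[N --> \oo] --> 0%E.

Lemma boundary_L2_cvg i : (i <= 2)%N -> vanish (fun N => nL2 0 T (fun t => Gh N i t - G i t)).
Proof.
move=> i2; apply: ecvg0_vanish cv => N.
have L : L2 0 T (fun t => Gh N i t - G i t).
  by apply: L2B; [exact: Sobolev2_L2 (SGh N) i2|exact: Sobolev2_L2 SG i2].
by rewrite -L2_normE//; exact: (@Hnorm_ge R 2 0 T (fun i t => Gh N i t - G i t) i i2).
Qed.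

Lemma boundary_initial_cvg i : (i < 2)%N -> vanish (fun N => `|Gh N i 0 - G i 0|).
Proof.
move=> i2.
have c1 : 0 <= Num.sqrt T by exact: sqrtr_ge0.
have c2 : 0 <= T^-1 * Num.sqrt T by rewrite mulr_ge0 ?invr_ge0 ?(ltW T0).
apply: vanish_leq (vanishD (vanishZ c2 (boundary_L2_cvg (ltnW i2))) (vanishZ c1 (boundary_L2_cvg i2))) _.
move=> N; rewrite -mulrA.
apply: (@initial_le T (fun t => Gh N i t - G i t) (fun t => Gh N i.+1 t - G i.+1 t)) => //.
  by apply: ACB; [exact: Sobolev2_AC T0 (SGh N) i2|exact: Sobolev2_AC T0 SG i2].
by apply: L2B; [exact: Sobolev2_L2 (SGh N) i2|exact: Sobolev2_L2 SG i2].
Qed.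

(** [z] is [d_tt y_h] at an end point and [u] the trace of [y] there. Both are compared with the
    second derivative of the boundary datum: [z] through convergence of the data, [moll1] of [u]
    because it is [(1 - eps)^2] times an average of that derivative. *)
Lemma boundary_velocity_cvg (z : nat -> R -> R) (u u1 : R -> R) :
  (forall N, L2 0 T (z N)) -> (forall N, nL2 0 T (fun t => z N t - Gh N 2%N t) = 0) ->
  ucont 0 T u1 -> AC 0 T u u1 -> AC 0 T u1 (G 2%N) ->
  vanish2 (fun n N => nL2 0 T (fun t => z N t - moll1 T n u t)).
Proof.
move=> Lz z0 cu A0 A1.
have LG : L2 0 T (G 2%N) by exact: Sobolev2_L2 SG _.
have Lt n : L2 0 T (tavg2 T n (G 2%N)) by apply: ucont_L2; apply: tavg2_ucont => //; exact: L2_L1.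
have v1 : vanish2 (fun n N => nL2 0 T (fun t => Gh N 2%N t - G 2%N t)).
  by apply: vanish2_2 => _; exact: boundary_L2_cvg.
have v2 := vanish2_1 (tavg2_cvg_L2 T0 LG).
have v3 := vanish2_1 (vanishZ (_ : 0 <= 8 * nL2 0 T (G 2%N)) vanish_eps).
have c3 : 0 <= 8 * nL2 0 T (G 2%N) by rewrite mulr_ge0// nL2_ge0.
apply: vanish2_le (vanish2D (vanish2D v1 v2) (v3 c3)) _ => n; exists 0%N => N _.
have ep := @eps_gt0 R n; have ep2 := @eps_half R n.
have LGh : L2 0 T (Gh N 2%N) by exact: Sobolev2_L2 (SGh N) _.
set c := (1 - eps n) ^+ 2 : R.
rewrite (@nL2_eq _ 0 T _ (fun t => z N t - c * tavg2 T n (G 2%N) t)); last first.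
  by move=> t /andP[t0 tT]; rewrite (moll1E T0 n _ cu A0 A1)// !ltW.
have Lc : L2 0 T (fun t => c * tavg2 T n (G 2%N) t) by exact: L2Z.
rewrite (le_trans (nL2_triangle (Lz N) LGh Lc))// z0 add0r.
rewrite (le_trans (nL2_triangle LGh LG Lc))// -addrA lerD2l.
rewrite (le_trans (nL2_triangle LG (Lt n) Lc))//.
rewrite -nL2N (@nL2_eq _ 0 T _ (fun t => tavg2 T n (G 2%N) t - G 2%N t)); last by move=> t _; ring.
rewrite lerD2l (@nL2_eq _ 0 T _ (fun t => (1 - c) * tavg2 T n (G 2%N) t)); last by move=> t _; ring.
rewrite nL2Z//.
have L1t : L1 0 T (tavg T (eps n) (G 2%N)) by exact/ucont_L1/(tavg_ucont T0 ep ep2)/L2_L1.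
have n4 : nL2 0 T (tavg2 T n (G 2%N)) <= 4 * nL2 0 T (G 2%N).
  rewrite /tavg2 (le_trans (nL2_tavg_le T0 ep ep2 _))//.
    exact/ucont_L2/(tavg_ucont T0 ep ep2)/L2_L1.
  have := nL2_tavg_le T0 ep ep2 LG; move: (nL2 0 T _) (nL2 0 T _) => *; lra.
(* From [1 - (1 - eps)^2 = eps (2 - eps)]; with the factor 4 for two averages this gives the 8 in
   [v3]. *)
have c1 : `|1 - c| <= 2 * eps n.
  rewrite /c (_ : 1 - (1 - eps n) ^+ 2 = eps n * (2 - eps n)); last ring.
  by rewrite ger0_norm; move: (eps n) ep ep2 => e *; nra.
rewrite (le_trans (ler_pM _ _ c1 n4))// ?nL2_ge0//.
by rewrite le_eqVlt; apply/orP; left; apply/eqP; ring.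
Qed.

End Boundary.
End Traces.

Section SourceAverages.
Context {R : realType}.

Lemma havg_sum N j (s : seq nat) (f : nat -> R -> R) (k : nat -> R) : (1 <= j <= N)%N ->
  (forall i, i \in s -> L1 0 1 (f i)) ->
  havg N (fun x => \sum_(i <- s) k i * f i x) j = \sum_(i <- s) k i * havg N (f i) j.
Proof.
move=> jN; elim: s => [|i s IH] H.
  rewrite big_nil (_ : (fun=> _) = fun=> 0) ?havg_cst//; by apply/funext => x; rewrite big_nil.
have Hs l : l \in s -> L1 0 1 (f l) by move=> ls; apply: H; rewrite inE ls orbT.
have Hi : L1 0 1 (f i) by apply: H; rewrite mem_head.
rewrite big_cons -IH// -havgZ// -havgD//; last 2 first.
- exact: L1Z.
- by apply: L1_sum => l ls _; apply: L1Z; exact: Hs.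
by congr (havg _ _ _); apply/funext => x; rewrite big_cons.
Qed.

Lemma indic_L1 (c d a b : R) : L1 a b (\1_(`[c, d[%classic) : R -> R).
Proof.
apply: (@L1_bounded _ _ _ _ 1).
  apply: (measurable_funS _ (@subsetT _ _)) => //; exact: measurable_indic.
by move=> x _; rewrite indicE; case: (_ \in _); rewrite ?normr1 ?normr0.
Qed.

Variables (T : R) (g : R -> R -> R) (gh : nat -> nat -> R -> R).
Hypotheses (T0 : 0 < T) (mg : box_meas T g) (fg : (L1L2_norm T g < +oo)%E).
Hypothesis Lgh : forall N j, (1 <= j <= N)%N -> L1 0 T (gh N j).
Hypothesis Lhg : forall N j, (1 <= j <= N)%N -> L1 0 T (fun t => havg N (g t) j).
Hypothesis mdiff : forall N, box_meas T (fun t x => ext_const N (fun j => gh N j t) x - g t x).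
Hypothesis cvg_g : L1L2_norm T (fun t x => ext_const N (fun j => gh N j t) x - g t x)
  @[N --> \oo] --> 0%E.

(* Comparing with one fixed piecewise constant source makes [n0] independent of [N]. *)
Lemma source_tavg_cvg (eta : R) : 0 < eta -> exists n0, forall n, (n0 <= n)%N -> forall N,
  itg 0 T (fun t => l2n N (fun j => havg N (g t) j - tavg2 T n (fun s => havg N (g s) j) t)) <= eta.
Proof.
move=> eta0.
(* Budget: with [D] the integrated source error below [eta / 20], the hat averages cost [2 D], their
   double time average [4 * 2 D], together at most [eta / 2]; the other half pays for the averaging
   error of the fixed source. *)
have [M HM] : exists M, (L1L2_norm T (fun t x => ext_const M (fun j => gh M j t) x - g t x)%R < (eta / 20)%:E)%E.
  have e20 : 0 < eta / 20 by rewrite divr_gt0.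
  have /fine_cvgP[F C] := cvg_g.
  move/cvgrPdist_lt: C => /(_ _ e20) [n1 _ H1]; case: F => n2 _ H2.
  exists (maxn n1 n2); have := H1 (maxn n1 n2); have := H2 (maxn n1 n2).
  rewrite /= leq_maxl leq_maxr => /(_ isT) f /(_ isT); rewrite sub0r normrN => l.
  by rewrite -(fineK f) lte_fin (le_lt_trans (ler_norm _) l).
set df := (fun t x => _) in HM.
have fdf : (L1L2_norm T df < +oo)%E := lt_le_trans HM (leey _).
have [Ldf Edf] := box_L1_nL2 (mdiff M) fdf.
move: HM; rewrite -/df -Edf lte_fin => HM.
(* For the fixed source the averaging error involves only these [M] scalar functions of time, so it
   is small for large [n] whatever the grid on which hat averages are taken. *)
pose a n i t := gh M i t - tavg2 T n (gh M i) t.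
have v : vanish (fun n => \sum_(1 <= i < M.+1) itg 0 T (fun t => `|a n i t|)).
  have : forall i, i \in index_iota 1 M.+1 -> vanish (fun n => itg 0 T (fun t => `|a n i t|)).
    move=> i; rewrite mem_index_iota ltnS => iM.
    apply: vanish_leq (tavg2_cvg_L1 T0 (Lgh iM)) _ => n.
    by rewrite (@itg_eq _ _ _ _ (fun t => `|tavg2 T n (gh M i) t - gh M i t|))// => t _; rewrite distrC.
  elim: (index_iota 1 M.+1) => [|i s IH] H.
    by apply: vanish_leq vanish0 _ => n; rewrite big_nil.
  apply: vanish_leq (vanishD (H i (mem_head _ _)) (IH _)) _ => [j js|n]; last by rewrite big_cons.
  by apply: H; rewrite inE js orbT.
have [|n0 H0] := v (eta / 4); first by rewrite divr_gt0.
exists n0 => n /H0 Hn N.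
pose I i : R -> R := \1_(`[(i%:R - 2^-1) * mesh M, (i%:R + 2^-1) * mesh M[%classic).
have La i : (1 <= i <= M)%N -> L1 0 T (a n i).
  move=> iM; apply: L1B; first exact: Lgh.
  by apply: ucont_L1; apply: tavg2_ucont => //; exact: Lgh.
have extE (b : nat -> R) x : ext_const M b x = \sum_(i <- index_iota 1 M.+1) b i * I i x by [].
have hE (b : nat -> R) j : (1 <= j <= N)%N ->
    havg N (ext_const M b) j = \sum_(i <- index_iota 1 M.+1) b i * havg N (I i) j.
  move=> jN; rewrite -havg_sum//; last by move=> i _; exact: indic_L1.
pose G t j := havg N (ext_const M (fun i => gh M i t)) j.
have LG j : (1 <= j <= N)%N -> L1 0 T (G^~ j).
  move=> jN; apply: (@L1_eq _ _ _ (fun t => \sum_(i <- index_iota 1 M.+1) havg N (I i) j * gh M i t)).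
    by move=> t _; rewrite /G hE//; apply: eq_bigr => i _; rewrite mulrC.
  by apply: L1_sum => i; rewrite mem_index_iota ltnS => iM _; apply: L1Z; exact: Lgh.
have Gt j t : (1 <= j <= N)%N -> 0 < t < T ->
    G t j - tavg2 T n (G^~ j) t = havg N (ext_const M (fun i => a n i t)) j.
  move=> jN /andP[t0 tT]; have tT' : 0 <= t <= T by rewrite !ltW.
  rewrite (tavg2_eq T0 n (g := fun t => \sum_(i <- index_iota 1 M.+1) havg N (I i) j * gh M i t) tT'); last first.
    by move=> s _; rewrite /G hE//; apply: eq_bigr => i _; rewrite mulrC.
  rewrite tavg2_sum//; last by move=> i; rewrite mem_index_iota ltnS; exact: Lgh.
  rewrite /G !hE// -sumrB; apply: eq_bigr => i _; rewrite /a; ring.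
pose d j t := G t j - havg N (g t) j.
have Ld j : (1 <= j <= N)%N -> L1 0 T (d j) by move=> jN; apply: L1B; [exact: LG|exact: Lhg].
pose Psi t := l2n N (fun j => d j t).
have LPsi : L1 0 T Psi by exact: l2n_L1.
have [Lt2 It2 Pt2] := tavg2_l2n_itg T0 n Ld LPsi (fun s _ => lexx _).
have IPsi : itg 0 T Psi <= 2 * (eta / 20).
  rewrite (le_trans (itg_le_ae LPsi (L1Z 2 Ldf) _))//; last by rewrite itgZ// ler_pM2l// ltW.
  apply: ae_mono (box_ae_L2 (mdiff M) fdf) => t Ht tT; have L2d := Ht tT.
  rewrite (le_trans _ (l2n_havg_le N L2d))// le_eqVlt; apply/orP; left; apply/eqP/l2n_eq => j jN.
  have Le := L2_L1 (ext_const_L2 M (fun i => gh M i t) 0 1).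
  have Lg : L1 0 1 (g t).
    by apply: L1_eq (L1B Le (L2_L1 L2d)) => x _; rewrite /df; ring.
  by rewrite /d /G -havgB.
have LA : L1 0 T (fun t => \sum_(1 <= i < M.+1) `|a n i t|).
  by apply: L1_sum => i; rewrite mem_index_iota ltnS => iM _; exact/L1_abs/La.
have IA : itg 0 T (fun t => \sum_(1 <= i < M.+1) `|a n i t|) <= eta / 4.
  by rewrite itg_sum// => i; rewrite mem_index_iota ltnS => iM _; exact/L1_abs/La.
have Lres j : (1 <= j <= N)%N -> L1 0 T (fun t => havg N (g t) j - tavg2 T n (fun s => havg N (g s) j) t).
  move=> jN; apply: L1B; first exact: Lhg.
  by apply: ucont_L1; apply: tavg2_ucont => //; exact: Lhg.
have -> : eta = 2 * (eta / 4) + (2 * (eta / 20) + 4 * (2 * (eta / 20))) by field.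
apply: (@le_trans _ _ (itg 0 T (fun t => 2 * (\sum_(1 <= i < M.+1) `|a n i t|) + (Psi t + tavg2 T n Psi t)))).
  apply: itg_le; first exact: l2n_L1.
    by apply: L1D; [exact: L1Z|exact: L1D].
  move=> t tT; have tT' : 0 <= t <= T by case/andP: tT => *; rewrite !ltW.
  rewrite (@l2n_eq _ _ _ (fun j => havg N (ext_const M (fun i => a n i t)) j - (d j t - tavg2 T n (d j) t))); last first.
    move=> j jN; rewrite -Gt//.
    have -> : tavg2 T n (d j) t = tavg2 T n (G^~ j) t - tavg2 T n (fun s => havg N (g s) j) t.
      exact: (tavg2B T0 n tT' (LG _ jN) (Lhg jN)).
    by rewrite /d; move: (G t j) (havg N (g t) j) (tavg2 T n _ t) (tavg2 T n _ t) => *; ring.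
  rewrite (le_trans (l2nB _ _ _))// lerD//.
    rewrite (le_trans (l2n_havg_le N (ext_const_L2 M _ 0 1)))// ler_pM2l// nL2_ext_const; exact: l2n_le_sum.
  by rewrite (le_trans (l2nB _ _ _))// lerD2l Pt2.
rewrite itgD//; last 2 first.
- exact: L1Z.
- exact: L1D.
by rewrite itgZ// itgD//; move: It2 IPsi IA; move: (itg 0 T _) (itg 0 T _) (itg 0 T _) => *; lra.
Qed.

End SourceAverages.

(** * Limits of the observations *)

Section Completeness.
Context {R : realType}.
Local Notation mu := (@lebesgue_measure R).

Lemma le_of_vanish (x c : R) (u : nat -> R) : vanish u -> (forall n, x <= c + u n) -> x <= c.
Proof.
move=> v H; apply/ler_addgt0Pl => e e0; have [n Hn] := v e e0.
by rewrite addrC (le_trans (H n))// lerD2l Hn.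
Qed.

Lemma vanish_geometric (z : R) : 0 < z -> z <= 2^-1 -> vanish (fun n => z ^+ n).
Proof.
move=> z0 z1; have H n : z ^+ n <= n.+1%:R^-1.
  rewrite -[leRHS]mul1r ler_pdivlMr ?ltr0n//; elim: n => [|n IH]; first by rewrite mulr1.
  rewrite exprS; have : z * z ^+ n * n.+2%:R <= z * (2 * (z ^+ n * n.+1%:R)).
    rewrite -mulrA ler_pM2l// [leRHS]mulrCA ler_wpM2l ?exprn_ge0 ?(ltW z0)//.
    by rewrite -natrM ler_nat; lia.
  move=> h; apply: le_trans h _; move: (_ * n.+1%:R) IH => q q1; nra.
apply: vanish_leq (@vanish_mesh R) _ => n; exact: H.
Qed.

Section Rapid.
Variables (a b : R) (h : nat -> R -> R).
Hypothesis Lh : forall k, L2 a b (h k).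
Let z : R := 4^-1.
Hypothesis rapid : forall k, nL2 a b (fun x => h k.+1 x - h k x) <= z ^+ k.
Let z0 : 0 < z. Proof. by rewrite invr_gt0. Qed.
Let D : set (measurableTypeR R) := `]a, b[%classic.
Let mD : measurable D. Proof. exact: measurable_itv. Qed.
Let d k x := h k.+1 x - h k x.
(* [Q] below is integrable and [2^-k * sqrt Q] dominates the increments. *)
Let w k x : \bar R := (4 ^+ k * d k x ^+ 2)%:E.
Let Q x : \bar R := (\sum_(0 <= k <oo) w k x)%E.
Let w0 k x : (0 <= w k x)%E. Proof. by rewrite lee_fin; apply: mulr_ge0; [apply: exprn_ge0|exact: sqr_ge0]. Qed.
Let Ld k : L2 a b (d k). Proof. exact: L2B. Qed.
Let mw k : measurable_fun D (w k).
Proof. by apply/measurable_EFinP; exact: L1_meas (L1Z (4 ^+ k) (Ld k).2). Qed.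
Let mQ : measurable_fun D Q. Proof. by apply: ge0_emeasurable_sum => // k x _ _; exact: w0. Qed.
Let Q0 x : (0 <= Q x)%E. Proof. by apply: nneseries_ge0 => k _ _; exact: w0. Qed.

Let intQ : mu.-integrable D Q.
Proof.
apply/integrableP; split=> //; under eq_integral do rewrite gee0_abs//.
rewrite /Q integral_nneseries//.
apply: (@le_lt_trans _ _ 2%:E); last exact: ltry.
apply: lime_le; first by apply: is_cvg_nneseries => n _ _; apply: integral_ge0 => x _; exact: w0.
apply: nearW => n.
have E k : (\int[mu]_(x in D) w k x)%E = (4 ^+ k * itg a b (fun x => d k x ^+ 2))%:E.
  by rewrite (integral_itg (L1Z (4 ^+ k) (Ld k).2)) itgZ//; exact: (Ld k).2.
under eq_bigr do rewrite E.
rewrite sumEFin lee_fin; apply: (@le_trans _ _ (2 - 2 * z ^+ n)); last by rewrite gerBl mulr_ge0 ?exprn_ge0 ?(ltW z0).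
elim: n => [|n IH]; first by rewrite big_geq// expr0 mulr1 subrr.
rewrite big_nat_recr//= (le_trans (lerD IH (_ : _ <= z ^+ n)))//.
  rewrite -nL2_sqr (_ : z ^+ n = 4 ^+ n * (z ^+ n) ^+ 2).
    rewrite ler_pM2l ?exprn_gt0// ler_sqr ?nnegrE ?nL2_ge0 ?exprn_ge0 ?(ltW z0)//; exact: rapid.
  by rewrite expr2 mulrA -exprMn /z divff// expr1n mul1r.
have zn : 0 <= z ^+ n by rewrite exprn_ge0// ltW.
rewrite exprS; move: (z ^+ n) zn => u u0; rewrite (_ : z * u = u / 4); last by rewrite /z mulrC.
by lra.
Qed.

Let q x := fine (Q x).
Let Lq : L1 a b q.
Proof.
apply: (le_integrable mD _ _ intQ).
  by apply/measurable_EFinP; apply: (measurableT_comp (fine_measurable _)).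
move=> x _; rewrite /= [leRHS]gee0_abs// ger0_norm ?fine_ge0//.
by rewrite /q; have := Q0 x; case: (Q x) => //= *; rewrite leey.
Qed.

Let q0 x : 0 <= q x. Proof. exact: fine_ge0. Qed.

Let d_le k x : (Q x < +oo)%E -> `|d k x| <= 2^-1 ^+ k * Num.sqrt (q x).
Proof.
move=> fx; have Qx : Q x = (q x)%:E by rewrite fineK// ge0_fin_numE.
have H : 4 ^+ k * d k x ^+ 2 <= q x.
  rewrite -lee_fin -Qx; have := @nneseries_lim_ge R (w ^~ x) xpredT 0 k.+1 (fun n _ _ => w0 n x).
  apply: le_trans; rewrite big_nat_recr//= leeDr//; apply: sume_ge0 => i _; exact: w0.
have -> : 2^-1 ^+ k * Num.sqrt (q x) = Num.sqrt ((2^-1 ^+ k) ^+ 2 * q x).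
  by rewrite sqrtrM ?sqr_ge0// sqrtr_sqr ger0_norm// exprn_ge0.
rewrite -sqrtr_sqr; apply: ler_wsqrtr; rewrite -exprM mulnC exprM.
have -> : (2^-1 ^+ 2) ^+ k = (4 ^+ k)^-1 :> R by rewrite -exprVn; congr (_ ^+ k); field.
by rewrite mulrC ler_pdivlMr ?exprn_gt0// mulrC.
Qed.

Let tail i k x : (Q x < +oo)%E -> `|h (k + i)%N x - h k x| <= 2 * 2^-1 ^+ k * Num.sqrt (q x).
Proof.
move=> fx; apply: (@le_trans _ _ ((2 * 2^-1 ^+ k - 2 * 2^-1 ^+ (k + i)) * Num.sqrt (q x))); last first.
  by apply: ler_wpM2r; rewrite ?sqrtr_ge0// gerBl mulr_ge0 ?exprn_ge0.
elim: i => [|i IH]; first by rewrite addn0 !subrr normr0 mul0r.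
rewrite addnS (_ : _ - _ = d (k + i)%N x + (h (k + i)%N x - h k x)); last by rewrite /d; ring.
rewrite (le_trans (ler_normD _ _))// (le_trans (lerD (d_le (k + i) fx) IH))//.
rewrite -mulrDl [2^-1 ^+ (k + i).+1]exprS le_eqVlt; apply/orP; left; apply/eqP; congr (_ * _).
by move: (2^-1 ^+ k : R) (2^-1 ^+ (k + i) : R) => *; field.
Qed.

(** Multiplying the sequence by the indicator of this set makes it converge at every point of the
    interval, so its limit is measurable; the complement in the interval is a null set. *)
Let A : set (measurableTypeR R) := D `&` [set x | (Q x < +oo)%E].
Let mA : measurable A. Proof. exact: emeasurable_fun_infty_o. Qed.
Let k1 k x := h k x * \1_A x.
Let theta x : R := lim (k1^~ x @ \oo).

Let k1_cvg x : D x -> k1^~ x @ \oo --> theta x.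
Proof.
move=> Dx; apply: cauchy_cvg; apply: cauchy_exP => e e0.
have [fx|fx] := boolP (Q x < +oo)%E.
  have e1 : 0 < e / (2 * (Num.sqrt (q x) + 1)) by rewrite divr_gt0// mulr_gt0// ltr_wpDl ?sqrtr_ge0.
  have h2 : 0 < 2^-1 :> R by rewrite invr_gt0.
  have [n Hn] := vanish_geometric h2 (lexx _) e1.
  exists (k1 n x); exists n => // j /= nj; rewrite /ball/= distrC.
  have Ax : \1_A x = 1 :> R by rewrite indicE mem_set.
  rewrite /k1 Ax !mulr1 -(subnKC nj) (le_lt_trans (tail _ _ fx))//.
  have := Hn n (leqnn n); have := sqrtr_ge0 (q x); have u0 : 0 < 2 * 2^-1 ^+ n :> R by rewrite mulr_gt0// exprn_gt0.
  move: (2^-1 ^+ n) (Num.sqrt (q x)) e1 u0 => u s e1 u0 s0.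
  rewrite ler_pdivlMr; last by rewrite mulr_gt0// ltr_wpDl.
  have -> : u * (2 * (s + 1)) = 2 * u * s + 2 * u by ring.
  move=> H; apply: lt_le_trans H; rewrite ltrDl; exact: u0.
exists 0; exists 0%N => // j _ /=; rewrite /ball/= /k1 indicE memNset ?mulr0 ?subrr ?normr0//.
by move=> [_ /=] h1; rewrite h1 in fx.
Qed.

Let mtheta : measurable_fun D theta.
Proof.
apply: (measurable_fun_cvg (h := k1)) k1_cvg => k; apply: measurable_funM; first exact: (Lh k).1.
by apply: (measurable_funS _ (@subsetT _ _)) => //; exact: measurable_indic.
Qed.

Let theta_le k x : A x -> `|theta x - h k x| <= 2 * 2^-1 ^+ k * Num.sqrt (q x).
Proof.
move=> Ax; have [Dx fx] := Ax; have E : \1_A x = 1 :> R by rewrite indicE mem_set.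
apply/ler_addgt0Pl => e e0; have /cvgrPdist_lt/(_ _ e0) [n _ Hn] := k1_cvg Dx.
have := Hn (maxn n k) (leq_maxl _ _); rewrite /k1 E mulr1 => H1.
have H2 := @tail (maxn n k - k)%N k x fx; rewrite subnKC ?leq_maxr// in H2.
rewrite (_ : theta x - h k x = (theta x - h (maxn n k) x) + (h (maxn n k) x - h k x)); last by ring.
by rewrite (le_trans (ler_normD _ _))// lerD// ltW.
Qed.

Let aeA : {ae mu, forall x : R, a < x < b -> A x}.
Proof.
apply: ae_mono (integrable_ae mD intQ) => x Hx xab; have Dx : D x by rewrite /D/= in_itv.
by split=> //=; rewrite -ge0_fin_numE// Hx.
Qed.

Lemma rapid_limit : exists2 theta, L2 a b theta &
  vanish (fun k => nL2 a b (fun x => h k x - theta x)).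
Proof.
have L k : L2 a b (fun x => theta x - h k x) /\ itg a b (fun x => (theta x - h k x) ^+ 2) <= (2 * 2^-1 ^+ k) ^+ 2 * itg a b q.
  have m1 : measurable_fun D (fun x => theta x - h k x) by apply: measurable_funB mtheta (Lh k).1.
  have sq x : A x -> (theta x - h k x) ^+ 2 <= (2 * 2^-1 ^+ k) ^+ 2 * q x.
    move=> Ax; rewrite -(sqr_sqrtr (q0 x)) -exprMn -(real_normK (num_real (theta x - h k x))) ler_sqr ?nnegrE//; exact: theta_le.
  have L1s : L1 a b (fun x => (theta x - h k x) ^+ 2).
    have m2 : measurable_fun D (fun x => ((theta x - h k x) ^+ 2)%:E) by apply/measurable_EFinP; exact: measurable_funX.
    have [/integrableP[m3 fin]] := (L1Z ((2 * 2^-1 ^+ k) ^+ 2) Lq).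
    apply/integrableP; split=> //; apply: le_lt_trans fin.
    apply: ae_ge0_le_integral => //.
    - by apply: measurableT_comp.
    - by apply: measurableT_comp m3.
    - apply: ae_mono aeA => x Ax Dx; rewrite /= lee_fin !ger0_norm ?sqr_ge0//.
        by apply: sq; apply: Ax; move: Dx; rewrite /D/= in_itv.
      by rewrite mulr_ge0 ?sqr_ge0.
  split; first by split.
  rewrite -itgZ//; apply: itg_le_ae => //; first exact: L1Z.
  by apply: ae_mono aeA => x Ax /Ax; exact: sq.
exists theta.
  by apply: L2_eq (L2D (L 0%N).1 (Lh 0%N)) => x _; rewrite subrK.
have I0 : 0 <= itg a b q by exact: itg_ge0.
have c0 : 0 <= 2 * Num.sqrt (itg a b q) by rewrite mulr_ge0 ?sqrtr_ge0.
have h2 : 0 < 2^-1 :> R by rewrite invr_gt0.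
have v := vanish_geometric h2 (lexx _).
apply: vanish_leq (vanishZ c0 v) _ => k; apply: nL2_le; first by rewrite mulr_ge0// exprn_ge0.
rewrite (@itg_eq _ _ _ _ (fun x => (theta x - h k x) ^+ 2)); last by move=> x _; rewrite -sqrrN opprB.
apply: le_trans (L k).2 _; by rewrite !exprMn sqr_sqrtr// le_eqVlt; apply/orP; left; apply/eqP; rewrite mulrAC.
Qed.

End Rapid.

Lemma L2_complete (a b : R) (f : nat -> R -> R) : (forall n, L2 a b (f n)) ->
  (forall e : R, 0 < e -> exists n0, forall n k, (n0 <= n)%N -> (n0 <= k)%N ->
     nL2 a b (fun x => f n x - f k x) <= e) ->
  exists2 theta, L2 a b theta & vanish (fun n => nL2 a b (fun x => f n x - theta x)).
Proof.
move=> Lf C.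
have z0 k : 0 < 4^-1 ^+ k :> R by rewrite exprn_gt0// invr_gt0.
have [phi Hphi] := choice (fun k => C _ (z0 k)).
(* Summing the thresholds makes [s k] and [s (k + 1)] both exceed [phi k], so that consecutive terms
   of the subsequence are within [4^-k]. *)
pose s k := (\sum_(i < k.+1) phi i)%N.
have s1 k : (phi k <= s k)%N by rewrite /s big_ord_recr/= leq_addl.
have s2 k : (phi k <= s k.+1)%N by rewrite (leq_trans (s1 k))// /s [leqRHS]big_ord_recr/= leq_addr.
have [theta Lt v] := @rapid_limit a b (fun k => f (s k)) (fun k => Lf (s k)) (fun k => Hphi k _ _ (s2 k) (s1 k)).
exists theta => // e e0; have e2 : 0 < e / 2 by rewrite divr_gt0.
have [k1 H1] := v _ e2; have z1 : 0 < 4^-1 :> R by rewrite invr_gt0.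
have z2 : 4^-1 <= 2^-1 :> R by rewrite lef_pV2 ?posrE// ler_nat.
have [k2 H2] := vanish_geometric z1 z2 e2.
pose k := maxn k1 k2; exists (phi k) => n kn.
rewrite (le_trans (nL2_triangle (Lf n) (Lf (s k)) Lt))// (splitr e) lerD//.
  by rewrite (le_trans (Hphi k _ _ kn (s1 k)))// H2// leq_maxr.
by apply: H1; rewrite leq_maxl.
Qed.

End Completeness.

Section BoundaryLimit.
Context {R : realType}.
Variable T : R.
Hypothesis T0 : 0 < T.

Lemma tavg2_of_deriv n (f f1 : R -> R) (t : R) : 0 <= t <= T -> ucont 0 T f1 -> AC 0 T f f1 ->
  tavg2 T n f1 t = (1 - eps n)^-1 * (eps n * T)^-1 * dlt T (eps n) (tavg T (eps n) f) t.
Proof.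
move=> tT u1 A; have e0 := @eps_gt0 R n; have e1 := @eps_half R n; have l0 := lt0r_neq0 (@lam_gt0 R n).
have A2 := tavg_AC T0 e0 e1 (AC_ucont A).
have ud := dlt_ucont T0 e0 e1 (AC_ucont A).
rewrite -mulrA -(tavg_deriv T0 e0 e1 tT A2).
have Ld : L1 0 T (dlt T (eps n) f) by exact: ucont_L1.
rewrite /tavg2 (tavg_eq T0 e0 e1 (g := fun s => (eps n * T)^-1 * dlt T (eps n) f s) tT); last first.
  by move=> s /andP[s0 sT]; rewrite (tavg_deriv T0 e0 e1 _ A)// !ltW.
rewrite (tavgZ T0 e0 e1 _ tT Ld).
rewrite (tavg_eq T0 e0 e1 (f := fun s => (eps n * T)^-1 * ((1 - eps n) * dlt T (eps n) f s))
  (g := fun s => ((eps n * T)^-1 * (1 - eps n)) * dlt T (eps n) f s) tT); last by move=> s _; rewrite mulrA.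
rewrite (tavgZ T0 e0 e1 ((eps n * T)^-1 * (1 - eps n)) tT Ld).
by move: (tavg _ _ _ t) (_ * T)^-1 => u v; rewrite (mulrC v (1 - eps n)) -!mulrA mulKf.
Qed.

Variables (Th : nat -> R -> R) (k : R -> R).
Hypotheses (uTh : forall N, L2 0 T (Th N)) (uk : ucont 0 T k).
(** By [tavg2_of_deriv], what the double average of the derivative of [k] would be; written this way
    it makes sense for [k] merely continuous. *)
Let zeta n t := (1 - eps n)^-1 * (eps n * T)^-1 * dlt T (eps n) (tavg T (eps n) k) t.
Hypothesis close : vanish2 (fun n N => nL2 0 T (fun t => Th N t - zeta n t)).

Let Lz n : L2 0 T (zeta n).
Proof.
have e0 := @eps_gt0 R n; have e1 := @eps_half R n.
by apply: ucont_L2; apply: ucontZ; apply: (dlt_ucont T0 e0 e1); apply: (tavg_ucont T0 e0 e1); exact: ucont_L1.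
Qed.

(** Two observations on fine grids are close to the same [zeta n], so the sequence is Cauchy. Its
    limit is then also the limit of [zeta n], whose integral over [[0, t]], times [(1 - eps)^2], is
    the increment of the double average of [k]; letting [n] grow shows that [theta] is the
    derivative of [k]. *)
Lemma boundary_limit : exists2 theta, L2 0 T theta &
  vanish (fun N => nL2 0 T (fun t => Th N t - theta t)) /\ AC 0 T k theta.
Proof.
have [|theta Lt v] := @L2_complete R 0 T Th uTh.
  move=> e e0; have e2 : 0 < e / 2 by rewrite divr_gt0.
  have [n0 /(_ n0 (leqnn _)) [N0 H]] := close e2; exists N0 => N M /H hN /H hM.
  rewrite (le_trans (nL2_triangle (uTh N) (Lz n0) (uTh M)))// (splitr e) lerD//.
  by rewrite -nL2N (@nL2_eq _ _ _ _ (fun t => Th M t - zeta n0 t))// => t _; rewrite opprB.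
exists theta => //; split=> //; split=> [|t tT]; first exact: L2_L1.
have vz : vanish (fun n => nL2 0 T (fun t => theta t - zeta n t)).
  move=> e e0; have e2 : 0 < e / 2 by rewrite divr_gt0.
  have [n0 H] := close e2; have [N1 H1] := v _ e2; exists n0 => n /H[N0 HN].
  have h0 := HN _ (leq_maxl N0 N1); have h1 := H1 _ (leq_maxr N0 N1).
  rewrite (le_trans (nL2_triangle Lt (uTh (maxn N0 N1)) (Lz n)))// (splitr e) lerD//.
  by rewrite -nL2N (@nL2_eq _ _ _ _ (fun t => Th (maxn N0 N1) t - theta t))// => s _; rewrite opprB.
have [t0 tT1] := andP tT; have z0 : 0 <= (0 : R) <= T by rewrite lexx ltW.
apply/eqP; rewrite -subr_eq0 -normr_le0.
pose c n : R := (1 - eps n) ^+ 2.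
have c1 n : 0 <= 1 - c n <= 2 * eps n.
  rewrite /c; have := @eps_gt0 R n; have := @eps_half R n; move: (eps n) => x x1 x0.
  by apply/andP; split; nra.
have An n : tavg2 T n k t - tavg2 T n k 0 = c n * itg 0 t (zeta n).
  have e0 := @eps_gt0 R n; have e1 := @eps_half R n; have l0 := lt0r_neq0 (@lam_gt0 R n).
  have ut := tavg_ucont T0 e0 e1 (ucont_L1 uk).
  have A := tavg_AC T0 e0 e1 ut; rewrite /tavg2 (A.2 t tT) addrAC subrr add0r.
  rewrite -itgZ; last by apply: L1_sub (L2_L1 (Lz n)).
  apply: itg_eq => s _; rewrite /c /zeta expr2; move: (dlt _ _ _ _) (eps n * T)^-1 => x1 x2.
  by rewrite -(mulrA (1 - eps n)^-1) -mulrA mulVKf// mulrCA.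
have vu : vanish (fun n => `|tavg2 T n k t - k t| + `|tavg2 T n k 0 - k 0|).
  by apply: vanishD => e e0; have [n0 H] := tavg2_unif T0 uk e0; exists n0 => n /H; apply.
have sT0 := sqrtr_ge0 T.
have vv : vanish (fun n => (`|tavg2 T n k t - k t| + `|tavg2 T n k 0 - k 0|) +
   (Num.sqrt T * nL2 0 T (fun t => theta t - zeta n t) +
    2 * Num.sqrt T * (nL2 0 T theta) * eps n)) .
  apply: vanishD => //; apply: vanishD; first exact: vanishZ.
  by apply: vanishZ (@vanish_eps R); rewrite !mulr_ge0// nL2_ge0.
apply: (le_of_vanish vv) => n; rewrite add0r.
have -> : k t - (k 0 + itg 0 t theta) = (- (tavg2 T n k t - k t) + (tavg2 T n k 0 - k 0)) +
    ((c n * itg 0 t (zeta n) - c n * itg 0 t theta) - (1 - c n) * itg 0 t theta).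
  by rewrite -An; ring.
have Lzt : L1 0 t (zeta n) by apply: L1_sub (L2_L1 (Lz n)).
have Ltt : L1 0 t theta by apply: L1_sub (L2_L1 Lt).
have st : Num.sqrt (t - 0) <= Num.sqrt T by apply: ler_wsqrtr; rewrite subr0.
have i1 : `|itg 0 t theta| <= Num.sqrt T * nL2 0 T theta.
  rewrite (le_trans (itg_le_nL2 t0 (L2_sub (lexx 0) tT1 Lt)))// ler_pM ?sqrtr_ge0 ?nL2_ge0//.
  exact: nL2_sub.
have i2 : `|c n * itg 0 t (zeta n) - c n * itg 0 t theta| <= Num.sqrt T * nL2 0 T (fun t => theta t - zeta n t).
  rewrite distrC -mulrBr -itgB//.
  have cc : `|c n| <= 1 by rewrite ger0_norm ?sqr_ge0//; have := c1 n; move: (c n) => x; lra.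
  rewrite normrM -[leRHS]mul1r ler_pM// (le_trans (itg_le_nL2 t0 (L2_sub (lexx 0) tT1 (L2B Lt (Lz n)))))//.
  rewrite ler_pM ?sqrtr_ge0 ?nL2_ge0//; exact: nL2_sub (L2B Lt (Lz n)).
have i3 : `|(1 - c n) * itg 0 t theta| <= 2 * Num.sqrt T * nL2 0 T theta * eps n.
  have /andP[c2 c3] := c1 n; rewrite normrM (ger0_norm c2) (_ : 2 * _ * _ * _ = (2 * eps n) * (Num.sqrt T * nL2 0 T theta)); last by ring.
  exact: ler_pM.
rewrite (le_trans (ler_normD _ _))// lerD//.
  by rewrite (le_trans (ler_normD _ _))// normrN.
by rewrite (le_trans (ler_normB _ _))// lerD.
Qed.

End BoundaryLimit.

Section IntegralMonotone.
Context {R : realType}.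
Local Notation mu := (@lebesgue_measure R).

(** The integral of a nonnegative function is a supremum over the simple functions below it, so
    comparison holds for arbitrary functions. A pointwise bound thus replaces a discussion of the
    joint measurability of the interior observation. *)
Lemma ge0_integral_mono (d : measure_display) (X : measurableType d) (nu : {measure set X -> \bar R})
    (D : set X) (f k : X -> \bar R) : (forall x, D x -> (0 <= f x)%E) -> (forall x, D x -> (f x <= k x)%E) ->
  (\int[nu]_(x in D) f x <= \int[nu]_(x in D) k x)%E.
Proof.
move=> f0 fk; have k0 x : D x -> (0 <= k x)%E by move=> Dx; exact: le_trans (f0 x Dx) (fk x Dx).
rewrite ge0_integralE// [leRHS]ge0_integralE//.
apply: ereal_sup_le => _ [u uf <-]; exists u => // x; apply: le_trans (uf x) _.
by rewrite !patchE; case: ifPn => // /set_mem/fk.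
Qed.

Variable T : R.
Let C : set (measurableTypeR R * measurableTypeR R) := cylinder T.
Let m : {sigma_finite_measure set (measurableTypeR R) -> \bar R} := mu.

Lemma box_tonelli (W : R -> R -> R) : box_meas T W -> (forall t x, 0 <= W t x) ->
  (\int[(mu \x mu)%E]_(tx in cylinder T) (W tx.1 tx.2)%:E =
   \int[mu]_(t in `]0%R, T[) \int[mu]_(x in `]0%R, 1%R[) (W t x)%:E)%E.
Proof.
move=> mW W0; pose f tx := (box_cut T W tx)%:E.
have mf : measurable_fun setT f by apply/measurable_EFinP; exact: box_cut_meas.
have f0 tx : (0 <= f tx)%E by rewrite lee_fin /box_cut patchE; case: ifP.
have -> : (\int[(mu \x mu)%E]_(tx in cylinder T) (W tx.1 tx.2)%:E = \int[(m \x m)%E]_tx f tx)%E.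
  rewrite [LHS]integral_mkcond; apply: eq_integral => tx _; rewrite /f /box_cut !patchE.
  by case: ifP.
rewrite (@fubini_tonelli1 _ _ (measurableTypeR R) (measurableTypeR R) R m m f mf f0).
rewrite [RHS]integral_mkcond; apply: eq_integral => t _.
rewrite patchE mem_setE in_itv/= /fubini_F; case: ifPn => tT; last first.
  by rewrite integral0_eq// => x _; rewrite /f box_cutE (negbTE tT).
rewrite [RHS]integral_mkcond; apply: eq_integral => x _.
by rewrite patchE mem_setE in_itv/= /f box_cutE tT/=; case: ifP.
Qed.

End IntegralMonotone.

Section AffineInterpolation.
Context {R : realType}.
Local Notation mu := (@lebesgue_measure R).
Variable N : nat.
Implicit Types f : nat -> R.

Lemma ext_affine_cell f j (x : R) : (j <= N)%N -> node N j <= x <= node N j.+1 ->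
  ext_affine N f x = f j + (f j.+1 - f j) * ((x - node N j) / mesh N).
Proof.
move=> jN /andP[x1 x2]; have h0 := @mesh_gt0 R N; have hn := lt0r_neq0 h0.
set s := (x - node N j) / mesh N.
have xE : x / mesh N = j%:R + s by rewrite /s mulrBl /node mulfK// addrC subrK.
have s0 : 0 <= s by rewrite divr_ge0 ?subr_ge0// ltW.
have s1 : s <= 1 by rewrite ler_pdivrMr// mul1r; move: x2; rewrite nodeS; lra.
have Z i : (i < j)%N || (j.+1 < i)%N -> f i * Num.max 0 (1 - `|x / mesh N - i%:R|) = 0.
  move=> ij; rewrite (max_idPl _) ?mulr0// xE subr_le0 ler_normr.
  case/orP: ij => ij; apply/orP; [left|right].
    have : i.+1%:R <= j%:R :> R by rewrite ler_nat.
    by rewrite -natr1; move: (i%:R : R) (j%:R : R) => u v; lra.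
  have : j.+2%:R <= i%:R :> R by rewrite ler_nat.
  by rewrite -!natr1; move: (i%:R : R) (j%:R : R) => u v; lra.
rewrite /ext_affine (@big_cat_nat _ _ _ j)//=; last by lia.
rewrite (@big_cat_nat _ _ _ j.+2 j)//=; last lia.
rewrite big_nat_cond big1 ?add0r; last by move=> i /andP[/andP[_ ij] _]; rewrite Z ?ij.
rewrite [X in _ + X]big_nat_cond [X in _ + X]big1 ?addr0; last first.
  by move=> i /andP[/andP[ij _] _]; rewrite Z ?ij ?orbT.
rewrite big_ltn// big_nat1 xE.
have -> : j%:R + s - j%:R = s by ring.
have -> : j%:R + s - j.+1%:R = s - 1 by rewrite -natr1; ring.
rewrite ger0_norm// ler0_norm ?subr_le0//.
rewrite !(max_idPr _); [ring| |]; by [rewrite opprB; lra|rewrite subr_ge0].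
Qed.

Lemma cell_index (x : R) : 0 < x < 1 -> exists2 j, (j <= N)%N & node N j <= x < node N j.+1.
Proof.
move=> /andP[x0 x1]; have h0 := @mesh_gt0 R N.
have q0 : 0 <= x / mesh N by rewrite divr_ge0 ?ltW.
have [j /andP[j1 j2]] : exists j : nat, j%:R <= x / mesh N < j.+1%:R by eexists; exact: truncn_itv q0.
exists j; last first.
  by rewrite /node -ler_pdivlMr// j1 -ltr_pdivrMr.
rewrite -ltnS -(ltr_nat R); apply: le_lt_trans j1 _; rewrite ltr_pdivrMr//.
by rewrite mulrC mesh_mul.
Qed.

Definition slope_sqr f (x : R) : R :=
  \sum_(0 <= j < N.+1) (f j.+1 - f j) ^+ 2 * \1_(`[node N j, node N j.+1[%classic) x.

(* At a kink [derive1] is the junk value 0. *)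
Lemma derive_ext_affine f (x : R) : 0 < x < 1 ->
  (mesh N * derive1 (ext_affine N f) x) ^+ 2 <= slope_sqr f x.
Proof.
move=> x01; have [j jN /andP[x1 x2]] := cell_index x01.
have h0 := @mesh_gt0 R N; have hn := lt0r_neq0 h0.
have S : (f j.+1 - f j) ^+ 2 <= slope_sqr f x.
  rewrite /slope_sqr (bigD1_seq j) ?iota_uniq ?mem_index_iota//=.
  rewrite indicE mem_set ?mulr1 /=; last by rewrite in_itv/= x1 x2.
  by rewrite lerDl sumr_ge0// => i _; rewrite mulr_ge0 ?sqr_ge0.
apply: le_trans S; rewrite /derive1; set F := (X in lim X).
have [c|c] := pselect (cvg F); last first.
  by rewrite dvgP// /point/= mulr0 expr0n sqr_ge0.
suff -> : lim F = (f j.+1 - f j) / mesh N by rewrite mulrC divfK.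
apply/eqP; rewrite -subr_eq0 -normr_le0; apply/ler_addgt0Pl => e e0; rewrite addr0.
have /cvgrPdist_lt/(_ _ e0) := c; rewrite /F /prop_near1/= => -[d /= d0 Hd].
(* A positive increment that stays in the cell of [x]: whenever the two-sided derivative exists,
   even at a node, it equals this right slope. *)
pose s := Num.min (d / 2) ((node N j.+1 - x) / 2).
have s0 : 0 < s by rewrite lt_min !divr_gt0// subr_gt0.
have sd : s < d by rewrite (@le_lt_trans _ _ (d / 2))// ?ge_min ?lexx// ltr_pdivrMr// ltr_pMr// ltr1n.
have sx : s <= (node N j.+1 - x) / 2 by rewrite ge_min lexx orbT.
have := Hd s; rewrite /ball_/= sub0r normrN gtr0_norm// => /(_ sd (lt0r_neq0 s0)).
rewrite (ext_affine_cell f jN) ?x1 ?(ltW x2)// (@ext_affine_cell f j (s + x) jN); last first.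
  by move: (node N j) (node N j.+1) s0 sx x1 x2 => *; lra.
rewrite /GRing.scale/= (_ : s^-1 * _ = (f j.+1 - f j) / mesh N); first exact: ltW.
have sn := lt0r_neq0 s0; move: (node N j) (mesh N : R) hn => u v vn.
by field; rewrite vn sn.
Qed.

Lemma itg_slope_sqr f : L1 0 1 (slope_sqr f) /\
  itg 0 1 (slope_sqr f) = mesh N * \sum_(0 <= j < N.+1) (f j.+1 - f j) ^+ 2.
Proof.
have L j : L1 0 1 (fun x => (f j.+1 - f j) ^+ 2 * \1_(`[node N j, node N j.+1[%classic) x) by apply: L1Z; exact: indic_L1.
split; first by apply: L1_sum.
rewrite itg_sum// mulr_sumr; apply: eq_big_nat => j /= jN.
rewrite itgZ; last exact: indic_L1.
rewrite mulrC; congr (_ * _).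
have i1 := @itg_indic R (node N j) (node N j.+1) (fun=> 1) (node_ge0 N j) (node_le1 jN).
have <- : itg (node N j) (node N j.+1) (fun=> 1 : R) = mesh N.
  by rewrite itg_cst ?node_leS// nodeS; ring.
rewrite i1; apply: itg_ae_eq; first exact: indic_L1.
  apply: (@L1_bounded _ _ _ _ 1) => [|x _]; last by rewrite mulr1 indicE; case: (_ \in _); rewrite ?normr1 ?normr0.
  apply: measurable_funM; last exact: measurable_cst.
  by apply: (measurable_funS _ (@subsetT _ _)) => //; exact: measurable_indic.
apply: ae_mono (ae_neq (node N j)) => x xn _; rewrite mulr1 !indicE !mem_setE !in_itv/=.
by rewrite le_eqVlt eq_sym (negbTE xn).
Qed.

Lemma interior_norm_le (T K : R) (f : nat -> R -> R) : 0 <= K ->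
  (forall j, (j <= N)%N -> L1 0 T (fun t => (f j.+1 t - f j t) ^+ 2)) ->
  itg 0 T (fun t => mesh N * \sum_(0 <= j < N.+1) (f j.+1 t - f j t) ^+ 2) <= K ^+ 2 ->
  (L2L2_norm T (fun tx => (mesh N * derive1 (ext_affine N (fun j => f j tx.1)) tx.2)%R) <= K%:E)%E.
Proof.
move=> K0 Lf HK.
have mI : measurable (`]0, T[%classic : set (measurableTypeR R)) by exact: measurable_itv.
apply: Lp2_norm_le => //; first by apply: measurableX; exact: measurable_itv.
(* Cut off in time, these coefficients are measurable on the whole line, from which joint
   measurability of the majorant [W] and Tonelli follow. *)
pose a j := (fun t => (f j.+1 t - f j t) ^+ 2) \_ (`]0, T[%classic : set (measurableTypeR R)).
pose W (t x : R) := \sum_(0 <= j < N.+1) a j t * \1_(`[node N j, node N j.+1[%classic) x.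
have aE j (t : R) : 0 < t < T -> a j t = (f j.+1 t - f j t) ^+ 2 by move=> tT; rewrite /a patchE mem_setE in_itv/= tT.
have a0 j (t : R) : 0 <= a j t by rewrite /a patchE; case: ifP => // _; exact: sqr_ge0.
have ma j : (j <= N)%N -> measurable_fun setT (a j).
  by move=> jN; have := L1_meas (Lf j jN); move/(measurable_restrictT _ mI).
have mW : box_meas T W.
  pose a' j := if (j <= N)%N then a j else fun=> 0.
  have ma' j : measurable_fun setT (a' j).
    by rewrite /a'; case: ifP => [/ma//|_]; exact: measurable_cst.
  apply: (eq_measurable_fun (fun tx => \sum_(0 <= j < N.+1) a' j tx.1 * \1_(`[node N j, node N j.+1[%classic) tx.2)).
    by move=> tx _; apply: eq_big_nat => j /= jN; rewrite /a' -ltnS jN.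
  apply: measurable_sum => j; apply: (measurable_funS _ (@subsetT _ _)) => //; apply: measurable_funM.
    exact: (measurableT_comp (ma' j)).
  apply: (measurableT_comp (measurable_indic _)) => //.
have W0 (t x : R) : 0 <= W t x by rewrite sumr_ge0// => j _; rewrite mulr_ge0.
apply: (@le_trans _ _ (\int[(mu \x mu)%E]_(tx in cylinder T) (W tx.1 tx.2)%:E)%E).
  apply: ge0_integral_mono => [tx _|[t x] [/= tT x01]]; first by rewrite lee_fin sqr_ge0.
  rewrite lee_fin; apply: le_trans (derive_ext_affine _ _) _; first by move: x01; rewrite in_itv.
  rewrite le_eqVlt; apply/orP; left; apply/eqP; by apply: eq_bigr => j _; rewrite aE.
rewrite box_tonelli//.
have Lt : L1 0 T (fun t => mesh N * \sum_(0 <= j < N.+1) (f j.+1 t - f j t) ^+ 2).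
  apply: L1Z; apply: L1_sum => j; rewrite mem_index_iota => jN _; exact: Lf.
apply: le_trans (_ : (_ <= (itg 0 T (fun t => mesh N * \sum_(0 <= j < N.+1) (f j.+1 t - f j t) ^+ 2))%:E)%E) _; last by rewrite lee_fin.
rewrite -integral_itg// le_eqVlt; apply/orP; left; apply/eqP; apply: eq_integral => t; rewrite inE/= in_itv/= => tT.
have [L E] := itg_slope_sqr (fun j => f j t).
rewrite -E -integral_itg//; apply: eq_integral => x _; congr (_%:E).
by apply: eq_bigr => j _; rewrite aE.
Qed.

End AffineInterpolation.

Section ExtendedLimit.
Context {R : realType}.

Lemma ecvg0_le (x : nat -> \bar R) : (forall N, (0 <= x N)%E) ->
  (forall e : R, 0 < e -> exists N0, forall N, (N0 <= N)%N -> (x N <= e%:E)%E) -> x @ \oo --> 0%E.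
Proof.
move=> x0 H; apply/fine_cvgP; split.
  have [N0 HN] := H 1 ltr01; exists N0 => // N /= /HN h.
  by rewrite ge0_fin_numE// (le_lt_trans h (ltry _)).
apply/vanish_cvg => e /H[N0 HN]; exists N0 => N /HN h; rewrite ger0_norm ?fine_ge0//.
by rewrite /=; move: h (x0 N); case: (x N) => //=.
Qed.

Definition ebounded (x : nat -> R) := exists M n0, forall n, (n0 <= n)%N -> x n <= M.

Lemma ebounded_vanish x : vanish x -> ebounded x.
Proof. by move=> v; have [n0 H] := v 1 ltr01; exists 1, n0. Qed.

Lemma ebounded_cst (c : R) : ebounded (fun=> c).
Proof. by exists c, 0%N. Qed.

Lemma eboundedD x u : ebounded x -> ebounded u -> ebounded (fun n => x n + u n).
Proof.
move=> [M [n0 H]] [M' [n1 H']]; exists (M + M'), (maxn n0 n1) => n; rewrite geq_max => /andP[a b].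
by rewrite lerD ?H ?H'.
Qed.

Lemma eboundedZ (c : R) x : 0 <= c -> ebounded x -> ebounded (fun n => c * x n).
Proof. by move=> c0 [M [n0 H]]; exists (c * M), n0 => n /H h; exact: ler_wpM2l. Qed.

Lemma ebounded_le x u : ebounded u -> (exists n0, forall n, (n0 <= n)%N -> x n <= u n) -> ebounded x.
Proof.
move=> [M [n0 H]] [n1 H']; exists M, (maxn n0 n1) => n; rewrite geq_max => /andP[a b].
exact: le_trans (H' n b) (H n a).
Qed.

(** The energy estimate speaks of fine grids only, while the final supremum runs over all of them;
    the finitely many coarse grids are absorbed into the constant. *)
Lemma eventually_all (P : nat -> R -> Prop) : (forall N B B', B <= B' -> P N B -> P N B') ->
  (forall N, exists B, P N B) -> (exists B n0, forall N, (n0 <= N)%N -> P N B) -> exists B, forall N, P N B.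
Proof.
move=> mono H [B [n0]]; elim: n0 B => [|n IH] B HB; first by exists B => N; exact: HB.
have [B1 H1] := H n; apply: (IH (Num.max B B1)) => N; rewrite leq_eqVlt => /orP[/eqP <-|nN].
  by apply: mono H1; rewrite le_max lexx orbT.
by apply: mono (HB N nN); rewrite le_max lexx.
Qed.

End ExtendedLimit.

Section FiniteAE.
Context {R : realType}.
Local Notation mu := (@lebesgue_measure R).

Lemma ae_ord (N : nat) (P : nat -> R -> Prop) :
  (forall j, (1 <= j <= N)%N -> {ae mu, forall t, P j t}) ->
  {ae mu, forall t, forall j, (1 <= j <= N)%N -> P j t}.
Proof.
move=> H; suff K k : (k <= N)%N -> {ae mu, forall t, forall j, (1 <= j <= k)%N -> P j t} by exact: K.
elim: k => [_|k IH kN]; first by apply: ae_all => t j; rewrite leqn0; case: j.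
apply: ae_mono (ae_and (IH (ltnW kN)) (H k.+1 (kN : (1 <= k.+1 <= N)%N))) => t [h1 h2] j /andP[j1].
by rewrite leq_eqVlt ltnS => /orP[/eqP->//|jk]; apply: h1; rewrite j1.
Qed.

End FiniteAE.

Section NodalConsistency.
Context {R : realType}.
Variables (N j : nat).
Hypothesis jN : (1 <= j <= N)%N.

Lemma laplacianB (a b : nat -> R) :
  laplacian_h N (fun l => a l - b l) j = laplacian_h N a j - laplacian_h N b j.
Proof. by rewrite /laplacian_h; ring. Qed.

(** Hölder continuity of exponent [1/2] for functions in [H^1]: the origin of every factor [sqrt h]
    between nodal values and hat averages. *)
Lemma node_osc (f f' : R -> R) x : AC 0 1 f f' -> L2 0 1 f' -> node N j.-1 < x < node N j.+1 ->
  `|f x - f (node N j)| <= Num.sqrt (mesh N) * nL2 0 1 f'.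
Proof.
move=> A L xj; have [j1 jN'] := andP jN; have h0 := @mesh_gt0 R N.
have nj := @node_in R N j (leqW jN').
have a0 := @node_ge0 R N j.-1; have b1 := @node_le1 R N j.+1 jN'.
have [x1 x2] := andP xj.
have x01 : 0 <= x <= 1 by rewrite (le_trans a0 (ltW x1)) (le_trans (ltW x2) b1).
rewrite (le_trans (H1_holder A L x01 nj))// ler_wpM2r ?nL2_ge0// ler_wsqrtr//.
move: x1 x2; rewrite nodeP// nodeS ler_norml; move: (node N j) (mesh N : R) => *; lra.
Qed.

Lemma havg_node (f f' : R -> R) : AC 0 1 f f' -> L2 0 1 f' ->
  `|havg N f j - f (node N j)| <= Num.sqrt (mesh N) * nL2 0 1 f'.
Proof.
move=> A L; apply: havg_osc => // [|x]; first exact: ucont_L1 (AC_ucont A).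
exact: node_osc.
Qed.

Lemma bounded_L1 (q : R -> R) (k : R) : measurable_fun `](0 : R), 1[ q -> (forall x, `|q x| <= k) -> L1 0 1 q.
Proof. by move=> mq qk; exact: (L1_bounded mq (k := k)). Qed.

Lemma havg_potential (q f f' : R -> R) (k : R) : measurable_fun `](0 : R), 1[ q -> (forall x, `|q x| <= k) ->
  AC 0 1 f f' -> L2 0 1 f' ->
  `|havg N (fun x => q x * f x) j - havg N q j * f (node N j)| <= k * (Num.sqrt (mesh N) * nL2 0 1 f').
Proof.
move=> mq qk A L; have L1q := bounded_L1 mq qk.
have Lf := ucont_L2 (AC_ucont A).
have [Lqf _] := weighted_L2 mq qk Lf; have L1qf := L2_L1 Lqf.
rewrite (mulrC (havg _ _ _)) -(havgZ jN _ L1q) -(havgB jN L1qf (L1Z _ L1q)).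
apply: (havg_abs_le jN) => [|x xj]; first exact: L1B L1qf (L1Z _ L1q).
rewrite (_ : _ - _ = q x * (f x - f (node N j))); last ring.
by rewrite normrM ler_pM// (node_osc A L).
Qed.

End NodalConsistency.

(** * Consistency and conclusion *)

Section Data.
Context {R : realType}.
Local Notation mu := (@lebesgue_measure R).
Variables (T m : R) (p : R -> R) (y0 y1 g0 g1 : nat -> R -> R) (g : nat -> R -> R -> R).
Variables (y0h y1h : nat -> nat -> R) (g0h g1h : nat -> nat -> R -> R) (gh : nat -> nat -> nat -> R -> R).
Hypotheses (T0 : 0 < T) (m0 : 0 <= m).
Hypotheses (mp : measurable_fun `](0 : R), 1[ p) (pm : forall x, `|p x| <= m).
Hypotheses (hy0 : Sobolev 2 2%:E 0 1 y0) (hy1 : Sobolev 1 2%:E 0 1 y1) (hg : W11L2 T g).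
Hypotheses (hg0 : Sobolev 2 2%:E 0 T g0) (hg1 : Sobolev 2 2%:E 0 T g1).
Hypotheses (hc00 : g0 0%N 0 = y0 0%N 0) (hc01 : g1 0%N 0 = y0 0%N 1).
Hypotheses (hc10 : g0 1%N 0 = y1 0%N 0) (hc11 : g1 1%N 0 = y1 0%N 1).
Hypothesis hgh : forall N j, (1 <= j <= N)%N -> Sobolev 1 1%:E 0 T (gh N j).
Hypothesis hg0h : forall N, Sobolev 2 2%:E 0 T (g0h N).
Hypothesis hg1h : forall N, Sobolev 2 2%:E 0 T (g1h N).
Definition initial_grid (v : nat -> nat -> R) i N : nat -> R := with_boundary N (g0h N i 0) (v N) (g1h N i 0).
Local Notation b0 := (initial_grid y0h 0).
Local Notation b1 := (initial_grid y1h 1).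
Hypothesis cvg_y0 : L2_norm 0 1 (fun x => ext_const N (laplacian_h N (b0 N)) x - y0 2%N x)
      @[N --> \oo] --> 0%E.
Hypothesis cvg_y1 : Hm1_norm (fun phi => fun_Hm1 (ext_const N (laplacian_h N (b1 N))) phi - dxx_Hm1 y1 phi)
      @[N --> \oo] --> 0%E.
Hypothesis cvg_g : forall i, (i <= 1)%N ->
  L1L2_norm T (fun t x => ext_const N (fun j => gh N j i t) x - g i t x) @[N --> \oo] --> 0%E.
Hypothesis cvg_g0 : Hnorm 2 0 T (fun i t => g0h N i t - g0 i t) @[N --> \oo] --> 0%E.
Hypothesis cvg_g1 : Hnorm 2 0 T (fun i t => g1h N i t - g1 i t) @[N --> \oo] --> 0%E.

Lemma source_AC N j : (1 <= j <= N)%N -> AC 0 T (gh N j 0%N) (gh N j 1%N).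
Proof. by move=> jN; exact: Sobolev1_AC T0 (hgh jN). Qed.

Lemma source_L1 i N j : (i <= 1)%N -> (1 <= j <= N)%N -> L1 0 T (gh N j i).
Proof.
case: i => [|[|//]] _ jN; have A := source_AC jN; last by case: A.
exact: ucont_L1 (AC_ucont A).
Qed.

Lemma source_mean_cvg i : (i <= 1)%N ->
  vanish (fun N => itg 0 T (fun t => l2n N (fun j => gh N j i t - havg N (g i t) j))).
Proof.
move=> i1; apply: (source_cvg (gh := fun N j => gh N j i) hg i1 _ (cvg_g i1)).
by move=> N j; exact: source_L1.
Qed.

Let A00 : AC 0 1 (y0 0%N) (y0 1%N). Proof. exact: Sobolev2_AC ltr01 hy0 _. Qed.
Let A01 : AC 0 1 (y0 1%N) (y0 2%N). Proof. exact: Sobolev2_AC ltr01 hy0 _. Qed.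
Let A10 : AC 0 1 (y1 0%N) (y1 1%N). Proof. exact: Sobolev2_AC ltr01 hy1 _. Qed.
Let L11 : L2 0 1 (y1 1%N). Proof. exact: Sobolev2_L2 hy1 _. Qed.

Lemma position_lap_cvg :
  vanish (fun N => l2n N (fun j => laplacian_h N (b0 N) j - laplacian_h N (fun l => y0 0%N (node N l)) j)).
Proof.
apply: vanish_leq (lap_initial_cvg (Sobolev2_L2 hy0 (leqnn 2)) cvg_y0) _ => N.
by rewrite le_eqVlt; apply/orP; left; apply/eqP/l2n_eq => j jN; rewrite (havg_lap jN A00 A01).
Qed.

(** Convergence of the second differences and of the two boundary values controls the error at every
    node by [grid_sup_lap]; the compatibility conditions identify the end values of [y0] with the
    boundary data. *)
Lemma position_sup_cvg : exists2 s : nat -> R, vanish s &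
  forall N j, (j <= N.+1)%N -> `|b0 N j - y0 0%N (node N j)| <= s N.
Proof.
have c2 : 0 <= 2 :> R by [].
exists (fun N => 2 * `|g0h N 0%N 0 - g0 0%N 0| + `|g1h N 0%N 0 - g1 0%N 0| +
   l2n N (fun j => laplacian_h N (b0 N) j - laplacian_h N (fun l => y0 0%N (node N l)) j)).
  apply: vanishD position_lap_cvg; apply: vanishD; first apply: vanishZ c2 _.
    exact: boundary_initial_cvg T0 hg0 hg0h cvg_g0 0%N isT.
  exact: boundary_initial_cvg T0 hg1 hg1h cvg_g1 0%N isT.
move=> N j jN; have := @grid_sup_lap R N (fun j => b0 N j - y0 0%N (node N j)) j jN.
rewrite node0 nodeN {2 3}/initial_grid /with_boundary eqxx /= eqxx hc00 hc01.
rewrite (@l2n_eq _ _ _ (fun j => laplacian_h N (b0 N) j - laplacian_h N (fun l => y0 0%N (node N l)) j))//.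
by move=> l _; rewrite /laplacian_h; ring.
Qed.

Lemma velocity_grad_cvg : vanish (fun N => gradn N (fun j => b1 N j - y1 0%N (node N j))).
Proof.
apply: velocity_cvg => //.
  apply: vanish_leq (boundary_initial_cvg T0 hg0 hg0h cvg_g0 (isT : (1 < 2)%N)) _ => N.
  by rewrite /initial_grid /with_boundary eqxx -hc10.
apply: vanish_leq (boundary_initial_cvg T0 hg1 hg1h cvg_g1 (isT : (1 < 2)%N)) _ => N.
by rewrite /initial_grid /with_boundary /= eqxx -hc11.
Qed.

Lemma position_potential_cvg :
  vanish (fun N => l2n N (fun j => havg N p j * b0 N j - havg N (fun x => p x * y0 0%N x) j)).
Proof.
have [s vs Hs] := position_sup_cvg.
have v := vanishD (vanishZ m0 vs) (vanishZ (nL2_ge0 0 1 (y0 1%N)) (vanishZ m0 vanish_sqrt_mesh)).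
have s0 N : 0 <= s N by apply: le_trans (Hs N 0%N isT).
apply: vanish_leq v _ => N; apply: l2n_sup => [|j jN].
  by rewrite addr_ge0// !mulr_ge0 ?nL2_ge0 ?sqrtr_ge0.
have P : `|havg N p j| <= m by apply: havg_abs_le => //; exact: bounded_L1 mp pm.
have := havg_potential jN mp pm A00 (Sobolev2_L2 hy0 (isT : (1 <= 2)%N)).
rewrite distrC => H; rewrite (_ : _ - _ = havg N p j * (b0 N j - y0 0%N (node N j)) +
  (havg N p j * y0 0%N (node N j) - havg N (fun x => p x * y0 0%N x) j)); last ring.
rewrite (le_trans (ler_normD _ _))// lerD//.
  by rewrite normrM ler_pM// Hs//; case/andP: jN => _ /leqW.
by rewrite (le_trans H)// le_eqVlt; apply/orP; left; apply/eqP; ring.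
Qed.

Lemma wave_const_ge0 : 0 <= wave_const T m.
Proof.
have c0 := chain_const_ge0 T; have T00 := ltW T0.
by rewrite /wave_const !(addr_ge0, mulr_ge0, sqrtr_ge0, expR_ge0).
Qed.

Section Consistency.
Variables (y : nat -> nat -> R -> R -> R) (yh : nat -> nat -> nat -> R -> R).
Hypothesis sol : wave_solution T p (y0 0%N) (y1 0%N) (g 0%N) (g0 0%N) (g1 0%N) y.
Hypothesis solh : forall N, semidiscrete_solution T N (havg N p) (y0h N) (y1h N)
  (fun j => gh N j 0%N) (g0h N 0%N) (g1h N 0%N) (yh N).

Let z0 : 0 <= (0 : R) <= T. Proof. by rewrite lexx ltW. Qed.

Lemma wave_init0 x : 0 <= x <= 1 -> y 0%N 0%N 0 x = y0 0%N x.
Proof.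
move: x; apply: (ucont_eq_closed ltr01); last 1 first.
- by have [_ _ _ _ [_ _ I _]] := sol => x x01; apply: I; rewrite in_itv.
- exact: AC_ucont (wave_AC sol (i := 0) (k := 0) isT z0).
- exact: AC_ucont A00.
Qed.

Lemma wave_init1 x : 0 <= x <= 1 -> y 1%N 0%N 0 x = y1 0%N x.
Proof.
move: x; apply: (ucont_eq_closed ltr01); last 1 first.
- by have [_ _ _ _ [_ _ _ I]] := sol => x x01; apply: I; rewrite in_itv.
- exact: AC_ucont (wave_AC sol (i := 1) (k := 0) isT z0).
- exact: AC_ucont A10.
Qed.

Let bd (x : R) (G : nat -> R -> R) : 0 <= x <= 1 -> Sobolev 2 2%:E 0 T G ->
  (forall t, t \in `[0, T] -> y 0%N 0%N t x = G 0%N t) ->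
  (forall t, 0 <= t <= T -> y 1%N 0%N t x = G 1%N t) /\ AC 0 T (fun t => y 1%N 0%N t x) (G 2%N).
Proof.
move=> x01 SG E; have A := wave_point_AC T0 sol x01.
have B0 := Sobolev2_AC T0 SG (isT : (0 < 2)%N); have B1 := Sobolev2_AC T0 SG (isT : (1 < 2)%N).
have E1 : forall t, 0 <= t <= T -> y 1%N 0%N t x = G 1%N t.
  apply: (AC_derivative_unique T0 A B0).
  - exact: (wave_point_ucont sol (isT : (1 < 2)%N) x01).
  - exact: AC_ucont B1.
  - by move=> t tT; apply: E; rewrite in_itv.
by split=> //; apply: AC_eq B1 => t tT; rewrite E1.
Qed.

Lemma wave_left : (forall t, 0 <= t <= T -> y 1%N 0%N t 0 = g0 1%N t) /\ AC 0 T (fun t => y 1%N 0%N t 0) (g0 2%N).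
Proof. by have [_ _ _ _ [E _ _ _]] := sol; apply: bd => //; rewrite lexx ler01. Qed.

Lemma wave_right : (forall t, 0 <= t <= T -> y 1%N 0%N t 1 = g1 1%N t) /\ AC 0 T (fun t => y 1%N 0%N t 1) (g1 2%N).
Proof. by have [_ _ _ _ [_ E _ _]] := sol; apply: bd => //; rewrite lexx ler01. Qed.

Definition nodal i N j t : R := y i 0%N t (node N j).

(* The velocities of the semi-discrete solution minus the time averages of those
   of the continuous one solve the semi-discrete equation with source [defect_src]. *)
Definition defect n N j t : R := yh N j 1%N t - tavg2 T n (nodal 1 N j) t.

Definition defect_vel n N j t : R :=
  semi_vel' N (havg N p) (gh N) (yh N) j t - moll1 T n (nodal 0 N j) t.

(** Three consistency errors: the discrete source against the averaged one; multiplication by the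
    potential before or after passing to nodal values; the inertia of hat averages against that of
    nodal values. *)
Definition defect_src n N j t : R :=
  (gh N j 1%N t - tavg2 T n (fun s => havg N (g 1%N s) j) t) +
  tavg2 T n (fun s => havg N (fun x => p x * y 1%N 0%N s x) j - havg N p j * nodal 1 N j s) t +
  ((1 - eps n)^-1 * ((eps n * T) ^+ 2)^-1 *
     dlt T (eps n) (dlt T (eps n) (fun s => havg N (y 1%N 0%N s) j)) t - moll2 T n (nodal 1 N j) t).

Lemma nodal_ucont i N j : (i < 2)%N -> (j <= N.+1)%N -> ucont 0 T (nodal i N j).
Proof. by move=> i2 jN; exact: (wave_point_ucont sol i2 (node_in jN)). Qed.

Lemma nodal_AC N j : (j <= N.+1)%N -> AC 0 T (nodal 0 N j) (nodal 1 N j).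
Proof. by move=> jN; exact: (wave_point_AC T0 sol (node_in jN)). Qed.

Let leN N j : (1 <= j <= N)%N -> (j <= N.+1)%N. Proof. by case/andP => _ /leqW. Qed.

Lemma defect_AC n N j : (j <= N.+1)%N -> AC 0 T (defect n N j) (defect_vel n N j).
Proof.
move=> jN; apply: ACB.
  exact: (semi_vel_AC T0 (@source_AC N) (solh N) jN).
by apply: moll_AC1 => //; [exact: nodal_ucont|exact: nodal_AC].
Qed.

Let Lnod N j : (j <= N.+1)%N -> L1 0 T (nodal 1 N j).
Proof. by move=> jN; apply: ucont_L1; exact: nodal_ucont. Qed.

Let uhq N j : (1 <= j <= N)%N -> ucont 0 T (fun s => havg N (fun x => p x * y 1%N 0%N s x) j).
Proof. by move=> jN; exact: (wave_havgq_ucont sol jN mp pm (isT : (1 <= 2)%N)). Qed.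

Lemma defect_src_L1 n N j : (1 <= j <= N)%N -> L1 0 T (defect_src n N j).
Proof.
move=> jN; have jN1 := leN jN; have e0 := @eps_gt0 R n; have e1 := @eps_half R n.
apply: L1D; [apply: L1D|apply: L1B].
- apply: L1B; first exact: source_L1.
  by apply: ucont_L1; apply: tavg2_ucont => //; exact: havg_source_L1 hg _ _ jN 1%N isT.
- apply: ucont_L1; apply: tavg2_ucont => //; apply: L1B; first exact/ucont_L1/uhq.
  by apply: L1Z; exact: Lnod.
- apply: L1Z; apply: ucont_L1; do 2 apply: (dlt_ucont T0 e0 e1).
  exact: (wave_havg_ucont sol jN (isT : (1 <= 2)%N)).
- apply: ucont_L1; apply: ucontZ; do 2 apply: (dlt_ucont T0 e0 e1).
  exact: nodal_ucont.
Qed.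

Lemma defect_vel_AC n N j : (1 <= j <= N)%N -> AC 0 T (defect_vel n N j)
  (fun t => laplacian_h N (fun l => defect n N l t) j - havg N p j * defect n N j t + defect_src n N j t).
Proof.
move=> jN; have jN1 := leN jN.
have A1 := semi_acc_AC T0 (@source_AC N) (solh N) jN.
have A2 := moll_AC2 T0 n (nodal_ucont (isT : (1 < 2)%N) jN1) (nodal_AC jN1).
apply: (AC_eq _ (AC_eqd _ (ACB A1 A2))); first by move=> t _; rewrite /defect_vel /semi_vel' jN.
move=> t /andP[t0 tT]; have tT' : 0 <= t <= T by rewrite !ltW.
have W := wave_lap_deriv T0 mp pm hg sol jN n tT'.
rewrite -(tavg2_lap T0 n tT' jN) in W; last by move=> l lN; exact: Lnod.
have Lq : L1 0 T (fun s => havg N (fun x => p x * y 1%N 0%N s x) j) by exact/ucont_L1/uhq.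
have Q : tavg2 T n (fun s => havg N (fun x => p x * y 1%N 0%N s x) j - havg N p j * nodal 1 N j s) t =
    tavg2 T n (fun s => havg N (fun x => p x * y 1%N 0%N s x) j) t - havg N p j * tavg2 T n (nodal 1 N j) t.
  rewrite (tavg2_eq T0 n (g := fun s => havg N (fun x => p x * y 1%N 0%N s x) j + (- havg N p j) * nodal 1 N j s) tT'); last first.
    by move=> s _; ring.
  by rewrite (tavg2_lin T0 n (- havg N p j) tT' Lq (Lnod jN1)); ring.
have Lp : laplacian_h N (fun l => defect n N l t) j =
    laplacian_h N (fun l => yh N l 1%N t) j - laplacian_h N (fun l => tavg2 T n (nodal 1 N l) t) j.
  exact: laplacianB.
rewrite Lp /defect_src Q /defect.
have -> : laplacian_h N (fun l => tavg2 T n (nodal 1 N l) t) j =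
  laplacian_h N (fun l => tavg2 T n (fun s => y 1%N 0%N s (node N l)) t) j by [].
rewrite W; move: (laplacian_h _ _ _) (dlt _ _ _ _) (havg N p j) (moll2 _ _ _ _) (tavg2 _ _ _ t) (tavg2 _ _ _ t) (tavg2 _ _ _ t).
by move=> *; ring.
Qed.

Lemma defect_vel_L2 n N : L2 0 T (defect_vel n N 0) /\ L2 0 T (defect_vel n N N.+1).
Proof.
have M j : (j <= N.+1)%N -> L2 0 T (moll1 T n (nodal 0 N j)).
  move=> jN; apply/ucont_L2/AC_ucont; apply: moll_AC2 => //; last exact: nodal_AC.
  exact: nodal_ucont.
split; apply: L2B; [|exact: M| |exact: M].
  by rewrite /semi_vel' /=; exact: (semi_L2 (solh N)).
by rewrite /semi_vel' ltnn andbF; exact: (semi_L2 (solh N)).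
Qed.

Let small (k : R) : 0 < k -> exists n0, forall n, (n0 <= n)%N -> 2 * (eps n * T) < k.
Proof.
move=> k0; have [|n0 H] := @eps_mul_lt R T (k / 2) T0; first by rewrite divr_gt0.
by exists n0 => n /H; move: (eps n * T) => *; lra.
Qed.

Let moll1_sub n (u k : R -> R) (c t : R) : 0 <= t <= T -> (forall s, 0 <= s <= T -> `|u s - k s| <= c) ->
  `|moll1 T n u t - moll1 T n k t| <= ((eps n * T) ^+ 2)^-1 * (4 * c).
Proof.
move=> tT H; have ep := @eps_gt0 R n; have l0 := @lam_gt0 R n.
have i0 : 0 <= ((eps n * T) ^+ 2)^-1 :> R by rewrite invr_ge0 sqr_ge0.
rewrite /moll1 -mulrBr -ddltB normrM normrM (ger0_norm (ltW l0)) (ger0_norm i0).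
apply: ler_pM => //; first by rewrite mulr_ge0// ltW.
  by rewrite ler_piMl// gerBl ltW.
exact: ddlt_le.
Qed.

(** At time 0 both accelerations are expressed through the data: that of [y_h] by the scheme, that
    of [y] by the hat average of the equation. Replacing nodal values by hat averages in [moll1]
    costs [sqrt h] for fixed [n], after which [moll1] is [(1 - eps)^2] times an average of [d_tt y]
    near the initial time. *)
Lemma defect_vel_init : vanish2 (fun n N => l2n N (fun j => defect_vel n N j 0)).
Proof.
have [M M0 HM] := wave_bound sol (i := 0) (k := 1) isT.
pose al N := l2n N (fun j => laplacian_h N (b0 N) j - laplacian_h N (fun l => y0 0%N (node N l)) j).
pose be N := l2n N (fun j => havg N p j * b0 N j - havg N (fun x => p x * y0 0%N x) j).
pose ga N := T^-1 * itg 0 T (fun t => l2n N (fun j => gh N j 0%N t - havg N (g 0%N t) j)) +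
  itg 0 T (fun t => l2n N (fun j => gh N j 1%N t - havg N (g 1%N t) j)).
pose d1 n N := ((eps n * T) ^+ 2)^-1 * (4 * (Num.sqrt (mesh N) * M)).
pose w n N := l2n N (fun j => havg N (y 2%N 0%N 0) j - tavg2 T n (fun s => havg N (y 2%N 0%N s) j) 0).
have v1 : vanish2 (fun n N => al N + be N + ga N + d1 n N).
  apply: vanish2_2 => n; apply: vanishD; first apply: vanishD; first apply: vanishD.
  - exact: position_lap_cvg.
  - exact: position_potential_cvg.
  - apply: vanishD; last exact: source_mean_cvg.
    apply: vanishZ; first by rewrite invr_ge0 ltW.
    exact: source_mean_cvg.
  have c0 : 0 <= ((eps n * T) ^+ 2)^-1 * 4 * M by rewrite !mulr_ge0 ?invr_ge0 ?sqr_ge0// ltW.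
  by apply: vanish_leq (vanishZ c0 vanish_sqrt_mesh) _ => N; rewrite le_eqVlt /d1; apply/orP; left; apply/eqP; ring.
have v2 : vanish2 w.
  move=> e e0; have e4 : 0 < e / 2 by rewrite divr_gt0.
  have [d d0 Hd] := wave_cont sol (i := 2) (k := 0) isT e4.
  have [n0 Hn] := small d0; exists n0 => n /Hn nd; exists 0%N => N _.
  have z1 j : (1 <= j <= N)%N -> L1 0 T (fun s => havg N (y 2%N 0%N s) j).
    by move=> jN; apply: ucont_L1; exact: (wave_havg_ucont sol jN (isT : (2 <= 2)%N)).
  rewrite /w (@l2n_eq _ _ _ (fun j => tavg2 T n (fun s => havg N (y 2%N 0%N 0) j - havg N (y 2%N 0%N s) j) 0)); last first.
    by move=> j jN; rewrite (tavg2B T0 n z0 (L1_cst _ _ _) (z1 j jN)) tavg2_cst.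
  apply: (tavg2_l2n0 T0) => [j jN|s sT sd]; first by apply: L1B; [exact: L1_cst|exact: z1].
  have La := wave_L2 sol (i := 2) (k := 0) isT z0; have Lb := wave_L2 sol (i := 2) (k := 0) isT sT.
  rewrite (@l2n_eq _ _ _ (havg N (fun x => y 2%N 0%N 0 x - y 2%N 0%N s x))); last first.
    by move=> j jN; rewrite (havgB jN (L2_L1 La) (L2_L1 Lb)).
  rewrite (le_trans (l2n_havg_le N (L2B La Lb)))//.
  have [s0 _] := andP sT.
  have := Hd 0 s z0 sT; rewrite sub0r normrN ger0_norm// => /(_ (le_lt_trans sd nd)).
  by move: (nL2 _ _ _) => *; lra.
have [M2 M20 HM2] := wave_bound sol (i := 2) (k := 0) isT.
have c4 : 0 <= 4 * M2 by rewrite mulr_ge0// ltW.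
have v3 := vanish2_1 (vanishZ c4 (@vanish_eps R)).
apply: vanish2_le (vanish2D (vanish2D v1 v2) v3) _ => n; exists 0%N => N _.
have ep := @eps_gt0 R n; have ep2 := @eps_half R n.
pose U j := moll1 T n (nodal 0 N j) 0 - moll1 T n (fun s => havg N (y 0%N 0%N s) j) 0.
pose S j := tavg2 T n (fun s => havg N (y 2%N 0%N s) j) 0.
pose W j := gh N j 0%N 0 - wave_source p y N j 0.
pose Y j := havg N (y 2%N 0%N 0) j.
pose La j := laplacian_h N (b0 N) j - laplacian_h N (fun l => y0 0%N (node N l)) j.
pose Pb j := havg N p j * b0 N j - havg N (fun x => p x * y0 0%N x) j.
(* Errors in order: second differences of the initial position, potential, initial source, nodal
   against hat averages, time averaging of [d_tt y], and the factor [(1 - eps)^2]. *)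
have E j : (1 <= j <= N)%N -> defect_vel n N j 0 =
    (La j - Pb j + W j - U j) + (Y j - S j) + (1 - (1 - eps n) ^+ 2) * S j.
  move=> jN; have jN1 := leN jN; have [j1 jN2] := andP jN.
  have m1 : moll1 T n (fun s => havg N (y 0%N 0%N s) j) 0 = (1 - eps n) ^+ 2 * S j.
    apply: (moll1E T0 n z0 (u1 := fun s => havg N (y 1%N 0%N s) j)).
    - exact: (wave_havg_ucont sol jN (isT : (1 <= 2)%N)).
    - exact: (wave_havg_AC T0 sol jN (isT : (0 < 2)%N)).
    - exact: (wave_havg_AC T0 sol jN (isT : (1 < 2)%N)).
  have Lp0 (f : R -> R) : L2 0 1 f -> L1 0 1 (fun x => p x * f x).
    by move=> Lf; have [/L2_L1] := weighted_L2 mp pm Lf.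
  have e1 : havg N (fun x => p x * y 0%N 0%N 0 x) j = havg N (fun x => p x * y0 0%N x) j.
    apply: (havg_ae jN).
    - apply: Lp0; exact: (wave_L2 sol (i := 0) (k := 0) isT z0).
    - apply: Lp0; exact: ucont_L2 (AC_ucont A00).
    - by apply: ae_all => x /andP[x0 x1]; rewrite wave_init0// !ltW.
  have e2 : laplacian_h N (fun l => y 0%N 0%N 0 (node N l)) j = laplacian_h N (fun l => y0 0%N (node N l)) j.
    have jp : (j.-1 <= N.+1)%N by rewrite (leq_trans (leq_pred j)).
    have js : (j.+1 <= N.+1)%N by [].
    by rewrite /laplacian_h !wave_init0// node_in.
  have e3 : laplacian_h N (fun l => yh N l 0%N 0) j = laplacian_h N (b0 N) j.
    have jp : (j.-1 <= N.+1)%N by rewrite (leq_trans (leq_pred j)).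
    have js : (j.+1 <= N.+1)%N by [].
    by rewrite /laplacian_h !(semi_init0 T0 (solh N)).
  rewrite /defect_vel /semi_vel' jN /semi_acc e3 (semi_init0 T0 (solh N) jN1) -/(b0 N j).
  rewrite /U /W /wave_source e1 e2 m1 /La /Pb /Y.
  by move: (laplacian_h _ _ _) (laplacian_h _ _ _) (havg N p j) (havg _ _ j) (havg _ _ j) (S j) (moll1 _ _ _ _) => *; ring.
rewrite (l2n_eq E).
have n1 : l2n N W <= ga N.
  rewrite (le_trans (l2n_initial_le T0 (f := fun j t => gh N j 0%N t - wave_source p y N j t)
    (f' := fun j t => gh N j 1%N t - havg N (g 1%N t) j) _))//.
    by move=> j jN; apply: ACB; [exact: source_AC|exact: (wave_source_AC T0 mp pm hg sol jN)].
  have Lw j : (1 <= j <= N)%N -> L1 0 T (fun t => gh N j 0%N t - wave_source p y N j t).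
    move=> jN; apply: L1B; first exact: source_L1.
    exact: ucont_L1 (AC_ucont (wave_source_AC T0 mp pm hg sol jN)).
  have Lv j : (1 <= j <= N)%N -> L1 0 T (fun t => gh N j 0%N t - havg N (g 0%N t) j).
    by move=> jN; apply: L1B; [exact: source_L1|exact: (havg_source_L1 hg jN (isT : (0 <= 1)%N))].
  rewrite lerD2r ler_pM2l ?invr_gt0//.
  rewrite (itg_ae_eq (l2n_L1 Lw) (l2n_L1 Lv))//.
  have : {ae mu, forall t : R, forall j, (1 <= j <= N)%N -> 0 < t < T -> wave_source p y N j t = havg N (g 0%N t) j}.
    apply: ae_ord => j jN; exact: (wave_source_ae mp pm hg sol jN).
  by apply: ae_mono => t Et tT; apply: l2n_eq => j jN; rewrite Et.
have n2 : l2n N U <= d1 n N.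
  have e0 : 0 <= d1 n N by rewrite !mulr_ge0 ?invr_ge0 ?sqr_ge0 ?sqrtr_ge0// ltW.
  apply: l2n_sup => // j jN; apply: moll1_sub => // s sT.
  rewrite distrC (le_trans (havg_node jN (wave_AC sol (i := 0) (k := 0) isT sT) (wave_L2 sol (i := 0) (k := 1) isT sT)))//.
  by rewrite ler_wpM2l ?sqrtr_ge0// HM.
have n3 : l2n N (fun j => (1 - (1 - eps n) ^+ 2) * S j) <= 4 * M2 * eps n.
  have S2 : l2n N S <= 2 * M2.
    apply: tavg2_l2n => // [j jN|s /andP[s0 sT]].
      by apply: ucont_L1; exact: (wave_havg_ucont sol jN (isT : (2 <= 2)%N)).
    have sT' : 0 <= s <= T by rewrite !ltW.
    rewrite (le_trans (l2n_havg_le N (wave_L2 sol (i := 2) (k := 0) isT sT')))// ler_pM2l//; exact: HM2.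
  rewrite l2nZ (_ : 4 * M2 * eps n = (2 * eps n) * (2 * M2)); last by ring.
  apply: ler_pM => //; first exact: l2n_ge0.
  rewrite (_ : 1 - (1 - eps n) ^+ 2 = eps n * (2 - eps n)); last ring.
  by rewrite ger0_norm; move: (eps n) ep ep2 => *; nra.
rewrite (le_trans (l2nD _ _ _))// lerD// (le_trans (l2nD _ _ _))// lerD//.
rewrite (le_trans (l2nB _ _ _))// lerD// (le_trans (l2nD _ _ _))// lerD//.
exact: l2nB.
Qed.

(** The discrete initial velocity converges in the gradient norm, and the time average at 0 is close
    to the value at 0 because [d_tx y] is continuous in time with values in [L^2]. *)
Lemma defect_grad_init : vanish2 (fun n N => gradn N (fun j => defect n N j 0)).
Proof.
pose w n N := gradn N (fun j => nodal 1 N j 0 - tavg2 T n (nodal 1 N j) 0).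
have v2 : vanish2 w.
  move=> e e0; have [d d0 Hd] := wave_cont sol (i := 1) (k := 1) isT e0.
  have [n0 Hn] := small d0; exists n0 => n /Hn nd; exists 0%N => N _.
  rewrite /w (@gradn_eq _ _ _ (fun j => tavg2 T n (fun s => nodal 1 N j 0 - nodal 1 N j s) 0)); last first.
    by move=> j jN; rewrite (tavg2B T0 n z0 (L1_cst _ _ _) (Lnod jN)) tavg2_cst.
  apply: (tavg2_gradn0 T0) => [j jN|s sT sd]; first by apply: L1B; [exact: L1_cst|exact: Lnod].
  have Aa := wave_AC sol (i := 1) (k := 0) isT z0; have Ab := wave_AC sol (i := 1) (k := 0) isT sT.
  have La := wave_L2 sol (i := 1) (k := 1) isT z0; have Lb := wave_L2 sol (i := 1) (k := 1) isT sT.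
  rewrite (le_trans (grad_nodes_le N (ACB Aa Ab) (L2B La Lb)))//.
  have [s0 _] := andP sT.
  by have := Hd 0 s z0 sT; rewrite sub0r normrN ger0_norm// => /(_ (le_lt_trans sd nd))/ltW.
have v1 : vanish2 (fun n N => gradn N (fun j => b1 N j - y1 0%N (node N j))).
  by apply: vanish2_2 => _; exact: velocity_grad_cvg.
apply: vanish2_le (vanish2D v1 v2) _ => n; exists 0%N => N _.
rewrite (le_trans _ (gradnD _ _ _))// le_eqVlt; apply/orP; left; apply/eqP/gradn_eq => j jN.
rewrite /defect (semi_init1 T0 (hg0h N) (hg1h N) (solh N) jN) /nodal (wave_init1 (node_in jN)).
by rewrite /initial_grid addrA subrK.
Qed.

Lemma defect_left_init : vanish2 (fun n N => `|defect n N 0 0|).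
Proof.
have v1 : vanish2 (fun n N => `|g0h N 1%N 0 - g0 1%N 0|).
  by apply: vanish2_2 => _; exact: boundary_initial_cvg T0 hg0 hg0h cvg_g0 1%N isT.
have v2 : vanish2 (fun n N => `|tavg2 T n (fun t => y 1%N 0%N t 0) 0 - y 1%N 0%N 0 0|).
  apply: vanish2_1 => e e0; have x0 : 0 <= (0 : R) <= 1 by rewrite lexx ler01.
  have [n0 Hn] := tavg2_unif T0 (wave_point_ucont sol (isT : (1 < 2)%N) x0) e0.
  by exists n0 => n /Hn; apply.
apply: vanish2_le (vanish2D v1 v2) _ => n; exists 0%N => N _.
have [El _] := semi_left T0 (hg0h N) (solh N); have [Ew _] := wave_left.
rewrite /defect El// (_ : nodal 1 N 0 = fun t => y 1%N 0%N t 0); last by apply/funext => t; rewrite /nodal node0.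
rewrite -(Ew 0 z0) (distrC (tavg2 _ _ _ _)); apply: le_trans (ler_normD _ _).
by rewrite addrA subrK.
Qed.

Lemma defect_left_vel : vanish2 (fun n N => nL2 0 T (defect_vel n N 0)).
Proof.
have x0 : 0 <= (0 : R) <= 1 by rewrite lexx ler01.
have [_ A1] := wave_left.
have := @boundary_velocity_cvg R T g0 g0h T0 hg0 hg0h cvg_g0 (fun N => yh N 0%N 2%N) _ _
  (fun N => semi_L2 (solh N) (leq0n N.+1) (leqnn 2)) (fun N => (semi_left T0 (hg0h N) (solh N)).2)
  (wave_point_ucont sol (isT : (1 < 2)%N) x0) (wave_point_AC T0 sol x0) A1.
move=> v; apply: vanish2_le v _ => n; exists 0%N => N _; rewrite le_eqVlt; apply/orP; left; apply/eqP/nL2_eq => t _.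
by rewrite /defect_vel /semi_vel' /= (_ : nodal 0 N 0 = fun t => y 0%N 0%N t 0)//; apply/funext => s; rewrite /nodal node0.
Qed.

Lemma defect_right_vel : vanish2 (fun n N => nL2 0 T (defect_vel n N N.+1)).
Proof.
have x0 : 0 <= (1 : R) <= 1 by rewrite lexx ler01.
have [_ A1] := wave_right.
have := @boundary_velocity_cvg R T g1 g1h T0 hg1 hg1h cvg_g1 (fun N => yh N N.+1 2%N) _ _
  (fun N => semi_L2 (solh N) (leqnn N.+1) (leqnn 2)) (fun N => (semi_right T0 (hg1h N) (solh N)).2)
  (wave_point_ucont sol (isT : (1 < 2)%N) x0) (wave_point_AC T0 sol x0) A1.
move=> v; apply: vanish2_le v _ => n; exists 0%N => N _; rewrite le_eqVlt; apply/orP; left; apply/eqP/nL2_eq => t _.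
rewrite /defect_vel /semi_vel' ltnn andbF (_ : nodal 0 N N.+1 = fun t => y 0%N 0%N t 1)//.
by apply/funext => s; rewrite /nodal nodeN.
Qed.

(** Two mismatches. Hat averages against nodal values: [sqrt h (eps T)^-2], small once [n] is fixed.
    The coefficients [(1 - eps)^-1] and [(1 - eps)^3]: their gap is of order [eps], the second
    difference gains [eps T] times the time modulus of [d_tt y], and together these compensate
    [(eps T)^-2], leaving a multiple of that modulus. *)
Lemma commutator_cvg : vanish2 (fun n N => itg 0 T (fun t => l2n N (fun j =>
  (1 - eps n)^-1 * ((eps n * T) ^+ 2)^-1 *
     dlt T (eps n) (dlt T (eps n) (fun s => havg N (y 1%N 0%N s) j)) t - moll2 T n (nodal 1 N j) t))).
Proof.
have [M M0 HM] := wave_bound sol (i := 1) (k := 1) isT.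
(* Then [k = e / 32], and the bound [8 k / T] integrated over a time [T] gives [e / 4]; at least
   half of [e] is left for the term in [sqrt h]. *)
move=> e e0; have e4 : 0 < e / 64 by rewrite divr_gt0.
have [d d0 Hd] := wave_cont sol (i := 2) (k := 0) isT e4.
have [n0 Hn] := small d0; exists n0 => n /Hn nd.
have ep := @eps_gt0 R n; have ep2 := @eps_half R n; have l0 := @lam_gt0 R n.
have eT0 : 0 < eps n * T by rewrite mulr_gt0.
set c := ((eps n * T) ^+ 2)^-1.
have c0 : 0 < c by rewrite invr_gt0 exprn_gt0.
have cM0 : 0 <= T * (c * 4 * M) by rewrite !mulr_ge0 ?(ltW c0) ?(ltW M0) ?(ltW T0).
have [|N0 HN] := vanishZ cM0 (@vanish_sqrt_mesh R) (e := e / 2); first by rewrite divr_gt0.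
exists N0 => N /HN {HN}HN.
pose w j t := (1 - eps n)^-1 * c * dlt T (eps n) (dlt T (eps n) (fun s => havg N (y 1%N 0%N s) j)) t -
  moll2 T n (nodal 1 N j) t.
have uh j : (1 <= j <= N)%N -> ucont 0 T (fun s => havg N (y 1%N 0%N s) j) /\
    ucont 0 T (fun s => havg N (y 2%N 0%N s) j).
  move=> jN; split; first exact: (wave_havg_ucont sol jN (isT : (1 <= 2)%N)).
  exact: (wave_havg_ucont sol jN (isT : (2 <= 2)%N)).
pose k := 2 * (e / 64).
have K t : 0 <= t <= T -> l2n N (fun j => dlt T (eps n) (dlt T (eps n) (fun s => havg N (y 1%N 0%N s) j)) t) <= eps n * T * k.
  move=> tT; apply: (ddlt_l2n T0 (f' := fun j s => havg N (y 2%N 0%N s) j) tT) => [j jN|s sT].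
    by split; [case: (uh j jN)|exact: (wave_havg_AC T0 sol jN (isT : (1 < 2)%N))].
  have [a b c1] := tavg_range T0 ep ep2 sT.
  have r1 : 0 <= (1 - eps n) * s <= T by rewrite a (le_trans b).
  have r2 : 0 <= (1 - eps n) * s + eps n * T <= T by rewrite c1 (le_trans a).
  have La := wave_L2 sol (i := 2) (k := 0) isT r2; have Lb := wave_L2 sol (i := 2) (k := 0) isT r1.
  rewrite (@l2n_eq _ _ _ (havg N (fun x => y 2%N 0%N ((1 - eps n) * s + eps n * T) x - y 2%N 0%N ((1 - eps n) * s) x))); last first.
    by move=> j jN; rewrite (havgB jN (L2_L1 La) (L2_L1 Lb)).
  rewrite (le_trans (l2n_havg_le N (L2B La Lb)))// /k ler_pM2l// ltW// Hd// addrAC subrr add0r gtr0_norm//.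
  by rewrite (le_lt_trans _ nd)// ler_peMl ?ler1n// ltW.
have B t : 0 < t < T -> l2n N (w^~ t) <= c * (4 * (Num.sqrt (mesh N) * M)) + 8 * k / T.
  move=> /andP[t0 tT]; have tT' : 0 <= t <= T by rewrite !ltW.
  pose A j := dlt T (eps n) (dlt T (eps n) (fun s => havg N (y 1%N 0%N s) j)) t.
  pose U j := dlt T (eps n) (dlt T (eps n) (nodal 1 N j)) t.
  pose q := (1 - eps n) ^+ 3 * c.
  have q0 : 0 <= q by rewrite mulr_ge0 ?exprn_ge0 ?(ltW l0) ?(ltW c0).
  rewrite (@l2n_eq _ _ _ (fun j => q * (A j - U j) + ((1 - eps n)^-1 * c - q) * A j)); last first.
    by move=> j jN; rewrite /w /moll2 -/(A j) -/(U j) -/c -/q; move: (A j) (U j) => *; ring.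
  rewrite (le_trans (l2nD _ _ _))// lerD//.
    apply: l2n_sup => [|j jN]; first by rewrite !mulr_ge0 ?sqrtr_ge0 ?(ltW c0) ?(ltW M0).
    rewrite normrM (ger0_norm q0) ler_pM//.
      by rewrite /q ler_piMl ?(ltW c0)// exprn_ile1 ?(ltW l0)// gerBl ltW.
    rewrite /A /U -ddltB; apply: ddlt_le => // s sT.
    rewrite (le_trans (havg_node jN (wave_AC sol (i := 1) (k := 0) isT sT) (wave_L2 sol (i := 1) (k := 1) isT sT)))//.
    by rewrite ler_wpM2l ?sqrtr_ge0// HM.
  rewrite l2nZ (le_trans (ler_wpM2l (normr_ge0 _) (K t tT')))//.
  have -> : 8 * k / T = (8 * eps n * c) * (eps n * T * k).
    by rewrite /c; have := lt0r_neq0 T0; have := lt0r_neq0 ep; move: (eps n) => ? ? ?; field; apply/andP.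
  apply: ler_wpM2r; first by rewrite mulr_ge0 ?(ltW eT0)// /k mulr_ge0// ltW.
  rewrite /q -mulrBl normrM (gtr0_norm c0); apply: ler_wpM2r; first exact: ltW.
  have -> : (1 - eps n)^-1 - (1 - eps n) ^+ 3 = (1 - eps n)^-1 * (1 - (1 - eps n) ^+ 4) :> R.
    by rewrite mulrBr mulr1 [_ ^+ 4]exprS mulrA mulVf ?mul1r// lt0r_neq0.
  have i2 : (0 : R) <= ((1 - eps n)^-1 : R) <= 2.
    rewrite invr_ge0 (ltW l0) /= -[leRHS]invrK lef_pV2 ?posrE ?invr_gt0//.
    by move: (eps n) ep2 => *; lra.
  have i3 : (0 : R) <= (1 - (1 - eps n) ^+ 4 : R) <= 4 * eps n.
    move: (eps n) ep ep2 => x x0 x1.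
    have -> : 1 - (1 - x) ^+ 4 = x * ((2 - x) * (1 + (1 - x) ^+ 2)) by ring.
    have a1 : 0 <= 2 - x by lra.
    have a2 : 0 <= 1 + (1 - x) ^+ 2 by rewrite addr_ge0 ?sqr_ge0.
    have a3 : 0 <= 6 - 4 * x + x ^+ 2 by have := sqr_ge0 x; move: (x ^+ 2) => *; lra.
    have a4 : 4 - (2 - x) * (1 + (1 - x) ^+ 2) = x * (6 - 4 * x + x ^+ 2) by ring.
    rewrite (mulr_ge0 (ltW x0) (mulr_ge0 a1 a2)) /= [leRHS]mulrC ler_pM2l// -subr_ge0 a4.
    exact: mulr_ge0 (ltW x0) a3.
  have [/andP[a1 a2] /andP[a3 a4]] := (i2, i3).
  rewrite ger0_norm ?mulr_ge0// (_ : 8 * eps n = 2 * (4 * eps n)); last by ring.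
  exact: ler_pM.
have Lw j : (1 <= j <= N)%N -> L1 0 T (w j).
  move=> jN; have [h1 h2] := uh j jN; apply: ucont_L1; apply: ucontB; apply: ucontZ; do 2 apply: (dlt_ucont T0 ep ep2) => //.
  exact: nodal_ucont (leN jN).
apply: le_trans (itg_le (l2n_L1 Lw) (L1_cst _ _ _) B) _.
rewrite itg_cst ?(ltW T0)// subr0 mulrDl -[8 * k / T * T]mulrA mulVf ?mulr1 ?gt_eqF//.
have -> : c * (4 * (Num.sqrt (mesh N) * M)) * T = T * (c * 4 * M) * Num.sqrt (mesh N) by ring.
by move: HN; rewrite /k; move: (_ * Num.sqrt _) => *; lra.
Qed.

(** The time-averaging error of the source must be small for large [n] uniformly in [N], whence
    [source_tavg_cvg]; the errors of data and potential tend to 0 with [h], with bounds that do not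
    involve [n]. *)
Lemma defect_src_cvg : vanish2 (fun n N => itg 0 T (fun t => l2n N (fun j => defect_src n N j t))).
Proof.
have [M M0 HM] := wave_bound sol (i := 1) (k := 1) isT.
have v1 : vanish2 (fun n N => itg 0 T (fun t => l2n N (fun j => gh N j 1%N t - havg N (g 1%N t) j))).
  by apply: vanish2_2 => _; exact: source_mean_cvg.
have v2 : vanish2 (fun n N => itg 0 T (fun t => l2n N (fun j => havg N (g 1%N t) j -
    tavg2 T n (fun s => havg N (g 1%N s) j) t))).
  move=> e e0; have [n0 H] := source_tavg_cvg (gh := fun N j => gh N j 1%N) T0
    (fun N j jN => source_L1 (isT : (1 <= 1)%N) jN) (fun N j jN => havg_source_L1 hg jN (isT : (1 <= 1)%N))
    (source_diff_meas hg (isT : (1 <= 1)%N) (fun N j jN => source_L1 (isT : (1 <= 1)%N) jN)) (cvg_g (isT : (1 <= 1)%N)) e0.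
  by exists n0 => n /H Hn; exists 0%N.
have c0 : 0 <= T * m * M by rewrite !mulr_ge0// ltW.
have v3 := @vanish2_2 R (fun _ N => T * m * M * Num.sqrt (mesh N)) (fun _ => vanishZ c0 (@vanish_sqrt_mesh R)).
apply: vanish2_le (vanish2D (vanish2D (vanish2D v1 v2) v3) commutator_cvg) _ => n; exists 0%N => N _.
have ep := @eps_gt0 R n; have ep2 := @eps_half R n.
pose f1 j t := gh N j 1%N t - havg N (g 1%N t) j.
pose f2 j t := havg N (g 1%N t) j - tavg2 T n (fun s => havg N (g 1%N s) j) t.
pose f3 j t := tavg2 T n (fun s => havg N (fun x => p x * y 1%N 0%N s x) j - havg N p j * nodal 1 N j s) t.
pose f4 j t := (1 - eps n)^-1 * ((eps n * T) ^+ 2)^-1 *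
     dlt T (eps n) (dlt T (eps n) (fun s => havg N (y 1%N 0%N s) j)) t - moll2 T n (nodal 1 N j) t.
have Lh j : (1 <= j <= N)%N -> L1 0 T (fun t => havg N (g 1%N t) j).
  by move=> jN; exact: (havg_source_L1 hg jN (isT : (1 <= 1)%N)).
have L1f j : (1 <= j <= N)%N -> L1 0 T (f1 j) by move=> jN; apply: L1B; [exact: source_L1|exact: Lh].
have L2f j : (1 <= j <= N)%N -> L1 0 T (f2 j).
  by move=> jN; apply: L1B; [exact: Lh|apply: ucont_L1; apply: tavg2_ucont => //; exact: Lh].
have Lp j : (1 <= j <= N)%N -> L1 0 T (fun s => havg N (fun x => p x * y 1%N 0%N s x) j - havg N p j * nodal 1 N j s).
  by move=> jN; apply: L1B; [exact/ucont_L1/uhq|apply: L1Z; exact: Lnod (leN jN)].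
have L4f j : (1 <= j <= N)%N -> L1 0 T (f4 j).
  move=> jN; apply: ucont_L1; apply: ucontB; apply: ucontZ; do 2 apply: (dlt_ucont T0 ep ep2) => //.
    exact: (wave_havg_ucont sol jN (isT : (1 <= 2)%N)).
  exact: nodal_ucont (leN jN).
have B3 t : 0 < t < T -> l2n N (fun j => f3 j t) <= m * (Num.sqrt (mesh N) * M).
  move=> /andP[t0 tT]; apply: tavg2_l2n => //; first by rewrite !ltW.
  move=> s /andP[s0 sT]; have sT' : 0 <= s <= T by rewrite !ltW.
  apply: l2n_sup => [|j jN]; first by rewrite !mulr_ge0 ?sqrtr_ge0// ltW.
  rewrite (le_trans (havg_potential jN mp pm (wave_AC sol (i := 1) (k := 0) isT sT') (wave_L2 sol (i := 1) (k := 1) isT sT')))//.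
  by rewrite ler_wpM2l// ler_wpM2l ?sqrtr_ge0// HM.
have I1 := l2n_L1 L1f; have I2 := l2n_L1 L2f; have I4 := l2n_L1 L4f.
have I3 : L1 0 T (fun=> m * (Num.sqrt (mesh N) * M)) by exact: L1_cst.
apply: le_trans (itg_le (l2n_L1 (fun j jN => defect_src_L1 n jN)) (L1D (L1D (L1D I1 I2) I3) I4) _) _.
  move=> t tT; apply: le_trans (l2nD _ _ _) _; apply: lerD => //.
  apply: le_trans (l2nD _ _ _) _; apply: lerD; last exact: B3.
  rewrite (@l2n_eq _ _ _ (fun j => f1 j t + f2 j t)) ?l2nD// => j jN.
  by rewrite /f1 /f2 addrA subrK.
rewrite (itgD (L1D (L1D I1 I2) I3) I4) (itgD (L1D I1 I2) I3) (itgD I1 I2) itg_cst ?(ltW T0)// subr0.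
rewrite lerD2r lerD2l le_eqVlt; apply/orP; left; apply/eqP; ring.
Qed.

Definition defect_data n N : R :=
  l2n N (fun j => defect_vel n N j 0) + gradn N (fun j => defect n N j 0) + `|defect n N 0 0| +
  nL2 0 T (defect_vel n N 0) + nL2 0 T (defect_vel n N N.+1) +
  itg 0 T (fun t => l2n N (fun j => defect_src n N j t)).

Lemma defect_data_cvg : vanish2 defect_data.
Proof.
apply: vanish2D defect_src_cvg; apply: vanish2D defect_right_vel; apply: vanish2D defect_left_vel.
by apply: vanish2D defect_left_init; apply: vanish2D defect_vel_init defect_grad_init.
Qed.

Lemma defect_estimate n N : (3 <= N)%N ->
  [/\ forall t, 0 <= t <= T -> Num.sqrt (wave_energy N (fun j => defect n N j t) (fun j => defect_vel n N j t)) <=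
        wave_const T m * defect_data n N,
      forall t j, 0 <= t <= T -> (j <= N.+1)%N -> `|defect n N j t| <= wave_const T m * defect_data n N &
      nL2 0 T (fun t => dminus_h N (fun j => defect n N j t) N.+1) <= wave_const T m * defect_data n N].
Proof.
move=> N3; have [La Lb] := defect_vel_L2 n N.
have P j : (1 <= j <= N)%N -> `|havg N p j| <= m.
  by move=> jN; apply: havg_abs_le => //; exact: bounded_L1 mp pm.
have [H1 H2 H3] := discrete_wave T0 m0 N3 P (@defect_AC n N) La Lb (@defect_src_L1 n N)
  (@defect_vel_AC n N) (l2n_L1 (@defect_src_L1 n N)) (fun t _ => lexx _).
have D : wave_const T m * wave_data T N (defect n N) (defect_vel n N) (fun t => l2n N (fun j => defect_src n N j t)) <=
    wave_const T m * defect_data n N.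
  apply: ler_wpM2l; first exact: wave_const_ge0.
  by rewrite /wave_data /defect_data !lerD2r sqrt_energy_le.
split=> [t tT|t j tT jN|].
- exact: le_trans (H1 t tT) D.
- exact: le_trans (H2 t j tT jN) D.
- exact: le_trans H3 D.
Qed.

Let slope N t : R := (nodal 0 N N.+1 t - nodal 0 N N t) / mesh N.

Let k t : R := y 0%N 1%N t 1.

Let tavg_bound n (f : R -> R) (c t : R) : 0 <= t <= T -> L1 0 T f ->
  (forall s, 0 < s < T -> `|f s| <= c) -> `|tavg T (eps n) f t| <= c.
Proof.
move=> tT Lf H; have e0 := @eps_gt0 R n; have e1 := @eps_half R n.
rewrite (le_trans (tavg_abs T0 e0 e1 tT Lf))// -[leRHS](tavg_cst T0 e0 c t).
by apply: (tavg_le T0 e0 e1 tT) => //; [exact: L1_abs|exact: L1_cst].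
Qed.

(** The observation is the last slope of the defect, controlled by [defect_estimate], plus that of
    the averaged nodal velocities. The latter is a difference of time averages of the last slope of
    [y], and so converges for fixed [n] even though [d_tx y(., 1)] is not yet known to exist. *)
Lemma observation_defect : vanish2 (fun n N => nL2 0 T (fun t => Theta_h_boundary N (yh N) t -
  (1 - eps n)^-1 * (eps n * T)^-1 * dlt T (eps n) (tavg T (eps n) k) t)).
Proof.
have [M M0 HM] := wave_bound sol (i := 0) (k := 2) isT.
have C0 := wave_const_ge0.
pose c n := Num.sqrt T * ((1 - eps n)^-1 * (eps n * T)^-1 * (2 * M)).
have c0 n : 0 <= c n.
  rewrite !mulr_ge0 ?sqrtr_ge0 ?invr_ge0 ?(ltW (lam_gt0 n)) ?(ltW M0)//.
  by rewrite mulr_ge0 ?(ltW T0) ?(ltW (eps_gt0 n)).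
have v1 := vanish2D (vanish2Z C0 defect_data_cvg)
  (@vanish2_2 R (fun n N => c n * Num.sqrt (mesh N)) (fun n => vanishZ (c0 n) (@vanish_sqrt_mesh R))).
apply: vanish2_le v1 _ => n; exists 3%N => N N3.
have [_ _ H3] := defect_estimate n N3.
have ep := @eps_gt0 R n; have ep2 := @eps_half R n; have l0 := @lam_gt0 R n.
have jN1 : (N.+1 <= N.+1)%N by []. have jN : (N <= N.+1)%N by [].
have h0 := @mesh_gt0 R N.
have ud j : (j <= N.+1)%N -> ucont 0 T (defect n N j) by move=> jl; exact: AC_ucont (defect_AC n jl).
have L1d : L2 0 T (fun t => dminus_h N (fun j => defect n N j t) N.+1).
  apply: (@L2_eq _ _ _ (fun t => (mesh N)^-1 * (defect n N N.+1 t - defect n N N t))).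
    by move=> t _; rewrite /dminus_h mulrC.
  by apply/ucont_L2/ucontZ/ucontB; exact: ud.
have uS : ucont 0 T (slope N).
  apply: (ucont_eq (f := fun t => (mesh N)^-1 * (nodal 0 N N.+1 t - nodal 0 N N t))).
    by move=> t _; rewrite /slope mulrC.
  by apply/ucontZ/ucontB; exact: nodal_ucont.
have uk : ucont 0 T k by exact: wave_slope_ucont sol.
pose A t := (1 - eps n)^-1 * (eps n * T)^-1 * dlt T (eps n) (tavg T (eps n) (slope N)) t.
pose B t := (1 - eps n)^-1 * (eps n * T)^-1 * dlt T (eps n) (tavg T (eps n) k) t.
have uAB : ucont 0 T (fun t => A t - B t).
  apply: ucontB; apply: ucontZ; apply: (dlt_ucont T0 ep ep2); apply: (tavg_ucont T0 ep ep2); exact: ucont_L1.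
have AE t : 0 < t < T -> Theta_h_boundary N (yh N) t = dminus_h N (fun j => defect n N j t) N.+1 + A t.
  move=> /andP[t0 tT]; have tT' : 0 <= t <= T by rewrite !ltW.
  have AS : AC 0 T (slope N) (fun t => (mesh N)^-1 * (nodal 1 N N.+1 t - nodal 1 N N t)).
    have := ACZ (mesh N)^-1 (ACB (nodal_AC jN1) (nodal_AC jN)); apply: AC_eq => s _.
    by rewrite /slope mulrC.
  have u1 : ucont 0 T (fun t => (mesh N)^-1 * (nodal 1 N N.+1 t - nodal 1 N N t)).
    by apply/ucontZ/ucontB; exact: nodal_ucont.
  rewrite /A -(tavg2_of_deriv T0 n tT' u1 AS).
  have := tavg2_lin T0 n (mesh N)^-1 tT' (L1_cst 0 T 0) (L1B (Lnod jN1) (Lnod jN)).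
  rewrite tavg2_cst// (tavg2B T0 n tT' (Lnod jN1) (Lnod jN)) add0r => E.
  rewrite (tavg2_eq T0 n (g := fun s => 0 + (mesh N)^-1 * (nodal 1 N N.+1 s - nodal 1 N N s)) tT'); last first.
    by move=> s _; rewrite add0r.
  by rewrite E /Theta_h_boundary /dminus_h /defect /=; ring.
(* The slope is the mean of [d_x y] over the last cell, and [d_x y] is Hölder of exponent [1/2] up
   to the boundary, uniformly in time, by the bound on [d_xx y]. *)
have SK s : 0 <= s <= T -> `|slope N s - k s| <= Num.sqrt (mesh N) * M.
  move=> sT; have A1 := wave_AC sol (i := 0) (k := 1) isT sT; have A0 := wave_AC sol (i := 0) (k := 0) isT sT.
  have L02 := wave_L2 sol (i := 0) (k := 2) isT sT.
  rewrite /slope /nodal (cavgE A0 (leqnn N)).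
  apply: (cavg_osc (leqnn N)); first exact: ucont_L1 (AC_ucont A1).
  move=> x /andP[x1 x2]; have n1 := @nodeN R N; rewrite n1 in x2.
  have n0 := @node_ge0 R N N; have x01 : 0 <= x <= 1 by rewrite (le_trans n0 (ltW x1)) ltW.
  have one1 : 0 <= (1 : R) <= 1 by rewrite ler01 lexx.
  rewrite (le_trans (H1_holder A1 L02 x01 one1))// ler_pM ?sqrtr_ge0 ?nL2_ge0 ?HM//.
  apply: ler_wsqrtr; rewrite distrC ger0_norm ?subr_ge0 ?(ltW x2)//.
  by move: n1 x1; rewrite nodeS; move: (node N N) (mesh N : R) => *; lra.
have LSk : L1 0 T (fun s => slope N s - k s) by apply: ucont_L1; exact: ucontB.
have P s : 0 <= s <= T -> `|tavg T (eps n) (slope N) s - tavg T (eps n) k s| <= Num.sqrt (mesh N) * M.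
  move=> sT; rewrite -(tavgB T0 ep ep2 sT (ucont_L1 uS) (ucont_L1 uk)).
  by apply: tavg_bound => // x /andP[x0 xT]; apply: SK; rewrite !ltW.
have AB t : 0 < t < T -> `|A t - B t| <= (1 - eps n)^-1 * (eps n * T)^-1 * (2 * (Num.sqrt (mesh N) * M)).
  move=> /andP[t0 tT]; have tT' : 0 <= t <= T by rewrite !ltW.
  have [a b c1] := tavg_range T0 ep ep2 tT'.
  have q0 : 0 <= (1 - eps n)^-1 * (eps n * T)^-1.
    by rewrite mulr_ge0 ?invr_ge0 ?(ltW l0)// mulr_ge0 ?(ltW T0) ?(ltW ep).
  rewrite /A /B -mulrBr normrM (ger0_norm q0) ler_wpM2l// /dlt.
  set s1 := (1 - eps n) * t in a b c1 *.
  have P1 := P (s1 + eps n * T); have P2 := P s1.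
  rewrite (_ : _ - _ - _ = (tavg T (eps n) (slope N) (s1 + eps n * T) - tavg T (eps n) k (s1 + eps n * T)) -
    (tavg T (eps n) (slope N) s1 - tavg T (eps n) k s1)); last by ring.
  rewrite (le_trans (ler_normB _ _))// mulr_natl mulr2n lerD ?P1 ?P2 ?a ?c1 ?andbT//=.
    exact: le_trans a b.
  exact: le_trans b c1.
rewrite (@nL2_eq _ _ _ _ (fun t => dminus_h N (fun j => defect n N j t) N.+1 + (A t - B t))); last first.
  by move=> t tT; rewrite AE// -/(B t); ring.
rewrite (le_trans (nL2D L1d (ucont_L2 uAB)))// lerD// .
apply: le_trans (nL2_sup (ltW T0) _ (ucont_L2 uAB) AB) _.
  by rewrite !mulr_ge0 ?invr_ge0 ?sqrtr_ge0 ?(ltW l0) ?(ltW M0)// mulr_ge0 ?(ltW T0) ?(ltW ep).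
by rewrite subr0 /c le_eqVlt; apply/orP; left; apply/eqP; ring.
Qed.

Lemma boundary_L2 N : L2 0 T (Theta_h_boundary N (yh N)).
Proof.
apply: (@L2_eq _ _ _ (fun t => (mesh N)^-1 * (yh N N.+1 1%N t - yh N N 1%N t))).
  by move=> t _; rewrite /Theta_h_boundary /dminus_h mulrC.
apply/ucont_L2/ucontZ/ucontB; apply: AC_ucont; exact: (semi_AC T0 (solh N) _ (isT : (1 < 2)%N)).
Qed.

Lemma boundary_observation_cvg : exists2 theta : R -> R, Theta_0_boundary T y theta &
  L2_norm 0 T (fun t => Theta_h_boundary N (yh N) t - theta t) @[N --> \oo] --> 0%E.
Proof.
have uk : ucont 0 T k by exact: wave_slope_ucont sol.
have [theta Lt [v A]] := boundary_limit T0 boundary_L2 uk observation_defect.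
exists theta; first by split; [exact/in_L2E|exact: AC_weak_derivative (ltW T0) A].
have Ld N : L2 0 T (fun t => Theta_h_boundary N (yh N) t - theta t) by apply: L2B; first exact: boundary_L2.
under eq_fun do rewrite L2_normE//.
apply: cvg_EFin; first exact: nearW.
apply/vanish_cvg; apply: vanish_leq v _ => N /=.
by rewrite ger0_norm ?nL2_ge0.
Qed.

Let data_ge0 n N : 0 <= defect_data n N /\ nL2 0 T (defect_vel n N 0) <= defect_data n N /\
  nL2 0 T (defect_vel n N N.+1) <= defect_data n N.
Proof.
have I0 : 0 <= itg 0 T (fun t => l2n N (fun j => defect_src n N j t)) by apply: itg_ge0 => t _; exact: l2n_ge0.
have h1 := l2n_ge0 N (fun j => defect_vel n N j 0); have h2 := gradn_ge0 N (fun j => defect n N j 0).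
have h3 := normr_ge0 (defect n N 0 0); have h4 := nL2_ge0 0 T (defect_vel n N 0).
have h5 := nL2_ge0 0 T (defect_vel n N N.+1).
rewrite /defect_data; move: (itg _ _ _) (l2n _ _) (gradn _ _) `|_| (nL2 _ _ _) (nL2 _ _ _) I0 h1 h2 h3 h4 h5.
by move=> *; split; [|split]; lra.
Qed.

(** [d_tt y_h] splits into [defect_vel], small in energy, and [moll1] of nodal values, whose
    increments are of order [sqrt h] for fixed [n]. Because of the factor [h] the observation
    measures increments rather than slopes, so the energy of the velocities is enough for the first
    part. *)
Let interior_bound n : exists2 c : R, 0 <= c & forall N, (3 <= N)%N ->
  (L2L2_norm T (Theta_h_interior N (yh N)) <=
   (Num.sqrt (8 * T * wave_const T m ^+ 2 + 8) * defect_data n N + c * Num.sqrt (mesh N))%:E)%E.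
Proof.
have [M M0 HM] := wave_bound sol (i := 0) (k := 1) isT.
pose C := wave_const T m; have C0 : 0 <= C := wave_const_ge0.
have i0 : 0 <= ((eps n * T) ^+ 2)^-1 :> R by rewrite invr_ge0 sqr_ge0.
exists (Num.sqrt (2 * T) * (((eps n * T) ^+ 2)^-1 * (4 * M))).
  by rewrite !mulr_ge0 ?sqrtr_ge0 ?(ltW M0).
move=> N N3; have [E1 _ _] := defect_estimate n N3.
have [d0 [dl dr]] := data_ge0 n N; move: (defect_data n N) d0 dl dr E1 => d d0 dl dr E1.
have h0 := @mesh_gt0 R N.
pose q := ((eps n * T) ^+ 2)^-1 * (4 * (Num.sqrt (mesh N) * M)).
have q0 : 0 <= q by rewrite !mulr_ge0 ?sqrtr_ge0 ?(ltW M0).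
pose mo j t := moll1 T n (nodal 0 N j) t.
pose V j t := defect_vel n N j t.
pose f j t := yh N j 2%N t.
have Lf j : (j <= N)%N -> L1 0 T (fun t => (f j.+1 t - f j t) ^+ 2).
  by move=> jN; apply: (L2B _ _).2; apply: (semi_L2 (solh N)) => //; exact: leqW.
have [LV0 LVN] := defect_vel_L2 n N.
(* Two uses of [(a + b)^2 <= 2 a^2 + 2 b^2], one separating [V] from [mo], one separating
   neighbouring nodes; the boundary values of [V] lie outside the energy and are kept apart. *)
pose G t := 8 * (C * d) ^+ 2 + 4 * (V 0%N t ^+ 2 + V N.+1 t ^+ 2) + 2 * q ^+ 2.
have LG : L1 0 T G.
  by apply: L1D; [apply: L1D; [exact: L1_cst|apply: L1Z; apply: L1D; [exact: LV0.2|exact: LVN.2]]|exact: L1_cst].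
have GE : itg 0 T G = 8 * (C * d) ^+ 2 * T + 4 * (nL2 0 T (V 0%N) ^+ 2 + nL2 0 T (V N.+1) ^+ 2) + 2 * q ^+ 2 * T.
  rewrite itgD; last 2 first.
  - by apply: L1D; [exact: L1_cst|apply: L1Z; apply: L1D; [exact: LV0.2|exact: LVN.2]].
  - exact: L1_cst.
  rewrite itgD; last 2 first.
  - exact: L1_cst.
  - by apply: L1Z; apply: L1D; [exact: LV0.2|exact: LVN.2].
  rewrite (@itgZ R 0 T 4 (fun x => V 0%N x ^+ 2 + V N.+1 x ^+ 2)); last by apply: L1D; [exact: LV0.2|exact: LVN.2].
  rewrite itgD; [|exact: LV0.2|exact: LVN.2].
  by rewrite !itg_cst ?(ltW T0)// subr0 !nL2_sqr.
have -> : Num.sqrt (2 * T) * (((eps n * T) ^+ 2)^-1 * (4 * M)) * Num.sqrt (mesh N) = Num.sqrt (2 * T) * q by rewrite /q; ring.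
have K0 : 0 <= 8 * T * C ^+ 2 + 8 by rewrite addr_ge0// !mulr_ge0 ?sqr_ge0 ?(ltW T0).
have T2 : 0 <= 2 * T by rewrite mulr_ge0 ?(ltW T0).
apply: (@interior_norm_le R N T _ f _ Lf); first by rewrite addr_ge0// mulr_ge0 ?sqrtr_ge0.
have LL : L1 0 T (fun t => mesh N * \sum_(0 <= j < N.+1) (f j.+1 t - f j t) ^+ 2).
  by apply: L1Z; apply: L1_sum => j; rewrite mem_index_iota ltnS => jN _; exact: Lf.
apply: (@le_trans _ _ (itg 0 T G)); last first.
  rewrite GE; have a1 : nL2 0 T (V 0%N) ^+ 2 <= d ^+ 2 by rewrite ler_sqr ?nnegrE ?nL2_ge0.
  have a2 : nL2 0 T (V N.+1) ^+ 2 <= d ^+ 2 by rewrite ler_sqr ?nnegrE ?nL2_ge0.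
  have s0 : 0 <= Num.sqrt (8 * T * C ^+ 2 + 8) * d * (Num.sqrt (2 * T) * q).
    by apply: mulr_ge0; apply: mulr_ge0; rewrite ?sqrtr_ge0.
  rewrite -/C.
  have -> : (Num.sqrt (8 * T * C ^+ 2 + 8) * d + Num.sqrt (2 * T) * q) ^+ 2 =
    Num.sqrt (8 * T * C ^+ 2 + 8) ^+ 2 * d ^+ 2 + Num.sqrt (2 * T) ^+ 2 * q ^+ 2 +
    2 * (Num.sqrt (8 * T * C ^+ 2 + 8) * d * (Num.sqrt (2 * T) * q)) by ring.
  rewrite (sqr_sqrtr K0) (sqr_sqrtr T2) (exprMn 2 C d); move: (_ * (Num.sqrt _ * q)) s0 => s s0.
  have -> : (8 * T * C ^+ 2 + 8) * d ^+ 2 + 2 * T * q ^+ 2 + 2 * s =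
    (8 * (C ^+ 2 * d ^+ 2) * T + 2 * q ^+ 2 * T) + (8 * d ^+ 2 + 2 * s) by ring.
  move: (nL2 _ _ _ ^+ 2) (nL2 _ _ _ ^+ 2) (d ^+ 2) (8 * (_ * _) * T) (2 * _ * T) a1 a2 => u v w x z a1 a2; lra.
apply: itg_le_ae => //.
apply: ae_mono (semi_vel'_ae (solh N)) => t Ht tT; have [t0 tT1] := andP tT.
have tT' : 0 <= t <= T by rewrite !ltW.
have fE j : (j <= N.+1)%N -> f j t = V j t + mo j t.
  move=> jN; rewrite /V /mo /defect_vel subrK /f.
  have [jN1|jN1] := boolP (1 <= j <= N)%N; first by rewrite Ht.
  by rewrite /semi_vel' (negbTE jN1).
have mD j : (j <= N)%N -> (mo j.+1 t - mo j t) ^+ 2 <= q ^+ 2.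
  move=> jN; rewrite -(real_normK (num_real (mo j.+1 t - mo j t))) ler_sqr ?nnegrE//.
  apply: moll1_sub => // s sT.
  have n1 := @node_in R N j.+1 jN; have n2 := @node_in R N j (leqW jN).
  rewrite (le_trans (H1_holder (wave_AC sol (i := 0) (k := 0) isT sT) (wave_L2 sol (i := 0) (k := 1) isT sT) n1 n2))//.
  have -> : `|node N j.+1 - node N j| = mesh N :> R by rewrite nodeS addrAC subrr add0r gtr0_norm.
  by rewrite ler_wpM2l ?sqrtr_ge0// HM.
have S1 : mesh N * \sum_(0 <= j < N.+1) (f j.+1 t - f j t) ^+ 2 <=
   2 * (mesh N * \sum_(0 <= j < N.+1) (V j.+1 t - V j t) ^+ 2) + 2 * q ^+ 2.
  have -> : 2 * q ^+ 2 = mesh N * \sum_(0 <= j < N.+1) (2 * q ^+ 2).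
    by rewrite sumr_const_nat subn0 -[_ *+ N.+1]mulr_natl [RHS]mulrA mesh_mul mul1r.
  rewrite mulrCA -mulrDr ler_pM2l// mulr_sumr -big_split/= !big_seq; apply: ler_sum => j.
  rewrite mem_index_iota => /andP[_ jN]; rewrite (fE j.+1 jN) (fE j (ltnW jN)).
  have := mD j jN; move: (V j.+1 t) (V j t) (mo j.+1 t) (mo j t) (q ^+ 2) => a b a' b' z Hz.
  apply: (@le_trans _ _ (2 * (a - b) ^+ 2 + 2 * (a' - b') ^+ 2)).
    have -> : a + a' - (b + b') = (a - b) + (a' - b') by ring.
    by move: (a - b) (a' - b') => x y'; have := sqr_ge0 (x - y'); nra.
  by rewrite lerD2l ler_pM2l.
have S2 : mesh N * \sum_(0 <= j < N.+1) (V j.+1 t - V j t) ^+ 2 <=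
   4 * (C * d) ^+ 2 + 2 * (V 0%N t ^+ 2 + V N.+1 t ^+ 2).
  have E2 : mesh N * \sum_(1 <= j < N.+1) V j t ^+ 2 <= (C * d) ^+ 2.
    have E := E1 t tT'; have W0 := wave_energy_ge0 N (fun j => defect n N j t) (fun j => defect_vel n N j t).
    apply: (@le_trans _ _ (wave_energy N (fun j => defect n N j t) (fun j => defect_vel n N j t))).
      by rewrite /wave_energy ler_pM2l// lerDl sumr_ge0// => j _; exact: sqr_ge0.
    by rewrite -(sqr_sqrtr W0) ler_sqr ?nnegrE ?sqrtr_ge0// mulr_ge0.
  apply: (@le_trans _ _ (mesh N * (2 * \sum_(0 <= j < N.+1) V j.+1 t ^+ 2 + 2 * \sum_(0 <= j < N.+1) V j t ^+ 2))).
    rewrite ler_pM2l// !mulr_sumr -big_split/=; apply: ler_sum => j _.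
    by move: (V j.+1 t) (V j t) => a b; have := sqr_ge0 (a + b); nra.
  have -> : \sum_(0 <= j < N.+1) V j.+1 t ^+ 2 = \sum_(1 <= j < N.+1) V j t ^+ 2 + V N.+1 t ^+ 2.
    by rewrite -(big_add1 _ _ 0 N.+2 xpredT (fun j => V j t ^+ 2)) big_nat_recr.
  rewrite (@big_ltn _ _ _ 0 N.+1)//.
  have m1 := @mesh_le1 R N; have v0 := sqr_ge0 (V 0%N t); have vN := sqr_ge0 (V N.+1 t).
  move: (\sum_(1 <= j < N.+1) _) (V 0%N t ^+ 2) (V N.+1 t ^+ 2) ((C * d) ^+ 2) E2 v0 vN => S a b z Sz a0 b0.
  have -> : mesh N * (2 * (S + b) + 2 * (a + S)) = 4 * (mesh N * S) + 2 * (mesh N * (a + b)) by ring.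
  by apply: lerD; rewrite ler_pM2l// ler_piMl// addr_ge0.
apply: le_trans S1 _; rewrite /G lerD2r.
by move: S2; move: (mesh N * _) ((C * d) ^+ 2) (V 0%N t ^+ 2 + _) => *; lra.
Qed.

Lemma interior_observation_cvg : L2L2_norm T (Theta_h_interior N (yh N)) @[N --> \oo] --> 0%E.
Proof.
apply: ecvg0_le => [N|e e0]; first exact: Lnorm_ge0.
have K0 := sqrtr_ge0 (8 * T * wave_const T m ^+ 2 + 8).
have e2 : 0 < e / 2 by rewrite divr_gt0.
have [n0 /(_ n0 (leqnn _))[N0 H]] := vanish2Z K0 defect_data_cvg e2.
have [c c0 Hc] := interior_bound n0; have [N1 H1] := vanishZ c0 (@vanish_sqrt_mesh R) e2.
exists (maxn 3 (maxn N0 N1)) => N; rewrite !geq_max => /and3P[h3 /H a /H1 b].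
by rewrite (le_trans (Hc N h3))// lee_fin (splitr e) lerD.
Qed.

End Consistency.

Section UniformBound.
Variable yh : nat -> nat -> nat -> R -> R.
Hypothesis solh : forall N, semidiscrete_solution T N (havg N p) (y0h N) (y1h N)
  (fun j => gh N j 0%N) (g0h N 0%N) (g1h N 0%N) (yh N).

Let source_bounded i : (i <= 1)%N -> ebounded (fun N => itg 0 T (fun t => l2n N (fun j => gh N j i t))).
Proof.
move=> i1; have [mg fg] := hg.1 i i1; have [Ln _] := box_L1_nL2 mg fg.
have := eboundedD (ebounded_vanish (source_mean_cvg i1)) (ebounded_cst (2 * itg 0 T (fun t => nL2 0 1 (g i t)))).
move=> eb; apply: ebounded_le eb _; exists 0%N => N _.
have Ld j : (1 <= j <= N)%N -> L1 0 T (fun t => gh N j i t - havg N (g i t) j).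
  by move=> jN; apply: L1B; [exact: source_L1|exact: havg_source_L1 hg _ _ jN i i1].
rewrite -itgZ// -itgD; [|exact: l2n_L1|exact: L1Z].
apply: itg_le_ae; [by apply: l2n_L1 => j; exact: source_L1|by apply: L1D; [exact: l2n_L1|exact: L1Z]|].
apply: ae_mono (box_ae_L2 mg fg) => t Ht tT.
rewrite (@l2n_eq _ _ _ (fun j => (gh N j i t - havg N (g i t) j) + havg N (g i t) j)); last by move=> j _; rewrite subrK.
by rewrite (le_trans (l2nD _ _ _))// lerD2l l2n_havg_le//; exact: Ht.
Qed.

Let position_bounded : ebounded (fun N => l2n N (laplacian_h N (b0 N)) +
  l2n N (fun j => havg N p j * b0 N j)).
Proof.
have L2y : L2 0 1 (y0 2%N) by exact: Sobolev2_L2 hy0 (leqnn 2).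
have [Lpy _] := weighted_L2 mp pm (ucont_L2 (AC_ucont A00)).
have eb := eboundedD (eboundedD (ebounded_vanish position_lap_cvg) (ebounded_cst (2 * nL2 0 1 (y0 2%N))))
  (eboundedD (ebounded_vanish position_potential_cvg) (ebounded_cst (2 * nL2 0 1 (fun x => p x * y0 0%N x)))).
apply: ebounded_le eb _; exists 0%N => N _; apply: lerD.
  rewrite (@l2n_eq _ _ _ (fun j => (laplacian_h N (b0 N) j - laplacian_h N (fun l => y0 0%N (node N l)) j) + havg N (y0 2%N) j)).
    by rewrite (le_trans (l2nD _ _ _))// lerD2l l2n_havg_le.
  by move=> j jN; rewrite (havg_lap jN A00 A01) subrK.
rewrite (@l2n_eq _ _ _ (fun j => (havg N p j * b0 N j - havg N (fun x => p x * y0 0%N x) j) + havg N (fun x => p x * y0 0%N x) j)).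
  by rewrite (le_trans (l2nD _ _ _))// lerD2l l2n_havg_le.
by move=> j jN; rewrite subrK.
Qed.

Let end_bounded (G : nat -> R -> R) (Gh : nat -> nat -> R -> R) (z : nat -> R -> R) :
  Sobolev 2 2%:E 0 T G -> (forall N, Sobolev 2 2%:E 0 T (Gh N)) ->
  Hnorm 2 0 T (fun i t => Gh N i t - G i t) @[N --> \oo] --> 0%E ->
  (forall N, L2 0 T (z N)) -> (forall N, nL2 0 T (fun t => z N t - Gh N 2%N t) = 0) ->
  ebounded (fun N => nL2 0 T (z N)).
Proof.
move=> SG SGh cv Lz z0.
have eb := eboundedD (ebounded_vanish (boundary_L2_cvg SG SGh cv (leqnn 2))) (ebounded_cst (nL2 0 T (G 2%N))).
apply: ebounded_le eb _; exists 0%N => N _.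
have LG : L2 0 T (G 2%N) by exact: Sobolev2_L2 SG _.
have LGh : L2 0 T (Gh N 2%N) by exact: Sobolev2_L2 (SGh N) _.
rewrite (@nL2_eq _ _ _ _ (fun t => (z N t - Gh N 2%N t) + ((Gh N 2%N t - G 2%N t) + G 2%N t))); last by move=> t _; ring.
rewrite (le_trans (nL2D (L2B (Lz N) LGh) (L2D (L2B LGh LG) LG)))// z0 add0r.
exact: nL2D (L2B LGh LG) LG.
Qed.

(** [discrete_wave] is applied to [d_t y_h] itself; its data stay bounded on fine grids, each being
    a convergent error plus a bounded average of the continuous data. *)
Let velocity_bounded : exists B n0, forall N, (n0 <= N)%N ->
  forall t j, 0 <= t <= T -> (j <= N.+1)%N -> `|yh N j 1%N t| <= B.
Proof.
have z0 : 0 <= (0 : R) <= T by rewrite lexx ltW.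
have T0i : 0 <= T^-1 by rewrite invr_ge0 ltW.
have eb1 := eboundedD position_bounded (eboundedD (eboundedZ T0i (source_bounded (leq0n 1))) (source_bounded (leqnn 1))).
have eb2 := eboundedD (ebounded_vanish velocity_grad_cvg) (ebounded_cst (nL2 0 1 (y1 1%N))).
have eb3 := eboundedD (ebounded_vanish (boundary_initial_cvg T0 hg0 hg0h cvg_g0 (isT : (1 < 2)%N))) (ebounded_cst `|g0 1%N 0|).
have eb4 := end_bounded hg0 hg0h cvg_g0 (z := fun N => yh N 0%N 2%N)
  (fun N => semi_L2 (solh N) (leq0n N.+1) (leqnn 2)) (fun N => (semi_left T0 (hg0h N) (solh N)).2).
have eb5 := end_bounded hg1 hg1h cvg_g1 (z := fun N => yh N N.+1 2%N)
  (fun N => semi_L2 (solh N) (leqnn N.+1) (leqnn 2)) (fun N => (semi_right T0 (hg1h N) (solh N)).2).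
have [M [n0 H]] := eboundedZ (wave_const_ge0) (eboundedD (eboundedD (eboundedD (eboundedD (eboundedD eb1 eb2) eb3) eb4) eb5) (source_bounded (leqnn 1))).
exists M, (maxn 3 n0) => N; rewrite geq_max => /andP[N3 /H{}H] t j tT jN.
pose v j := semi_vel' N (havg N p) (gh N) (yh N) j.
have P l : (1 <= l <= N)%N -> `|havg N p l| <= m.
  by move=> lN; apply: havg_abs_le => //; exact: bounded_L1 mp pm.
have vN : v N.+1 = yh N N.+1 2%N by rewrite /v /semi_vel' ltnn andbF.
have La : L2 0 T (v 0%N) by exact: (semi_L2 (solh N)).
have Lb : L2 0 T (v N.+1) by rewrite vN; exact: (semi_L2 (solh N)).
have Lg l : (1 <= l <= N)%N -> L1 0 T (gh N l 1%N) by exact: source_L1.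
have Av l : (1 <= l <= N)%N -> AC 0 T (v l) (fun t => laplacian_h N (fun j => yh N j 1%N t) l -
    havg N p l * yh N l 1%N t + gh N l 1%N t).
  move=> lN; apply: AC_eq (semi_acc_AC T0 (@source_AC N) (solh N) lN) => s _.
  by rewrite /v /semi_vel' lN.
have [_ H2 _] := discrete_wave T0 m0 N3 P (fun l lN => semi_vel_AC T0 (@source_AC N) (solh N) lN) La Lb Lg
  Av (l2n_L1 Lg) (fun t _ => lexx _).
apply: le_trans (H2 t j tT jN) _; apply: le_trans H; apply: ler_wpM2l; first exact: wave_const_ge0.
rewrite /wave_data -/(v 0%N) -/(v N.+1) lerD// lerD//; last first.
  by rewrite -/(nL2 0 T (v N.+1)) vN.
rewrite lerD// lerD//; last first.
  have [El _] := semi_left T0 (hg0h N) (solh N); rewrite El//.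
  by have := ler_normD (g0h N 1%N 0 - g0 1%N 0) (g0 1%N 0); rewrite subrK.
rewrite (le_trans (sqrt_energy_le _ _ _))// lerD//; last first.
  rewrite (@gradn_eq _ _ _ (fun l => (b1 N l - y1 0%N (node N l)) + y1 0%N (node N l))).
    by rewrite (le_trans (gradnD _ _ _))// lerD2l; exact: grad_nodes_le A10 L11.
  by move=> l lN; rewrite subrK (semi_init1 T0 (hg0h N) (hg1h N) (solh N) lN).
rewrite (@l2n_eq _ _ _ (fun l => (laplacian_h N (b0 N) l - havg N p l * b0 N l) + gh N l 0%N 0)); last first.
  move=> l lN; have [l1 l2] := andP lN; rewrite /v /semi_vel' lN /semi_acc.
  have lp : (l.-1 <= N.+1)%N by rewrite (leq_trans (leq_pred l)) ?leqW.
  by rewrite /laplacian_h !(semi_init0 T0 (solh N))// leqW.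
rewrite (le_trans (l2nD _ _ _))// lerD//; first exact: l2nB.
exact: (l2n_initial_le T0 (@source_AC N)).
Qed.

(** On a fixed grid there are finitely many continuous functions of time; on fine grids the velocity
    bound is integrated from the initial position, which is bounded by [position_sup_cvg]. *)
Let grid_bounded : exists B, forall N, forall i t j, (i <= 1)%N -> 0 <= t <= T -> (j <= N.+1)%N ->
  `|yh N j i t| <= B.
Proof.
apply: (@eventually_all R (fun N B => forall i t j, (i <= 1)%N -> 0 <= t <= T -> (j <= N.+1)%N -> `|yh N j i t| <= B)).
- by move=> N B B' BB H i t j i1 tT jN; exact: le_trans (H i t j i1 tT jN) BB.
- move=> N; suff H K : (K <= N.+1)%N -> exists B, forall i t j, (i <= 1)%N -> 0 <= t <= T -> (j <= K)%N -> `|yh N j i t| <= B.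
    exact: H.
  have A j i : (j <= N.+1)%N -> (i <= 1)%N -> exists B, forall t, 0 <= t <= T -> `|yh N j i t| <= B.
    move=> jN i1; have [B _ H] := ucont_bounded (AC_ucont (semi_AC T0 (solh N) jN (i1 : (i < 2)%N))).
    by exists B.
  have A2 j : (j <= N.+1)%N -> exists B, forall i t, (i <= 1)%N -> 0 <= t <= T -> `|yh N j i t| <= B.
    move=> jN; have [B H] := A j 0%N jN isT; have [B' H'] := A j 1%N jN isT.
    exists (Num.max B B') => -[|[|//]] t _ tT; rewrite le_max ?H ?H' ?orbT//.
  elim: K => [|K IH] KN.
    by have [B H] := A2 0%N KN; exists B => i t [|//] i1 tT _; exact: H.
  have [B H] := IH (ltnW KN); have [B' H'] := A2 _ KN; exists (Num.max B B') => i t j i1 tT.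
  by rewrite leq_eqVlt ltnS le_max => /orP[/eqP ->|jK]; [rewrite H' ?orbT|rewrite H].
have [B [n0 H]] := velocity_bounded; have [s vs Hs] := position_sup_cvg.
have [M M0 HM] := ucont_bounded (AC_ucont A00); have [n1 H1] := vs 1 ltr01.
exists (Num.max B (1 + M + B * T)), (maxn n0 n1) => N; rewrite geq_max => /andP[h0 h1] i t j i1 tT jN.
have Hv := H N h0; case: i i1 => [|[|//]] _; rewrite le_max; last by rewrite Hv.
apply/orP; right; have [t0 tT1] := andP tT.
have A := semi_AC T0 (solh N) jN (isT : (0 < 2)%N); rewrite (A.2 t tT).
have B0 : 0 <= B by apply: le_trans (Hv t j tT jN).
rewrite (le_trans (ler_normD _ _))// lerD//.
  rewrite (semi_init0 T0 (solh N) jN) -[with_boundary _ _ _ _ _]/(b0 N j) -[b0 N j](subrK (y0 0%N (node N j))).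
  by rewrite (le_trans (ler_normD _ _))// lerD ?HM ?node_in// (le_trans (Hs N j jN))// H1.
apply: (@le_trans _ _ (B * (t - 0))); last by rewrite subr0 ler_wpM2l.
apply: itg_abs_le => //; first by apply: L1_sub A.1.
by move=> x /andP[x0 xt]; apply: Hv; rewrite ?(ltW x0)// (ltW (lt_le_trans xt tT1)).
Qed.

Lemma uniform_bound : (ereal_sup [set H1Linf_norm T N (yh N) | N in [set N | (0 < N)%N]] < +oo)%E.
Proof.
have [B H] := grid_bounded; have z0 : 0 <= (0 : R) <= T by rewrite lexx ltW.
have B0 : 0 <= B by apply: le_trans (H 0%N 0%N 0 0%N isT z0 isT).
apply: (@le_lt_trans _ _ (Num.sqrt 2%:R * (Num.sqrt T * B))%:E); last exact: ltry.
apply: ub_ereal_sup => _ [N _ <-]; apply: Hnorm_le => i i1.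
have mI : measurable (`]0, T[%classic : set (measurableTypeR R)) by exact: measurable_itv.
apply: Lp2_norm_le => //; first by rewrite mulr_ge0 ?sqrtr_ge0.
apply: (@le_trans _ _ (\int[mu]_(t in `]0%R, T[) (B ^+ 2)%:E)%E).
  apply: ge0_integral_mono => t; rewrite /= in_itv/= => /andP[t0 tT]; first by rewrite lee_fin sqr_ge0.
  have g0' : 0 <= Linf_h N (fun j => yh N j i t) by exact: bigmax_ge_id.
  rewrite lee_fin ler_sqr ?nnegrE// /Linf_h big_seq; apply: bigmax_le => // j.
  by rewrite mem_index_iota => /andP[_ jN]; apply: H; rewrite ?(ltW t0) ?(ltW tT)// ltnW.
rewrite integral_itg; last exact: L1_cst.
by rewrite itg_cst ?(ltW T0)// subr0 lee_fin exprMn sqr_sqrtr ?(ltW T0)// mulrC.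
Qed.

End UniformBound.

End Data.

Section Potential.
Context {R : realType}.
Local Notation mu := (@lebesgue_measure R).

Lemma Linf_ae (a b m : R) (p : R -> R) : in_Linf a b p -> (Linf_norm a b p <= m%:E)%E ->
  measurable_fun `]a, b[ p /\ {ae mu, forall x : R, a < x < b -> `|p x| <= m}.
Proof.
move=> Hp; rewrite /Linf_norm /Lp_norm unlock.
have -> : (0 < mu [set: R])%E by rewrite -set_itvNyy lebesgue_measure_itv/= ltry.
move=> /ess_supP H; split.
  move: Hp; rewrite /in_Linf /in_Lp inE => /andP[]; rewrite inE/= => mf _.
  by have := measurable_restrictT p (@measurable_itv R `]a, b[); tauto.
apply: ae_mono H => x; rewrite /= patchE mem_setE in_itv/= => h xab.
by move: h; rewrite xab lee_fin.
Qed.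

Lemma ecvg0_squeeze (x z : nat -> \bar R) : (forall N, (0 <= x N)%E) -> (forall N, (x N <= z N)%E) ->
  z @ \oo --> 0%E -> x @ \oo --> 0%E.
Proof.
move=> x0 xz cz; apply: (@squeeze_cvge _ _ _ _ (cst 0%E) x z) => //; last exact: cvg_cst.
by apply: nearW => N; rewrite x0 xz.
Qed.

Lemma wave_solution_ae (T : R) (p q y0 y1 : R -> R) (g : R -> R -> R) (g0 g1 : R -> R)
    (y : nat -> nat -> R -> R -> R) : {ae mu, forall x : R, 0 < x < 1 -> p x = q x} ->
  wave_solution T p y0 y1 g g0 g1 y -> wave_solution T q y0 y1 g g0 g1 y.
Proof.
move=> pq [h1 h2 h3 h4 h5]; split=> //; apply: ae_mono h4 => t Ht tT.
apply: ae_mono (ae_and pq (Ht tT)) => x [Ex Hx] x01; rewrite -Ex; first exact: Hx.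
by move: x01; rewrite in_itv.
Qed.

End Potential.

Theorem theorem4p2 (R : realType) (T m : R)
  (hT : 0 < T) (hm : 0 < m)
  (y0 y1 g0 g1 : nat -> R -> R) (g : nat -> R -> R -> R)
  (y0h y1h : nat -> nat -> R) (g0h g1h : nat -> nat -> R -> R)
  (gh : nat -> nat -> nat -> R -> R)
  (* regularity *)
  (hy0 : Sobolev 2 2%:E 0 1 y0) (hy1 : Sobolev 1 2%:E 0 1 y1)
  (hg : W11L2 T g)
  (hg0 : Sobolev 2 2%:E 0 T g0) (hg1 : Sobolev 2 2%:E 0 T g1)
  (hc00 : g0 0%N 0 = y0 0%N 0) (hc01 : g1 0%N 0 = y0 0%N 1)
  (hc10 : g0 1%N 0 = y1 0%N 0) (hc11 : g1 1%N 0 = y1 0%N 1)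
  (* convergence of the data *)
  (hgh : forall N j, (1 <= j <= N)%N -> Sobolev 1 1%:E 0 T (gh N j))
  (hg0h : forall N, Sobolev 2 2%:E 0 T (g0h N))
  (hg1h : forall N, Sobolev 2 2%:E 0 T (g1h N))
  (cvg_y0 : L2_norm 0 1
      (fun x => ext_const N (laplacian_h N
         (with_boundary N (g0h N 0%N 0) (y0h N) (g1h N 0%N 0))) x - y0 2%N x)
      @[N --> \oo] --> 0%E)
  (cvg_y1 : Hm1_norm (fun phi =>
      fun_Hm1 (ext_const N (laplacian_h N
         (with_boundary N (g0h N 1%N 0) (y1h N) (g1h N 1%N 0)))) phi
      - dxx_Hm1 y1 phi)
      @[N --> \oo] --> 0%E)
  (cvg_g : (\sum_(i < 2) L1L2_norm T
      (fun t x => ext_const N (fun j => gh N j i t) x - g i t x)%R)%E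
      @[N --> \oo] --> 0%E)
  (cvg_g0 : Hnorm 2 0 T (fun i t => g0h N i t - g0 i t) @[N --> \oo] --> 0%E)
  (cvg_g1 : Hnorm 2 0 T (fun i t => g1h N i t - g1 i t) @[N --> \oo] --> 0%E)
  (* positivity *)
  (r : R) (hr : 0 < r)
  (hpos : forall x : R, x \in `]0, 1[ -> r <= `|y0 0%N x|)
  (hposh : forall N j, (1 <= j <= N)%N -> r <= `|y0h N j|) :
  forall p : R -> R, in_Linf 0 1 p ->
    (Linf_norm 0 1 p <= m%:E)%E ->
  exists ph : nat -> nat -> R,
    [/\ forall N, Linf_h N (ph N) <= m,
        L2_norm 0 1 (fun x => ext_const N (ph N) x - p x)
          @[N --> \oo] --> 0%E &
        forall yh : nat -> nat -> nat -> R -> R,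
          (forall N, semidiscrete_solution T N (ph N) (y0h N) (y1h N)
             (fun j => gh N j 0%N) (g0h N 0%N) (g1h N 0%N) (yh N)) ->
          (forall y, wave_solution T p (y0 0%N) (y1 0%N) (g 0%N)
               (g0 0%N) (g1 0%N) y ->
             exists2 theta : R -> R, Theta_0_boundary T y theta &
               L2_norm 0 T
                   (fun t => Theta_h_boundary N (yh N) t - theta t)
                 @[N --> \oo] --> 0%E /\
               L2L2_norm T (Theta_h_interior N (yh N)) @[N --> \oo] --> 0%E) /\
          (ereal_sup [set H1Linf_norm T N (yh N) | N in [set N | (0 < N)%N]]
             < +oo)%E].
Proof.
move=> p Hp Hpm; have m0 := ltW hm.
have [mp pm] := Linf_ae Hp Hpm.
(* The data section asks for a potential bounded by [m] at every point. Truncation changes [p] on a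
   null set only, which affects neither its class nor the continuous solutions. *)
pose q x := clip m (p x).
have qm x : `|q x| <= m by exact: clip_le.
have L2q : L2 0 1 q by exact: L2_clip.
have mq := L2_meas L2q.
have pq : {ae @lebesgue_measure R, forall x : R, 0 < x < 1 -> p x = q x}.
  by apply: ae_mono pm => x H x01; rewrite /q clip_id// H.
have cvg_gi i : (i <= 1)%N -> L1L2_norm T (fun t x => ext_const N (fun j => gh N j i t) x - g i t x)
    @[N --> \oo] --> 0%E.
  move=> i1; apply: ecvg0_squeeze cvg_g => N; first by apply: integral_ge0 => t _; exact: L2_norm_ge0.
  rewrite (bigD1 (Ordinal (i1 : (i < 2)%N)))//= leeDl// sume_ge0// => l _.
  by apply: integral_ge0 => t _; exact: L2_norm_ge0.
exists (fun N => havg N q); split.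
- move=> N; rewrite /Linf_h big_seq; apply: bigmax_le => // j; rewrite mem_index_iota ltnS => jN.
  by apply: havg_abs_le => //; exact: bounded_L1 mq qm.
- have Lp : L2 0 1 p.
    split=> //; apply/integrableP; split; first by apply/measurable_EFinP; exact: measurable_funX.
    have [_ /integrableP[mq2 fin]] := L2q; apply: le_lt_trans fin.
    apply: ae_ge0_le_integral => //.
    + by apply: measurableT_comp => //; apply/measurable_EFinP; exact: measurable_funX.
    + by apply: measurableT_comp mq2.
    + by apply: ae_mono pq => x Ex; rewrite /= in_itv/= => x01; rewrite Ex.
  have Ln N (f : R -> R) : L2 0 1 f -> L2 0 1 (fun x => ext_const N (havg N q) x - f x).
    by move=> Lf; apply: L2B => //; exact: ext_const_L2.
  apply: ecvg0_le => [N|e e0]; first exact: L2_norm_ge0.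
  have [N0 H] := ext_const_havg_cvg L2q e0; exists N0 => N /H h.
  rewrite (L2_normE (Ln N p Lp)) lee_fin; apply: le_trans h.
  rewrite /nL2 (itg_ae_eq (Ln N p Lp).2 (Ln N q L2q).2)//.
  by apply: ae_mono pq => x Ex x01; rewrite Ex.
move=> yh solh; split.
  move=> y /(wave_solution_ae pq) sol.
  have [theta Ht cv] := boundary_observation_cvg hT m0 mq qm hy0 hy1 hg hg0 hg1 hc00 hc01 hc10 hc11
    hgh hg0h hg1h cvg_y0 cvg_y1 cvg_gi cvg_g0 cvg_g1 sol solh.
  exists theta => //; split=> //.
  exact: (interior_observation_cvg hT m0 mq qm hy0 hy1 hg hg0 hg1 hc00 hc01 hc10 hc11
    hgh hg0h hg1h cvg_y0 cvg_y1 cvg_gi cvg_g0 cvg_g1 sol solh).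
exact: (uniform_bound hT m0 mq qm hy0 hy1 hg hg0 hg1 hc00 hc01 hc10 hc11
    hgh hg0h hg1h cvg_y0 cvg_y1 cvg_gi cvg_g0 cvg_g1 solh).
Qed.
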